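(* Let $d\in\mathbb{N}$ ($d\ge 1$), $\alpha\in(1,2)$, $q_0=(\alpha-1)/d$, $b\in\mathbb{R}^d$ and $q\ge q_0$. Let $u_0\ge 0$ with $\|u_0\|_1>0$, and assume that one of the following holds: (a) $q=q_0$ and $u_0\in L^1(\mathbb{R}^d)$; or (b) $q>q_0$ and $u_0\in L^1(\mathbb{R}^d)\cap L^\infty(\mathbb{R}^d)$. Let $u(t,x)$ be the solution of $$u_t-\Delta^{\alpha/2}u+b\cdot\nabla\left(u|u|^q\right)=0,\qquad u(0,x)=u_0(x),$$ and put $u^*(t,x)=t^{d/\alpha}u(t,t^{1/\alpha}x)$ and $(P_t^*u_0)(x)=t^{d/\alpha}(P_tu_0)(t^{1/\alpha}x)$. Then $$\lim_{t\to0}\left\|\frac{u^*(t,\cdot)}{(P^*_tu_0)(\cdot)}-1\right\|_\infty=0.$$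
   Context: $\Delta^{\alpha/2}$ is the fractional Laplacian, $\widehat{\Delta^{\alpha/2}\phi}(\xi)=-|\xi|^\alpha\widehat\phi(\xi)$. Its heat kernel is $p(t,x)=(2\pi)^{-d}\int_{\mathbb{R}^d}e^{-ix\cdot\xi}e^{-t|\xi|^\alpha}\,d\xi$ for $t>0$, $x\in\mathbb{R}^d$, and $(P_tf)(x)=\int_{\mathbb{R}^d}p(t,x-y)f(y)\,dy$ is the stable semigroup. ''Solution'' means the (unique, global) mild solution: $u\in C([0,\infty);L^1(\mathbb{R}^d))\cap C((0,\infty);L^\infty(\mathbb{R}^d))$ with $u(0)=u_0$ and, for $t>0$, $x\in\mathbb{R}^d$, $$u(t,x)=(P_tu_0)(x)+\int_0^t\int_{\mathbb{R}^d} b\cdot\nabla_z p(t-s,x-z)\,u(s,z)|u(s,z)|^{q}\,dz\,ds.$$ For $u_0\ge0$ the solution is non-negative. $\|\cdot\|_\infty$ is the $L^\infty(\mathbb{R}^d)$ norm in the space variable. *)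

(* Defs.v *)
From HB Require Import structures.
From mathcomp Require Import all_boot all_order all_algebra.
From mathcomp Require Import all_classical all_reals all_analysis.
From mathcomp Require Import complex.

Set Implicit Arguments.
Unset Strict Implicit.
Unset Printing Implicit Defensive.

Import Order.TTheory GRing.Theory Num.Theory.
Import numFieldNormedType.Exports.

Local Open Scope classical_set_scope.
Local Open Scope ring_scope.

Definition measure_rV_display : measure_display.
Proof. exact: default_measure_display. Qed.

Section measurable_rV.
Context {R : realType} {d : nat}.

Let coords : 'I_d -> 'rV[R]_d -> R := fun i x => x 0 i.

Let rV_set0 : g_sigma_preimage coords set0.
Proof. exact: sigma_algebra0. Qed.

Let rV_setC A : g_sigma_preimage coords A -> g_sigma_preimage coords (~` A).
Proof. exact: sigma_algebraC. Qed.

Let rV_bigcup (F : (set 'rV[R]_d)^nat) :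
  (forall i, g_sigma_preimage coords (F i)) ->
  g_sigma_preimage coords (\bigcup_i (F i)).
Proof. exact: sigma_algebra_bigcup. Qed.

HB.instance Definition _ := @isMeasurable.Build measure_rV_display
  'rV[R]_d (g_sigma_preimage coords) rV_set0 rV_setC rV_bigcup.

Lemma measurable_rV_coord (i : 'I_d) :
  measurable_fun [set: 'rV[R]_d] (fun x : 'rV[R]_d => x 0 i).
Proof.
move=> _ Y mY; rewrite setTI; apply: sub_sigma_algebra => /=.
rewrite -bigcup_seq/=; exists i => /=; first by rewrite mem_index_enum.
by exists Y => //; rewrite setTI.
Qed.

Lemma measurable_fun_rV d1 (T : measurableType d1) (f : T -> 'rV[R]_d) :
  (forall i, measurable_fun [set: T] (fun x => f x 0 i)) ->
  measurable_fun [set: T] f.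
Proof.
move=> mf _ A mA; rewrite setTI.
suff : g_sigma_preimage coords `<=` [set B | measurable (f @^-1` B)] by exact.
apply: smallest_sub.
  split => /=.
  - by rewrite preimage_set0.
  - by move=> B mB; rewrite setTD preimage_setC; exact: measurableC.
  - by move=> F mF; rewrite preimage_bigcup; exact: bigcup_measurable.
rewrite -bigcup_seq => B [i _ [C mC <-]] /=.
by rewrite setTI -[X in measurable X]setTI; exact: mf.
Qed.

End measurable_rV.

Section lebesgue_rV.
Context {R : realType}.

Definition rV_cons d (p : R * 'rV[R]_d) : 'rV[R]_d.+1 := row_mx p.1%:M p.2.

Definition rV_uncons d (x : 'rV[R]_d.+1) : R * 'rV[R]_d :=
  (x 0 ord0, \row_i x 0 (lift ord0 i)).

Lemma rV_consK d : cancel (@rV_cons d) (@rV_uncons d).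
Proof.
move=> [a v]; rewrite /rV_uncons /rV_cons /=; congr pair.
  rewrite (_ : ord0 = @lshift 1 d 0); last exact: val_inj.
  by rewrite (@row_mxEl _ 1 1 d) mxE eqxx mulr1n.
apply/rowP => i; rewrite mxE.
rewrite (_ : lift ord0 i = @rshift 1 d i); last exact: val_inj.
by rewrite (@row_mxEr _ 1 1 d).
Qed.

Lemma measurable_rV_cons d :
  measurable_fun [set: R * 'rV[R]_d] (@rV_cons d).
Proof.
apply: measurable_fun_rV => i; rewrite /rV_cons.
case: (@split_ordP 1 d i) => j ->.
- under eq_fun do rewrite (@row_mxEl _ 1 1 d) mxE (ord1 j) eqxx mulr1n.
  exact: measurable_fst.
- under eq_fun do rewrite (@row_mxEr _ 1 1 d).
  apply: (measurableT_comp (measurable_rV_coord j)).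
  exact: measurable_snd.
Qed.

Lemma measurable_rV_uncons d :
  measurable_fun [set: 'rV[R]_d.+1] (@rV_uncons d).
Proof.
apply/measurable_fun_pair; first exact: measurable_rV_coord.
apply: measurable_fun_rV => i /=.
under eq_fun do rewrite mxE.
exact: measurable_rV_coord.
Qed.

Section step.
Context {d : nat}.
Variable mu : {sigma_finite_measure set 'rV[R]_d -> \bar R}.

Definition lebesgue_rV_step : set 'rV[R]_d.+1 -> \bar R :=
  pushforward (@lebesgue_measure R \x mu)%E (@rV_cons d).

HB.instance Definition _ := Measure.copy lebesgue_rV_step
  (@measure_function_pushforward__canonical__measure_function_Measure
    _ _ _ _ _ (@lebesgue_measure R \x mu)%E _ (@measurable_rV_cons d)).

Lemma lebesgue_rV_step_sigma_finite : sigma_finite setT lebesgue_rV_step.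
Proof.
have /sigma_finiteP[F [TF ndF Foo]] := sigma_finiteT (@lebesgue_measure R).
have /sigma_finiteP[G [TG ndG Goo]] := sigma_finiteT mu.
exists (fun n => @rV_uncons d @^-1` (F n `*` G n)).
  apply/esym/seteqP; split => // x _.
  have [n _ Fn] : (\bigcup_i F i) (rV_uncons x).1 by rewrite -TF.
  have [k _ Gk] : (\bigcup_i G i) (rV_uncons x).2 by rewrite -TG.
  exists (maxn n k) => //; split.
  - by move: Fn; exact/subsetPset/ndF/leq_maxl.
  - by move: Gk; exact/subsetPset/ndG/leq_maxr.
move=> n; have [mF Foon] := Foo n; have [mG Goon] := Goo n; split.
  rewrite -[X in measurable X]setTI.
  by apply: measurable_rV_uncons => //; exact: measurableX.
rewrite /lebesgue_rV_step /pushforward -comp_preimage.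
rewrite (_ : _ \o _ = id); last by apply/funext => p /=; exact: rV_consK.
by rewrite preimage_id product_measure1E// lte_mul_pinfty// ge0_fin_numE.
Qed.

HB.instance Definition _ := Measure_isSigmaFinite.Build _ _ _ lebesgue_rV_step
  lebesgue_rV_step_sigma_finite.

End step.

Fixpoint lebesgue_rV (d : nat) : {sigma_finite_measure set 'rV[R]_d -> \bar R} :=
  match d with
  | 0 => \d_(0 : 'rV[R]_0)
  | d'.+1 => lebesgue_rV_step (lebesgue_rV d')
  end.

Lemma lebesgue_rV_box d (A : 'I_d -> set R) :
  (forall i, measurable (A i)) ->
  measurable [set x : 'rV[R]_d | forall i, A i (x 0 i)] /\
  lebesgue_rV d [set x : 'rV[R]_d | forall i, A i (x 0 i)] =
  (\prod_(i < d) lebesgue_measure (A i))%E.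
Proof.
elim: d A => [|d IH] A mA.
  rewrite (_ : [set _ | _] = setT); last by apply/seteqP; split=> // x _ [].
  by rewrite big_ord0 /= diracT; split.
have [mB Bprod] := IH (fun i => A (lift ord0 i)) (fun i => mA _).
set B := [set x : 'rV[R]_d | _] in mB Bprod.
have EB : [set x : 'rV[R]_d.+1 | forall i, A i (x 0 i)] =
    @rV_uncons d @^-1` (A ord0 `*` B).
  apply/seteqP; split => x /=.
    by move=> Ax; split => // i /=; rewrite mxE.
  move=> [A0 Bx] i; case: (unliftP ord0 i) => [j ->|->] //.
  by have := Bx j; rewrite mxE.
rewrite EB; split.
  rewrite -[X in measurable X]setTI.
  by apply: measurable_rV_uncons => //; exact: measurableX.
rewrite /= /lebesgue_rV_step /pushforward -comp_preimage.
rewrite (_ : _ \o _ = id); last by apply/funext => p /=; exact: rV_consK.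
rewrite preimage_id product_measure1E //; last exact: mA.
by rewrite big_ord_recl Bprod.
Qed.

End lebesgue_rV.

Section stable_semigroup.
Context {R : realType} {d : nat}.
Implicit Types (x y b : 'rV[R]_d) (f : 'rV[R]_d -> R).

Definition dotv x y : R := \sum_(i < d) x 0 i * y 0 i.

(* The library norm `|x| on 'rV[R]_d is the sup norm. *)
Definition enorm x : R := Num.sqrt (\sum_(i < d) x 0 i ^+ 2).

Definition dot_grad b f x : R :=
  \sum_(i < d) b 0 i * 'D_(delta_mx 0 i : 'rV[R]_d) f x.

Definition cexp (z : R[i]) : R[i] :=
  (expR (complex.Re z))%:C%C * (cos (complex.Im z) +i* sin (complex.Im z))%C.

Definition Cintegral (g : 'rV[R]_d -> R[i]) : R[i] :=
  ((\int[lebesgue_rV d]_x complex.Re (g x))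
    +i* (\int[lebesgue_rV d]_x complex.Im (g x)))%C.

(* The integral is real, the imaginary part of its integrand being odd in xi;
   Re only brings its value back to R. *)
Definition heat_kernel (alpha t : R) x : R := complex.Re
  (((2 * pi) ^- d)%:C%C *
   Cintegral (fun xi => cexp (- (0 +i* 1)%C * (dotv x xi)%:C%C) *
                        cexp (- (t * enorm xi `^ alpha)%:C%C))).

Definition stable_semigroup (alpha t : R) f x : R :=
  \int[lebesgue_rV d]_y (heat_kernel alpha t (x - y) * f y).

(* u in C(I; L^p), with u t a Borel function rather than its class *)
Definition continuous_Lp (p : \bar R) (I : set R) (u : R -> 'rV[R]_d -> R) :=
  forall t, I t ->
    u t \in Lfun (lebesgue_rV d) p /\
    ('N[lebesgue_rV d]_p [EFin \o (u s \- u t)%R])%E @[s --> within I (nbhs t)]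
      --> 0%E.

(* The gradient falls on the variable z, as in the Duhamel formula. *)
Definition duhamel_integrand (alpha q : R) b (u : R -> 'rV[R]_d -> R)
    (t : R) x (s : R) (z : 'rV[R]_d) : R :=
  dot_grad b (fun z' => heat_kernel alpha (t - s) (x - z')) z *
  (u s z * `|u s z| `^ q).

(* The finiteness clause says that the space-time integral of the formula that
   follows it is (absolutely) convergent; otherwise the library would give it
   a conventional value. *)
Definition mild_solution (alpha q : R) b (u0 : 'rV[R]_d -> R)
    (u : R -> 'rV[R]_d -> R) : Prop :=
  [/\ continuous_Lp 1%E `[0, +oo[ u,
      continuous_Lp +oo%E `]0, +oo[ u,
      {ae lebesgue_rV d, forall x, u 0 x = u0 x} &
      forall (t : R) x, 0 < t ->
        (\int[lebesgue_measure]_(s in `]0%R, t[)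
           \int[lebesgue_rV d]_z
             `|(duhamel_integrand alpha q b u t x s z)%:E| < +oo)%E /\
        u t x = stable_semigroup alpha t u0 x +
          \int[lebesgue_measure]_(s in `]0, t[)
            \int[lebesgue_rV d]_z duhamel_integrand alpha q b u t x s z].

Definition rescale (alpha : R) (v : R -> 'rV[R]_d -> R) (t : R) x : R :=
  t `^ (d%:R / alpha) * v t (t `^ alpha^-1 *: x).

End stable_semigroup.

(* Main.v *)
(* Write nu = 1 / alpha, p_t for the heat kernel and k_t = - b . grad p_t. The
   heart of the matter is the pair of bounds p_1(x) ~ (1 + |x|^2)^(-(d + alpha) / 2)
   and |k_t| <= C t^(-nu) p_t. They are read off the Fourier integrals, because
   e^(-lambda^(alpha / 2)) is a limit of nonnegative combinations of the
   exponentials e^(-s lambda), for which the integrals are Gaussian.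

   Suppose |u(s)| <= D P_s u0 and (P_s u0)^q <= eta s^(-(1 - nu)) for small s. By the
   semigroup property the Duhamel term at time t is then at most
   C D^(q+1) eta (int_0^t (t - s)^(-nu) s^(-(1 - nu)) ds) P_t u0, a fixed multiple of
   eta P_t u0; since eta is arbitrary, u / P u0 tends to 1 uniformly.

   The first bound comes from restarting the equation at a time a > 0, where u
   is bounded, iterating the Duhamel inequality from there, and letting a tend
   to 0. (That u satisfies the equation restarted at a is itself not immediate:
   the defect is an integrable function invariant under translation by b, hence
   zero.) The second bound follows for q = q0 from splitting u0 at a high level,
   and for q > q0 from the maximum principle |u(t)| <= |u0|_oo. The latter holds
   because u is the L^1 limit of the monotone splitting scheme
   v |-> P_tau (v - (f(v) - f(v(. - h b))) / L), h = L tau, none of whose steps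
   increases the integral of (|v| - K)_+. *)
Require Import Defs.
From HB Require Import structures.
From mathcomp Require Import all_boot all_order all_algebra.
From mathcomp Require Import all_classical all_reals all_analysis.
From mathcomp Require Import measurable_realfun complex ess_sup_inf.
From mathcomp Require Import ring lra.

Set Implicit Arguments.
Unset Strict Implicit.
Unset Printing Implicit Defensive.

Import Order.TTheory GRing.Theory Num.Theory.
Import numFieldNormedType.Exports.

Local Open Scope classical_set_scope.
Local Open Scope ring_scope.

(** The exponent [q0] is the borderline case: P_r maps L^1 to L^oo with norm of order r^(-d nu), and
    d nu q0 = 1 - nu. The time integral in the Duhamel term is then a Beta integral whose value does
    not depend on t, so that nothing small comes from t -> 0 by itself. Smallness has to sit in the
    factor eta; for q = q0 it comes from u0, whose part above a high level has small L^1 norm, a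
    property that passes to u(a) for small a by continuity in L^1.

    The bound by P_s u0 cannot be obtained at once from time 0: absorbing the Duhamel term requires
    an a priori bound of u, and the hypotheses give one only on compact subsets of (0, oo), without
    any rate at 0. Hence every constant of the iteration is kept independent of the restarting time,
    except a step length that does not survive in the conclusion.

    No explicit formula, subordinator or representing measure is used for the kernel: its bounds
    come from comparing, for all s > 0, a Gaussian transform with a few exponentials chosen by
    hand. *)

Definition L1 {d} {T : measurableType d} {R : realType}
  (mu : {measure set T -> \bar R}) (f : T -> R) : Prop :=
  mu.-integrable [set: T] (EFin \o f).

(** * Real-valued Lebesgue integrals and Fubini's theorem *)

Section real_integral.
Context {d} {T : measurableType d} {R : realType}.
Variable mu : {measure set T -> \bar R}.
Implicit Types f g : T -> R.

Lemma L1P f : L1 mu f <->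
  measurable_fun setT f /\ (\int[mu]_x `|f x|%:E < +oo)%E.
Proof.
split=> [/integrableP[/measurable_EFinP]//|[mf fy]].
by apply/integrableP; split=> //; exact/measurable_EFinP.
Qed.

Lemma L1_measurable f : L1 mu f -> measurable_fun setT f.
Proof. by move=> /L1P[]. Qed.

Lemma L1_le f g : measurable_fun setT f -> (forall x, `|f x| <= g x) ->
  L1 mu g -> L1 mu f.
Proof.
move=> mf fg; apply: le_integrable => //; first exact/measurable_EFinP.
by move=> x _ /=; rewrite lee_fin (le_trans (fg x))// ler_norm.
Qed.

Lemma L1D f g : L1 mu f -> L1 mu g -> L1 mu (fun x => f x + g x).
Proof. by move=> lf lg; exact: (integrableD measurableT lf lg). Qed.

Lemma L1N f : L1 mu f -> L1 mu (fun x => - f x).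
Proof. by move=> lf; exact: (integrableN lf). Qed.

Lemma L1B f g : L1 mu f -> L1 mu g -> L1 mu (fun x => f x - g x).
Proof. by move=> lf lg; apply: L1D => //; exact: L1N. Qed.

Lemma L1Z c f : L1 mu f -> L1 mu (fun x => c * f x).
Proof.
by move=> lf; exact: (integrableZl measurableT c lf).
Qed.

Lemma L1_norm f : L1 mu f -> L1 mu (fun x => `|f x|).
Proof. exact: integrable_norm. Qed.

Lemma L1_0 : L1 mu (fun=> 0).
Proof. exact: integrable0. Qed.

Lemma L1_sum (I : Type) (s : seq I) (F : I -> T -> R) :
  (forall i, L1 mu (F i)) -> L1 mu (fun x => \sum_(i <- s) F i x).
Proof.
move=> lF; elim: s => [|i s IH].
  by under eq_fun do rewrite big_nil; exact: L1_0.
by under eq_fun do rewrite big_cons; exact: L1D.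
Qed.

Lemma L1_bddM c f g : measurable_fun setT g -> (forall x, `|g x| <= c) ->
  L1 mu f -> L1 mu (fun x => g x * f x).
Proof.
move=> mg gc lf; apply: (@L1_le _ (fun x => c * `|f x|)).
- by apply: measurable_funM => //; exact: L1_measurable.
- by move=> x; rewrite normrM ler_wpM2r.
- by apply: L1Z; exact: L1_norm.
Qed.

Lemma EFin_Rint f : L1 mu f -> (\int[mu]_x f x)%:E = (\int[mu]_x (f x)%:E)%E.
Proof. by move=> lf; rewrite /Rintegral fineK//; exact: integrable_fin_num. Qed.

Lemma RintD f g : L1 mu f -> L1 mu g ->
  \int[mu]_x (f x + g x) = \int[mu]_x f x + \int[mu]_x g x.
Proof. by move=> lf lg; rewrite RintegralD. Qed.

Lemma RintB f g : L1 mu f -> L1 mu g ->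
  \int[mu]_x (f x - g x) = \int[mu]_x f x - \int[mu]_x g x.
Proof. by move=> lf lg; rewrite RintegralB. Qed.

Lemma RintZ c f : L1 mu f -> \int[mu]_x (c * f x) = c * \int[mu]_x f x.
Proof. by move=> lf; rewrite RintegralZl. Qed.

Lemma RintZr c f : L1 mu f -> \int[mu]_x (f x * c) = \int[mu]_x f x * c.
Proof. by move=> lf; rewrite RintegralZr. Qed.

Lemma RintN f : L1 mu f -> \int[mu]_x (- f x) = - \int[mu]_x f x.
Proof.
move=> lf; rewrite -mulN1r -RintZ//.
by apply: eq_Rintegral => x _; rewrite mulN1r.
Qed.

Lemma Rint0 : \int[mu]_x (0 : R) = 0.
Proof. by rewrite /Rintegral integral0. Qed.

Lemma Rint_eq0 f : (forall x, f x = 0) -> \int[mu]_x f x = 0.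
Proof. by move=> f0; rewrite /Rintegral integral0_eq// => x _; rewrite f0. Qed.

Lemma Rint_sum (I : Type) (s : seq I) (F : I -> T -> R) :
  (forall i, L1 mu (F i)) ->
  \int[mu]_x (\sum_(i <- s) F i x) = \sum_(i <- s) \int[mu]_x F i x.
Proof.
move=> lF; elim: s => [|i s IH].
  by rewrite big_nil; under eq_Rintegral do rewrite big_nil; rewrite Rint0.
rewrite big_cons -IH -RintD//; last exact: L1_sum.
by apply: eq_Rintegral => x _; rewrite big_cons.
Qed.

Lemma ler_Rint f g : L1 mu f -> L1 mu g -> (forall x, f x <= g x) ->
  \int[mu]_x f x <= \int[mu]_x g x.
Proof. by move=> lf lg fg; apply: le_Rintegral. Qed.

Lemma ler_norm_Rint f : L1 mu f -> `|\int[mu]_x f x| <= \int[mu]_x `|f x|.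
Proof. by move=> lf; apply: le_normr_Rintegral. Qed.

Lemma ler_norm_Rint_le f g : L1 mu f -> L1 mu g -> (forall x, `|f x| <= g x) ->
  `|\int[mu]_x f x| <= \int[mu]_x g x.
Proof.
move=> lf lg fg; apply: (le_trans (ler_norm_Rint lf)).
by apply: ler_Rint => //; exact: L1_norm.
Qed.

Lemma Rint_ge0 f : (forall x, 0 <= f x) -> 0 <= \int[mu]_x f x.
Proof. by move=> f0; apply: Rintegral_ge0. Qed.

Lemma ge0_L1 f : measurable_fun setT f -> (forall x, 0 <= f x) ->
  (\int[mu]_x (f x)%:E < +oo)%E -> L1 mu f.
Proof.
move=> mf f0 fy; apply/L1P; split=> //.
by under eq_integral do rewrite ger0_norm//.
Qed.

Lemma ae_L1 f g : L1 mu f -> measurable_fun setT g ->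
  {ae mu, forall x, f x = g x} -> L1 mu g.
Proof.
move=> /L1P[mf fy] mg fg; apply/L1P; split=> //.
rewrite (@ge0_ae_eq_integral _ _ _ mu setT _ (fun x => `|f x|%:E))//.
- by apply/measurable_EFinP; exact: measurableT_comp.
- by apply/measurable_EFinP; exact: measurableT_comp.
- by apply: filterS fg => x -> _.
Qed.

Lemma ae_eq_Rint f g : measurable_fun setT f -> measurable_fun setT g ->
  {ae mu, forall x, f x = g x} -> \int[mu]_x f x = \int[mu]_x g x.
Proof.
move=> mf mg fg; rewrite /Rintegral; congr fine.
apply: ae_eq_integral => //; try exact/measurable_EFinP.
by apply: filterS fg => x -> _.
Qed.

(** [g] may be replaced by max(f, g), which equals it almost everywhere and dominates [f]
    everywhere; this reduces the claim to pointwise monotonicity. *)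
Lemma ae_ler_Rint f g : L1 mu f -> L1 mu g ->
  {ae mu, forall x, f x <= g x} -> \int[mu]_x f x <= \int[mu]_x g x.
Proof.
move=> lf lg fg.
have mf := L1_measurable lf; have mg := L1_measurable lg.
have lm : L1 mu (fun x => Num.max (f x) (g x)).
  apply: (@L1_le _ (fun x => `|f x| + `|g x|)).
  - exact: measurable_maxr.
  - move=> x; case: (leP (f x) (g x)) => _.
      by rewrite lerDr.
    by rewrite lerDl.
  - by apply: L1D; exact: L1_norm.
rewrite (@ae_eq_Rint g (fun x => Num.max (f x) (g x)))//.
- by apply: ler_Rint => // x; rewrite le_max lexx.
- exact: L1_measurable lm.
- by apply: filterS fg => x /max_idPr.
Qed.

Lemma ae_ge0_L1_eq0 f : L1 mu f -> (forall x, 0 <= f x) ->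
  \int[mu]_x f x <= 0 -> {ae mu, forall x, f x = 0}.
Proof.
move=> lf f0 fle; have mf := L1_measurable lf.
have : (\int[mu]_x `|(f x)%:E| = 0)%E.
  under eq_integral do rewrite /= ger0_norm//.
  rewrite -EFin_Rint//; congr EFin; apply/eqP; rewrite eq_le fle/=.
  exact: Rint_ge0.
have mEf : measurable_fun setT (EFin \o f) by exact/measurable_EFinP.
move/(ae_eq_integral_abs mu measurableT mEf).
by apply: filterS => x /(_ Logic.I)/= [].
Qed.

Lemma Rint_cvg (F : nat -> T -> R) f g :
  (forall n, measurable_fun setT (F n)) -> measurable_fun setT f ->
  L1 mu g -> (forall x, F n x @[n --> \oo] --> f x) ->
  (forall n x, `|F n x| <= g x) ->
  \int[mu]_x F n x @[n --> \oo] --> \int[mu]_x f x.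
Proof.
move=> mF mf lg Ff Fg.
have FfE : {ae mu, forall x, setT x ->
    (fun n => (F n x)%:E) @ \oo --> (EFin \o f) x}.
  by apply: aeW => x _; apply: cvg_EFin; [exact: nearW|exact: Ff].
have FgE : {ae mu, forall x n, setT x -> (`|(F n x)%:E| <= (EFin \o g) x)%E}.
  by apply: aeW => x n _; rewrite lee_fin; exact: Fg.
have [lf _] := @dominated_convergence _ _ _ mu setT measurableT
  (fun n x => (F n x)%:E) (EFin \o f) (EFin \o g)
  (fun n => (measurable_EFinP _ _).2 (mF n)) ((measurable_EFinP _ _).2 mf)
  FfE lg FgE.
rewrite -EFin_Rint//; apply: fine_cvg.
Qed.

End real_integral.

Section fubini_real.
Context {d1 d2} {T1 : measurableType d1} {T2 : measurableType d2} {R : realType}.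
Variables (m1 : {sigma_finite_measure set T1 -> \bar R})
          (m2 : {sigma_finite_measure set T2 -> \bar R}).

Lemma L1_prod (f : T1 * T2 -> R) : measurable_fun setT f ->
  (\int[m1]_x \int[m2]_y `|f (x, y)|%:E < +oo)%E -> L1 (m1 \x m2)%E f.
Proof.
move=> mf fy; apply/integrable12ltyP => //=; exact/measurable_EFinP.
Qed.

Lemma L1_prodM f g : L1 m1 f -> L1 m2 g ->
  L1 (m1 \x m2)%E (fun p => f p.1 * g p.2).
Proof.
move=> lf lg; have [mf _] := (L1P _ _).1 lf; have [mg gy] := (L1P _ _).1 lg.
apply: L1_prod.
  by apply: measurable_funM; exact: measurableT_comp.
under eq_integral => x _.
  under eq_integral do rewrite normrM EFinM.
    rewrite /= ge0_integralZl//; last first.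
      by apply/measurable_EFinP; exact: measurableT_comp.
    over.
rewrite /= -(EFin_Rint (L1_norm lg)).
under eq_integral do rewrite -EFinM.
rewrite -(@EFin_Rint _ _ _ _ (fun x => `|f x| * _)) ?ltry//.
by under eq_fun do rewrite mulrC; apply: L1Z; exact: L1_norm.
Qed.

Variable f : T1 * T2 -> R.
Hypothesis lf : L1 (m1 \x m2)%E f.

Lemma ae_L1_section1 : {ae m1, forall x, L1 m2 (fun y => f (x, y))}.
Proof. exact: (ae_integrable1 lf). Qed.

Lemma ae_L1_section2 : {ae m2, forall y, L1 m1 (fun x => f (x, y))}.
Proof. exact: (ae_integrable2 lf). Qed.

Lemma measurable_Rint1 : measurable_fun setT (fun x => \int[m2]_y f (x, y)).
Proof.
by apply: measurableT_comp => //; exact: (measurable_fubini_F lf).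
Qed.

Lemma measurable_Rint2 : measurable_fun setT (fun y => \int[m1]_x f (x, y)).
Proof.
by apply: measurableT_comp => //; exact: (measurable_fubini_G lf).
Qed.

(** Integrability of [g] is not assumed, because sections of [f] are integrable only almost
    everywhere: when the extended integral is infinite, [fine] returns 0 and the bound is
    trivial. *)
Let fine_le_abs d (T : measurableType d) (m : {measure set T -> \bar R})
    (g : T -> R) : measurable_fun setT g ->
  (`|\int[m]_x g x|%:E <= \int[m]_x `|g x|%:E)%E.
Proof.
move=> mg.
have : (`|\int[m]_x (g x)%:E| <= \int[m]_x `|(g x)%:E|)%E.
  by apply: le_abse_integral => //; exact/measurable_EFinP.
apply: le_trans; rewrite /Rintegral.
by case: (\int[m]_x (g x)%:E)%E => [r| |] //=; rewrite normr0 leey.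
Qed.

Let mf : measurable_fun setT f. Proof. exact: L1_measurable lf. Qed.

Lemma L1_Rint1 : L1 m1 (fun x => \int[m2]_y f (x, y)).
Proof.
have mF := measurable_Rint1; apply/L1P; split => //.
have mEf : measurable_fun setT (EFin \o f) by exact/measurable_EFinP.
have := (integrable12ltyP m1 m2 mEf).1 lf; apply: le_lt_trans.
apply: ge0_le_integral => //.
- by apply/measurable_EFinP; exact: measurableT_comp.
- apply: (measurable_fun_fubini_tonelli_F (fun z => `|f z|%:E)) => //.
  by apply/measurable_EFinP; exact: measurableT_comp.
- by move=> x _; apply: fine_le_abs; exact: measurableT_comp.
Qed.

Lemma L1_Rint2 : L1 m2 (fun y => \int[m1]_x f (x, y)).
Proof.
have mF := measurable_Rint2; apply/L1P; split => //.
have mEf : measurable_fun setT (EFin \o f) by exact/measurable_EFinP.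
have := (integrable21ltyP m1 m2 mEf).1 lf; apply: le_lt_trans.
apply: ge0_le_integral => //.
- by apply/measurable_EFinP; exact: measurableT_comp.
- apply: (measurable_fun_fubini_tonelli_G (fun z => `|f z|%:E)) => //.
  by apply/measurable_EFinP; exact: measurableT_comp.
- by move=> x _; apply: fine_le_abs; exact: measurableT_comp.
Qed.

Lemma Rint_prod1 : \int[m1]_x \int[m2]_y f (x, y) = \int[(m1 \x m2)%E]_z f z.
Proof.
apply: EFin_inj; rewrite EFin_Rint; last exact: L1_Rint1.
rewrite EFin_Rint// -(integral12_prod_meas1 lf).
apply: ae_eq_integral => //.
- by apply/measurable_EFinP; exact: measurable_Rint1.
- exact: (measurable_fubini_F lf).
- by apply: filterS ae_L1_section1 => x lx _; rewrite EFin_Rint.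
Qed.

Lemma Rint_prod2 : \int[m2]_y \int[m1]_x f (x, y) = \int[(m1 \x m2)%E]_z f z.
Proof.
apply: EFin_inj; rewrite EFin_Rint; last exact: L1_Rint2.
rewrite EFin_Rint// -(integral21_prod_meas1 lf).
apply: ae_eq_integral => //.
- by apply/measurable_EFinP; exact: measurable_Rint2.
- exact: (measurable_fubini_G lf).
- by apply: filterS ae_L1_section2 => x lx _; rewrite EFin_Rint.
Qed.

Lemma Rint_fubini : \int[m1]_x \int[m2]_y f (x, y) = \int[m2]_y \int[m1]_x f (x, y).
Proof. by rewrite Rint_prod1 Rint_prod2. Qed.

End fubini_real.

(* lebesgue_measure lives on a generated sigma-algebra type that unification
   does not identify with R; leb is the same measure, on R itself. *)
Definition leb {R : realType} (A : set R) : \bar R := @lebesgue_measure R A.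

Section leb.
Context {R : realType}.

Let leb0 : leb (set0 : set R) = 0%E. Proof. exact: measure0. Qed.

Let leb_ge0 (A : set R) : (0 <= leb A)%E. Proof. exact: measure_ge0. Qed.

Let leb_semi_sigma_additive : semi_sigma_additive (@leb R).
Proof. exact: (@measure_semi_sigma_additive _ _ _ (@lebesgue_measure R)). Qed.

HB.instance Definition _ := isMeasure.Build _ R R (@leb R)
  leb0 leb_ge0 leb_semi_sigma_additive.

Let leb_sigma_finite : sigma_finite [set: R] (@leb R).
Proof. exact: (sigma_finiteT (@lebesgue_measure R)). Qed.

HB.instance Definition _ := Measure_isSigmaFinite.Build _ _ _ (@leb R)
  leb_sigma_finite.

Lemma ge0_integral_leb (f : R -> \bar R) : measurable_fun setT f ->
  (forall x, 0 <= f x)%E ->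
  (\int[@leb R]_x f x = \int[lebesgue_measure]_x f x)%E.
Proof.
move=> mf f0.
have mid : measurable_fun [set: measurableTypeR R] (fun x : measurableTypeR R => x : R).
  by move=> _ Y mY; rewrite setTI.
have := @ge0_integral_pushforward _ _ _ _ _ _ mid (@lebesgue_measure R) setT f
  measurableT mf (fun x _ => f0 x).
rewrite preimage_setT => <-.
pose m := measure_function_pushforward__canonical__measure_function_Measure
  (@lebesgue_measure R) mid.
by apply: (eq_measure_integral m) => A mA _.
Qed.

Lemma integral_leb (f : R -> \bar R) : measurable_fun setT f ->
  (\int[@leb R]_x f x = \int[lebesgue_measure]_x f x)%E.
Proof.
move=> mf; rewrite integralE [RHS]integralE; congr (_ - _)%E.
- by apply: ge0_integral_leb => //; exact: measurable_funepos.
- by apply: ge0_integral_leb => //; exact: measurable_funeneg.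
Qed.

End leb.

(** * Affine changes of variables in R^n *)

Section affine_change.
Context {R : realType}.
Notation leb := (@leb R).

(** The image of Lebesgue measure under x -> a + c x, multiplied by |c|, gives the right value to
    half-open intervals, whose preimages are again half-open (with the closed end swapped when c <
    0); uniqueness of Lebesgue measure does the rest. *)
Lemma ge0_integral_affine1 (f : R -> \bar R) (c a : R) : c != 0 ->
  measurable_fun setT f -> (forall x, 0 <= f x)%E ->
  (\int[leb]_x f (a + c * x)%R = `|c|^-1%:E * \int[leb]_x f x)%E.
Proof.
move=> c0 mf f0; rewrite !ge0_integral_leb//; last first.
  apply: (measurableT_comp mf).
  by apply: measurable_funD => //; exact: measurable_funM.
pose phi (x : R) : measurableTypeR R := a + c * x.
have mphi : measurable_fun setT phi.
  by apply: measurable_funD => //; exact: measurable_funM.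
have c_ge0 : 0 <= `|c| by [].
pose nu : {measure set (measurableTypeR R) -> \bar R} := mscale (NngNum c_ge0)
  (measure_function_pushforward__canonical__measure_function_Measure (@lebesgue_measure R) mphi).
have nuE A : measurable A -> lebesgue_measure A = nu A.
  apply: lebesgue_measure_unique => X /ocitvP[->|[[x y] /= xy ->]].
    by rewrite !measure0.
  rewrite /nu/= /mscale/= /pushforward.
  rewrite lebesgue_measure_itv/= lte_fin xy.
  have [cp|cn] := ltP 0 c.
    have -> : phi @^-1` `]x, y] = `](x - a) / c, (y - a) / c]%classic.
      apply/seteqP; split => z /=; rewrite !in_itv/= /phi;
        rewrite ltr_pdivrMr// ler_pdivlMr// (mulrC z); lra.
    rewrite lebesgue_measure_itv/= lte_fin ltr_pM2r ?invr_gt0// ltrD2r xy.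
    rewrite -!EFinB -EFinM gtr0_norm//; congr EFin; field.
    by rewrite gt_eqF.
  have {}cn : c < 0 by rewrite lt_neqAle c0.
  have -> : phi @^-1` `]x, y] = `[(y - a) / c, (x - a) / c[%classic.
    apply/seteqP; split => z /=; rewrite !in_itv/= /phi;
      rewrite ltr_ndivlMr// ler_ndivrMr// (mulrC z); lra.
  rewrite lebesgue_measure_itv/= lte_fin ltr_nM2r ?invr_lt0// ltrD2r xy.
  rewrite -!EFinB -EFinM ltr0_norm//; congr EFin; field.
  by rewrite lt_eqF.
have -> : (\int[lebesgue_measure]_x f x = \int[nu]_x f x)%E.
  by apply: eq_measure_integral => A mA _; exact: nuE.
rewrite ge0_integral_mscale//= ge0_integral_pushforward//=.
rewrite muleA -EFinM mulVf ?normr_eq0// mul1e.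
by apply: eq_integral => x _.
Qed.

(** One unfolding of the recursive definition of the measure, a pushforward of a product, followed
    by Tonelli. The inductions on the dimension go through this identity. *)
Lemma integral_rVS n (f : 'rV[R]_n.+1 -> \bar R) :
  measurable_fun setT f -> (forall x, 0 <= f x)%E ->
  (\int[lebesgue_rV n.+1]_x f x =
   \int[leb]_r \int[lebesgue_rV n]_v f (rV_cons (r, v)))%E.
Proof.
move=> mf f0 /=.
have mc : measurable_fun [set: measurableTypeR R * 'rV[R]_n] (@rV_cons R n).
  exact: measurable_rV_cons.
rewrite [LHS](ge0_integral_pushforward mc (@lebesgue_measure R \x lebesgue_rV n)%E
  (D := setT) (f := f))//= preimage_setT.
have mfc : measurable_fun setT (fun p : R * 'rV[R]_n => f (rV_cons p)).
  by apply: measurableT_comp => //; exact: measurable_rV_cons.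
rewrite fubini_tonelli1//= ge0_integral_leb//; last first.
  by move=> r; exact: integral_ge0.
exact: (measurable_fun_fubini_tonelli_F (fun p : R * 'rV[R]_n => f (rV_cons p))) mfc (fun=> f0 _).
Qed.

Lemma measurable_affine n (c : R) (a : 'rV[R]_n) :
  measurable_fun setT (fun x : 'rV[R]_n => a + c *: x).
Proof.
apply: measurable_fun_rV => i; under eq_fun do rewrite !mxE.
by apply: measurable_funD => //; apply: measurable_funM => //; exact: measurable_rV_coord.
Qed.

Lemma rV_cons_uncons n (x : 'rV[R]_n.+1) : rV_cons (rV_uncons x) = x.
Proof.
apply/rowP => i; rewrite /rV_cons.
case: (@split_ordP 1 n i) => j ->.
  by rewrite (@row_mxEl _ 1 1 n) mxE (ord1 j) eqxx mulr1n/=; congr (x _ _); apply: val_inj.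
by rewrite (@row_mxEr _ 1 1 n)/= mxE; congr (x _ _); apply: val_inj.
Qed.

Lemma rV_cons_affine n (c r a : R) (b v : 'rV[R]_n) :
  rV_cons (a, b) + c *: rV_cons (r, v) = rV_cons (a + c * r, b + c *: v).
Proof.
rewrite /rV_cons/= (@scale_row_mx _ 1 1 n) (@add_row_mx _ 1 1 n).
congr (@row_mx _ 1 1 n _ _).
by rewrite scale_scalar_mx raddfD.
Qed.

Lemma ge0_integral_affine n (f : 'rV[R]_n -> \bar R) (c : R) (a : 'rV[R]_n) :
  c != 0 -> measurable_fun setT f -> (forall x, 0 <= f x)%E ->
  (\int[lebesgue_rV n]_x f (a + c *: x)%R =
   (`|c| ^- n)%:E * \int[lebesgue_rV n]_x f x)%E.
Proof.
move=> c0; elim: n f a => [|n IH] f a mf f0.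
  rewrite expr0 invr1 mul1e; apply: eq_integral => x _; congr f.
  by apply/rowP => -[].
rewrite integral_rVS//; last first.
  by apply: measurableT_comp => //; exact: measurable_affine.
rewrite -(rV_cons_uncons a); case: (rV_uncons a) => a0 a'.
have mf' r : measurable_fun setT (fun v => f (rV_cons (r, v))).
  apply: measurableT_comp => //.
  by apply: measurableT_comp => //; exact: measurable_rV_cons.
under eq_integral => r _.
  under eq_integral do rewrite rV_cons_affine.
  rewrite (IH (fun v => f (rV_cons (a0 + c * r, v))))//.
  over.
rewrite /=.
have mF : measurable_fun setT
    (fun r => \int[lebesgue_rV n]_v f (rV_cons (r, v)))%E.
  apply: (measurable_fun_fubini_tonelli_F (fun p => f (rV_cons p))) => //.
  by apply: measurableT_comp => //; exact: measurable_rV_cons.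
rewrite ge0_integralZl//; last 2 first.
- apply: (measurableT_comp mF).
  by apply: measurable_funD => //; exact: measurable_funM.
- by move=> r _; exact: integral_ge0.
rewrite (@ge0_integral_affine1
   (fun r => \int[lebesgue_rV n]_v f (rV_cons (r, v)))%E)//.
  by rewrite muleA -EFinM -invfM -exprSr -integral_rVS.
by move=> r; exact: integral_ge0.
Qed.

Lemma L1_affine n (f : 'rV[R]_n -> R) (c : R) (a : 'rV[R]_n) : c != 0 ->
  L1 (lebesgue_rV n) f -> L1 (lebesgue_rV n) (fun x => f (a + c *: x)).
Proof.
move=> c0 lf; have [mf fy] := (L1P _ _).1 lf; apply/L1P; split.
  by apply: measurableT_comp => //; exact: measurable_affine.
rewrite (@ge0_integral_affine n (fun x => `|f x|%:E))//; last first.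
  by apply/measurable_EFinP; exact: measurableT_comp.
by rewrite -(EFin_Rint (L1_norm lf)) -EFinM ltry.
Qed.

Lemma Rint_affine n (f : 'rV[R]_n -> R) (c : R) (a : 'rV[R]_n) : c != 0 ->
  L1 (lebesgue_rV n) f ->
  \int[lebesgue_rV n]_x f (a + c *: x) =
  `|c| ^- n * \int[lebesgue_rV n]_x f x.
Proof.
move=> c0 lf; have mf := L1_measurable lf.
apply: EFin_inj; rewrite EFinM EFin_Rint; last exact: L1_affine.
rewrite EFin_Rint// integralE [in RHS]integralE muleBr//; last first.
  exact: integrable_add_def.
congr (_ - _)%E.
- rewrite -[X in (\int[_]_x X^\+%E x)%E]/((EFin \o f) \o (fun x => a + c *: x)).
  rewrite funepos_comp.
  apply: (@ge0_integral_affine n (EFin \o f)^\+%E c a) => //.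
  exact: (measurable_funepos ((measurable_EFinP _ _).2 mf)).
- rewrite -[X in (\int[_]_x X^\-%E x)%E]/((EFin \o f) \o (fun x => a + c *: x)).
  rewrite funeneg_comp.
  apply: (@ge0_integral_affine n (EFin \o f)^\-%E c a) => //.
  exact: (measurable_funeneg ((measurable_EFinP _ _).2 mf)).
Qed.

Lemma L1_cons n (f : 'rV[R]_n.+1 -> R) : measurable_fun setT f ->
  L1 (leb \x lebesgue_rV n)%E (f \o @rV_cons R n) <-> L1 (lebesgue_rV n.+1) f.
Proof.
move=> mf.
have mfc : measurable_fun setT (fun p : R * 'rV[R]_n => f (rV_cons p)).
  by apply: measurableT_comp => //; exact: measurable_rV_cons.
have mnf : measurable_fun setT (fun x => `|f x|%:E).
  by apply/measurable_EFinP; exact: measurableT_comp.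
have mEfc : measurable_fun setT (EFin \o (f \o @rV_cons R n)).
  exact/measurable_EFinP.
split=> [/(integrable12ltyP leb (lebesgue_rV n) mEfc) H|/L1P[_ H]].
  by apply/L1P; split=> //; rewrite integral_rVS.
apply/(integrable12ltyP leb (lebesgue_rV n) mEfc).
by rewrite integral_rVS in H.
Qed.

Lemma Rint_cons n (f : 'rV[R]_n.+1 -> R) : L1 (lebesgue_rV n.+1) f ->
  \int[lebesgue_rV n.+1]_x f x =
  \int[leb]_r \int[lebesgue_rV n]_v f (rV_cons (r, v)).
Proof.
move=> lf; have mf := L1_measurable lf; have mEf := (measurable_EFinP _ _).2 mf.
have lfc := (L1_cons mf).2 lf.
have mc : measurable_fun setT (@rV_cons R n) by exact: measurable_rV_cons.
rewrite (Rint_prod1 lfc); apply: EFin_inj; rewrite !EFin_Rint//.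
rewrite integralE [RHS]integralE.
have mp := measurable_funepos mEf; have mn := measurable_funeneg mEf.
congr (_ - _)%E.
- rewrite integral_rVS//.
  rewrite -(@fubini_tonelli1 _ _ _ _ _ leb (lebesgue_rV n)
    (fun p => (EFin \o f)^\+%E (rV_cons p)))//; last exact: (measurableT_comp mp mc).
  apply: eq_integral => p _.
  exact: (congr1 (fun F => F p) (esym (funepos_comp (EFin \o f) (@rV_cons R n)))).
- rewrite integral_rVS//.
  rewrite -(@fubini_tonelli1 _ _ _ _ _ leb (lebesgue_rV n)
    (fun p => (EFin \o f)^\-%E (rV_cons p)))//; last exact: (measurableT_comp mn mc).
  apply: eq_integral => p _.
  exact: (congr1 (fun F => F p) (esym (funeneg_comp (EFin \o f) (@rV_cons R n)))).
Qed.

End affine_change.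

(** * Gaussian Fourier transforms *)

Section calculus.
Context {R : realType}.

(** A quadratic remainder with one constant for all increments. It replaces differentiation under
    the integral sign: for the Fourier integrals below, [C] is a second moment. *)
Lemma is_derive_quad (V : normedModType R) (f : V -> R) (x v : V) (l C : R) :
  (forall k : R, `|f (k *: v + x) - f x - k * l| <= C * k ^+ 2) ->
  is_derive x v f l.
Proof.
move=> fq.
have C0 : 0 <= C by have := le_trans (normr_ge0 _) (fq 1); rewrite expr1n mulr1.
have fl : (fun h : R => h^-1 *: (f (h *: v + x) - f x)) @ 0^' --> l.
  apply/cvgrPdist_le => e e0.
  have C1 : 0 < C + 1 by rewrite ltr_wpDl.
  near=> h.
  have h0 : h != 0 by near: h; exact: nbhs_dnbhs_neq.
  have hsmall : `|h| <= e / (C + 1).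
    near: h; apply: dnbhs0_le; exact: divr_gt0.
  rewrite -[X in X - _](mulKf h0) -[_ *: _]/(_ * _) -mulrBr normrM normfV.
  rewrite distrC ler_pdivrMl ?normr_gt0//.
  apply: (le_trans (fq h)).
  rewrite -(real_normK (num_real h)) expr2 mulrCA ler_wpM2l//.
  rewrite (le_trans (ler_wpM2l C0 hsmall))// mulrCA ler_piMr ?(ltW e0)//.
  by rewrite ler_pdivrMr// mul1r lerDl.
split; first by apply/cvg_ex; exists l.
by apply/cvg_lim.
Unshelve. all: by end_near. Qed.

Lemma is_derive_ext (f g : R -> R) (x l l' : R) :
  is_derive x (1 : R) g l' -> (forall t, f t = g t) -> l = l' ->
  is_derive x (1 : R) f l.
Proof. by move=> dg fg ->; rewrite (_ : f = g)//; exact/funext. Qed.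

Lemma is_derive_continuous (f df : R -> R) :
  (forall x : R, is_derive x (1 : R) f (df x)) -> continuous f.
Proof.
move=> h x; apply/differentiable_continuous/derivable1_diffP.
by have := h x; case.
Qed.

Lemma lipschitz_is_derive (f df : R -> R) (M : R) :
  (forall x : R, is_derive x (1 : R) f (df x)) -> (forall x, `|df x| <= M) ->
  forall x y, `|f y - f x| <= M * `|y - x|.
Proof.
move=> fd dM x y; wlog xy : x y / x <= y.
  move=> H; have [|/ltW] := leP x y; first exact: H.
  by move=> /H; rewrite distrC (distrC x).
have [c _ ->] := MVT_segment xy (fun z _ => fd z)
  (continuous_subspaceT (is_derive_continuous fd)).
by rewrite normrM ler_wpM2r.
Qed.

Lemma sin_lip (x y : R) : `|sin y - sin x| <= `|y - x|.
Proof.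
rewrite -[leRHS]mul1r; apply: (lipschitz_is_derive (df := cos)) => // z.
exact: cos_max.
Qed.

Lemma norm_sin_le (x : R) : `|sin x| <= `|x|.
Proof. by have := sin_lip 0 x; rewrite sin0 !subr0. Qed.

Lemma cos_quad (a h : R) : `|cos (a + h) - cos a + h * sin a| <= h ^+ 2.
Proof.
pose f (t : R) := cos (a + t) + t * sin a.
have fd (t : R) : is_derive t (1 : R) f (sin a - sin (a + t)).
  have d1 := is_deriveD (is_derive_cst a t (1 : R)) (is_derive_id t (1:R)).
  have d2 := @is_derive1_comp _ cos (fun t => a + t) t _ _ (is_derive_cos _) d1.
  have d3 := is_deriveM (is_derive_id t (1:R)) (is_derive_cst (sin a) t (1 : R)).
  apply: (is_derive_ext (is_deriveD d2 d3)) => //.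
  by rewrite -![_ *: _]/(_ * _)/=; ring.
have [h0|h0] := leP 0 h.
  have [c /andP[c0 ch] E] := MVT_segment h0 (fun z _ => fd z)
    (continuous_subspaceT (is_derive_continuous fd)).
  move: E; rewrite /f addr0 mul0r addr0 subr0 addrAC => ->.
  rewrite normrM (ger0_norm h0) expr2 ler_wpM2r// (le_trans (sin_lip _ _))//.
  rewrite opprD addNKr normrN ger0_norm//.
have {}h0 := ltW h0.
have [c /andP[ch c0] E] := MVT_segment h0 (fun z _ => fd z)
  (continuous_subspaceT (is_derive_continuous fd)).
move: E; rewrite /f addr0 mul0r addr0 addrAC => E.
rewrite distrC E normrM sub0r normrN (ler0_norm h0) [leRHS](_ : _ = (- h) * (- h)); last by ring.
rewrite ler_wpM2r ?oppr_ge0//.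
by rewrite (le_trans (sin_lip _ _))// opprD addNKr normrN ler0_norm// lerN2.
Qed.

Lemma measurable_cos : measurable_fun setT (@cos R).
Proof. by apply: continuous_measurable_fun; exact: continuous_cos. Qed.

Lemma measurable_sin : measurable_fun setT (@sin R).
Proof. by apply: continuous_measurable_fun; exact: continuous_sin. Qed.

Lemma expR_poly_bound (n : nat) (x : R) : 0 <= x -> x ^+ n <= n`!%:R * expR x.
Proof.
move=> x0; case: n => [|n].
  by rewrite expr0 fact0 mul1r -expR0 ler_expR.
have := expR_ge1Dxn n x0; rewrite -(ler_pM2l (_ : 0 < (n.+1)`!%:R)); last first.
  by rewrite ltr0n fact_gt0.
apply: le_trans; rewrite mulrDr mulrCA divff ?mulr1.
  by rewrite lerDr ler0n.
by rewrite pnatr_eq0 -lt0n fact_gt0.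
Qed.

End calculus.

Section oscillatory.
Context {d} {T : measurableType d} {R : realType}.
Variable mu : {measure set T -> \bar R}.
Variables (w c : T -> R).
Hypothesis (mc : measurable_fun setT c) (lw : L1 mu w)
  (lcw : L1 mu (fun x => c x ^+ 2 * `|w x|)).

Lemma L1_cosM (a : T -> R) : measurable_fun setT a ->
  L1 mu (fun x => cos (a x) * w x).
Proof.
move=> ma; apply: (L1_bddM (c := 1)) => //; last by move=> x; exact: cos_max.
by apply: measurableT_comp => //; exact: measurable_cos.
Qed.

Lemma L1_moment1 : L1 mu (fun x => c x * w x).
Proof.
apply: (@L1_le _ _ _ _ _ (fun x => `|w x| + c x ^+ 2 * `|w x|)).
- by apply: measurable_funM => //; exact: L1_measurable lw.
- move=> x; rewrite normrM -[X in X + _]mul1r -mulrDl ler_wpM2r//.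
  by rewrite -(real_normK (num_real (c x))); have := sqr_ge0 (`|c x| - 1); nra.
- by apply: L1D => //; exact: L1_norm.
Qed.

Lemma L1_sinM (a : T -> R) : measurable_fun setT a ->
  L1 mu (fun x => c x * sin (a x) * w x).
Proof.
move=> ma; have := L1_moment1.
move/(L1_bddM (c := 1) (g := fun x => sin (a x))) => H.
have -> : (fun x => c x * sin (a x) * w x) = (fun x => sin (a x) * (c x * w x)).
  by apply/funext => x; ring.
apply: H; last by move=> x; exact: sin_max.
by apply: measurableT_comp => //; exact: measurable_sin.
Qed.

(** [cos_quad] integrated against [w]. Together with [is_derive_quad] it differentiates Fourier
    integrals in the frequency, the constant being the second moment of [c]. *)
Lemma oscillatory_quad (a : T -> R) (k : R) : measurable_fun setT a ->
  `| \int[mu]_x (cos (a x + k * c x) * w x) - \int[mu]_x (cos (a x) * w x)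
     + k * \int[mu]_x (c x * sin (a x) * w x) |
  <= (\int[mu]_x (c x ^+ 2 * `|w x|)) * k ^+ 2.
Proof.
move=> ma.
have mak : measurable_fun setT (fun x => a x + k * c x).
  by apply: measurable_funD => //; exact: measurable_funM.
have l1 := L1_cosM mak; have l2 := L1_cosM ma; have l3 := L1_sinM ma.
rewrite -RintB// -RintZ// -RintD//; [|exact: L1B|exact: L1Z].
rewrite mulrC -RintZ//.
apply: ler_norm_Rint_le.
- by apply: L1D; [exact: L1B|exact: L1Z].
- exact: L1Z.
- move=> x.
  rewrite (_ : _ + _ = (cos (a x + k * c x) - cos (a x) + k * c x * sin (a x)) * w x).
    by rewrite normrM mulrA ler_wpM2r// -exprMn cos_quad.
  by ring.
Qed.

End oscillatory.

Section gauss1.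
Context {R : realType}.
Notation leb := (@leb R).
Variable s : R.
Hypothesis s0 : 0 < s.

Let g (x : R) := expR (- (s * x ^+ 2)).

Lemma measurable_gauss1 : measurable_fun setT g.
Proof.
apply: measurableT_comp => //; apply: measurableT_comp => //.
by apply: measurable_funM => //; exact: measurable_funX.
Qed.

Lemma integral_gauss1 : (\int[leb]_x (g x)%:E = (Num.sqrt (pi / s))%:E)%E.
Proof.
have ss0 : Num.sqrt s != 0 by rewrite sqrtr_eq0 -ltNge.
have mgf : measurable_fun setT (fun x : R => (gauss_fun x)%:E).
  by apply/measurable_EFinP; exact: measurable_gauss_fun.
have := @ge0_integral_affine1 R (fun x => (gauss_fun x)%:E) (Num.sqrt s) 0 ss0.
rewrite [X in _ = (_ * X)%E]integral_leb// integralT_gauss -EFinM => H.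
under eq_integral => x _.
  rewrite (_ : g x = gauss_fun (0 + Num.sqrt s * x)).
    over.
  by rewrite /g /gauss_fun add0r exprMn sqr_sqrtr// ltW.
rewrite H.
- rewrite ger0_norm ?sqrtr_ge0//; congr EFin.
  by rewrite sqrtrM ?pi_ge0// sqrtrV ?ltW// mulrC.
- by apply/measurable_EFinP; exact: measurable_gauss_fun.
- by move=> x; rewrite lee_fin expR_ge0.
Qed.

Lemma L1_gauss1 : L1 leb g.
Proof.
apply: ge0_L1; first exact: measurable_gauss1.
- by move=> x; exact: expR_ge0.
- by rewrite integral_gauss1 ltry.
Qed.

Lemma Rint_gauss1 : \int[leb]_x g x = Num.sqrt (pi / s).
Proof. by rewrite /Rintegral integral_gauss1. Qed.

End gauss1.

Section gauss1FT.
Context {R : realType}.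
Notation leb := (@leb R).
Variable s : R.
Hypothesis s0 : 0 < s.

Let g (x : R) := expR (- (s * x ^+ 2)).

Lemma L1_gauss1_moment2 : L1 leb (fun x => x ^+ 2 * `|g x|).
Proof.
have s20 : 0 < s / 2 by rewrite divr_gt0.
apply: (@L1_le _ _ _ leb _ (fun x => (s / 2)^-1 * expR (- (s / 2 * x ^+ 2)))).
- apply: measurable_funM; first exact: measurable_funX.
  by apply: measurableT_comp => //; exact: measurable_gauss1.
- move=> x; rewrite ger0_norm; last by rewrite mulr_ge0 ?sqr_ge0.
  rewrite ger0_norm ?expR_ge0// ler_pdivlMl// mulrA.
  have -> : g x = expR (- (s / 2 * x ^+ 2)) * expR (- (s / 2 * x ^+ 2)).
    by rewrite -expRD /g; congr expR; field.
  rewrite mulrA ler_piMl ?expR_ge0// expRN ler_pdivrMr ?expR_gt0// mul1r.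
  by apply: le_trans (expR_ge1Dx _); rewrite lerDr.
- by apply: L1Z; exact: L1_gauss1.
Qed.

Let is_derive_phase (x th t : R) :
  is_derive t (1 : R) (fun t => sin (th + x * t) * g t)
   ((x * cos (th + x * t) - 2 * s * (t * sin (th + x * t))) * g t).
Proof.
have d1 : is_derive t (1 : R) (fun t => th + x * t) x.
  have H := is_deriveM (is_derive_cst x t (1 : R)) (is_derive_id t (1:R)).
  apply: (is_derive_ext (is_deriveD (is_derive_cst th t (1 : R)) H)) => //.
  by rewrite -![_ *: _]/(_ * _)/=; ring.
have d2 : is_derive t (1 : R) (fun t : R => - (s * t ^+ 2)) (- (s * (2 * t))).
  have H := is_deriveX 2 (is_derive_id t (1:R)).
  apply: (is_derive_ext (is_deriveN (is_deriveM (is_derive_cst s t (1 : R)) H))) => //.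
  by rewrite -![_ *: _]/(_ * _)/= expr1; ring.
have d3 := @is_derive1_comp _ sin (fun t => th + x * t) t _ _ (is_derive_sin _) d1.
have d4 := @is_derive1_comp _ expR (fun t => - (s * t ^+ 2)) t _ _ (is_derive_expR _) d2.
apply: (is_derive_ext (is_deriveM d3 d4)) => //.
by rewrite -![_ *: _]/(_ * _)/= /g; ring.
Qed.

Let L1_deriv (x th : R) : L1 leb (fun t =>
  (x * cos (th + x * t) - 2 * s * (t * sin (th + x * t))) * g t).
Proof.
have lg := L1_gauss1 s0; have lg2 := L1_gauss1_moment2.
have mth : measurable_fun setT (fun t : R => th + x * t).
  by apply: measurable_funD => //; exact: measurable_funM.
have mid : measurable_fun setT (fun t : R => t) by [].
have := L1B (L1Z x (L1_cosM lg mth)) (L1Z (2 * s) (L1_sinM mid lg lg2 mth)).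
rewrite [X in L1 _ X -> _](_ : _ = (fun t =>
  (x * cos (th + x * t) - 2 * s * (t * sin (th + x * t))) * g t))//.
by apply/funext => t; rewrite /g; ring.
Qed.

Lemma cvg_gauss_nat : g n.+1%:R @[n --> \oo] --> 0.
Proof.
have H : s^-1 * n.+1%:R^-1 @[n --> \oo] --> (0 : R).
  by rewrite -[X in _ --> X](mulr0 s^-1); apply: cvgMr; exact: cvg_harmonic.
apply: (squeeze_cvgr _ (cvg_cst (0 : R)) H).
apply: nearW => n; rewrite expR_ge0/= /g expRN -invfM lef_pV2 ?posrE//.
- apply: le_trans (expR_ge1Dx _); rewrite ler_wpDl// ler_wpM2l// ?(ltW s0)//.
  by rewrite -[leLHS]mulr1 expr2 ler_wpM2l// ler1n.
- exact: expR_gt0.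
- by rewrite mulr_gt0.
Qed.

(** The integrand is the derivative of sin (th + x t) g(t); over [-(n+1), n+1] its integral is a
    boundary term of size at most 2 g(n+1), which tends to 0. *)
Let ibp (x th : R) : \int[leb]_t
  ((x * cos (th + x * t) - 2 * s * (t * sin (th + x * t))) * g t) = 0.
Proof.
set f := fun t : R => _.
pose F (t : R) := sin (th + x * t) * g t.
pose D n := [set` `[- n.+1%:R, n.+1%:R : R]].
have mD n : measurable (D n) by exact: measurable_itv.
have lf : L1 leb f by exact: L1_deriv.
have mf := L1_measurable lf.
have cF : continuous F := is_derive_continuous (is_derive_phase x th).
have cf : continuous f.
  move=> t; apply: cvgM; last first.
    apply: (@is_derive_continuous _ g (fun t => - (s * (2 * t)) * g t)) => z.
    (* For x = 0 and th = pi / 2 the sine is constantly 1, and [is_derive_phase] is the derivative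
       of [g] itself. *)
    have := is_derive_phase 0 (pi / 2) z.
    move=> H; apply: (is_derive_ext H).
      by move=> u; rewrite mul0r addr0 sin_pihalf mul1r.
    by rewrite !mul0r addr0 sin_pihalf; ring.
  apply: cvgB; last apply: cvgM; [| exact: cvg_cst |].
    apply: cvgM; first exact: cvg_cst.
    apply: (@continuous_comp _ _ _ (fun t : R => th + x * t) cos).
      by apply: cvgD; [exact: cvg_cst|apply: cvgM; [exact: cvg_cst|exact: cvg_id]].
    exact: continuous_cos.
  apply: cvgM; first exact: cvg_id.
  apply: (@continuous_comp _ _ _ (fun t : R => th + x * t) sin).
    by apply: cvgD; [exact: cvg_cst|apply: cvgM; [exact: cvg_cst|exact: cvg_id]].
  exact: continuous_sin.
have E n : \int[leb]_t (f \_ (D n)) t = F n.+1%:R - F (- n.+1%:R).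
  have mfD : measurable_fun setT (f \_ (D n)).
    by apply/(measurable_restrictT _ (mD n)); exact: measurable_funTS.
  rewrite /Rintegral integral_leb; last exact/measurable_EFinP.
  transitivity (fine (\int[lebesgue_measure]_(x in D n) (f x)%:E)%E).
    rewrite [in RHS]integral_mkcond.
    by under [in RHS]eq_integral do rewrite restrict_EFin.
  rewrite (@continuous_FTC2 _ f F)//.
  - by rewrite (@lt_trans _ _ 0)// oppr_lt0.
  - exact: continuous_subspaceT.
  - split => //.
    + by apply: cvg_at_right_filter; exact: cF.
    + by apply: cvg_at_left_filter; exact: cF.
  - by move=> z _; rewrite derive1E; exact: (@derive_val _ _ _ _ _ _ _ (is_derive_phase x th z)).
have H1 : \int[leb]_t (f \_ (D n)) t @[n --> \oo] --> \int[leb]_t f t.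
  apply: (Rint_cvg (g := fun t => `|f t|)) => //.
  - by move=> n; apply/(measurable_restrictT _ (mD n)); exact: measurable_funTS.
  - exact: L1_norm.
  - move=> t; apply: cvg_near_cst.
    near=> n; rewrite patchE ifT// inE/= /D/= in_itv/= -ler_norml.
    rewrite (@le_trans _ _ n%:R) ?ler_nat//.
    by near: n; exact: nbhs_infty_ger.
  - by move=> n t; rewrite patchE; case: ifP => //; rewrite normr0.
have H2 : \int[leb]_t (f \_ (D n)) t @[n --> \oo] --> 0.
  have gN0 : g n.+1%:R + g n.+1%:R @[n --> \oo] --> 0.
    by rewrite -[X in _ --> X]addr0; apply: cvgD; exact: cvg_gauss_nat.
  apply/norm_cvg0P; apply: (squeeze_cvgr _ (cvg_cst (0 : R)) gN0).
  apply: nearW => n; rewrite normr_ge0 E/= (le_trans (ler_normB _ _))//.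
  rewrite /F !normrM /g sqrrN !(ger0_norm (expR_ge0 _)).
  by rewrite lerD// ler_piMl ?expR_ge0// sin_max.
exact: (cvg_unique _ H1 H2).
Unshelve. all: by end_near. Qed.

(* The Fourier integral solves phi' = - x / (2 s) phi, by integration by parts. *)
Lemma gauss1_fourier (x th : R) :
  \int[leb]_t (cos (th + x * t) * g t) =
  cos th * Num.sqrt (pi / s) * expR (- (x ^+ 2 / (4 * s))).
Proof.
have lg := L1_gauss1 s0; have lg2 := L1_gauss1_moment2.
have mid : measurable_fun setT (fun t : R => t) by [].
have mth y : measurable_fun setT (fun t : R => th + y * t).
  by apply: measurable_funD => //; exact: measurable_funM.
pose phi y := \int[leb]_t (cos (th + y * t) * g t).
have dphi y : is_derive y (1 : R) phi (- (y / (2 * s)) * phi y).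
  have Ey : \int[leb]_t (t * sin (th + y * t) * g t) = y / (2 * s) * phi y.
    have := ibp y th.
    under eq_Rintegral => t _.
      rewrite mulrBl -!mulrA [X in _ - X](_ : _ = (2 * s) * (t * sin (th + y * t) * g t)); last by ring.
      over.
    rewrite RintB; [|by apply: L1Z; exact: (L1_cosM lg)|by apply: L1Z; exact: (L1_sinM mid lg lg2)].
    rewrite (RintZ y (L1_cosM lg (mth y))).
    rewrite (RintZ (2 * s) (L1_sinM mid lg lg2 (mth y))).
    rewrite -/(phi y) => /eqP; rewrite subr_eq0 => /eqP H.
    have s2 : 2 * s != 0 by rewrite mulf_neq0 ?gt_eqF.
    apply: (mulfI s2); rewrite -H; field.
    by rewrite gt_eqF.
  rewrite mulNr -Ey.
  apply: (is_derive_quad (C := \int[leb]_t (t ^+ 2 * `|g t|))) => k.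
  have := oscillatory_quad mid lg lg2 k (mth y).
  rewrite mulrN opprK /phi [k *: 1]mulr1.
  under [X in `|X - _ + _| <= _]eq_Rintegral => t _.
    rewrite -addrA -mulrDl (addrC y) over.
  by [].
  exact.
(* The integrating factor of the differential equation: [psi] is constant, and its value at 0 is the
   Gaussian mass times cos th. *)
pose psi y := phi y * expR (y ^+ 2 / (4 * s)).
have dpsi y : is_derive y (1 : R) psi 0.
  have d2 : is_derive y (1 : R) (fun t : R => t ^+ 2 / (4 * s)) (y / (2 * s)).
    have H := is_deriveX 2 (is_derive_id y (1:R)).
    apply: (is_derive_ext (is_deriveM H (is_derive_cst ((4 * s)^-1) y (1 : R)))) => //.
    rewrite -![_ *: _]/(_ * _)/= expr1; field.
    by rewrite gt_eqF.
  have d3 := @is_derive1_comp _ expR (fun t => t ^+ 2 / (4 * s)) y _ _ (is_derive_expR _) d2.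
  apply: (is_derive_ext (is_deriveM (dphi y) d3)) => //.
  by rewrite -![_ *: _]/(_ * _)/=; ring.
have := is_derive_0_is_cst x 0 dpsi; rewrite /psi expr0n/= mul0r expR0 mulr1.
have -> : phi 0 = cos th * Num.sqrt (pi / s).
  rewrite /phi; under eq_Rintegral do rewrite mul0r addr0.
  by rewrite RintZ// Rint_gauss1.
by move=> <-; rewrite -mulrA -expRD subrr expR0 mulr1.
Qed.

End gauss1FT.

(** * Euclidean quantities and Gaussian transforms in R^n *)

Section euclid.
Context {R : realType} {n : nat}.
Implicit Types x y z : 'rV[R]_n.

(** Working with |x|^2 avoids square roots: with alpha = 2 be, the symbol |x|^alpha is (sqn
    x)^be. *)
Definition sqn x : R := \sum_(i < n) x 0 i ^+ 2.

(** The norm that splits over coordinates, so that e^(-c l1n x) is a product of one-dimensional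
    integrable functions; it serves only to dominate. *)
Definition l1n x : R := \sum_(i < n) `|x 0 i|.

Lemma sqn_ge0 x : 0 <= sqn x.
Proof. by apply: sumr_ge0 => i _; exact: sqr_ge0. Qed.

Lemma sqn0 : sqn 0 = 0.
Proof. by rewrite /sqn big1// => i _; rewrite mxE expr0n. Qed.

Lemma coord_sqn x i : x 0 i ^+ 2 <= sqn x.
Proof.
rewrite /sqn (bigD1 i)//= lerDl.
by apply: sumr_ge0 => j _; exact: sqr_ge0.
Qed.

Lemma sqnZ c x : sqn (c *: x) = c ^+ 2 * sqn x.
Proof. by rewrite /sqn mulr_sumr; apply: eq_bigr => i _; rewrite mxE exprMn. Qed.

Lemma sqnN x : sqn (- x) = sqn x.
Proof. by rewrite -scaleN1r sqnZ sqrrN expr1n mul1r. Qed.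

Lemma dotvC x y : dotv x y = dotv y x.
Proof. by apply: eq_bigr => i _; rewrite mulrC. Qed.

Lemma dotvDl x y z : dotv (x + y) z = dotv x z + dotv y z.
Proof. by rewrite -big_split; apply: eq_bigr => i _; rewrite mxE mulrDl. Qed.

Lemma dotvZl c x y : dotv (c *: x) y = c * dotv x y.
Proof. by rewrite /dotv mulr_sumr; apply: eq_bigr => i _; rewrite mxE mulrA. Qed.

Lemma dotvNl x y : dotv (- x) y = - dotv x y.
Proof. by rewrite -scaleN1r dotvZl mulN1r. Qed.

Lemma dotvBl x y z : dotv (x - y) z = dotv x z - dotv y z.
Proof. by rewrite dotvDl dotvNl. Qed.

Lemma dotvDr x y z : dotv z (x + y) = dotv z x + dotv z y.
Proof. by rewrite dotvC dotvDl !(dotvC z). Qed.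

Lemma dotvZr c x y : dotv x (c *: y) = c * dotv x y.
Proof. by rewrite dotvC dotvZl dotvC. Qed.

Lemma dotvNr x y : dotv x (- y) = - dotv x y.
Proof. by rewrite dotvC dotvNl dotvC. Qed.

Lemma dotvBr x y z : dotv z (x - y) = dotv z x - dotv z y.
Proof. by rewrite dotvDr dotvNr. Qed.

Lemma dotvv x : dotv x x = sqn x.
Proof. by apply: eq_bigr => i _; rewrite expr2. Qed.

Lemma dotv0l y : dotv 0 y = 0.
Proof. by rewrite /dotv big1// => i _; rewrite mxE mul0r. Qed.

Lemma sqnD x y : sqn (x + y) = sqn x + 2 * dotv x y + sqn y.
Proof. by rewrite -!dotvv dotvDl !dotvDr (dotvC y x); ring. Qed.

Lemma sqnB x y : sqn (x - y) = sqn x - 2 * dotv x y + sqn y.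
Proof. by rewrite sqnD dotvNr sqnN mulrN. Qed.

Lemma sqnD_le x y : sqn (x + y) <= 2 * sqn x + 2 * sqn y.
Proof. by have := sqn_ge0 (x - y); rewrite sqnB sqnD; lra. Qed.

Lemma sqn_eq0 x : sqn x = 0 -> x = 0.
Proof.
move=> x0; apply/rowP => i; rewrite mxE; apply/eqP; rewrite -sqrf_eq0.
by rewrite eq_le sqr_ge0 andbT -x0 coord_sqn.
Qed.

Lemma dotv_cauchy x y : dotv x y ^+ 2 <= sqn x * sqn y.
Proof.
have [y0|y0] := eqVneq (sqn y) 0.
  by rewrite (sqn_eq0 y0) dotvC dotv0l sqn0 mulr0 expr0n.
have yp : 0 < sqn y by rewrite lt_neqAle eq_sym y0 sqn_ge0.
have := sqn_ge0 (x - (dotv x y / sqn y) *: y).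
rewrite sqnB sqnZ dotvZr => H.
have : 0 <= (sqn x - 2 * (dotv x y / sqn y * dotv x y) +
  (dotv x y / sqn y) ^+ 2 * sqn y) * sqn y by rewrite mulr_ge0// ltW.
rewrite [X in 0 <= X -> _](_ : _ = sqn x * sqn y - dotv x y ^+ 2).
  by rewrite subr_ge0.
by field.
Qed.

Lemma l1n_ge0 x : 0 <= l1n x.
Proof. exact: sumr_ge0. Qed.

Lemma l1n_sqn x : l1n x ^+ 2 <= n%:R ^+ 2 * sqn x.
Proof.
have H : l1n x <= n%:R * Num.sqrt (sqn x).
  rewrite mulr_natl -[n in leRHS]card_ord -sumr_const; apply: ler_sum => i _.
  by rewrite -sqrtr_sqr ler_wsqrtr// coord_sqn.
rewrite -[in leRHS](sqr_sqrtr (sqn_ge0 x)) -exprMn.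
by rewrite lerXn2r// ?nnegrE ?l1n_ge0// mulr_ge0// sqrtr_ge0.
Qed.

Lemma measurable_sqn : measurable_fun setT sqn.
Proof.
apply: measurable_sum => i; apply: measurable_funX; exact: measurable_rV_coord.
Qed.

Lemma measurable_l1n : measurable_fun setT l1n.
Proof.
apply: measurable_sum => i; apply: measurableT_comp => //.
exact: measurable_rV_coord.
Qed.

Lemma measurable_dotv x : measurable_fun setT (dotv x).
Proof.
apply: measurable_sum => i; apply: measurable_funM => //.
exact: measurable_rV_coord.
Qed.

Lemma measurable_fun_dotv d (T : measurableType d) (f g : T -> 'rV[R]_n) :
  measurable_fun setT f -> measurable_fun setT g ->
  measurable_fun setT (fun t => dotv (f t) (g t)).
Proof.
move=> mf mg; apply: measurable_sum => i.
by apply: measurable_funM; apply: measurableT_comp (measurable_rV_coord _) _.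
Qed.

Lemma measurable_fun_addv d (T : measurableType d) (f g : T -> 'rV[R]_n) :
  measurable_fun setT f -> measurable_fun setT g ->
  measurable_fun setT (fun t => f t + g t).
Proof.
move=> mf mg; apply: measurable_fun_rV => i.
under eq_fun do rewrite mxE.
by apply: measurable_funD; apply: measurableT_comp (measurable_rV_coord _) _.
Qed.

Lemma measurable_fun_scalev d (T : measurableType d) (f : T -> R) (g : T -> 'rV[R]_n) :
  measurable_fun setT f -> measurable_fun setT g ->
  measurable_fun setT (fun t => f t *: g t).
Proof.
move=> mf mg; apply: measurable_fun_rV => i.
under eq_fun do rewrite mxE.
by apply: measurable_funM => //; apply: measurableT_comp (measurable_rV_coord _) _.
Qed.

Lemma measurable_fun_oppv d (T : measurableType d) (g : T -> 'rV[R]_n) :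
  measurable_fun setT g -> measurable_fun setT (fun t => - g t).
Proof.
move=> mg; under eq_fun do rewrite -scaleN1r.
exact: measurable_fun_scalev.
Qed.

Lemma measurable_fun_subv d (T : measurableType d) (f g : T -> 'rV[R]_n) :
  measurable_fun setT f -> measurable_fun setT g ->
  measurable_fun setT (fun t => f t - g t).
Proof. by move=> mf mg; apply: measurable_fun_addv => //; exact: measurable_fun_oppv. Qed.

End euclid.

Section cons.
Context {R : realType}.

Lemma sum_cons n (F : R -> R) (r : R) (v : 'rV[R]_n) :
  \sum_(i < n.+1) F (rV_cons (r, v) 0 i) = F r + \sum_(i < n) F (v 0 i).
Proof.
have := @rV_consK R n (r, v); rewrite /rV_uncons => -[E1 E2].
rewrite big_ord_recl E1; congr (_ + _); apply: eq_bigr => i _.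
by rewrite -{2}E2 mxE.
Qed.

Lemma sqn_cons n (r : R) (v : 'rV[R]_n) : sqn (rV_cons (r, v)) = r ^+ 2 + sqn v.
Proof. exact: (sum_cons (fun x => x ^+ 2)). Qed.

Lemma l1n_cons n (r : R) (v : 'rV[R]_n) : l1n (rV_cons (r, v)) = `|r| + l1n v.
Proof. exact: (sum_cons (fun x => `|x|)). Qed.

Lemma dotv_cons n (r a : R) (v w : 'rV[R]_n) :
  dotv (rV_cons (r, v)) (rV_cons (a, w)) = r * a + dotv v w.
Proof.
have := @rV_consK R n (r, v); rewrite /rV_uncons => -[E1 E2].
have := @rV_consK R n (a, w); rewrite /rV_uncons => -[E3 E4].
rewrite /dotv big_ord_recl E1 E3; congr (_ + _); apply: eq_bigr => i _.
by rewrite -{2}E2 -{2}E4 !mxE.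
Qed.

End cons.

Section gaussn.
Context {R : realType}.
Variable s : R.
Hypothesis s0 : 0 < s.

Lemma measurable_gauss n :
  measurable_fun setT (fun x : 'rV[R]_n => expR (- (s * sqn x))).
Proof.
apply: measurableT_comp => //; apply: measurableT_comp => //.
by apply: measurable_funM => //; exact: measurable_sqn.
Qed.

Lemma L1_rV0 (f : 'rV[R]_0 -> R) : measurable_fun setT f -> L1 (lebesgue_rV 0) f.
Proof.
move=> mf; apply/L1P; split => //=.
rewrite integral_dirac//; first by rewrite diracT mul1e ltry.
by apply/measurable_EFinP; exact: measurableT_comp.
Qed.

Lemma L1_gauss n : L1 (lebesgue_rV n) (fun x => expR (- (s * sqn x))).
Proof.
elim: n => [|n IH]; first by apply: L1_rV0; exact: measurable_gauss.
apply/(L1_cons (@measurable_gauss n.+1)).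
have := L1_prodM (L1_gauss1 s0) IH.
congr L1; apply/funext => -[r v] /=.
by rewrite sqn_cons -expRD; congr expR; ring.
Qed.

(** The free phase [th] is what makes the induction on the dimension close: the contribution of the
    first coordinate is absorbed in the phase of the integral over the others. *)
Lemma gauss_fourier n (x : 'rV[R]_n) (th : R) :
  \int[lebesgue_rV n]_y (cos (th + dotv x y) * expR (- (s * sqn y))) =
  cos th * Num.sqrt (pi / s) ^+ n * expR (- (sqn x / (4 * s))).
Proof.
elim: n x th => [|n IH] x th.
  rewrite expr0 /sqn/= big_ord0 mul0r oppr0 expR0 !mulr1.
  rewrite /Rintegral /= integral_dirac//; last first.
    apply/measurable_EFinP; apply: measurable_funM; last exact: measurable_gauss.
    apply: measurableT_comp; first exact: measurable_cos.
    by apply: measurable_funD => //; exact: measurable_dotv.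
  by rewrite diracT mul1e/= /dotv /sqn !big_ord0 mulr0 oppr0 expR0 addr0 mulr1.
have lx : L1 (lebesgue_rV n.+1) (fun y => cos (th + dotv x y) * expR (- (s * sqn y))).
  apply: (L1_cosM (@L1_gauss _)).
  by apply: measurable_funD => //; exact: measurable_dotv.
rewrite Rint_cons// -(rV_cons_uncons x); case: (rV_uncons x) => a w.
under eq_Rintegral => r _.
  under eq_Rintegral => v _.
    rewrite dotv_cons addrA sqn_cons mulrDr opprD expRD mulrCA.
    over.
  rewrite RintZ; last first.
    apply: (L1_cosM (@L1_gauss n)).
    by apply: measurable_funD => //; exact: measurable_dotv.
  rewrite IH -!mulrA mulrCA mulrA.
  over.
rewrite /= RintZr; last first.
  apply: (L1_cosM (L1_gauss1 s0)).
  by apply: measurable_funD => //; exact: measurable_funM.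
rewrite (gauss1_fourier s0) (_ : - (sqn (rV_cons (a, w)) / (4 * s)) =
  - (a ^+ 2 / (4 * s)) + - (sqn w / (4 * s))); last first.
  by rewrite sqn_cons mulrDl opprD.
by rewrite expRD (exprS _ n); ring.
Qed.

End gaussn.

(** * Integrability and moments of e^(-t |x|^alpha) *)

Section stable_weight.
Context {R : realType}.

Lemma L1_exp_abs (c : R) : 0 < c -> L1 leb (fun x => expR (- (c * `|x|))).
Proof.
move=> c0.
have mf : measurable_fun setT (fun x : R => expR (- (c * `|x|))).
  apply: measurableT_comp => //; apply: measurableT_comp => //.
  by apply: measurable_funM => //; exact: measurableT_comp.
have lp : L1 leb (exponential_pdf c).
  apply: ge0_L1.
  - exact: measurable_exponential_pdf.
  - by move=> x; apply: exponential_pdf_ge0; exact: ltW.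
  - rewrite integral_leb; first by rewrite integral_exponential_pdf// ltry.
    by apply/measurable_EFinP; exact: measurable_exponential_pdf.
have lpN : L1 leb (fun x => exponential_pdf c (- x)).
  have mp := L1_measurable lp.
  have mN : measurable_fun setT (fun x : R => exponential_pdf c (- x)).
    exact: measurableT_comp.
  apply: ge0_L1 => //.
    by move=> x; apply: exponential_pdf_ge0; exact: ltW.
  have N10 : (-1 : R) != 0 by rewrite oppr_eq0 oner_eq0.
  under eq_integral do rewrite -[- _]mulN1r -[-1 * _]add0r.
  rewrite (@ge0_integral_affine1 R (fun x => (exponential_pdf c x)%:E) (-1) 0 N10).
  - by rewrite -(EFin_Rint lp) -EFinM ltry.
  - exact/measurable_EFinP.
  - by move=> x; rewrite lee_fin exponential_pdf_ge0// ltW.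
apply: (@L1_le _ _ _ leb _ (fun x => c^-1 * (exponential_pdf c x + exponential_pdf c (- x)))) => //.
- move=> x; rewrite ger0_norm ?expR_ge0// ler_pdivlMl//.
  have pg y : 0 <= exponential_pdf c y by apply: exponential_pdf_ge0; exact: ltW.
  have E y : 0 <= y -> exponential_pdf c y = c * expR (- (c * y)).
    move=> y0; rewrite /exponential_pdf patchE ifT ?mulNr//.
    by rewrite inE/= in_itv/= andbT.
  have [x0|x0] := leP 0 x.
    by rewrite ger0_norm// (E x)// lerDl.
  by rewrite ltr0_norm// (E (- x)) ?lerDr// oppr_ge0 ltW.
- by apply: L1Z; exact: L1D.
Qed.

Lemma L1_exp_l1n n (c : R) : 0 < c ->
  L1 (lebesgue_rV n) (fun x => expR (- (c * l1n x))).
Proof.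
move=> c0.
have mf k : measurable_fun setT (fun x : 'rV[R]_k => expR (- (c * l1n x))).
  apply: measurableT_comp => //; apply: measurableT_comp => //.
  by apply: measurable_funM => //; exact: measurable_l1n.
elim: n => [|n IH]; first exact: L1_rV0.
apply/(L1_cons (mf n.+1)).
have := L1_prodM (L1_exp_abs c0) IH.
congr L1; apply/funext => -[r v] /=.
by rewrite l1n_cons -expRD; congr expR; ring.
Qed.

Variables (n : nat) (be : R).
Hypotheses (be_half : 2^-1 < be).

Let be0 : 0 < be. Proof. by apply: lt_trans be_half; rewrite invr_gt0. Qed.

(** The Fourier multiplier e^(-t |x|^alpha) of the stable semigroup, for alpha = 2 be. *)
Definition wt (t : R) (x : 'rV[R]_n) : R := expR (- (t * sqn x `^ be)).

Lemma measurable_wt t : measurable_fun setT (wt t).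
Proof.
apply: measurableT_comp => //; apply: measurableT_comp => //.
apply: measurable_funM => //; apply: (measurableT_comp (measurable_powR be)).
exact: measurable_sqn.
Qed.

Lemma wt_ge0 t x : 0 <= wt t x. Proof. exact: expR_ge0. Qed.

Lemma wt_le1 t x : 0 <= t -> wt t x <= 1.
Proof. by move=> t0; rewrite /wt -expR0 ler_expR oppr_le0 mulr_ge0// powR_ge0. Qed.

Lemma wtD t s x : wt t x * wt s x = wt (t + s) x.
Proof. by rewrite /wt -expRD; congr expR; ring. Qed.

Let powR_half (y : R) : 1 <= y -> Num.sqrt y <= y `^ be.
Proof.
move=> y1; rewrite -powR12_sqrt; last by rewrite (le_trans _ y1).
by apply: ler_powR => //; rewrite ltW.
Qed.

Lemma l1n_le_powR (x : 'rV[R]_n) : l1n x <= n%:R * (sqn x `^ be + 1).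
Proof.
have H : l1n x <= n%:R * Num.sqrt (sqn x).
  rewrite -(ler_pXn2r (_ : 0 < 2)%N) ?nnegrE ?l1n_ge0// ?mulr_ge0 ?sqrtr_ge0//.
  by rewrite exprMn sqr_sqrtr ?sqn_ge0// l1n_sqn.
rewrite (le_trans H)// ler_wpM2l//.
have [y1|y1] := leP 1 (sqn x).
  by rewrite (le_trans (powR_half y1))// lerDl.
rewrite -[leLHS]addr0 addrC lerD ?powR_ge0//.
by rewrite -sqrtr1 ler_wsqrtr// ltW.
Qed.

(** Since 2 be > 1, the l1 norm is at most n (|x|^(2 be) + 1), so the weight is dominated by a
    product of exponentials. The rate t / (n + 1) rather than t / n keeps dimension 0 in the
    argument. *)
Lemma L1_wt t : 0 < t -> L1 (lebesgue_rV n) (wt t).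
Proof.
move=> t0; have c0 : 0 < t / n.+1%:R by rewrite divr_gt0.
apply: (@L1_le _ _ _ _ _ (fun x => expR t * expR (- (t / n.+1%:R * l1n x)))).
- exact: measurable_wt.
- move=> x; rewrite ger0_norm ?wt_ge0// -expRD ler_expR.
  have := l1n_le_powR x; have := l1n_ge0 x; have := powR_ge0 (sqn x) be.
  set y := _ `^ _; set l := l1n _ => y0 l_ge0 ly.
  have : l / n.+1%:R <= y + 1.
    rewrite ler_pdivrMr// mulrC (le_trans ly)// ler_wpM2r ?addr_ge0//.
    by rewrite ler_nat.
  move=> /(ler_wpM2l (ltW t0)).
  rewrite (_ : t / n.+1%:R * l = t * (l / n.+1%:R)); last by ring.
  by rewrite mulrDr mulr1 lerNl opprB lerBlDr.
- by apply: L1Z; exact: L1_exp_l1n.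
Qed.

Lemma L1_wt_moment t j : 0 < t -> L1 (lebesgue_rV n) (fun x => sqn x ^+ j * wt t x).
Proof.
(* Half of the weight absorbs the polynomial. With z = (t / 2) |x|^(2 be), the first summand is the
   constant in |x|^(2 j) <= (2 z / t)^(2 j) <= const e^z where |x| >= 1; the summand 1 covers |x| <
   1. *)
move=> t0; pose C := (2 / t) ^+ (2 * j) * ((2 * j)`!)%:R + 1.
have t20 : 0 < t / 2 by rewrite divr_gt0.
apply: (@L1_le _ _ _ _ _ (fun x => C * wt (t / 2) x)).
- by apply: measurable_funM; [exact: measurable_funX measurable_sqn|exact: measurable_wt].
- move=> x; rewrite ger0_norm; last by rewrite mulr_ge0 ?wt_ge0// exprn_ge0// sqn_ge0.
  rewrite [in leLHS](splitr t) -wtD mulrA ler_wpM2r ?wt_ge0//.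
  rewrite /wt expRN ler_pdivrMr ?expR_gt0//.
  set z := t / 2 * _; have z0 : 0 <= z by rewrite mulr_ge0 ?powR_ge0// ltW.
  have [y1|y1] := leP 1 (sqn x); last first.
    apply: (@le_trans _ _ 1); first by rewrite exprn_ile1 ?sqn_ge0// ltW.
    rewrite /C mulrDl mul1r ler_wpDl//.
      by rewrite mulr_ge0 ?expR_ge0// mulr_ge0// exprn_ge0// divr_ge0// ltW.
    by rewrite -expR0 ler_expR.
  rewrite /C mulrDl mul1r ler_wpDr ?expR_ge0// -mulrA.
  have zj := expR_poly_bound (2 * j) z0.
  apply: (@le_trans _ _ ((2 / t) ^+ (2 * j) * z ^+ (2 * j))); last first.
    by rewrite ler_wpM2l// exprn_ge0// divr_ge0// ltW.
  rewrite -exprMn (_ : 2 / t * z = sqn x `^ be); last first.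
    by rewrite /z mulrA (_ : 2 / t * (t / 2) = 1) ?mul1r//; field; rewrite gt_eqF.
  rewrite exprM lerXn2r ?nnegrE ?sqn_ge0 ?exprn_ge0 ?powR_ge0//.
  rewrite -[leLHS](sqr_sqrtr (sqn_ge0 x)) lerXn2r ?nnegrE ?sqrtr_ge0 ?powR_ge0//.
  exact: powR_half.
- by apply: L1Z; exact: L1_wt.
Qed.

End stable_weight.

(** * Two-sided bounds for the stable kernel *)

Section real_limits.
Context {R : realType}.

Lemma cvgn_ge0 (u : nat -> R) (l : R) :
  u n @[n --> \oo] --> l -> (forall n, 0 <= u n) -> 0 <= l.
Proof.
move=> ul u0; have cu : cvgn u by apply/cvg_ex; exists l.
by rewrite -(cvg_lim _ ul)//; apply: limr_ge => //; exact: nearW.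
Qed.

Lemma cvgn_continuous (f : R -> R) (u : nat -> R) (l : R) :
  {for l, continuous f} -> u n @[n --> \oo] --> l -> f (u n) @[n --> \oo] --> f l.
Proof. by move=> cf ul; exact: (cvg_comp _ _ ul cf). Qed.

Lemma exprfctE (f : R -> R) n (t : R) : (f ^+ n) t = f t ^+ n.
Proof. by elim: n => [|n IH]; rewrite ?expr0// !exprS -IH. Qed.

Lemma cvg_powR (u : nat -> R) (l p : R) : 0 < p -> (forall n, 0 <= u n) ->
  u n @[n --> \oo] --> l -> u n `^ p @[n --> \oo] --> l `^ p.
Proof.
move=> p0 u0 ul; have l0 : 0 <= l := cvgn_ge0 ul u0.
have [lE|ln0] := eqVneq l 0.
  rewrite lE powR0 ?gt_eqF//; apply/cvgrPdist_le => e e0.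
  have ep : 0 < e `^ p^-1 by exact: powR_gt0.
  move: ul; rewrite lE => /cvgrPdist_le/(_ _ ep); apply: filterS => n.
  rewrite !sub0r !normrN (ger0_norm (u0 n)) (ger0_norm (powR_ge0 _ _)) => H.
  have -> : e = (e `^ p^-1) `^ p by rewrite -powRrM mulVf ?gt_eqF// powRr1// ltW.
  by apply: ge0_ler_powR; rewrite ?nnegrE ?powR_ge0 ?(ltW p0).
have lp : 0 < l by rewrite lt_neqAle eq_sym ln0.
have H : expR (p * ln (u n)) @[n --> \oo] --> expR (p * ln l).
  apply: cvgn_continuous; first exact: continuous_expR.
  by apply: cvgMr; apply: cvgn_continuous ul; exact: continuous_ln.
rewrite [X in _ --> X]/powR (negbTE ln0).
apply: cvg_trans H; apply: near_eq_cvg.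
have [N _ HN] := cvgr_gt _ ul _ lp.
by exists N => // n /HN un0; rewrite /powR gt_eqF.
Qed.

End real_limits.

(* e^{-lambda^be} as a limit of nonnegative combinations of exponentials e^{-s lambda}:
   a functional that is nonnegative on all exponentials is nonnegative on it. *)
Section positive_functions.
Context {R : realType}.
Implicit Types (phi psi : R -> R) (J : (R -> R) -> R).

Definition exp_decay phi : Prop := measurable_fun setT phi /\
  exists M s : R, 0 < s /\ forall l, 0 <= l -> `|phi l| <= M * expR (- (s * l)).

(** The two properties needed of phi -> int f phi(ell) + sum of c_i phi(l_i), where [f] and the c_i
    may have any sign: linearity and dominated convergence. *)
Definition laplace_functional J : Prop :=
  (forall a phi psi, exp_decay phi -> exp_decay psi ->
    J (fun l => a * phi l + psi l) = a * J phi + J psi) /\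
  (forall (F : nat -> R -> R) phi (M s : R), 0 < s ->
    (forall n, measurable_fun setT (F n)) -> measurable_fun setT phi ->
    (forall n l, 0 <= l -> `|F n l| <= M * expR (- (s * l))) ->
    (forall l, 0 <= l -> F n l @[n --> \oo] --> phi l) ->
    J (F n) @[n --> \oo] --> J phi).

Definition bdd_measurable phi : Prop := measurable_fun setT phi /\
  exists M, forall l, 0 <= l -> `|phi l| <= M.

(** The damping factor e^(-s l) puts the product with a merely bounded [phi] in the domain where
    functionals are controlled; asking for every s > 0 is what makes the class stable under
    products. *)
Definition exp_positive phi : Prop := bdd_measurable phi /\
  forall J, laplace_functional J ->
    (forall s, 0 < s -> 0 <= J (fun l => expR (- (s * l)))) ->
    forall s, 0 < s -> 0 <= J (fun l => phi l * expR (- (s * l))).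

Lemma measurable_expNM s : measurable_fun setT (fun l : R => expR (- (s * l))).
Proof.
by apply: measurableT_comp => //; apply: measurableT_comp.
Qed.

Lemma bdd_exp_decay phi s : bdd_measurable phi -> 0 < s ->
  exp_decay (fun l => phi l * expR (- (s * l))).
Proof.
move=> [mphi [M HM]] s0; split.
  by apply: measurable_funM => //; exact: measurable_expNM.
exists M, s; split => // l l0; rewrite normrM (ger0_norm (expR_ge0 _)).
by rewrite ler_wpM2r ?expR_ge0 ?HM.
Qed.

Lemma laplace_mul J phi : laplace_functional J -> bdd_measurable phi ->
  laplace_functional (fun psi => J (fun l => phi l * psi l)).
Proof.
move=> [Jlin Jlim] [mphi [M HM]].
have dM psi : exp_decay psi -> exp_decay (fun l => phi l * psi l).
  move=> [mpsi [N [s [s0 HN]]]]; split; first exact: measurable_funM.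
  exists (M * N), s; split => // l l0; rewrite normrM -mulrA.
  by apply: ler_pM => //; [exact: HM|exact: HN].
split.
  move=> a f g df dg; rewrite -Jlin; [|exact: dM|exact: dM].
  by congr J; apply/funext => l; ring.
move=> F psi N s s0 mF mpsi FN Fpsi.
apply: (Jlim _ _ (M * N) s) => //.
- by move=> n; exact: measurable_funM.
- exact: measurable_funM.
- move=> n l l0; rewrite normrM -mulrA.
  by apply: ler_pM => //; [exact: HM|exact: FN].
- by move=> l l0; apply: cvgMr; exact: Fpsi.
Qed.

Lemma exp_positive_exp s : 0 <= s -> exp_positive (fun l => expR (- (s * l))).
Proof.
move=> s0; split.
  split; first exact: measurable_expNM.
  exists 1 => l l0; rewrite ger0_norm ?expR_ge0// -expR0 ler_expR oppr_le0.
  exact: mulr_ge0.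
move=> J _ H t t0; have := H (s + t) (ltr_wpDl s0 t0).
by congr (0 <= J _); apply/funext => l; rewrite -expRD; congr expR; ring.
Qed.

Lemma bddD phi psi c : bdd_measurable phi -> bdd_measurable psi ->
  bdd_measurable (fun l => c * phi l + psi l).
Proof.
move=> [mphi [M HM]] [mpsi [N HN]]; split.
  by apply: measurable_funD => //; exact: measurable_funM.
exists (`|c| * M + N) => l l0; rewrite (le_trans (ler_normD _ _))// lerD ?HN//.
by rewrite normrM ler_wpM2l ?HM.
Qed.

Lemma exp_positiveD phi psi c : 0 <= c -> exp_positive phi -> exp_positive psi ->
  exp_positive (fun l => c * phi l + psi l).
Proof.
move=> c0 [bphi pphi] [bpsi ppsi]; split; first exact: bddD.
move=> J HJ H s s0.
have -> : (fun l => (c * phi l + psi l) * expR (- (s * l))) =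
  (fun l => c * (phi l * expR (- (s * l))) + psi l * expR (- (s * l))).
  by apply/funext => l; ring.
rewrite HJ.1; [|exact: bdd_exp_decay|exact: bdd_exp_decay].
by rewrite addr_ge0// ?mulr_ge0// ?pphi// ppsi.
Qed.

(** The functional psi -> J(phi psi) is again a Laplace functional, nonnegative on exponentials
    because [phi] belongs to the class; [psi] is then tested on that functional. *)
Lemma exp_positiveM phi psi : exp_positive phi -> exp_positive psi ->
  exp_positive (fun l => phi l * psi l).
Proof.
move=> [bphi pphi] [bpsi ppsi]; split.
  move: bphi bpsi => [mphi [M HM]] [mpsi [N HN]]; split.
    exact: measurable_funM.
  exists (M * N) => l l0; rewrite normrM.
  by apply: ler_pM => //; [exact: HM|exact: HN].
move=> J HJ H s s0.
have := ppsi _ (laplace_mul HJ bphi) (pphi _ HJ H) s s0.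
by congr (0 <= J _); apply/funext => l; rewrite mulrA.
Qed.

Lemma exp_positive_lim (F : nat -> R -> R) phi (M : R) :
  (forall n, exp_positive (F n)) -> measurable_fun setT phi ->
  (forall n l, 0 <= l -> `|F n l| <= M) ->
  (forall l, 0 <= l -> F n l @[n --> \oo] --> phi l) -> exp_positive phi.
Proof.
move=> pF mphi FM Fphi; split.
  split => //; exists M => l l0.
  rewrite -subr_ge0; apply: (@cvgn_ge0 _ (fun n => M - `|F n l|)).
    by apply: cvgB; [exact: cvg_cst|apply: cvg_norm; exact: Fphi].
  by move=> n; rewrite subr_ge0 FM.
move=> J HJ H s s0.
apply: (@cvgn_ge0 _ (fun n => J (fun l => F n l * expR (- (s * l))))).
  apply: (HJ.2 _ _ M s) => //.
  - move=> n; apply: measurable_funM; last exact: measurable_expNM.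
    by have [[]] := pF n.
  - by apply: measurable_funM => //; exact: measurable_expNM.
  - move=> n l l0; rewrite normrM (ger0_norm (expR_ge0 _)).
    by rewrite ler_wpM2r ?expR_ge0 ?FM.
  - by move=> l l0; apply: cvgMl; exact: Fphi.
by move=> n; exact: (pF n).2.
Qed.

Lemma exp_positive_ext phi psi : measurable_fun setT psi ->
  (forall l, 0 <= l -> phi l = psi l) -> exp_positive phi -> exp_positive psi.
Proof.
move=> mpsi E pphi; have [[_ [M HM]] _] := pphi.
apply: (@exp_positive_lim (fun=> phi) psi M) => // l l0.
by rewrite E//; exact: cvg_cst.
Qed.

Lemma exp_positive0 : exp_positive (fun=> 0).
Proof.
split; first by split => //; exists 0 => l _; rewrite normr0.
move=> J HJ _ s s0; under [fun=> _]eq_fun do rewrite mul0r.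
have d0 : exp_decay (fun=> 0).
  split => //; exists 0, 1; split => // l _.
  by rewrite normr0 mul0r.
have := HJ.1 1 _ _ d0 d0.
under [fun=> _]eq_fun do rewrite mulr0 addr0.
by rewrite mul1r => /eqP; rewrite -subr_eq0 opprD addNKr oppr_eq0 => /eqP ->.
Qed.

Lemma exp_positiveZ c phi : 0 <= c -> exp_positive phi ->
  exp_positive (fun l => c * phi l).
Proof.
move=> c0 pphi; have := exp_positiveD c0 pphi exp_positive0.
by under eq_fun do rewrite addr0.
Qed.

Lemma exp_positive_cst c : 0 <= c -> exp_positive (fun=> c).
Proof.
move=> c0; have := exp_positiveZ c0 (exp_positive_exp (lexx 0)).
by under eq_fun do rewrite mul0r oppr0 expR0 mulr1.
Qed.

Lemma exp_positiveX phi k : exp_positive phi -> exp_positive (fun l => phi l ^+ k).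
Proof.
move=> pphi; elim: k => [|k IH]; first exact: exp_positive_cst.
under eq_fun do rewrite exprS.
exact: exp_positiveM.
Qed.

Lemma series_exp_le (x y : R) n : 0 <= x -> x <= y ->
  series (exp_coeff x) n <= expR y.
Proof.
move=> x0 xy; rewrite (@le_trans _ _ (expR x)) ?ler_expR//.
apply: nondecreasing_cvgn_le; last exact: is_cvg_series_exp_coeff.
apply/nondecreasing_seqP => k; rewrite seriesSr lerDl.
exact: exp_coeff_ge0.
Qed.

(** The exponential series has nonnegative coefficients, and its partial sums are bounded by e^M
    when [phi] takes its values in [0, M]. *)
Lemma exp_positive_expR phi : exp_positive phi -> (forall l, 0 <= l -> 0 <= phi l) ->
  exp_positive (fun l => expR (phi l)).
Proof.
move=> pphi phi0; have [[mphi [M HM]] _] := pphi.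
have phiM l : 0 <= l -> phi l <= M.
  by move=> l0; apply: le_trans (HM _ l0); exact: ler_norm.
apply: (@exp_positive_lim (fun n l => series (exp_coeff (phi l)) n) _ (expR M)).
- elim=> [|n IH].
    by under eq_fun do rewrite /series/= big_geq//; exact: exp_positive0.
  have -> : (fun l => series (exp_coeff (phi l)) n.+1) =
      (fun l => n`!%:R^-1 * phi l ^+ n + series (exp_coeff (phi l)) n).
    by apply/funext => l; rewrite seriesSr addrC; congr (_ + _); rewrite exp_coeffE.
  by apply: exp_positiveD => //; exact: exp_positiveX.
- exact: measurableT_comp.
- move=> n l l0; rewrite ger0_norm; first by apply: series_exp_le; [exact: phi0|exact: phiM].
  by apply: sumr_ge0 => k _; apply: exp_coeff_ge0; exact: phi0.
- by move=> l l0; exact: is_cvg_series_exp_coeff.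
Qed.

Section binomial_series.
Variable be : R.
Hypotheses (be0 : 0 < be) (be1 : be < 1).

(** The coefficients of z^k in (1 - z)^be. As 0 < be < 1 they are all nonpositive from k = 1 on, so
    1 - (1 - z)^be has nonnegative coefficients. [binom_sum] is the partial sum and [binom_sum'] its
    derivative. *)
Fixpoint binom_coef (k : nat) : R :=
  if k is k'.+1 then binom_coef k' * (k'%:R - be) / k'.+1%:R else 1.

Fixpoint binom_sum (N : nat) (z : R) : R :=
  if N is N'.+1 then binom_sum N' z + binom_coef N * z ^+ N else 1.

Fixpoint binom_sum' (N : nat) (z : R) : R :=
  if N is N'.+1 then binom_sum' N' z + binom_coef N * (N%:R * z ^+ N') else 0.

Lemma binom_coefS k : k.+1%:R * binom_coef k.+1 = (k%:R - be) * binom_coef k.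
Proof. by rewrite [binom_coef k.+1]/= mulrC divfK ?pnatr_eq0// mulrC. Qed.

Lemma binom_coef_bound k : - be <= k.+1%:R * binom_coef k.+1 <= 0.
Proof.
elim: k => [|k IH]; first by rewrite binom_coefS/= mulr1 sub0r lexx oppr_le0 ltW.
rewrite binom_coefS.
have k1 : 0 < k.+1%:R :> R by rewrite ltr0n.
have kb : 0 <= k.+1%:R - be.
  by rewrite subr_ge0 (le_trans (ltW be1))// ler1n.
move: IH => /andP[IH1 IH2].
have a0 : binom_coef k.+1 <= 0 by rewrite pmulr_rle0 in IH2.
rewrite mulr_ge0_le0// andbT (le_trans IH1)//.
by rewrite ler_wnM2r// gerDl oppr_le0 ltW.
Qed.

Lemma binom_coef_le0 k : binom_coef k.+1 <= 0.
Proof.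
have /andP[_] := binom_coef_bound k.
by rewrite pmulr_rle0// ltr0n.
Qed.

Lemma is_derive_binom_sum N (z : R) : is_derive z (1 : R) (binom_sum N) (binom_sum' N z).
Proof.
elim: N => [|N IH]; first exact: is_derive_cst.
have H := is_deriveX N.+1 (is_derive_id z (1 : R)).
have H2 := is_deriveM (is_derive_cst (binom_coef N.+1) z (1 : R)) H.
apply: (is_derive_ext (is_deriveD IH H2)).
  by move=> t; rewrite -[RHS]/(binom_sum N t + binom_coef N.+1 * (id ^+ N.+1) t) exprfctE.
by rewrite -![_ *: _]/(_ * _)/=; ring.
Qed.

(** (1 - z)^be solves (1 - z) y' + be y = 0; a partial sum solves the same equation up to a single
    term of degree N. *)
Lemma binom_sum_ode N z :
  (1 - z) * binom_sum' N z + be * binom_sum N z =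
  - (N.+1%:R * binom_coef N.+1 * z ^+ N).
Proof.
elim: N => [|N IH]; first by rewrite binom_coefS/= mulr0 expr0; ring.
rewrite [in RHS]binom_coefS -/binom_coef.
rewrite [binom_sum' _ _]/= [binom_sum _ _]/= -![binom_coef N * _ / _]/(binom_coef N.+1).
rewrite !mulrDr addrACA IH !exprS -!natr1.
set a := binom_coef N.+1; ring.
Qed.

Lemma binom_sum0 N : binom_sum N 0 = 1.
Proof. by elim: N => //= N ->; rewrite exprS mul0r mulr0 addr0. Qed.

(* S_N (1 - z)^{-be} has derivative of size O(z^N), by the differential equation. *)
Lemma binom_sum_quotient N z : 0 <= z -> z < 1 ->
  0 <= binom_sum N z * expR (- be * ln (1 - z)) - 1
    <= be * z ^+ N * expR (- (be + 1) * ln (1 - z)).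
Proof.
move=> z0 z1.
pose G x := binom_sum N x * expR (- be * ln (1 - x)).
pose dG x := - (N.+1%:R * binom_coef N.+1 * x ^+ N) * expR (- (be + 1) * ln (1 - x)).
have dGP (x : R) : x < 1 -> is_derive x (1 : R) G (dG x).
  move=> x1; have x10 : 0 < 1 - x by rewrite subr_gt0.
  have d1 := is_deriveB (is_derive_cst (1 : R) x (1 : R)) (is_derive_id x (1 : R)).
  have d2 := @is_derive1_comp _ (@ln R) (fun x => 1 - x) x _ _ (is_derive1_ln x10) d1.
  have d3 := is_deriveM (is_derive_cst (- be) x (1 : R)) d2.
  have d4 := @is_derive1_comp _ expR (fun x => - be * ln (1 - x)) x _ _
    (is_derive_expR _) d3.
  apply: (is_derive_ext (is_deriveM (is_derive_binom_sum N x) d4)) => //.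
  have x10p : 1 - x \is Num.pos by rewrite posrE.
  have eB : expR (- (be + 1) * ln (1 - x)) = expR (- be * ln (1 - x)) / (1 - x).
    by rewrite -[X in _ / X](lnK x10p) -expRN -expRD; congr expR; ring.
  rewrite /dG -binom_sum_ode eB -![_ *: _]/(_ * _)/=; field.
  by rewrite gt_eqF.
move: z0; rewrite le_eqVlt => /predU1P[<-|z0].
  rewrite subr0 ln1 !mulr0 expR0 !mulr1.
  by rewrite binom_sum0 subrr lexx/= mulr_ge0// ?exprn_ge0// ltW.
have dMVT (x : R) : x \in `]0, z[%R -> is_derive x (1 : R) G (dG x).
  by rewrite in_itv/= => /andP[_ xz]; apply: dGP; exact: lt_trans z1.
have cMVT : {within `[0, z], continuous G}.
  apply: continuous_in_subspaceT => x; rewrite inE/= in_itv/= => /andP[_ xz].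
  apply/differentiable_continuous/derivable1_diffP.
  by have := dGP x (le_lt_trans xz z1); case.
have [c] := MVT z0 dMVT cMVT; rewrite in_itv/= => /andP[c0 cz].
rewrite /G subr0 ln1 mulr0 expR0 mulr1 subr0.
rewrite binom_sum0 => ->; rewrite /dG; set e := expR _; set r := N.+1%:R * _.
have /andP[r1 r0] : - be <= r <= 0 := binom_coef_bound N.
rewrite -(mulNr r); have cN : c ^+ N <= z ^+ N.
  by apply: lerXn2r; rewrite ?nnegrE ?(ltW c0) ?(ltW z0) ?(ltW cz).
have cN0 : 0 <= c ^+ N by rewrite exprn_ge0// ltW.
have rr : 0 <= - r by rewrite oppr_ge0.
apply/andP; split.
  by rewrite mulr_ge0 ?(ltW z0)// mulr_ge0 ?expR_ge0// mulr_ge0.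
rewrite -[leRHS]mulr1; apply: ler_pM; rewrite ?(ltW z0) ?(ltW z1)//.
  by rewrite mulr_ge0 ?expR_ge0// mulr_ge0.
apply: ler_pM; rewrite ?expR_ge0 ?mulr_ge0//.
  by apply: ler_pM => //; rewrite lerNl.
rewrite ler_expR !mulNr lerN2 ler_pM2l ?ltr_wpDr// ?(ltW be0)//.
by rewrite ler_ln ?posrE ?subr_gt0// ?(lt_trans cz)// lerD2l lerN2 ltW.
Qed.

Lemma exp_positive_binom_sum (F : R -> R) N : exp_positive F ->
  exp_positive (fun l => 1 - binom_sum N (F l)).
Proof.
move=> pF; elim: N => [|N IH].
  by under eq_fun do rewrite /= subrr; exact: exp_positive0.
have -> : (fun l => 1 - binom_sum N.+1 (F l)) =
  (fun l => - binom_coef N.+1 * F l ^+ N.+1 + (1 - binom_sum N (F l))).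
  by apply/funext => l /=; ring.
apply: exp_positiveD => //; last exact: exp_positiveX.
by rewrite oppr_ge0 binom_coef_le0.
Qed.

(** Limit of the binomial partial sums at z = e^(-(h l + r)). The shift r > 0 keeps z < 1 even at l
    = 0, inside the disc of convergence. *)
Lemma exp_positive_1Bpow (h r : R) : 0 <= h -> 0 < r ->
  exp_positive (fun l => 1 - (1 - expR (- (h * l + r))) `^ be).
Proof.
move=> h0 r0; pose F l := expR (- (h * l + r)).
have pF : exp_positive F.
  have := exp_positiveZ (expR_ge0 (- r)) (exp_positive_exp h0).
  congr exp_positive; apply/funext => l; rewrite -expRD /F; congr expR; ring.
have mF := pF.1.1.
have F0 l : 0 <= F l by exact: expR_ge0.
have F1 l : 0 <= l -> F l < 1.
  by move=> l0; rewrite /F -expR0 ltr_expR oppr_lt0 ltr_wpDl// mulr_ge0.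
have pw l : 0 <= l -> (1 - F l) `^ be = expR (be * ln (1 - F l)).
  by move=> l0; rewrite /powR gt_eqF// subr_gt0 F1.
have Spos l N : 0 <= l -> 0 <= binom_sum N (F l).
  move=> l0; have /andP[+ _] := binom_sum_quotient N (F0 l) (F1 l l0).
  rewrite subr_ge0 => H; rewrite -(pmulr_lge0 _ (expR_gt0 (- be * ln (1 - F l)))).
  by rewrite (le_trans _ H).
apply: (@exp_positive_lim (fun N l => 1 - binom_sum N (F l)) _ 1).
- by move=> N; exact: exp_positive_binom_sum.
- apply: measurable_funB => //; apply: (measurableT_comp (measurable_powR be)).
  exact: measurable_funB.
- move=> N l l0; rewrite ger0_norm; first by rewrite gerBl Spos.
  elim: N => [|N IH]; first by rewrite subrr.
  by rewrite (le_trans IH)// lerD2l lerN2 /= gerDl mulr_le0_ge0 ?binom_coef_le0 ?exprn_ge0.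
- move=> l l0; apply: cvgB; first exact: cvg_cst.
  rewrite -/(F l) pw//.
  set z := F l; set L := ln (1 - z).
  have H1 : be * z ^+ N * expR (- (be + 1) * L) @[N --> \oo] --> 0.
    have H : z ^+ N @[N --> \oo] --> 0.
      have z1 : `|z| < 1 by rewrite ger0_norm ?F0// F1.
      have -> : (fun N => z ^+ N) = geometric 1 z.
        by apply/funext => N; rewrite -[RHS]/(1 * z ^+ N) mul1r.
      exact: cvg_geometric.
    rewrite -(mul0r (expR (- (be + 1) * L))) -(mulr0 be).
    by apply: cvgMl; apply: cvgMr.
  have H2 : binom_sum N z * expR (- be * L) - 1 @[N --> \oo] --> 0.
    apply: (squeeze_cvgr _ (cvg_cst (0 : R)) H1).
    by apply: nearW => N; exact: binom_sum_quotient (F0 l) (F1 l l0).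
  have H3 : expR (be * L) * (binom_sum N z * expR (- be * L) - 1 + 1) @[N --> \oo]
      --> expR (be * L) * (0 + 1).
    by apply: cvgMr; apply: cvgD => //; exact: cvg_cst.
  rewrite (_ : (fun N => binom_sum N z) = (fun N => expR (be * L) *
    (binom_sum N z * expR (- be * L) - 1 + 1))).
    by move: H3; rewrite add0r mulr1.
  by apply/funext => N; rewrite subrK mulrCA -expRD mulNr subrr expR0 mulr1.
Qed.

Lemma expN_bounds (u : R) : 0 <= u -> u - u ^+ 2 <= 1 - expR (- u) <= u.
Proof.
move=> u0; apply/andP; split; last first.
  by have := expR_ge1Dx (- u); lra.
have H : expR (- u) <= (1 + u)^-1.
  by rewrite expRN lef_pV2 ?posrE ?expR_gt0 ?ltr_pwDl ?expR_ge1Dx.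
have : (1 + u)^-1 <= 1 - u + u ^+ 2.
  rewrite -[leLHS]mul1r ler_pdivrMr ?ltr_pwDl//.
  have -> : (1 - u + u ^+ 2) * (1 + u) = 1 + u ^+ 3 by ring.
  by rewrite lerDl exprn_ge0.
by lra.
Qed.

(** With h = 1 / (n + 1), D = 1 - e^(-(h l + h^2)) and c = h^(-be), the function e^(-c D^be) =
    e^(-c) e^(c (1 - D^be)) belongs to the class by the exponential series, and D / h tends to l.
    The extra h^2 is the positive shift required by [exp_positive_1Bpow]. *)
Lemma exp_positive_stable : exp_positive (fun l => expR (- (l `^ be))).
Proof.
pose h n : R := n.+1%:R^-1.
have h0 n : 0 < h n by rewrite invr_gt0.
pose D n l := 1 - expR (- (h n * l + h n ^+ 2)).
have D0 n l : 0 <= l -> 0 <= D n l.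
  move=> l0; rewrite subr_ge0 -expR0 ler_expR oppr_le0 addr_ge0 ?sqr_ge0//.
  by rewrite mulr_ge0// ltW.
pose c n := n.+1%:R `^ be : R.
have c0 n : 0 <= c n by exact: powR_ge0.
apply: (@exp_positive_lim (fun n l => expR (- (c n * (D n l) `^ be))) _ 1).
- move=> n.
  have P := exp_positiveZ (c0 n) (exp_positive_1Bpow (ltW (h0 n)) (exprn_gt0 2 (h0 n))).
  have Q := exp_positiveZ (expR_ge0 (- c n)) (exp_positive_expR P _).
  have {}Q := Q _; apply: (exp_positive_ext _ _ (Q _)).
  + apply: measurableT_comp => //; apply: measurableT_comp => //.
    apply: measurable_funM => //; apply: (measurableT_comp (measurable_powR be)).
    apply: measurable_funB => //; apply: measurableT_comp => //.
    by apply: measurableT_comp => //; exact: measurable_funD.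
  + by move=> l l0; rewrite -expRD -/(D n l); congr expR; ring.
  + move=> l l0; rewrite mulr_ge0// subr_ge0 -/(D n l).
    have E1 : (1 : R) `^ be = 1 by rewrite powR1.
    rewrite -[leRHS]E1; apply: ge0_ler_powR; rewrite ?nnegrE ?(ltW be0) ?D0//.
    by rewrite /D gerBl expR_ge0.
- by apply: measurableT_comp => //; apply: measurableT_comp.
- move=> n l l0; rewrite ger0_norm ?expR_ge0// -expR0 ler_expR oppr_le0.
  by rewrite mulr_ge0// powR_ge0.
- move=> l l0.
  apply: cvgn_continuous; first exact: continuous_expR.
  apply: cvgN.
  have E n : c n * D n l `^ be = (n.+1%:R * D n l) `^ be by rewrite powRM ?D0.
  under eq_fun do rewrite E.
  apply: cvg_powR => //; first by move=> n; rewrite mulr_ge0 ?D0.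
  have hc : h n @[n --> \oo] --> 0 by exact: cvg_harmonic.
  have lh : l + h n @[n --> \oo] --> l.
    by rewrite -[X in _ --> X]addr0; apply: cvgD => //; exact: cvg_cst.
  have lo : (l + h n) - h n * (l + h n) ^+ 2 @[n --> \oo] --> l.
    rewrite -[X in _ --> X]subr0 -(mul0r (l ^+ 2)).
    by apply: cvgB => //; apply: cvgM => //; exact: cvgM.
  apply: (squeeze_cvgr _ lo lh); apply: nearW => n.
  have hn1 : n.+1%:R * h n = 1 by rewrite mulfV.
  have u0 : 0 <= h n * (l + h n) by rewrite mulr_ge0 ?ltW// ltr_wpDl.
  have := expN_bounds u0.
  have -> : 1 - expR (- (h n * (l + h n))) = D n l.
    by rewrite /D; congr (1 - expR (- _)); ring.
  move=> /andP[H1 H2].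
  have n1 : 0 <= n.+1%:R :> R by [].
  have := ler_wpM2l n1 H1; have := ler_wpM2l n1 H2.
  rewrite mulrA hn1 mul1r => -> /= H; rewrite andbT; apply: le_trans H.
  have -> : n.+1%:R * (h n * (l + h n) - (h n * (l + h n)) ^+ 2) =
    n.+1%:R * h n * (l + h n) - n.+1%:R * h n * (h n * (l + h n) ^+ 2) by ring.
  by rewrite hn1 !mul1r.
Qed.

End binomial_series.

End positive_functions.

(** * Transfer from Gaussian transforms to stable ones *)

Section bernstein.
Context {d} {T : measurableType d} {R : realType}.
Variable mu : {measure set T -> \bar R}.
Variables (ell f : T -> R) (bs : seq (R * R)) (be : R).
Hypotheses (mell : measurable_fun setT ell) (ell0 : forall x, 0 <= ell x).
Hypotheses (mf : measurable_fun setT f) (be0 : 0 < be) (be1 : be < 1).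
Hypothesis lf : forall s, 0 < s -> L1 mu (fun x => f x * expR (- (s * ell x))).
Hypothesis bs0 : forall p, p \in bs -> 0 <= p.2.

Let J phi := \int[mu]_x (f x * phi (ell x)) + \sum_(p <- bs) p.1 * phi p.2.

Let L1_decay phi : exp_decay phi -> L1 mu (fun x => f x * phi (ell x)).
Proof.
move=> [mphi [M [s [s0 HM]]]].
apply: (@L1_le _ _ _ _ _ (fun x => M * `|f x * expR (- (s * ell x))|)).
- by apply: measurable_funM => //; exact: measurableT_comp.
- move=> x; rewrite !normrM (ger0_norm (expR_ge0 _)) mulrCA ler_wpM2l//.
  exact: HM.
- by apply: L1Z; apply: L1_norm; exact: lf.
Qed.

Let J_laplace : laplace_functional J.
Proof.
split.
  move=> a phi psi dphi dpsi; rewrite /J.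
  under eq_Rintegral do rewrite mulrDr mulrCA.
  rewrite RintD; [|by apply: L1Z; exact: L1_decay|exact: L1_decay].
  rewrite RintZ; last exact: L1_decay.
  under eq_bigr do rewrite mulrDr mulrCA.
  by rewrite big_split/= -mulr_sumr; ring.
move=> F phi M s s0 mF mphi FM Fphi; apply: cvgD.
  apply: (Rint_cvg (g := fun x => M * `|f x * expR (- (s * ell x))|)).
  - by move=> n; apply: measurable_funM => //; exact: measurableT_comp.
  - by apply: measurable_funM => //; exact: measurableT_comp.
  - by apply: L1Z; apply: L1_norm; exact: lf.
  - by move=> x; apply: cvgMr; exact: Fphi.
  - move=> n x; rewrite !normrM (ger0_norm (expR_ge0 _)) mulrCA ler_wpM2l//.
    exact: FM.
have bs0' : all (fun p : R * R => 0 <= p.2) bs by apply/allP => p; exact: bs0.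
elim: bs bs0' => [_|p s' IH /= /andP[p0 s'0]].
  by under eq_fun do rewrite big_nil; rewrite big_nil; exact: cvg_cst.
under eq_fun do rewrite big_cons; rewrite big_cons.
by apply: cvgD; [apply: cvgMr; exact: Fphi|exact: IH].
Qed.

(** The finite sum stands for point masses with coefficients of either sign: it allows a transform
    to be compared with exponentials placed by hand, as well as with another transform. *)
Theorem bernstein_positivity :
  L1 mu (fun x => f x * expR (- (ell x `^ be))) ->
  (forall s, 0 < s -> 0 <= \int[mu]_x (f x * expR (- (s * ell x))) +
     \sum_(p <- bs) p.1 * expR (- (s * p.2))) ->
  0 <= \int[mu]_x (f x * expR (- (ell x `^ be))) +
     \sum_(p <- bs) p.1 * expR (- (p.2 `^ be)).
Proof.
move=> lfb H.
have [_ /(_ J J_laplace H) P] := exp_positive_stable be0 be1.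
(* The class [exp_positive] only speaks of damped functions; the damping rate 1 / (n + 1) is sent to
   0. *)
apply: (@cvgn_ge0 _ (fun n => J (fun l => expR (- (l `^ be)) * expR (- (n.+1%:R^-1 * l))))).
  have mE : measurable_fun setT (fun l : R => expR (- (l `^ be))).
    by apply: measurableT_comp => //; apply: measurableT_comp => //; exact: measurable_powR.
  have lim1 l : expR (- (l `^ be)) * expR (- (n.+1%:R^-1 * l)) @[n --> \oo]
      --> expR (- (l `^ be)).
    rewrite -[X in _ --> X]mulr1; apply: cvgMr; rewrite -[X in _ --> X]expR0.
    apply: cvgn_continuous; first exact: continuous_expR.
    by rewrite -oppr0 -(mul0r l); apply: cvgN; apply: cvgMl; exact: cvg_harmonic.
  apply: cvgD.
    apply: (Rint_cvg (g := fun x => `|f x * expR (- (ell x `^ be))|)).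
    - move=> n; apply: measurable_funM => //; apply: (measurableT_comp (f := fun l =>
        expR (- (l `^ be)) * expR (- (n.+1%:R^-1 * l)))) => //.
      by apply: measurable_funM => //; exact: measurable_expNM.
    - by apply: measurable_funM => //; exact: (measurableT_comp mE).
    - exact: L1_norm.
    - by move=> x; apply: cvgMr; exact: lim1.
    - move=> n x; rewrite mulrA normrM ler_piMr// ger0_norm ?expR_ge0//.
      by rewrite -expR0 ler_expR oppr_le0 mulr_ge0.
  elim: bs => [|p s' IH].
    by under eq_fun do rewrite big_nil; rewrite big_nil; exact: cvg_cst.
  under eq_fun do rewrite big_cons; rewrite big_cons.
  by apply: cvgD => //; apply: cvgMr; exact: lim1.
by move=> n; apply: P; rewrite invr_gt0.
Qed.

End bernstein.

Section exp_elementary.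
Context {R : realType}.

Lemma expN_lower (y : R) : 0 <= y -> y / (1 + y) <= 1 - expR (- y).
Proof.
move=> y0; have y1 : 0 < 1 + y by rewrite ltr_pwDl.
have H : expR (- y) <= (1 + y)^-1.
  by rewrite expRN lef_pV2 ?posrE ?expR_gt0 ?expR_ge1Dx.
have -> : y / (1 + y) = 1 - (1 + y)^-1 by field; rewrite gt_eqF.
by rewrite lerD2l lerN2.
Qed.

Lemma expN_lower2 (y : R) : 0 <= y -> y <= 1 -> y / 2 <= 1 - expR (- y).
Proof.
move=> y0 y1; apply: le_trans (expN_lower y0); rewrite ler_wpM2l//.
by rewrite lef_pV2 ?posrE ?ltr_pwDl//; lra.
Qed.

Lemma expN_half (y : R) : 1 <= y -> 2^-1 <= 1 - expR (- y).
Proof.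
move=> y1; have y0 : 0 <= y by rewrite (le_trans _ y1).
apply: le_trans (expN_lower y0).
by rewrite ler_pdivlMr ?ltr_pwDl//; lra.
Qed.

Lemma expN_upper (y : R) : 1 - expR (- y) <= y.
Proof. by have := expR_ge1Dx (- y); lra. Qed.

(** The normalized Gaussian profile on the left is bounded for large y and vanishes faster than any
    power at 0, so it lies below a multiple of 1 - e^(-y), which behaves like min(y, 1). *)
Lemma powR_exp_bound (m : nat) (y : R) : 0 < y ->
  y `^ (- (m%:R / 2)) * expR (- ((4 * y)^-1)) <=
  2 * 4 ^+ m.+1 * (m.+1)`!%:R * (1 - expR (- y)).
Proof.
move=> y0.
have a0 : 0 <= m%:R / 2 :> R by rewrite divr_ge0.
have C1 : 1 <= 4 ^+ m.+1 * (m.+1)`!%:R :> R.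
  by rewrite -natrX -natrM ler1n muln_gt0 expn_gt0 fact_gt0.
have [y1|y1] := leP 1 y.
  apply: (@le_trans _ _ 1).
    rewrite -[leRHS]mulr1; apply: ler_pM; rewrite ?powR_ge0 ?expR_ge0//.
      by rewrite -[leRHS](powRr0 y); apply: ler_powR => //; rewrite oppr_le0.
    by rewrite -expR0 ler_expR oppr_le0 invr_ge0 mulr_ge0// ltW.
  have := expN_half y1 => H.
  rewrite -(mulrA 2) -[leLHS](divff (_ : 2 != 0 :> R))// -mulrA ler_wpM2l//.
  rewrite -[leLHS]mul1r; apply: ler_pM => //.
pose v := y^-1; have v0 : 0 < v by rewrite invr_gt0.
have v1 : 1 <= v by rewrite invf_ge1// ltW.
have yE : y = v^-1 by rewrite invrK.
have -> : y `^ (- (m%:R / 2)) = v `^ (m%:R / 2).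
  by rewrite -mulN1r powRrM -/v powR_inv1// ltW.
have -> : (4 * y)^-1 = v / 4 by rewrite invfM mulrC.
apply: (@le_trans _ _ (v ^+ m * expR (- (v / 4)))).
  rewrite ler_wpM2r ?expR_ge0// -powR_mulrn ?(ltW v0)// ler_powR//.
  by rewrite ler_pdivrMr// ler_peMr// ler1n.
have H1 : (2 * v)^-1 <= 1 - expR (- y).
  apply: le_trans (expN_lower2 (ltW y0) (ltW y1)).
  by rewrite invfM -yE mulrC.
have H2 := expR_poly_bound m.+1 (_ : 0 <= v / 4).
have {}H2 := H2 (ltW (divr_gt0 v0 (ltr0n R 4))).
apply: (@le_trans _ _ (2 * 4 ^+ m.+1 * (m.+1)`!%:R * (2 * v)^-1)); last first.
  by rewrite ler_wpM2l// -mulrA mulr_ge0// (le_trans _ C1).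
rewrite expRN ler_pdivrMr ?expR_gt0//.
rewrite -(ler_pM2l v0) -exprS.
have -> : v ^+ m.+1 = 4 ^+ m.+1 * (v / 4) ^+ m.+1.
  by rewrite -exprMn mulrC divfK.
have -> : v * (2 * 4 ^+ m.+1 * (m.+1)`!%:R / (2 * v) * expR (v / 4)) =
  4 ^+ m.+1 * ((m.+1)`!%:R * expR (v / 4)) by field; rewrite gt_eqF.
by rewrite ler_wpM2l// exprn_ge0.
Qed.

(** A combination of exponentials that is nonpositive outside [dl, K]: below dl the second term
    outweighs 1 - e^(-y) <= y, above K the third one is at least 1. A lower bound known only for y
    in a window thereby becomes a bound for all y > 0. *)
Lemma window_bound (dl K y : R) : 0 < dl -> 0 < K -> 0 < y -> (y < dl) || (K < y) ->
  1 - expR (- y) - 2 * dl * (1 - expR (- (y / dl))) - 2 * (1 - expR (- (y / K))) <= 0.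
Proof.
move=> dl0 K0 y0 /orP[yd|Ky].
  have u0 : 0 <= y / dl by rewrite divr_ge0// ltW.
  have u1 : y / dl <= 1 by rewrite ler_pdivrMr// mul1r ltW.
  have A := expN_lower2 u0 u1; have := expN_upper y.
  have : 2 * dl * (y / dl / 2) <= 2 * dl * (1 - expR (- (y / dl))).
    by rewrite ler_wpM2l// mulr_ge0// ltW.
  have -> : 2 * dl * (y / dl / 2) = y by field; rewrite gt_eqF.
  have : 0 <= 1 - expR (- (y / K)).
    by rewrite subr_ge0 -expR0 ler_expR oppr_le0 divr_ge0// ltW.
  by lra.
have u1 : 1 <= y / K by rewrite ler_pdivlMr// mul1r ltW.
have := expN_half u1.
have : 0 <= 2 * dl * (1 - expR (- (y / dl))).
  rewrite mulr_ge0//; first by rewrite mulr_ge0// ltW.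
  by rewrite subr_ge0 -expR0 ler_expR oppr_le0 divr_ge0// ltW.
by have := expR_ge0 (- y); lra.
Qed.

Lemma ler_powRN (x y c : R) : 0 <= c -> 0 < x -> x <= y -> y `^ (- c) <= x `^ (- c).
Proof.
move=> c0 x0 xy; have y0 := lt_le_trans x0 xy.
rewrite !powRN lef_pV2 ?posrE ?powR_gt0//.
by apply: ge0_ler_powR; rewrite // nnegrE ltW.
Qed.

Lemma window_sum (k D a b c : R) :
  - (k * (1 + 2 * D) + (k * a + (- (2 * D * k) * b + - (2 * k) * c))) =
  k * (1 - a - 2 * D * (1 - b) - 2 * (1 - c)).
Proof. by ring. Qed.

Lemma window_le1 (e1 D E : R) : 0 <= e1 -> 0 <= D -> 0 <= E ->
  1 - e1 - D - 2 * E <= 1.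
Proof. by lra. Qed.

Lemma window_ge (h E1 D E : R) : h / 2 <= E1 -> D <= 2 * (16^-1 * h) ->
  E <= 16^-1 * h -> h / 4 <= E1 - D - 2 * E.
Proof. by lra. Qed.

End exp_elementary.

Lemma big_seq2 (V : nmodType) (T : Type) (F : T -> V) x0 x1 :
  \sum_(x <- [:: x0; x1]) F x = F x0 + F x1.
Proof. by rewrite 2!big_cons big_nil addr0. Qed.

Lemma big_seq4 (V : nmodType) (T : Type) (F : T -> V) x0 x1 x2 x3 :
  \sum_(x <- [:: x0; x1; x2; x3]) F x = F x0 + (F x1 + (F x2 + F x3)).
Proof. by rewrite 4!big_cons big_nil addr0. Qed.

Section two_sided.
Context {d} {T : measurableType d} {R : realType}.
Variable mu : {measure set T -> \bar R}.
Variables (ell : T -> R) (be : R).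
Hypotheses (mell : measurable_fun setT ell) (ell0 : forall x, 0 <= ell x).
Hypotheses (be0 : 0 < be) (be1 : be < 1).

Definition stable_admissible (f : T -> R) : Prop :=
  [/\ measurable_fun setT f, forall s, 0 < s -> L1 mu (fun x => f x * expR (- (s * ell x)))
    & L1 mu (fun x => f x * expR (- (ell x `^ be)))].

Lemma stable_admissibleZ c f : stable_admissible f -> stable_admissible (fun x => c * f x).
Proof.
move=> [mf lf lfb]; split.
- exact: measurable_funM.
- by move=> s s0; under eq_fun do rewrite -mulrA; apply: L1Z; exact: lf.
- by under eq_fun do rewrite -mulrA; apply: L1Z.
Qed.

Lemma stable_admissibleB f g : stable_admissible f -> stable_admissible g ->
  stable_admissible (fun x => f x - g x).
Proof.
move=> [mf lf lfb] [mg lg lgb]; split.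
- exact: measurable_funB.
- by move=> s s0; under eq_fun do rewrite mulrBl; apply: L1B; [exact: lf|exact: lg].
- by under eq_fun do rewrite mulrBl; exact: L1B.
Qed.

Lemma stable_mono f g : stable_admissible f -> stable_admissible g ->
  (forall s, 0 < s -> \int[mu]_x (f x * expR (- (s * ell x))) <=
     \int[mu]_x (g x * expR (- (s * ell x)))) ->
  \int[mu]_x (f x * expR (- (ell x `^ be))) <=
     \int[mu]_x (g x * expR (- (ell x `^ be))).
Proof.
move=> af ag fg.
have [mh lh lhb] := stable_admissibleB ag af.
have [_ lf lfb] := af; have [_ lg lgb] := ag.
have := @bernstein_positivity _ _ _ mu ell _ [::] be mell ell0 mh be0 be1 lh.
move=> /(_ (fun p => ltac:(by rewrite in_nil)) lhb).
rewrite big_nil addr0 => H; rewrite -subr_ge0 -RintB//.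
under eq_Rintegral do rewrite -mulrBl.
apply: H => s s0; rewrite big_nil addr0.
under eq_Rintegral do rewrite mulrBl.
by rewrite RintB ?subr_ge0 ?fg//; [exact: lg|exact: lf].
Qed.

Lemma stable_le_deltas f (bs : seq (R * R)) : stable_admissible f ->
  (forall p, p \in bs -> 0 <= p.2) ->
  (forall s, 0 < s -> \int[mu]_x (f x * expR (- (s * ell x))) <=
     \sum_(p <- bs) p.1 * expR (- (s * p.2))) ->
  \int[mu]_x (f x * expR (- (ell x `^ be))) <=
     \sum_(p <- bs) p.1 * expR (- (p.2 `^ be)).
Proof.
move=> af bs0 fb; have [mf lf lfb] := stable_admissibleZ (-1) af.
have [_ lf' lfb'] := af.
have := @bernstein_positivity _ _ _ mu ell _ bs be mell ell0 mf be0 be1 lf bs0 lfb.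
under [X in _ -> 0 <= X + _]eq_Rintegral do rewrite -mulrA mulN1r.
rewrite RintN// addrC subr_ge0; apply => s s0.
under eq_Rintegral do rewrite -mulrA mulN1r.
by rewrite RintN ?(addrC (- _)) ?subr_ge0 ?fb//; exact: lf'.
Qed.

(** [g] is a nonnegative comparison weight whose Laplace transform dominates s^(-m/2). It gives the
    upper bound where the Gaussian factor e^(-rho / (4 s)) can be discarded. *)
Variables (m : nat) (g : T -> R).
Hypotheses (ag : stable_admissible g) (g0 : forall x, 0 <= g x).
Let a : R := m%:R / 2.
Hypothesis gE : forall s, 0 < s ->
  s `^ (- a) <= \int[mu]_x (g x * expR (- (s * ell x))).

(** Satisfied with rho = |x|^2 by cos (x.y), with m equal to the dimension, and by (b.y) sin (x.y)
    when b.x >= 0, with m larger by 2 because the derivative brings out one more factor 1 / s. *)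
Definition gaussian_transform (f : T -> R) (A rho : R) : Prop :=
  [/\ stable_admissible f, 0 <= A, 0 <= rho & forall s, 0 < s ->
    \int[mu]_x (f x * expR (- (s * ell x))) =
    A * (s `^ (- a) * expR (- (rho / (4 * s))))].

Let a0 : 0 <= a. Proof. by rewrite /a divr_ge0. Qed.

Let upper_small f A rho : gaussian_transform f A rho ->
  \int[mu]_x (f x * expR (- (ell x `^ be))) <=
  A * \int[mu]_x (g x * expR (- (ell x `^ be))).
Proof.
move=> [af A0 rho0 fE]; have aAg := stable_admissibleZ A ag.
rewrite -RintZ; last by case: ag.
under [X in _ <= X]eq_Rintegral do rewrite mulrA.
apply: stable_mono => // s s0; rewrite fE//.
under [X in _ <= X]eq_Rintegral do rewrite -mulrA.
rewrite RintZ; last by case: ag => _ lg _; exact: lg.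
rewrite ler_wpM2l// (le_trans _ (gE s0))// ler_piMr ?powR_ge0//.
by rewrite -expR0 ler_expR oppr_le0 divr_ge0// mulr_ge0// ltW.
Qed.

Let C1 : R := 2 * 4 ^+ m.+1 * (m.+1)`!%:R.

Let C1_ge0 : 0 <= C1.
Proof. by rewrite /C1 mulr_ge0// mulr_ge0// exprn_ge0. Qed.

(** The transform is below k (1 - e^(-s / rho)), that is, below masses k at 0 and -k at 1 / rho.
    Passing to the exponent be turns this into k (1 - e^(-rho^(-be))) <= k rho^(-be), which is where
    the polynomial tail comes from. *)
Let upper_large f A rho : gaussian_transform f A rho -> 0 < rho ->
  \int[mu]_x (f x * expR (- (ell x `^ be))) <= C1 * A * rho `^ (- (a + be)).
Proof.
move=> [af A0 _ fE] rho0.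
pose k := C1 * A * rho `^ (- a).
have k0 : 0 <= k by rewrite mulr_ge0 ?powR_ge0// mulr_ge0.
have := @stable_le_deltas f [:: (k, 0); (- k, rho^-1)] af.
rewrite big_seq2/= powR0 ?gt_eqF// oppr0 expR0 mulr1.
move=> H; apply: (@le_trans _ _ (k * (1 - expR (- (rho^-1 `^ be))))).
  apply: le_trans (H _ _) _; last by rewrite mulrBr mulr1 mulNr.
    by move=> p; rewrite !inE => /orP[|] /eqP->//=; rewrite invr_ge0 ltW.
  move=> s s0; rewrite big_seq2/= mulr0 oppr0 expR0 mulr1 fE//.
  have y0 : 0 < s / rho by rewrite divr_gt0.
  have := powR_exp_bound m y0; rewrite -/a -/C1 => B.
  have -> : s `^ (- a) = rho `^ (- a) * (s / rho) `^ (- a).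
    by rewrite -powRM ?ltW// mulrC divfK ?gt_eqF.
  have -> : rho / (4 * s) = (4 * (s / rho))^-1 by field; rewrite !gt_eqF.
  rewrite [leRHS](_ : _ = A * (rho `^ (- a) * (C1 * (1 - expR (- (s / rho)))))); last first.
    by rewrite /k; ring.
  by rewrite -(mulrA (rho `^ _)) ler_wpM2l// ler_wpM2l// powR_ge0.
rewrite opprD powRD; last by rewrite (gt_eqF rho0) implybT.
rewrite mulrA ler_wpM2l// (le_trans (expN_upper _))//.
by rewrite -(powR_inv1 (ltW rho0)) -powRrM mulN1r.
Qed.

Let stable_ge_deltas4 f (c0 c1 c2 c3 l0 l1 l2 l3 : R) : stable_admissible f ->
  0 <= l0 -> 0 <= l1 -> 0 <= l2 -> 0 <= l3 ->
  (forall s, 0 < s -> - (\int[mu]_x (f x * expR (- (s * ell x)))) <=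
     c0 * expR (- (s * l0)) + (c1 * expR (- (s * l1)) +
     (c2 * expR (- (s * l2)) + c3 * expR (- (s * l3))))) ->
  - (\int[mu]_x (f x * expR (- (ell x `^ be)))) <=
     c0 * expR (- (l0 `^ be)) + (c1 * expR (- (l1 `^ be)) +
     (c2 * expR (- (l2 `^ be)) + c3 * expR (- (l3 `^ be)))).
Proof.
move=> af l00 l10 l20 l30 H; have aNf := stable_admissibleZ (-1) af.
have [_ lf lfb] := af.
have := @stable_le_deltas _ [:: (c0, l0); (c1, l1); (c2, l2); (c3, l3)] aNf.
rewrite big_seq4.
under [X in _ -> _ -> X <= _]eq_Rintegral do rewrite -mulrA mulN1r.
rewrite RintN//; apply.
  by move=> p; rewrite !inE => /or4P[] /eqP->.
move=> s s0; rewrite big_seq4.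
under eq_Rintegral do rewrite -mulrA mulN1r.
by rewrite RintN; [exact: H|exact: lf].
Qed.

(** The values for which dl^(1 - be) = K^(-be) = 1 / 16. At the stable level the two corrections of
    [window_bound] then cost at most h / 8 each, against h / 2 for the main term. [c0] is the
    minimum of the profile over the window, up to the remaining factor 1 / 4. *)
Let dl : R := 16^-1 `^ (1 - be)^-1.
Let K : R := 16 `^ be^-1.
Let c0 : R := K `^ (- a) * expR (- ((4 * dl)^-1)) / 4.

Let dl0 : 0 < dl. Proof. by rewrite /dl powR_gt0// invr_gt0. Qed.
Let K0 : 0 < K. Proof. by rewrite /K powR_gt0. Qed.

(** With r = 1 + rho, the transform is at least k for s / r in [dl, K], hence at least k times the
    combination of [window_bound] for every s > 0. That combination has four exponentials, at 0, 1 /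
    r, 1 / (dl r) and 1 / (K r). *)
Let lower f A rho : gaussian_transform f A rho ->
  c0 * A * (1 + rho) `^ (- (a + be)) <= \int[mu]_x (f x * expR (- (ell x `^ be))).
Proof.
move=> [af A0 rho0 fE]; set r := 1 + rho.
have r1 : 1 <= r by rewrite lerDl.
have r0 : 0 < r by rewrite (lt_le_trans _ r1).
pose k := 4 * c0 * A * r `^ (- a).
have c00 : 0 < c0 by rewrite /c0 divr_gt0// mulr_gt0 ?powR_gt0 ?expR_gt0.
have k0 : 0 <= k by rewrite !mulr_ge0 ?powR_ge0// ltW.
have [_ lf lfb] := af.
have := @stable_ge_deltas4 _ (k * (1 + 2 * dl)) k (- (2 * dl * k)) (- (2 * k))
  0 r^-1 (dl * r)^-1 (K * r)^-1 af (lexx 0).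
rewrite !invr_ge0 (ltW r0) !(mulr_ge0 (ltW _) (ltW r0))//.
move=> /(_ isT isT isT).
rewrite powR0 ?gt_eqF// oppr0 expR0 mulr1.
have h0 : 0 < r `^ (- be) by exact: powR_gt0.
have invE z : 0 < z -> (z * r)^-1 `^ be = z `^ (- be) * r `^ (- be).
  by move=> z0; rewrite -powRM ?ltW// -(powR_inv1 (ltW (mulr_gt0 z0 r0))) -powRrM mulN1r.
rewrite !invE// -(powR_inv1 (ltW r0)) -powRrM mulN1r.
set h := r `^ (- be) => H.
have h1 : h <= 1 by rewrite /h -(powRr0 r) ler_powR// oppr_le0 ltW.
have dlE : dl * dl `^ (- be) = 16^-1.
  rewrite -{1}(powRr1 (ltW dl0)) -powRD; last by rewrite (gt_eqF dl0) implybT.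
  have := powRrM (16^-1 : R) (1 - be)^-1 (1 - be).
  rewrite mulVf; last by rewrite gt_eqF// subr_gt0.
  by rewrite powRr1 ?invr_ge0// => ->.
have KE : K `^ (- be) = 16^-1.
  by rewrite /K -powRrM mulrN mulVf ?gt_eqF// powR_inv1.
have E1 := expN_lower2 (ltW h0) h1.
have E2 := expN_upper (dl `^ (- be) * h).
have E3 := expN_upper (K `^ (- be) * h).
have : k * (h / 4) <= \int[mu]_x (f x * expR (- (ell x `^ be))).
  rewrite -lerN2; apply: le_trans (H _) _.
  - move=> s s0; rewrite fE// mulr0 oppr0 expR0 mulr1.
    pose y := s / r; have y0 : 0 < y by rewrite divr_gt0.
    have -> : s * r `^ (-1) = y by rewrite powR_inv1// ltW.
    have -> : s * (dl * r)^-1 = y / dl by rewrite /y invfM mulrA mulrAC.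
    have -> : s * (K * r)^-1 = y / K by rewrite /y invfM mulrA mulrAC.
    set e1 := expR (- y); set e2 := expR (- (y / dl)); set e3 := expR (- (y / K)).
    rewrite -lerN2 opprK window_sum.
    have [out|inside] := boolP ((y < dl) || (K < y)).
      apply: (@le_trans _ _ 0); last first.
        by rewrite mulr_ge0// mulr_ge0 ?powR_ge0 ?expR_ge0.
      by rewrite mulr_ge0_le0//; exact: window_bound.
    move: inside; rewrite negb_or -!leNgt => /andP[dy yK].
    have B : 1 - e1 - 2 * dl * (1 - e2) - 2 * (1 - e3) <= 1.
      have : 0 <= 1 - e2.
        by rewrite subr_ge0 -expR0 ler_expR oppr_le0 divr_ge0// ltW.
      have : 0 <= 1 - e3.
        by rewrite subr_ge0 -expR0 ler_expR oppr_le0 divr_ge0// ltW.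
      move=> E3' /(mulr_ge0 (mulr_ge0 (ler0n R 2) (ltW dl0))) E2'.
      by apply: window_le1 => //; exact: expR_ge0.
    apply: (@le_trans _ _ k); first by rewrite ler_piMr.
    rewrite [leLHS](_ : _ = A * ((K `^ (- a) * r `^ (- a)) * expR (- (4 * dl)^-1))); last first.
      by rewrite /k /c0; field.
    rewrite ler_wpM2l//.
    apply: ler_pM; rewrite ?mulr_ge0 ?powR_ge0 ?expR_ge0//.
      rewrite -powRM ?(ltW K0) ?(ltW r0)//; apply: ler_powRN => //.
      by rewrite -ler_pdivrMr.
    rewrite ler_expR lerN2.
    rewrite ler_pdivrMr ?mulr_gt0// mulrC -ler_pdivrMr ?invr_gt0 ?mulr_gt0//.
    rewrite invrK mulrCA ler_pM2l//.
    apply: (@le_trans _ _ (dl * r)); last by rewrite -ler_pdivlMr.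
    by rewrite mulrC ler_wpM2l ?(ltW dl0)// lerDr.
  - rewrite -lerN2 opprK.
    rewrite window_sum ler_wpM2l//.
    have E2' : 2 * dl * (1 - expR (- (dl `^ (- be) * h))) <= 2 * (16^-1 * h).
      apply: (le_trans (ler_wpM2l (mulr_ge0 (ler0n R 2) (ltW dl0)) E2)).
      by rewrite -mulrA (mulrA dl) dlE.
    rewrite KE in E3 *; exact: window_ge.
rewrite opprD powRD; last by rewrite (gt_eqF r0) implybT.
apply: le_trans; rewrite -/h /k le_eqVlt; apply/orP; left; apply/eqP.
by field.
Qed.

(** The constants are chosen before [f], [A] and [rho], which makes the kernel bounds uniform in x.
    The power of 2 in the upper constant pays for replacing max(1, rho) by 1 + rho. *)
Theorem stable_two_sided : exists c C : R, [/\ 0 < c, 0 < C &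
  forall f A rho, gaussian_transform f A rho ->
    c * A * (1 + rho) `^ (- (a + be)) <= \int[mu]_x (f x * expR (- (ell x `^ be)))
      <= C * A * (1 + rho) `^ (- (a + be))].
Proof.
pose G := \int[mu]_x (g x * expR (- (ell x `^ be))).
have G0 : 0 <= G by apply: Rint_ge0 => x; rewrite mulr_ge0 ?expR_ge0.
have t0 : 0 < 2 `^ (a + be) :> R by exact: powR_gt0.
exists c0, (2 `^ (a + be) * (G + C1 + 1)); split.
- by rewrite /c0 divr_gt0// mulr_gt0 ?powR_gt0 ?expR_gt0.
- by rewrite mulr_gt0// ltr_wpDl// addr_ge0.
move=> f A rho H; rewrite lower//=; have [_ A0 rho0 _] := H.
have ab0 : 0 <= a + be by rewrite addr_ge0// ltW.
have r0 : 0 < 1 + rho by rewrite ltr_pwDl.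
have [rho1|rho1] := leP rho 1.
  apply: (le_trans (upper_small H)); rewrite -/G mulrAC mulrC ler_wpM2r//.
  apply: (@le_trans _ _ (2 `^ (a + be) * G * 2 `^ (- (a + be)))).
    by rewrite mulrAC powRN divff ?mul1r// gt_eqF.
  apply: ler_pM; rewrite ?powR_ge0 ?mulr_ge0 ?(ltW t0)//.
    by rewrite ler_wpM2l ?(ltW t0)// -addrA lerDl addr_ge0.
  rewrite !powRN lef_pV2 ?posrE ?powR_gt0//.
  by apply: ge0_ler_powR; rewrite ?nnegrE ?(ltW r0)//; lra.
have rho00 : 0 < rho by rewrite (lt_trans _ rho1).
apply: (le_trans (upper_large H rho00)).
rewrite !(mulrAC _ A) ler_wpM2r//.
apply: (@le_trans _ _ (C1 * (2 `^ (a + be) * (1 + rho) `^ (- (a + be))))).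
  rewrite ler_wpM2l// !powRN ler_pdivlMr ?powR_gt0// mulrC ler_pdivrMr ?powR_gt0//.
  rewrite -powRM ?(ltW rho00)//; apply: ge0_ler_powR; rewrite ?nnegrE ?(ltW r0)//.
    by rewrite mulr_ge0// ltW.
  by lra.
rewrite mulrA ler_wpM2r ?powR_ge0// mulrC ler_wpM2l ?(ltW t0)//.
by rewrite addrAC lerDr addr_ge0.
Qed.

End two_sided.

(** * The stable kernel and its gradient as Fourier integrals *)

Section stable_kernel.
Context {R : realType} {n : nat}.
Variable be : R.
Hypotheses (be_half : 2^-1 < be) (be1 : be < 1).
Implicit Types (x y v b : 'rV[R]_n) (t s r : R).
Local Notation mu := (lebesgue_rV n).

Let be0 : 0 < be. Proof. by apply: lt_trans be_half; rewrite invr_gt0. Qed.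

Lemma L1_wt_quad (f : 'rV[R]_n -> R) (A B t : R) : measurable_fun setT f ->
  (forall x, `|f x| <= A + B * sqn x) -> 0 < t ->
  L1 mu (fun x => f x * wt be t x).
Proof.
move=> mf fAB t0.
apply: (@L1_le _ _ _ _ _ (fun x => A * wt be t x + B * (sqn x ^+ 1 * wt be t x))).
- by apply: measurable_funM => //; exact: measurable_wt.
- move=> x; rewrite normrM (ger0_norm (wt_ge0 _ _ _)) expr1 mulrA -mulrDl.
  by rewrite ler_wpM2r// wt_ge0.
- by apply: L1D; apply: L1Z; [exact: L1_wt|exact: L1_wt_moment].
Qed.

Lemma dotv_sqn_le v x : `|dotv v x| <= 1 + sqn v * sqn x.
Proof.
have H := dotv_cauchy v x; have H2 := sqr_ge0 (`|dotv v x| - 1).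
have := normr_ge0 (dotv v x).
have : `|dotv v x| ^+ 2 = dotv v x ^+ 2 by rewrite real_normK// num_real.
by nra.
Qed.

Lemma dotv_sqr_le v x : dotv v x ^+ 2 <= 0 + sqn v * sqn x.
Proof. by rewrite add0r dotv_cauchy. Qed.

Lemma L1_dotv2_wt v t : 0 < t -> L1 mu (fun x => dotv v x ^+ 2 * `|wt be t x|).
Proof.
move=> t0; under eq_fun do rewrite ger0_norm ?wt_ge0//.
apply: (@L1_wt_quad _ 0 (sqn v)) => //.
  by apply: measurable_funX; exact: measurable_dotv.
by move=> x; rewrite ger0_norm ?sqr_ge0//; exact: dotv_sqr_le.
Qed.

Definition cpi : R := (2 * pi) ^- n.

Lemma cpi_gt0 : 0 < cpi.
Proof. by rewrite invr_gt0 exprn_gt0// mulr_gt0// pi_gt0. Qed.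

(* fp t is the heat kernel for alpha = 2 be, and fk v t = - v . grad (fp t). *)
Definition fp t x : R := cpi * \int[mu]_y (cos (dotv x y) * wt be t y).

Definition fk v t x : R := cpi * \int[mu]_y (dotv v y * sin (dotv x y) * wt be t y).

Lemma L1_fp0 t x : 0 < t -> L1 mu (fun y => cos (dotv x y) * wt be t y).
Proof. by move=> t0; apply: L1_cosM; [exact: L1_wt|exact: measurable_dotv]. Qed.

Lemma L1_fk v t x : 0 < t -> L1 mu (fun y => dotv v y * sin (dotv x y) * wt be t y).
Proof.
move=> t0; apply: L1_sinM; rewrite ?measurable_dotv//.
- exact: measurable_dotv.
- exact: L1_wt.
- exact: L1_dotv2_wt.
- exact: measurable_dotv.
Qed.

Lemma fp_quad v t x k : 0 < t ->
  `|fp t (k *: v + x) - fp t x + k * fk v t x| <=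
  cpi * (\int[mu]_y (dotv v y ^+ 2 * `|wt be t y|)) * k ^+ 2.
Proof.
move=> t0.
have := oscillatory_quad (measurable_dotv v) (L1_wt n be_half t0) (L1_dotv2_wt v t0) k
  (measurable_dotv x).
move=> /(ler_wpM2l (ltW cpi_gt0)); rewrite (mulrA cpi); apply: le_trans.
rewrite -{1}(gtr0_norm cpi_gt0) -normrM le_eqVlt; apply/orP; left; apply/eqP; congr `|_|.
rewrite /fp /fk mulrDr mulrBr mulrCA; congr (cpi * _ - _ + _).
by apply: eq_Rintegral => y _; rewrite dotvDl dotvZl addrC.
Qed.

Lemma enorm_powR x : enorm x `^ (2 * be) = sqn x `^ be.
Proof.
rewrite powRrM powR_mulrn ?sqrtr_ge0// /enorm sqr_sqrtr//.
by apply: sumr_ge0 => i _; exact: sqr_ge0.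
Qed.

Lemma ReZ (r : R) (z : R[i]) : complex.Re (r%:C%C * z) = r * complex.Re z.
Proof. by case: z => c e /=; rewrite mul0r subr0. Qed.

Lemma heat_kernelE t x : heat_kernel (2 * be) t x = fp t x.
Proof.
rewrite /heat_kernel ReZ /fp /cpi /Cintegral/=; congr (_ * _).
apply: eq_Rintegral => y _; rewrite /cexp/= enorm_powR.
rewrite /wt !(mul0r, mulN1r, mulr0, oppr0, subr0, addr0, add0r, expR0).
by rewrite cosN cos0 sin0 !(mul1r, mulr1, mulr0, subr0).
Qed.

Lemma dotv_sum_delta v y : dotv v y = \sum_(i < n) v 0 i * dotv (delta_mx 0 i) y.
Proof.
rewrite /dotv; apply: eq_bigr => i _; congr (_ * _).
rewrite (bigD1 i)//= mxE !eqxx mul1r big1 ?addr0// => j ji.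
by rewrite mxE (negbTE ji) andbF mul0r.
Qed.

Lemma fk_sum_delta v t x : 0 < t ->
  fk v t x = \sum_(i < n) v 0 i * fk (delta_mx 0 i) t x.
Proof.
move=> t0; have E i : v 0 i * fk (delta_mx 0 i) t x =
    cpi * \int[mu]_y (v 0 i * (dotv (delta_mx 0 i) y * sin (dotv x y) * wt be t y)).
  by rewrite /fk mulrCA RintZ//; exact: L1_fk.
under [RHS]eq_bigr do rewrite E.
rewrite -mulr_sumr -Rint_sum; last by move=> i; apply: L1Z; exact: L1_fk.
congr (_ * _); apply: eq_Rintegral => y _.
by rewrite dotv_sum_delta !mulr_suml; apply: eq_bigr => i _; rewrite !mulrA.
Qed.

(** Differentiating p(x - z) in z reverses the sign of the gradient; with the minus sign built into
    [fk], the Duhamel kernel is [fk] at x - z. *)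
Lemma dot_grad_heat v t x z : 0 < t ->
  dot_grad v (fun z' => heat_kernel (2 * be) t (x - z')) z = fk v t (x - z).
Proof.
move=> t0; rewrite fk_sum_delta// /dot_grad; apply: eq_bigr => i _; congr (_ * _).
apply: derive_val.
apply: (is_derive_quad (C := cpi * (\int[mu]_y (dotv (- delta_mx 0 i) y ^+ 2 * `|wt be t y|)))) => k.
rewrite !heat_kernelE.
have := @fp_quad (- delta_mx 0 i) t (x - z) k t0.
rewrite (_ : k *: - delta_mx 0 i + (x - z) = x - (k *: delta_mx 0 i + z)); last first.
  by rewrite scalerN opprD addrCA addrA.
rewrite (_ : fk (- _) t (x - z) = - fk (delta_mx 0 i) t (x - z)).
  by rewrite mulrN.
rewrite /fk -mulrN -RintN; last exact: L1_fk.
by congr (_ * _); apply: eq_Rintegral => y _; rewrite dotvNl !mulNr.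
Qed.

Lemma fkN v t x : 0 < t -> fk v t (- x) = - fk v t x.
Proof.
move=> t0; rewrite /fk -mulrN -RintN; last exact: L1_fk.
by congr (_ * _); apply: eq_Rintegral => y _; rewrite dotvNl sinN mulrN mulNr.
Qed.

Let nu : R := (2 * be)^-1.

Lemma wt_scale t y : 0 < t -> wt be 1 (t `^ nu *: y) = wt be t y.
Proof.
move=> t0; rewrite /wt sqnZ powRM ?sqr_ge0 ?sqn_ge0// -powR_mulrn ?powR_ge0//.
rewrite -!powRrM (_ : nu * (2 * be) = 1); first by rewrite powRr1 ?(ltW t0)// mul1r.
by rewrite /nu; field; rewrite gt_eqF.
Qed.

Let scale_Rint (f : 'rV[R]_n -> R) t : 0 < t -> L1 mu f ->
  \int[mu]_y f (t `^ nu *: y) = t `^ (- (n%:R * nu)) * \int[mu]_y f y.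
Proof.
move=> t0 lf; have c0 : t `^ nu != 0 by rewrite gt_eqF// powR_gt0.
have := @Rint_affine _ _ f (t `^ nu) 0 c0 lf.
under eq_Rintegral do rewrite add0r; move=> ->; congr (_ * _).
by rewrite ger0_norm ?powR_ge0// powRN -powR_mulrn ?powR_ge0// -powRrM mulrC.
Qed.

Lemma fp_scale t x : 0 < t ->
  fp t x = t `^ (- (n%:R * nu)) * fp 1 (t `^ (- nu) *: x).
Proof.
move=> t0; rewrite /fp mulrCA; congr (_ * _).
rewrite -(scale_Rint t0 (L1_fp0 (t `^ (- nu) *: x) ltr01)).
apply: eq_Rintegral => y _; rewrite wt_scale// dotvZl dotvZr mulrA -powRD.
  by rewrite addNr powRr0 mul1r.
by rewrite (gt_eqF t0) implybT.
Qed.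

Lemma fk_scale v t x : 0 < t ->
  fk v t x = t `^ (- (n.+1%:R * nu)) * fk v 1 (t `^ (- nu) *: x).
Proof.
move=> t0; rewrite /fk mulrCA; congr (_ * _).
have tnu0 : t `^ nu != 0 by rewrite gt_eqF// powR_gt0.
rewrite -natr1 mulrDl mul1r opprD powRD; last by rewrite (gt_eqF t0) implybT.
rewrite mulrAC [RHS]mulrC.
rewrite -(scale_Rint t0 (L1_fk v (t `^ (- nu) *: x) ltr01)).
set J := (X in _ = _ * X).
have -> : J = t `^ nu * \int[mu]_y (dotv v y * sin (dotv x y) * wt be t y).
  rewrite -(RintZ _ (L1_fk v x t0)); apply: eq_Rintegral => y _.
  rewrite wt_scale// dotvZl !dotvZr (mulrA (t `^ (- nu))) -powRD.
    by rewrite addNr powRr0 mul1r !mulrA.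
  by rewrite (gt_eqF t0) implybT.
rewrite mulrA -powRD; first by rewrite addNr powRr0 mul1r.
by rewrite (gt_eqF t0) implybT.
Qed.

(** [F] is dominated uniformly in x, hence in general not integrable in (x, y). A Gaussian factor in
    x makes it so; Fubini gives measurability of the integral, and the factor is divided out. *)
Let gauss_bdd_measurable (F : 'rV[R]_n -> 'rV[R]_n -> R) (g : 'rV[R]_n -> R) :
  measurable_fun setT (fun p : 'rV[R]_n * 'rV[R]_n => F p.1 p.2) ->
  L1 mu g -> (forall x y, `|F x y| <= g y) ->
  measurable_fun setT (fun x => \int[mu]_y F x y).
Proof.
move=> mF lg Fg.
have lG := L1_gauss (ltr01 : 0 < (1 : R)) n.
have mG := L1_measurable lG.
have L : L1 (mu \x mu)%E (fun p => expR (- (1 * sqn p.1)) * F p.1 p.2).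
  apply: (@L1_le _ _ _ _ _ _ _ _ (L1_prodM lG lg)).
    by apply: measurable_funM => //; exact: measurableT_comp mG measurable_fst.
  by move=> p; rewrite normrM (ger0_norm (expR_ge0 _)) ler_wpM2l ?expR_ge0.
have mI := measurable_Rint1 L.
have : measurable_fun setT
    (fun x => expR (1 * sqn x) * \int[mu]_y (expR (- (1 * sqn x)) * F x y)).
  apply: measurable_funM => //; apply: measurableT_comp => //.
  by apply: measurable_funM => //; exact: measurable_sqn.
congr measurable_fun; apply/funext => x; rewrite RintZ; last first.
  apply: (@L1_le _ _ _ _ _ g) => //.
  exact: (measurableT_comp mF (pair1_measurable x)).
by rewrite mulrA -expRD subrr expR0 mul1r.
Qed.

Lemma measurable_fp t : 0 < t -> measurable_fun setT (fp t).
Proof.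
move=> t0; apply: measurable_funM => //.
apply: (@gauss_bdd_measurable _ (wt be t)); [|exact: L1_wt|].
- apply: measurable_funM.
    apply: (measurableT_comp measurable_cos).
    by apply: measurable_fun_dotv; [exact: measurable_fst|exact: measurable_snd].
  by apply: (measurableT_comp (measurable_wt _ _)); exact: measurable_snd.
- by move=> x y; rewrite normrM (ger0_norm (wt_ge0 _ _ _)) ler_piMl ?wt_ge0// cos_max.
Qed.

Lemma measurable_fk v t : 0 < t -> measurable_fun setT (fk v t).
Proof.
move=> t0; apply: measurable_funM => //.
apply: (@gauss_bdd_measurable _ (fun y => `|dotv v y| * wt be t y)).
- apply: measurable_funM; last first.
    by apply: (measurableT_comp (measurable_wt _ _)); exact: measurable_snd.
  apply: measurable_funM.
    by apply: (measurableT_comp (measurable_dotv _)); exact: measurable_snd.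
  apply: (measurableT_comp measurable_sin).
  by apply: measurable_fun_dotv; [exact: measurable_fst|exact: measurable_snd].
- apply: (@L1_wt_quad _ 1 (sqn v)) => //.
    by apply: measurableT_comp => //; exact: measurable_dotv.
  by move=> x; rewrite normr_id; exact: dotv_sqn_le.
- move=> x y; rewrite !normrM (ger0_norm (wt_ge0 _ _ _)) -mulrA ler_wpM2l//.
  by rewrite ler_piMl ?wt_ge0// sin_max.
Qed.

End stable_kernel.

Section gauss_transforms.
Context {R : realType} {n : nat}.
Implicit Types (x y v b : 'rV[R]_n) (t s r : R).
Local Notation mu := (lebesgue_rV n).

(** At exponent 1 the stable weight is the Gaussian, so that the moment lemmas for [wt] also serve
    for Gaussians. *)
Lemma wt_gauss s : @wt R n 1 s = (fun y => expR (- (s * sqn y))).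
Proof. by apply/funext => y; rewrite /wt powRr1// sqn_ge0. Qed.

Let half1 : 2^-1 < 1 :> R. Proof. by lra. Qed.

Lemma sqrt_pi_div s : 0 < s ->
  Num.sqrt (pi / s) ^+ n = Num.sqrt pi ^+ n * s `^ (- (n%:R / 2)) :> R.
Proof.
move=> s0; rewrite sqrtrM ?pi_ge0// exprMn; congr (_ * _).
rewrite -powR12_sqrt ?invr_ge0 ?(ltW s0)// -(powR_inv1 (ltW s0)) -powRrM.
by rewrite -powR_mulrn ?powR_ge0// -powRrM; congr (_ `^ _); lra.
Qed.

(** The derivative at r = 0 of the cosine transform at x + r b, computed twice: under the integral
    sign and on the closed form. Uniqueness of the derivative gives the identity. *)
Lemma gauss_fourier_dotv b x s : 0 < s ->
  \int[mu]_y (dotv b y * sin (dotv x y) * expR (- (s * sqn y))) =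
  dotv b x / (2 * s) * (Num.sqrt (pi / s) ^+ n * expR (- (sqn x / (4 * s)))).
Proof.
move=> s0; pose G y := expR (- (s * sqn y)); pose K := Num.sqrt (pi / s) ^+ n : R.
have lG : L1 mu G := L1_gauss s0 n.
have lG2 : L1 mu (fun y => dotv b y ^+ 2 * `|G y|).
  by have := L1_dotv2_wt half1 b s0; rewrite wt_gauss.
pose I := \int[mu]_y (dotv b y * sin (dotv x y) * G y).
have d1 : is_derive (0 : R) (1 : R)
    (fun r : R => \int[mu]_y (cos (dotv x y + r * dotv b y) * G y)) (- I).
  apply: (is_derive_quad (C := \int[mu]_y (dotv b y ^+ 2 * `|G y|))) => k.
  have := oscillatory_quad (measurable_dotv b) lG lG2 k (measurable_dotv x).
  rewrite mulrN opprK addr0 [k *: 1]mulr1.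
  under [in X in _ -> `|_ - X + _| <= _]eq_Rintegral do rewrite mul0r addr0.
  by [].
have gE r : \int[mu]_y (cos (dotv x y + r * dotv b y) * G y) =
    K * expR (- ((sqn x + r * (2 * dotv b x) + r ^+ 2 * sqn b) / (4 * s))).
  have := @gauss_fourier _ s s0 n (x + r *: b) 0.
  rewrite cos0 mul1r sqnD dotvZr sqnZ (dotvC x b) (mulrCA 2) => <-.
    by apply: eq_Rintegral => y _; rewrite add0r dotvDl dotvZl.
have d2 : is_derive (0 : R) (1 : R)
    (fun r : R => (sqn x + r * (2 * dotv b x) + r ^+ 2 * sqn b) / (4 * s)) (dotv b x / (2 * s)).
  have H := is_deriveX 2 (is_derive_id (0 : R) (1:R)).
  have H2 := is_deriveM H (is_derive_cst (sqn b) (0 : R) (1 : R)).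
  have H1 := is_deriveM (is_derive_id (0 : R) (1:R)) (is_derive_cst (2 * dotv b x) (0 : R) (1 : R)).
  have H3 := is_deriveD (is_deriveD (is_derive_cst (sqn x) (0 : R) (1 : R)) H1) H2.
  apply: (is_derive_ext (is_deriveM H3 (is_derive_cst ((4 * s)^-1) (0 : R) (1 : R)))) => //.
  rewrite -![_ *: _]/(_ * _)/= expr1; field.
  by rewrite gt_eqF.
have d3 := @is_derive1_comp _ expR _ 0 _ _ (is_derive_expR _) (is_deriveN d2).
have d4 := is_deriveM (is_derive_cst K (0 : R) (1 : R)) d3.
have d5 : is_derive (0 : R) (1 : R)
    (fun r : R => \int[mu]_y (cos (dotv x y + r * dotv b y) * G y))
    (- (dotv b x / (2 * s) * (K * expR (- (sqn x / (4 * s)))))).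
  apply: (is_derive_ext d4) => //.
  pose E : R := expR (- ((sqn x + 0 * (2 * dotv b x) + 0 ^+ 2 * sqn b) / (4 * s))).
  rewrite -[RHS]/(K * (E * - (dotv b x / (2 * s))) + E * 0) /E.
  by rewrite !mul0r expr0n/= mul0r !addr0; ring.
have := derive_val (is_derive := d1); rewrite (derive_val (is_derive := d5)) => /oppr_inj.
by rewrite /I => <-.
Qed.

End gauss_transforms.

Section kernel_bounds.
Context {R : realType} {n : nat}.
Variable be : R.
Hypotheses (be_half : 2^-1 < be) (be1 : be < 1).
Implicit Types (x y v b : 'rV[R]_n) (t s r : R).
Local Notation mu := (lebesgue_rV n).

Let be0 : 0 < be. Proof. by apply: lt_trans be_half; rewrite invr_gt0. Qed.
Let half1 : 2^-1 < 1 :> R. Proof. by lra. Qed.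

Lemma stable_admissible_quad (f : 'rV[R]_n -> R) (A B : R) : measurable_fun setT f ->
  (forall x, `|f x| <= A + B * sqn x) -> stable_admissible mu sqn be f.
Proof.
move=> mf fAB; split => //.
- by move=> s s0; have := L1_wt_quad half1 mf fAB s0; rewrite wt_gauss.
- have := L1_wt_quad be_half mf fAB ltr01; congr L1; apply/funext => x.
  by rewrite /wt mul1r.
Qed.

Let wt1 x : wt be 1 x = expR (- (sqn x `^ be)). Proof. by rewrite /wt mul1r. Qed.

Let gauss_mass s : 0 < s ->
  \int[mu]_y expR (- (s * sqn y)) = Num.sqrt pi ^+ n * s `^ (- (n%:R / 2)) :> R.
Proof.
move=> s0; rewrite -(sqrt_pi_div s0).
have := @gauss_fourier _ s s0 n 0 0; rewrite cos0 mul1r sqn0 mul0r oppr0 expR0 mulr1 => <-.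
by apply: eq_Rintegral => y _; rewrite dotv0l addr0 cos0 mul1r.
Qed.

Let spi0 : 0 < Num.sqrt pi ^+ n :> R.
Proof. by rewrite exprn_gt0// sqrtr_gt0 pi_gt0. Qed.

Lemma fp_bounds : exists c C : R, [/\ 0 < c, 0 < C & forall x,
  c * (1 + sqn x) `^ (- (n%:R / 2 + be)) <= fp be 1 x <=
  C * (1 + sqn x) `^ (- (n%:R / 2 + be))].
Proof.
have ag : stable_admissible mu sqn be (fun=> (Num.sqrt pi ^+ n)^-1 : R).
  apply: (@stable_admissible_quad _ (Num.sqrt pi ^+ n)^-1 0) => // x.
  by rewrite mul0r addr0 ger0_norm// invr_ge0 ltW.
have [||c [C [c0 C0 H]]] := stable_two_sided (@measurable_sqn R n) (@sqn_ge0 R n) be0 be1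
  (m := n) ag.
- by move=> x; rewrite invr_ge0 ltW.
- move=> s s0; rewrite RintZ ?gauss_mass//; last exact: L1_gauss.
  by rewrite mulrA mulVf ?mul1r// gt_eqF.
exists (@cpi R n * (c * Num.sqrt pi ^+ n)), (@cpi R n * (C * Num.sqrt pi ^+ n)).
split; rewrite ?mulr_gt0 ?cpi_gt0// => x.
rewrite /fp -!(mulrA (@cpi R n)) !ler_pM2l ?cpi_gt0//.
under eq_Rintegral do rewrite wt1.
apply: H; split; rewrite ?sqn_ge0 ?(ltW spi0)//.
  apply: (@stable_admissible_quad _ 1 0).
    by apply: (measurableT_comp measurable_cos); exact: measurable_dotv.
  by move=> y; rewrite mul0r addr0 cos_max.
move=> s s0; rewrite mulrA -(sqrt_pi_div s0).
have := @gauss_fourier _ s s0 n x 0; rewrite cos0 mul1r => <-.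
by apply: eq_Rintegral => y _; rewrite add0r.
Qed.

Let sqn_gt0 b : b != 0 -> 0 < sqn b.
Proof.
by move=> b0; rewrite lt_neqAle sqn_ge0 andbT eq_sym; apply: contra_neq b0; exact: sqn_eq0.
Qed.

Lemma sin_mul_le (r z : R) : 0 < r -> z * sin (r * z) <= r * z ^+ 2.
Proof.
move=> r0; have := norm_sin_le (r * z); rewrite normrM (gtr0_norm r0) => H.
apply: (le_trans (ler_norm _)); rewrite normrM.
apply: (le_trans (ler_wpM2l (normr_ge0 z) H)).
by rewrite mulrCA -expr2 real_normK// num_real.
Qed.

(** The comparison weight for the gradient is a multiple of (b.y)^2. Its Gaussian integral is
    bounded from below, not computed: z sin (r z) <= r z^2, and the integral of the left side is
    known exactly. *)
Let fk_weight b : b != 0 -> exists g : 'rV[R]_n -> R,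
  [/\ stable_admissible mu sqn be g, forall x, 0 <= g x & forall s, 0 < s ->
  s `^ (- (n.+2%:R / 2)) <= \int[mu]_x (g x * expR (- (s * sqn x)))].
Proof.
move=> b0; have sb := sqn_gt0 b0.
pose k : R := 4 / (sqn b * Num.sqrt pi ^+ n).
have k0 : 0 < k by rewrite divr_gt0// mulr_gt0.
exists (fun y => k * dotv b y ^+ 2); split.
- apply: (@stable_admissible_quad _ 0 (k * sqn b)).
    by apply: measurable_funM => //; apply: measurable_funX; exact: measurable_dotv.
  move=> x; rewrite ger0_norm; last by rewrite mulr_ge0 ?sqr_ge0// ltW.
  by rewrite add0r -mulrA ler_pM2l// dotv_cauchy.
- by move=> x; rewrite mulr_ge0 ?sqr_ge0// ltW.
(* The frequency r b is chosen so that |r b|^2 / (4 s) = 1 / 4: the Gaussian factor is then a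
   constant, at least 1 / 2. *)
move=> s s0; pose r := Num.sqrt (s / sqn b).
have sr0 : 0 < s / sqn b by rewrite divr_gt0.
have r0 : 0 < r by rewrite sqrtr_gt0.
have r2 : r ^+ 2 = s / sqn b by rewrite sqr_sqrtr// ltW.
have L1g : L1 mu (fun y => dotv b y ^+ 2 * expR (- (s * sqn y))).
  have := @L1_wt_quad _ _ _ half1 (fun y => dotv b y ^+ 2) 0 (sqn b) s.
  rewrite wt_gauss; apply => //; first by apply: measurable_funX; exact: measurable_dotv.
  by move=> x; rewrite ger0_norm ?sqr_ge0//; exact: dotv_sqr_le.
have L1h : L1 mu (fun y => dotv b y * sin (dotv (r *: b) y) * expR (- (s * sqn y))).
  by have := L1_fk half1 b (r *: b) s0; rewrite wt_gauss.
have : \int[mu]_y (dotv b y * sin (dotv (r *: b) y) * expR (- (s * sqn y))) <=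
    r * \int[mu]_y (dotv b y ^+ 2 * expR (- (s * sqn y))).
  rewrite -RintZ//; apply: ler_Rint => //; first exact: L1Z.
  by move=> y; rewrite mulrA ler_wpM2r ?expR_ge0// dotvZl sin_mul_le.
rewrite gauss_fourier_dotv// dotvZr dotvv sqnZ r2 divfK ?gt_eqF// sqrt_pi_div//.
rewrite -!mulrA ler_pM2l// => H.
under eq_Rintegral do rewrite -mulrA.
rewrite RintZ//.
have e4 : 2^-1 <= expR (- (s / (4 * s))) :> R.
  rewrite (_ : s / (4 * s) = 4^-1); last by field; rewrite gt_eqF.
  by have := expR_ge1Dx (- 4^-1 : R); lra.
have -> : s `^ (- (n.+2%:R / 2)) = s `^ (- (n%:R / 2)) * s^-1.
  rewrite -(powR_inv1 (ltW s0)) -powRD; last by rewrite (gt_eqF s0) implybT.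
  by congr (_ `^ _); rewrite -natr1 -natr1; lra.
apply: le_trans (ler_wpM2l (ltW k0) H).
set e := expR _ in e4 *.
have -> : k * (sqn b * ((2 * s)^-1 * (Num.sqrt pi ^+ n * (s `^ (- (n%:R / 2)) * e)))) =
    s `^ (- (n%:R / 2)) * s^-1 * (2 * e).
  by rewrite /k; field; rewrite !gt_eqF.
by rewrite ler_peMr ?mulr_ge0 ?powR_ge0 ?invr_ge0 ?(ltW s0)//; lra.
Qed.

Lemma fk_bounds b : b != 0 -> exists c C : R, [/\ 0 < c, 0 < C & forall x,
  c * (`|dotv b x| * (1 + sqn x) `^ (- (n%:R / 2 + 1 + be))) <= `|fk be b 1 x| <=
  C * (`|dotv b x| * (1 + sqn x) `^ (- (n%:R / 2 + 1 + be)))].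
Proof.
move=> b0; have [g [ag g0 gE]] := fk_weight b0.
have [c [C [c0 C0 H]]] := stable_two_sided (@measurable_sqn R n) (@sqn_ge0 R n) be0 be1
  (m := n.+2) ag g0 gE.
pose q : R := @cpi R n * (Num.sqrt pi ^+ n / 2).
have q0 : 0 < q by rewrite mulr_gt0 ?cpi_gt0// divr_gt0.
exists (q * c), (q * C); split; [exact: mulr_gt0|exact: mulr_gt0|move=> x].
(* The amplitude A of the transform is a multiple of b.x and has to be nonnegative; the kernel is
   odd, which settles the other sign. *)
wlog bx : x / 0 <= dotv b x.
  move=> W; have [|bx] := leP 0 (dotv b x); first exact: W.
  have := W (- x); rewrite dotvNr normrN sqnN fkN// normrN; apply.
  by rewrite oppr_ge0 ltW.
have nE : n.+2%:R / 2 = n%:R / 2 + 1 :> R by rewrite -natr1 -natr1; lra.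
have gt : gaussian_transform mu sqn be n.+2 (fun y => dotv b y * sin (dotv x y))
    (dotv b x * (Num.sqrt pi ^+ n / 2)) (sqn x).
  split; rewrite ?sqn_ge0 ?mulr_ge0 ?(ltW spi0)//.
    apply: (@stable_admissible_quad _ 1 (sqn b)).
      apply: measurable_funM; first exact: measurable_dotv.
      by apply: (measurableT_comp measurable_sin); exact: measurable_dotv.
    move=> y; apply: le_trans (dotv_sqn_le b y).
    by rewrite normrM ler_piMr// sin_max.
  move=> s s0; rewrite gauss_fourier_dotv// sqrt_pi_div// nE opprD powRD.
    by rewrite (powR_inv1 (ltW s0)); field; rewrite gt_eqF.
  by rewrite (gt_eqF s0) implybT.
have {H} := H _ _ _ gt.
have -> : \int[mu]_x0 (dotv b x0 * sin (dotv x x0) * expR (- sqn x0 `^ be)) = (@cpi R n)^-1 * fk be b 1 x.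
  rewrite /fk mulrA mulVf; last by rewrite gt_eqF// cpi_gt0.
  rewrite mul1r.
  by apply: eq_Rintegral => y _; rewrite wt1.
rewrite -nE; set P := _ `^ _; set K := fk _ _ _ _ => /andP[H1 H2].
have cp := @cpi_gt0 R n.
have K0 : 0 <= K.
  have : 0 <= (@cpi R n)^-1 * K by apply: le_trans H1; rewrite !mulr_ge0 ?powR_ge0 ?(ltW c0)// ltW.
  have ci : 0 < (@cpi R n)^-1 by rewrite invr_gt0.
  by rewrite (pmulr_rge0 _ ci).
rewrite (ger0_norm K0) (ger0_norm bx); move: H1 H2.
rewrite (ler_pdivlMl _ _ cp) (ler_pdivrMl _ _ cp) => H1 H2.
apply/andP; split.
  by apply: le_trans H1; rewrite /q le_eqVlt; apply/orP; left; apply/eqP; ring.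
by apply: (le_trans H2); rewrite /q le_eqVlt; apply/orP; left; apply/eqP; ring.
Qed.

End kernel_bounds.

Lemma L1_fatou d (T : measurableType d) (R : realType) (mu : {measure set T -> \bar R})
    (F : nat -> T -> R) (f : T -> R) (B : R) :
  (forall k, L1 mu (F k)) -> (forall k x, 0 <= F k x) ->
  (forall x, F k x @[k --> \oo] --> f x) -> (forall k, \int[mu]_x F k x <= B) ->
  L1 mu f /\ \int[mu]_x f x <= B.
Proof.
move=> lF F0 Ff FB.
have mF k := L1_measurable (lF k).
have mf : measurable_fun setT f by apply: (measurable_fun_cvg mF) => x _; exact: Ff.
have f0 x : 0 <= f x.
  exact: (cvgn_ge0 (Ff x) (fun k => F0 k x)).
have lE x : limn_einf (fun k => (F k x)%:E) = (f x)%:E.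
  have /cvg_limn_einf_sup[-> _] // : (fun k => (F k x)%:E) @ \oo --> (f x)%:E.
  by apply: cvg_EFin; [exact: nearW|exact: Ff].
have fB : (\int[mu]_x (f x)%:E <= B%:E)%E.
  have := @fatou _ _ _ mu setT measurableT (fun k x => (F k x)%:E)
    (fun k => (measurable_EFinP _ _).2 (mF k)) (fun k x _ => F0 k x).
  under [X in (X <= _)%E -> _]eq_integral do rewrite lE.
  move=> /le_trans; apply.
  rewrite limn_einf_lim; apply: lime_le; first exact: is_cvg_einfs.
  apply: nearW => k; apply: (@le_trans _ _ (\int[mu]_x (F k x)%:E)%E).
    by rewrite /einfs; apply: ereal_inf_lbound; exists k => /=.
  by rewrite -EFin_Rint// lee_fin.
have lf : L1 mu f.
  by apply: ge0_L1 => //; apply: (le_lt_trans fB); rewrite ltry.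
by split=> //; rewrite -lee_fin EFin_Rint.
Qed.

(** * Fourier inversion for the stable kernel *)

Section inversion.
Context {R : realType} {n : nat}.
Variable be : R.
Hypotheses (be_half : 2^-1 < be) (be1 : be < 1).
Implicit Types (x y z v b : 'rV[R]_n) (t s r e a : R).
Local Notation mu := (lebesgue_rV n).
Local Notation nu := ((2 * be)^-1).

Let be0 : 0 < be. Proof. by apply: lt_trans be_half; rewrite invr_gt0. Qed.

Lemma fp_gt0 t x : 0 < t -> 0 < fp be t x.
Proof.
move=> t0; rewrite (fp_scale be_half)//.
have [c [C [c0 C0 H]]] := @fp_bounds R n _ be_half be1.
rewrite mulr_gt0 ?powR_gt0//.
have /andP[+ _] := H (t `^ (- nu) *: x); apply: lt_le_trans.
by rewrite mulr_gt0// powR_gt0// ltr_pwDl// sqn_ge0.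
Qed.

Let gW e y : R := expR (- (e * sqn y)).

Let gE e y : R := expR (- (sqn y / (4 * e))).

Let gauss_cos2 e a x z : 0 < e ->
  \int[mu]_y (cos (a + dotv y x) * gW e y * cos (dotv y z)) =
  cos a * Num.sqrt (pi / e) ^+ n * ((gE e (x + z) + gE e (x - z)) / 2).
Proof.
move=> e0; have lG := @L1_gauss R e e0 n.
have lC w : L1 mu (fun y => cos (a + dotv w y) * gW e y).
  by apply: L1_cosM => //; apply: measurable_funD => //; exact: measurable_dotv.
have E y : cos (a + dotv y x) * gW e y * cos (dotv y z) =
    2^-1 * (cos (a + dotv (x + z) y) * gW e y + cos (a + dotv (x - z) y) * gW e y).
  rewrite (dotvC y x) (dotvC y z) dotvDl dotvBl !addrA; move: (a + dotv x y) => A.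
  by rewrite cosD cosB; field.
under eq_Rintegral do rewrite E.
rewrite RintZ; last by apply: L1D; exact: lC.
rewrite RintD; [|exact: lC|exact: lC].
by rewrite !gauss_fourier// /gE; ring.
Qed.

Let wtN t y : wt be t (- y) = wt be t y.
Proof. by rewrite /wt sqnN. Qed.

Lemma L1_wtM t (f : 'rV[R]_n -> R) (c : R) : 0 < t -> measurable_fun setT f ->
  (forall y, `|f y| <= c) -> L1 mu (fun y => f y * wt be t y).
Proof. by move=> t0 mf fc; apply: (L1_bddM mf fc); exact: L1_wt. Qed.

Let sum_window t e x : 0 < t -> 0 < e ->
  \int[mu]_z (wt be t z * ((gE e (x + z) + gE e (x - z)) / 2)) =
  (2 * Num.sqrt e) ^+ n *
    \int[mu]_w (wt be t (x + (2 * Num.sqrt e) *: w) * expR (- (1 * sqn w))).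
Proof.
move=> t0 e0; pose c : R := 2 * Num.sqrt e.
have c0 : 0 < c by rewrite mulr_gt0// sqrtr_gt0.
pose f z := wt be t z * gE e (x - z).
have gE1 y : `|gE e y| <= 1.
  rewrite ger0_norm ?expR_ge0// -expR0 ler_expR oppr_le0 divr_ge0 ?sqn_ge0//.
  by rewrite mulr_ge0// ltW.
have mgE : measurable_fun setT (gE e).
  apply: measurableT_comp => //; apply: measurableT_comp => //.
  by apply: measurable_funM => //; exact: measurable_sqn.
have lf : L1 mu f.
  rewrite /f; under eq_fun do rewrite mulrC.
  apply: (@L1_wtM t _ 1) => //; apply: (measurableT_comp mgE).
  by apply: measurable_fun_subv => //; exact: measurable_cst.
have E z : wt be t z * ((gE e (x + z) + gE e (x - z)) / 2) = 2^-1 * (f z + f (0 + (- 1) *: z)).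
  by rewrite /f add0r scaleN1r wtN opprK; field.
under eq_Rintegral do rewrite E.
have lf' : L1 mu (fun z => f (0 + (- 1) *: z)).
  by apply: L1_affine => //; rewrite oppr_eq0 oner_neq0.
rewrite RintZ; last exact: L1D.
rewrite RintD// Rint_affine ?oppr_eq0 ?oner_neq0// normrN normr1 expr1n invr1 mul1r.
have := @Rint_affine _ _ f c x (lt0r_neq0 c0) lf.
rewrite (ger0_norm (ltW c0)) => H.
have -> : \int[mu]_w (wt be t (x + c *: w) * expR (- (1 * sqn w))) =
    \int[mu]_w f (x + c *: w).
  apply: eq_Rintegral => w _; rewrite /f opprD addNKr /gE sqnN sqnZ; congr (_ * expR (- _)).
  by rewrite /c exprMn sqr_sqrtr ?(ltW e0)//; field; rewrite gt_eqF.
rewrite H mulVKf; first by field.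
by rewrite expf_neq0// gt_eqF.
Qed.

(** Regularized inversion: the factor e^(-e |y|^2) makes the double integral absolutely convergent,
    and Fubini turns it into a Gaussian average of [wt] around x at scale 2 sqrt e. *)
Lemma fp_gauss_window t e a x : 0 < t -> 0 < e ->
  \int[mu]_y (cos (a + dotv y x) * expR (- (e * sqn y)) * fp be t y) =
  cos a * (Num.sqrt pi ^- n *
    \int[mu]_w (wt be t (x + (2 * Num.sqrt e) *: w) * expR (- (1 * sqn w)))).
Proof.
move=> t0 e0; have lG := @L1_gauss R e e0 n; have lw := L1_wt n be_half t0.
pose F (p : 'rV[R]_n * 'rV[R]_n) : R :=
  cos (a + dotv p.1 x) * gW e p.1 * cos (dotv p.1 p.2) * wt be t p.2.
have mcos1 : measurable_fun setT (fun p : 'rV[R]_n * 'rV[R]_n => cos (a + dotv p.1 x)).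
  apply: (measurableT_comp measurable_cos); apply: measurable_funD => //.
  by apply: measurable_fun_dotv; [exact: measurable_fst|exact: measurable_cst].
have lF : L1 (mu \x mu)%E F.
  apply: (@L1_le _ _ _ _ _ _ _ _ (L1_prodM lG lw)).
    apply: measurable_funM; last first.
      by apply: (measurableT_comp (measurable_wt _ _)); exact: measurable_snd.
    apply: measurable_funM.
      apply: measurable_funM => //.
      exact: (measurableT_comp (L1_measurable lG) measurable_fst).
    apply: (measurableT_comp measurable_cos).
    by apply: measurable_fun_dotv; [exact: measurable_fst|exact: measurable_snd].
  move=> p; rewrite /F normrM (ger0_norm (wt_ge0 _ _ _)) ler_wpM2r ?wt_ge0//.
  rewrite normrM -[leRHS]mulr1 ler_pM ?cos_max// normrM (ger0_norm (expR_ge0 _)).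
  by rewrite ler_piMl ?expR_ge0// cos_max.
have -> : \int[mu]_y (cos (a + dotv y x) * expR (- (e * sqn y)) * fp be t y) =
    @cpi R n * \int[mu]_y \int[mu]_z F (y, z).
  rewrite -RintZ; last exact: (L1_Rint1 lF).
  apply: eq_Rintegral => y _; rewrite /fp mulrCA; congr (_ * _).
  rewrite -RintZ; last exact: L1_fp0.
  by apply: eq_Rintegral => z _; rewrite /F/= !mulrA.
rewrite (Rint_fubini lF) /F/=.
have E z : \int[mu]_y (cos (a + dotv y x) * gW e y * cos (dotv y z) * wt be t z) =
    cos a * Num.sqrt (pi / e) ^+ n * (wt be t z * ((gE e (x + z) + gE e (x - z)) / 2)).
  rewrite RintZr; first by rewrite gauss_cos2//; ring.
  have mc : measurable_fun setT (fun y => cos (a + dotv y x) * cos (dotv y z)).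
    apply: measurable_funM; apply: (measurableT_comp measurable_cos).
      apply: measurable_funD => //.
      by apply: measurable_fun_dotv => //; exact: measurable_cst.
    by apply: measurable_fun_dotv => //; exact: measurable_cst.
  under eq_fun do rewrite mulrAC.
  apply: (L1_bddM (c := 1) mc) => // y.
  by rewrite normrM mulr_ile1// cos_max.
under eq_Rintegral do rewrite E.
pose J := \int[mu]_z (wt be t z * ((gE e (x + z) + gE e (x - z)) / 2)).
rewrite RintZ; last first.
  have mgE (c : R) : measurable_fun setT (fun w : 'rV[R]_n => gE e (x + c *: w)).
    have mgE0 : measurable_fun setT (gE e).
      apply: measurableT_comp => //; apply: measurableT_comp => //.
      by apply: measurable_funM => //; exact: measurable_sqn.
    exact: (measurableT_comp mgE0 (measurable_affine c x)).
  have gE1 y : 0 <= gE e y <= 1.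
    rewrite expR_ge0/= -expR0 ler_expR oppr_le0 divr_ge0 ?sqn_ge0//.
    by rewrite mulr_ge0// ltW.
  under eq_fun do rewrite mulrC; apply: (@L1_wtM _ _ 1) => //.
    apply: measurable_funM => //; apply: measurable_funD.
      by have := mgE 1; congr measurable_fun; apply/funext => w; rewrite scale1r.
    by have := mgE (-1); congr measurable_fun; apply/funext => w; rewrite scaleN1r.
  move=> z; have /andP[A1 A2] := gE1 (x + z); have /andP[B1 B2] := gE1 (x - z).
  by rewrite ger0_norm; lra.
rewrite sum_window//; set W := \int[mu]_w _.
rewrite -mulrA [LHS]mulrCA; congr (cos a * _); rewrite !mulrA; congr (_ * W).
rewrite /cpi -!exprVn -!exprMn; congr (_ ^+ n).
rewrite sqrtrM ?pi_ge0// sqrtrV ?(ltW e0)//.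
have p0 : Num.sqrt pi != 0 :> R by rewrite gt_eqF// sqrtr_gt0 pi_gt0.
have q0 : Num.sqrt e != 0 by rewrite gt_eqF// sqrtr_gt0.
rewrite -[X in (2 * X)^-1](sqr_sqrtr (pi_ge0 R)).
by field; rewrite p0 q0.
Qed.

Let ek (k : nat) : R := k.+1%:R^-1.
Let ek0 k : 0 < ek k. Proof. by rewrite invr_gt0. Qed.

Let gauss_mass1 : \int[mu]_w expR (- (1 * sqn w)) = Num.sqrt pi ^+ n :> R.
Proof.
have := @gauss_fourier R 1 ltr01 n 0 0.
rewrite cos0 mul1r sqn0 mul0r oppr0 expR0 mulr1 divr1 => <-.
by apply: eq_Rintegral => y _; rewrite dotv0l addr0 cos0 !mul1r.
Qed.

Let window_cvg t x : 0 < t ->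
  (fun k : nat => Num.sqrt pi ^- n *
    \int[mu]_w (wt be t (x + (2 * Num.sqrt (ek k)) *: w) * expR (- (1 * sqn w))))
  @ \oo --> wt be t x.
Proof.
move=> t0; have lG := L1_gauss (ltr01 : 0 < (1 : R)) n.
have -> : wt be t x = Num.sqrt pi ^- n * \int[mu]_w (wt be t x * expR (- (1 * sqn w))).
  rewrite RintZ// mulrCA gauss_mass1.
  by rewrite mulVf ?mulr1// expf_neq0// gt_eqF// sqrtr_gt0 pi_gt0.
apply: cvgM; first exact: cvg_cst.
apply: (Rint_cvg (g := fun w => expR (- (1 * sqn w)))) => //.
- move=> k; apply: measurable_funM; last exact: measurable_gauss.
  by apply: (measurableT_comp (measurable_wt _ _)); exact: measurable_affine.
- by apply: measurable_funM => //; exact: measurable_gauss.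
- move=> w; apply: cvgM; last exact: cvg_cst.
  rewrite /wt; apply: cvgn_continuous; first exact: continuous_expR.
  apply: cvgN; apply: cvgM; first exact: cvg_cst.
  apply: cvg_powR => //; first by move=> k; exact: sqn_ge0.
  have H : (fun k => 2 * Num.sqrt (ek k)) @ \oo --> (0 : R).
    rewrite -[X in _ --> X](mulr0 2); apply: cvgM; first exact: cvg_cst.
    rewrite -[X in _ --> X](@sqrtr0 R); apply: cvgn_continuous.
      exact: sqrt_continuous.
    exact: cvg_harmonic.
  pose c k := 2 * Num.sqrt (ek k).
  have C : (fun k => sqn x + 2 * (c k * dotv x w) + c k * c k * sqn w) @ \oo -->
      sqn x + 2 * (0 * dotv x w) + 0 * 0 * sqn w.
    apply: cvgD; first (apply: cvgD; first exact: cvg_cst).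
      by apply: cvgM; [exact: cvg_cst|apply: cvgM => //; exact: cvg_cst].
    by apply: cvgM; [exact: cvgM|exact: cvg_cst].
  move: C; rewrite !(mul0r, mulr0, addr0) => C.
  by under eq_fun do rewrite sqnD dotvZr sqnZ expr2.
- move=> k w; rewrite normrM (ger0_norm (wt_ge0 _ _ _)) (ger0_norm (expR_ge0 _)).
  by rewrite ler_piMl ?expR_ge0// wt_le1// ltW.
Qed.

Let gauss_cvg1 y : (fun k => expR (- (ek k * sqn y))) @ \oo --> (1 : R).
Proof.
rewrite -[X in _ --> X]expR0 -[X in _ --> expR X]oppr0 -[X in _ --> expR (- X)](mul0r (sqn y)).
have H : (fun k => - (ek k * sqn y)) @ \oo --> - (0 * sqn y).
  by apply: cvgN; apply: cvgM; [exact: cvg_harmonic|exact: cvg_cst].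
by apply: cvgn_continuous; first exact: continuous_expR.
Qed.

Lemma fp_le t x : 0 < t -> fp be t x <= fp be t (0 : 'rV[R]_n).
Proof.
move=> t0; rewrite /fp ler_pM2l ?cpi_gt0//; apply: ler_Rint.
- exact: L1_fp0.
- exact: L1_fp0.
- by move=> y; rewrite dotv0l cos0 ler_wpM2r ?wt_ge0// cos_le1.
Qed.

(** At frequency 0 the regularized inversion bounds the damped mass by 1; since the kernel is
    positive, Fatou removes the damping. *)
Lemma L1_fp_space t : 0 < t -> L1 mu (fp be t).
Proof.
move=> t0; have lG k := @L1_gauss R _ (ek0 k) n.
have mp := @measurable_fp R n be be_half t t0.
apply: (L1_fatou (B := 1) (F := fun k y => expR (- (ek k * sqn y)) * fp be t y) _ _ _ _).1.
- move=> k; under eq_fun do rewrite mulrC.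
  apply: (L1_bddM (c := fp be t (0 : 'rV[R]_n)) mp) => // y.
  by rewrite ger0_norm ?fp_le// ltW// fp_gt0.
- by move=> k y; rewrite mulr_ge0 ?expR_ge0// ltW// fp_gt0.
- move=> y; rewrite -[X in _ --> X]mul1r; apply: cvgM; last exact: cvg_cst.
  exact: gauss_cvg1.
- move=> k; have := fp_gauss_window 0 0 t0 (ek0 k).
  under eq_Rintegral => y _ do rewrite dotvC dotv0l addr0 cos0 mul1r.
  move=> ->; rewrite cos0 mul1r.
  have lG1 := L1_gauss (ltr01 : 0 < (1 : R)) n.
  have p0 : 0 < Num.sqrt pi ^+ n :> R by rewrite exprn_gt0// sqrtr_gt0 pi_gt0.
  rewrite ler_pdivrMl// mulr1.
  rewrite -gauss_mass1.
  apply: ler_Rint => //.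
    apply: (L1_bddM (c := 1)) => //.
      by apply: (measurableT_comp (measurable_wt _ _)); exact: measurable_affine.
    by move=> w; rewrite ger0_norm ?wt_ge0// wt_le1// ltW.
  by move=> w; rewrite ler_piMl ?expR_ge0// wt_le1// ltW.
Qed.

(** Once the kernel is integrable, it dominates the regularized integrand and the damping can be
    sent to 0. The phase [a] makes the sine transform a special case. *)
Theorem fp_fourier t a x : 0 < t ->
  \int[mu]_y (cos (a + dotv y x) * fp be t y) = cos a * wt be t x.
Proof.
move=> t0; have lp := L1_fp_space t0; have mp := L1_measurable lp.
have mc : measurable_fun setT (fun y => cos (a + dotv y x)).
  apply: (measurableT_comp measurable_cos); apply: measurable_funD => //.
  by apply: measurable_fun_dotv => //; exact: measurable_cst.
have H1 : (fun k => \int[mu]_y (cos (a + dotv y x) * expR (- (ek k * sqn y)) * fp be t y))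
    @ \oo --> \int[mu]_y (cos (a + dotv y x) * fp be t y).
  apply: (Rint_cvg (g := fp be t)) => //.
  - move=> k; apply: measurable_funM => //; apply: measurable_funM => //.
    exact: measurable_gauss.
  - exact: measurable_funM.
  - move=> y; apply: cvgM; last exact: cvg_cst.
    rewrite -[X in _ --> X]mulr1; apply: cvgM; first exact: cvg_cst.
    exact: gauss_cvg1.
  - move=> k y; rewrite normrM (gtr0_norm (fp_gt0 _ t0)) ler_piMl ?(ltW (fp_gt0 _ t0))//.
    rewrite normrM mulr_ile1 ?cos_max// ger0_norm ?expR_ge0//.
    by rewrite -expR0 ler_expR oppr_le0 mulr_ge0 ?sqn_ge0// ltW.
have H2 : (fun k => \int[mu]_y (cos (a + dotv y x) * expR (- (ek k * sqn y)) * fp be t y))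
    @ \oo --> cos a * wt be t x.
  under eq_fun do rewrite fp_gauss_window//.
  by apply: cvgM; [exact: cvg_cst|exact: window_cvg].
exact: (cvg_unique _ H1 H2).
Qed.

Lemma Rint_fp t : 0 < t -> \int[mu]_y fp be t y = 1.
Proof.
move=> t0; have := fp_fourier 0 0 t0.
rewrite cos0 mul1r /wt sqn0 powR0 ?gt_eqF// mulr0 oppr0 expR0 => <-.
by apply: eq_Rintegral => y _; rewrite dotvC dotv0l addr0 cos0 mul1r.
Qed.

End inversion.

(** * Semigroup law, Harnack inequality and gradient bound *)

Section stable_density.
Context {R : realType} {n : nat}.
Variable be : R.
Hypotheses (be_half : 2^-1 < be) (be1 : be < 1).
Variable b : 'rV[R]_n.
Implicit Types (x y z v : 'rV[R]_n) (t s r e a : R).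
Local Notation mu := (lebesgue_rV n).
Local Notation nu := ((2 * be)^-1).

Let be0 : 0 < be. Proof. by apply: lt_trans be_half; rewrite invr_gt0. Qed.

(** Extension by 0 to t <= 0 gives functions that are jointly measurable on all of R x R^n, so that
    the constraint s < t of the Duhamel formula is carried by the kernel. *)
Definition pk t x : R := if 0 < t then fp be t x else 0.

Definition kk t x : R := if 0 < t then fk be b t x else 0.

Lemma pkE t x : 0 < t -> pk t x = fp be t x.
Proof. by rewrite /pk => ->. Qed.

Lemma kkE t x : 0 < t -> kk t x = fk be b t x.
Proof. by rewrite /kk => ->. Qed.

Lemma pk_gt0 t x : 0 < t -> 0 < pk t x.
Proof. by move=> t0; rewrite pkE//; exact: fp_gt0. Qed.

Lemma pk_ge0 t x : 0 <= pk t x.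
Proof. by rewrite /pk; case: ifPn => // t0; rewrite ltW// fp_gt0. Qed.

Lemma pk0 t x : t <= 0 -> pk t x = 0.
Proof. by rewrite /pk ltNge => ->. Qed.

Lemma kk0 t x : t <= 0 -> kk t x = 0.
Proof. by rewrite /kk ltNge => ->. Qed.

Lemma measurable_pk : measurable_fun setT (fun q : R * 'rV[R]_n => pk q.1 q.2).
Proof.
have -> : (fun q : R * 'rV[R]_n => pk q.1 q.2) =
    (fun q => if 0 < q.1 then q.1 `^ (- (n%:R * nu)) * fp be 1 (q.1 `^ (- nu) *: q.2) else 0).
  by apply/funext => q; rewrite /pk; case: ifPn => // q0; rewrite (fp_scale be_half).
apply: measurable_fun_ifT => //.
  by apply: measurable_fun_ltr => //; exact: measurable_fst.
apply: measurable_funM.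
  by apply: (measurableT_comp (measurable_powR _)); exact: measurable_fst.
apply: (measurableT_comp (measurable_fp be_half ltr01)).
apply: measurable_fun_scalev; last exact: measurable_snd.
by apply: (measurableT_comp (measurable_powR _)); exact: measurable_fst.
Qed.

Lemma measurable_kk : measurable_fun setT (fun q : R * 'rV[R]_n => kk q.1 q.2).
Proof.
have -> : (fun q : R * 'rV[R]_n => kk q.1 q.2) =
    (fun q => if 0 < q.1 then q.1 `^ (- (n.+1%:R * nu)) * fk be b 1 (q.1 `^ (- nu) *: q.2) else 0).
  by apply/funext => q; rewrite /kk; case: ifPn => // q0; rewrite (fk_scale be_half).
apply: measurable_fun_ifT => //.
  by apply: measurable_fun_ltr => //; exact: measurable_fst.
apply: measurable_funM.
  by apply: (measurableT_comp (measurable_powR _)); exact: measurable_fst.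
apply: (measurableT_comp (measurable_fk be_half b ltr01)).
apply: measurable_fun_scalev; last exact: measurable_snd.
by apply: (measurableT_comp (measurable_powR _)); exact: measurable_fst.
Qed.

Lemma measurable_pkT d (T : measurableType d) (f : T -> R) (g : T -> 'rV[R]_n) :
  measurable_fun setT f -> measurable_fun setT g ->
  measurable_fun setT (fun w => pk (f w) (g w)).
Proof.
move=> mf mg.
exact: (measurableT_comp measurable_pk (measurable_fun_pair mf mg)).
Qed.

Lemma measurable_kkT d (T : measurableType d) (f : T -> R) (g : T -> 'rV[R]_n) :
  measurable_fun setT f -> measurable_fun setT g ->
  measurable_fun setT (fun w => kk (f w) (g w)).
Proof.
move=> mf mg.
exact: (measurableT_comp measurable_kk (measurable_fun_pair mf mg)).
Qed.

Lemma L1_pk t : L1 mu (pk t).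
Proof.
have [t0|t0] := leP t 0.
  by rewrite (_ : pk t = fun=> 0); [exact: L1_0|apply/funext => x; exact: pk0].
have := @L1_fp_space R n be be_half be1 t t0.
by congr L1; apply/funext => x; rewrite pkE.
Qed.

Lemma Rint_pk t : 0 < t -> \int[mu]_x pk t x = 1.
Proof. by move=> t0; rewrite -(@Rint_fp R n be be_half be1 t t0); apply: eq_Rintegral => x _; rewrite pkE. Qed.

Lemma pk_scale t x : 0 < t ->
  pk t x = t `^ (- (n%:R * nu)) * pk 1 (t `^ (- nu) *: x).
Proof. by move=> t0; rewrite !pkE// -(fp_scale be_half). Qed.

Lemma kk_scale t x : 0 < t ->
  kk t x = t `^ (- (n.+1%:R * nu)) * kk 1 (t `^ (- nu) *: x).
Proof. by move=> t0; rewrite !kkE// -(fk_scale be_half). Qed.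

Lemma pk_le0 t x : pk t x <= pk 1 0 * t `^ (- (n%:R * nu)).
Proof.
have [t0|t0] := leP t 0; first by rewrite pk0// mulr_ge0 ?powR_ge0 ?pk_ge0.
rewrite pk_scale// mulrC ler_wpM2r ?powR_ge0// !pkE//.
exact: fp_le.
Qed.

Lemma L1_shift (f : 'rV[R]_n -> R) x : L1 mu f -> L1 mu (fun y => f (x - y)).
Proof.
move=> lf; have := @L1_affine _ _ f (- 1) x _ lf; rewrite oppr_eq0 oner_neq0.
by move=> /(_ isT); congr L1; apply/funext => y; rewrite scaleN1r.
Qed.

Lemma Rint_shift (f : 'rV[R]_n -> R) x : L1 mu f ->
  \int[mu]_y f (x - y) = \int[mu]_y f y.
Proof.
move=> lf; have := @Rint_affine _ _ f (- 1) x _ lf; rewrite oppr_eq0 oner_neq0.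
move=> /(_ isT); rewrite normrN normr1 expr1n invr1 mul1r => <-.
by apply: eq_Rintegral => y _; rewrite scaleN1r.
Qed.

Lemma L1_transl (f : 'rV[R]_n -> R) x : L1 mu f -> L1 mu (fun y => f (y + x)).
Proof.
move=> lf; have := @L1_affine _ _ f 1 x (oner_neq0 _) lf.
by congr L1; apply/funext => y; rewrite scale1r addrC.
Qed.

Lemma Rint_transl (f : 'rV[R]_n -> R) x : L1 mu f ->
  \int[mu]_y f (y + x) = \int[mu]_y f y.
Proof.
move=> lf; have := @Rint_affine _ _ f 1 x (oner_neq0 _) lf.
rewrite normr1 expr1n invr1 mul1r => <-.
by apply: eq_Rintegral => y _; rewrite scale1r addrC.
Qed.

(** The first kernel is written as a Fourier integral and Fubini is applied; the transform of the
    second kernel supplies the missing multiplier e^(-s |z|^alpha). *)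
Lemma pk_semigroup t s x : 0 < t -> 0 < s ->
  \int[mu]_y (pk t (x - y) * pk s y) = pk (t + s) x.
Proof.
move=> t0 s0; have lw := L1_wt n be_half t0; have lp := @L1_fp_space R n be be_half be1 s s0.
have mp := L1_measurable lp.
pose F (q : 'rV[R]_n * 'rV[R]_n) : R := cos (dotv (x - q.1) q.2) * (fp be s q.1 * wt be t q.2).
have lF : L1 (mu \x mu)%E F.
  apply: (L1_bddM (c := 1)) (L1_prodM lp lw); last by move=> q; exact: cos_max.
  apply: (measurableT_comp measurable_cos); apply: measurable_fun_dotv; last exact: measurable_snd.
  by apply: measurable_fun_subv => //; exact: measurable_cst.
transitivity (@cpi R n * \int[mu]_y \int[mu]_z F (y, z)).
  rewrite -RintZ; last exact: (L1_Rint1 lF).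
  apply: eq_Rintegral => y _; rewrite (pkE _ t0) (pkE _ s0) [X in X * _]/fp -mulrA; congr (_ * _).
  rewrite -RintZr; last exact: L1_fp0.
  by apply: eq_Rintegral => z _; rewrite /F/=; ring.
rewrite (Rint_fubini lF) pkE ?addr_gt0// /fp; congr (_ * _).
apply: eq_Rintegral => z _; rewrite /F/=.
under eq_Rintegral => y _.
  rewrite dotvBl -dotvNr mulrA.
  over.
rewrite RintZr; first by rewrite fp_fourier// -mulrA [wt _ _ _ * _]mulrC /wt sqnN -/(wt be t z) -/(wt be s z) wtD.
apply: (L1_bddM (c := 1)) lp => [|y]; last exact: cos_max.
apply: (measurableT_comp measurable_cos); apply: measurable_funD => //.
by apply: measurable_fun_dotv => //; exact: measurable_cst.
Qed.

Let cos_sub_pihalf a : cos (a - pi / 2) = sin a.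
Proof. by rewrite cosB cos_pihalf sin_pihalf mulr0 add0r mulr1. Qed.

Lemma fp_fourier_sin t a x : 0 < t ->
  \int[mu]_y (sin (a + dotv y x) * fp be t y) = sin a * wt be t x.
Proof.
move=> t0; rewrite -[in RHS]cos_sub_pihalf -(fp_fourier be_half be1 _ _ t0).
by apply: eq_Rintegral => y _; rewrite addrAC cos_sub_pihalf.
Qed.

Lemma kk_semigroup t s x : 0 < t -> 0 < s ->
  \int[mu]_y (kk t (x - y) * pk s y) = kk (t + s) x.
Proof.
move=> t0 s0; have lp := @L1_fp_space R n be be_half be1 s s0.
have mp := L1_measurable lp.
have lw : L1 mu (fun z => dotv b z * wt be t z).
  apply: (@L1_wt_quad _ _ _ be_half _ 1 (sqn b)) => //; last exact: dotv_sqn_le.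
  exact: measurable_dotv.
pose F (q : 'rV[R]_n * 'rV[R]_n) : R :=
  sin (dotv (x - q.1) q.2) * (fp be s q.1 * (dotv b q.2 * wt be t q.2)).
have lF : L1 (mu \x mu)%E F.
  apply: (L1_bddM (c := 1)) (L1_prodM lp lw); last by move=> q; exact: sin_max.
  apply: (measurableT_comp measurable_sin); apply: measurable_fun_dotv; last exact: measurable_snd.
  by apply: measurable_fun_subv => //; exact: measurable_cst.
transitivity (@cpi R n * \int[mu]_y \int[mu]_z F (y, z)).
  rewrite -RintZ; last exact: (L1_Rint1 lF).
  apply: eq_Rintegral => y _; rewrite kkE// pkE// /fk -mulrA; congr (_ * _).
  rewrite -RintZr; last exact: L1_fk.
  by apply: eq_Rintegral => z _; rewrite /F/=; ring.
rewrite (Rint_fubini lF) kkE ?addr_gt0// /fk; congr (_ * _).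
apply: eq_Rintegral => z _; rewrite /F/=.
under eq_Rintegral => y _.
  rewrite dotvBl -dotvNr mulrA.
  over.
rewrite RintZr; first by rewrite fp_fourier_sin// /wt sqnN -/(wt be t z) -/(wt be s z) -/(wt be (t + s) z) -(wtD be t s); ring.
apply: (L1_bddM (c := 1)) lp => [|y]; last exact: sin_max.
apply: (measurableT_comp measurable_sin); apply: measurable_funD => //.
by apply: measurable_fun_dotv => //; exact: measurable_cst.
Qed.

Lemma powR_sqn_mono (e : R) (c X Y : R) : 0 <= e -> 0 < c -> 0 < X -> 0 < Y ->
  X <= c * Y -> Y `^ (- e) <= c `^ e * X `^ (- e).
Proof.
move=> e0 c0 X0 Y0 XY.
rewrite !powRN ler_pdivlMr ?powR_gt0// mulrC ler_pdivrMr ?powR_gt0//.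
rewrite -powRM ?(ltW c0) ?(ltW Y0)//.
by apply: ge0_ler_powR; rewrite ?nnegrE ?(ltW X0)// mulr_ge0 ?(ltW c0) ?(ltW Y0).
Qed.

Lemma sqn1_gt0 x : 0 < 1 + sqn x.
Proof. by rewrite ltr_pwDl// sqn_ge0. Qed.

(** Shifts within the natural scale t^nu change 1 + |x|^2 by a bounded factor after rescaling to t =
    1, and the two-sided power bound translates this to the kernel. *)
Lemma harnack : exists2 C : R, 0 < C &
  forall t x y, 0 < t -> sqn y <= t `^ (2 * nu) -> pk t (x - y) <= C * pk t x.
Proof.
have [c [C [c0 C0 H]]] := @fp_bounds R n be be_half be1.
have e0 : 0 <= n%:R / 2 + be by rewrite addr_ge0// ltW.
exists (C * 3 `^ (n%:R / 2 + be) / c); first by rewrite divr_gt0// mulr_gt0// powR_gt0.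
move=> t x y t0 yt; rewrite !(pk_scale _ t0) mulrCA ler_pM2l ?powR_gt0// !pkE//.
rewrite scalerBr; set X := _ *: x; set Y := _ *: y.
have Y1 : sqn Y <= 1.
  rewrite /Y sqnZ -powR_mulrn ?powR_ge0// -powRrM mulrC -ler_pdivlMr ?powR_gt0//.
  by rewrite -powRN mulNr opprK mul1r mulrC.
have /andP[_ H1] := H (X - Y); have /andP[H2 _] := H X.
have XY : 1 + sqn X <= 3 * (1 + sqn (X - Y)).
  by have := sqnD_le (X - Y) Y; rewrite subrK; have := sqn_ge0 (X - Y); lra.
have H3 := powR_sqn_mono e0 (ltr0n R 3 : 0 < 3) (sqn1_gt0 X) (sqn1_gt0 (X - Y)) XY.
apply: (le_trans H1); apply: (@le_trans _ _ (C * (3 `^ (n%:R / 2 + be) * (fp be 1 X / c)))).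
  rewrite ler_pM2l//; apply: (le_trans H3); rewrite ler_pM2l ?powR_gt0//.
  by rewrite ler_pdivlMr// mulrC.
by rewrite le_eqVlt; apply/orP; left; apply/eqP; ring.
Qed.

(** The gradient has the extra factor |b.x| <= 1 + |b|^2 |x|^2, which is paid for by its extra decay
    (1 + |x|^2)^(-1). Scaling then gives t^(-nu). *)
Lemma kk_bound : exists2 C : R, 0 < C &
  forall t x, 0 < t -> `|kk t x| <= C * t `^ (- nu) * pk t x.
Proof.
have [c [C [c0 C0 H]]] := @fp_bounds R n be be_half be1.
have [c' [C' [c0' C0' H']]] : exists c C : R, [/\ 0 < c, 0 < C & forall x,
    c * (`|dotv b x| * (1 + sqn x) `^ (- (n%:R / 2 + 1 + be))) <= `|fk be b 1 x| <=
    C * (`|dotv b x| * (1 + sqn x) `^ (- (n%:R / 2 + 1 + be)))].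
  have [bE|b0] := eqVneq b 0; last exact: fk_bounds.
  exists 1, 1; split=> // x; rewrite bE dotv0l normr0 mul0r mulr0/= /fk.
  under eq_Rintegral do rewrite dotv0l !mul0r.
  by rewrite /Rintegral integral0 mulr0 normr0 lexx.
pose D := C' * (1 + sqn b) / c.
have D0 : 0 < D by rewrite divr_gt0// mulr_gt0// sqn1_gt0.
exists D => // t x t0; rewrite kk_scale// (pk_scale _ t0) !kkE// !pkE//.
set X := _ *: x; rewrite normrM (ger0_norm (powR_ge0 _ _)).
have -> : t `^ (- (n.+1%:R * nu)) = t `^ (- nu) * t `^ (- (n%:R * nu)).
  rewrite -powRD; last by rewrite (gt_eqF t0) implybT.
  by congr (_ `^ _); rewrite -natr1; ring.
have HX : `|fk be b 1 X| <= D * fp be 1 X.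
  have /andP[H2 _] := H X; have /andP[_ H1] := H' X.
  apply: (le_trans H1); rewrite /D -2!mulrA ler_pM2l//.
  apply: (@le_trans _ _ ((1 + sqn b) * (1 + sqn X) `^ (- (n%:R / 2 + be)))).
    have -> : (1 + sqn X) `^ (- (n%:R / 2 + be)) = (1 + sqn X) * (1 + sqn X) `^ (- (n%:R / 2 + 1 + be)).
      rewrite -{2}(powRr1 (ltW (sqn1_gt0 X))) -powRD; last by rewrite (gt_eqF (sqn1_gt0 X)) implybT.
      by congr (_ `^ _); ring.
    rewrite mulrA ler_wpM2r ?powR_ge0//; apply: (le_trans (dotv_sqn_le _ _)).
    by have := sqn_ge0 X; have := sqn_ge0 b; nra.
  by rewrite ler_pM2l ?sqn1_gt0// ler_pdivlMl.
apply: (le_trans (ler_wpM2l _ HX)); first by rewrite mulr_ge0 ?powR_ge0.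
by rewrite le_eqVlt; apply/orP; left; apply/eqP; ring.
Qed.

Lemma L1_kk t : L1 mu (kk t).
Proof.
have [t0|t0] := leP t 0.
  by rewrite (_ : kk t = fun=> 0); [exact: L1_0|apply/funext => x; exact: kk0].
have [C C0 H] := kk_bound.
apply: (@L1_le _ _ _ _ _ (fun x => C * t `^ (- nu) * pk t x)).
- by apply: measurable_kkT => //; exact: measurable_cst.
- by move=> x; exact: H.
- exact/L1Z/L1_pk.
Qed.

End stable_density.

(** * Space-time measure, convolutions and power singularities in time *)

Section space_time.
Context {R : realType} {n : nat}.

(** The product measure under its own name, with a sigma-finite structure, so that space-time can be
    one factor of a further product in Fubini's theorem. *)
Definition stm (A : set (R * 'rV[R]_n)) : \bar R := (leb \x lebesgue_rV n)%E A.

HB.instance Definition _ := Measure.copy stm (leb \x lebesgue_rV n)%E.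

Let stm_sigma_finite : sigma_finite setT stm.
Proof.
have /sigma_finiteP[F [TF ndF Foo]] := sigma_finiteT (@leb R).
have /sigma_finiteP[G [TG ndG Goo]] := sigma_finiteT (@lebesgue_rV R n).
exists (fun k => F k `*` G k).
  apply/esym/seteqP; split => // -[r x] _.
  have [k _ Fk] : (\bigcup_i F i) r by rewrite -TF.
  have [j _ Gj] : (\bigcup_i G i) x by rewrite -TG.
  exists (maxn k j) => //; split.
  - by move: r Fk; exact/subsetPset/ndF/leq_maxl.
  - by move: x Gj; exact/subsetPset/ndG/leq_maxr.
move=> k; have [mF Foon] := Foo k; have [mG Goon] := Goo k; split.
  exact: measurableX.
by rewrite /stm product_measure1E// lte_mul_pinfty// ge0_fin_numE.
Qed.

HB.instance Definition _ := Measure_isSigmaFinite.Build _ _ _ stm stm_sigma_finite.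

Lemma Rint_stm (f : R * 'rV[R]_n -> R) :
  \int[stm]_x f x = \int[(leb \x lebesgue_rV n)%E]_x f x.
Proof. by []. Qed.

End space_time.

Section prod_iter.
Context {d1 d2} {T1 : measurableType d1} {T2 : measurableType d2} {R : realType}.
Variables (m1 : {sigma_finite_measure set T1 -> \bar R})
          (m2 : {sigma_finite_measure set T2 -> \bar R}).
Variable f : T1 * T2 -> R.
Hypothesis mf : measurable_fun setT f.

Lemma L1_prod_iter1 (g : T1 -> R) : (forall x, L1 m2 (fun y => f (x, y))) ->
  L1 m1 g -> (forall x, \int[m2]_y `|f (x, y)| <= g x) -> L1 (m1 \x m2)%E f.
Proof.
move=> l2 l1 fg; apply: L1_prod => //.
have mEf : measurable_fun setT (fun z => `|f z|%:E).
  by apply/measurable_EFinP; exact: measurableT_comp.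
apply: (@le_lt_trans _ _ (\int[m1]_x `|g x|%:E)%E); last by have [] := (L1P _ _).1 l1.
apply: ge0_le_integral => //.
- by move=> x _; exact: integral_ge0.
- exact: (measurable_fun_fubini_tonelli_F (fun z => `|f z|%:E)).
- by apply/measurable_EFinP; apply: measurableT_comp => //; exact: L1_measurable l1.
- move=> x _; rewrite -EFin_Rint; last exact: L1_norm.
  by rewrite lee_fin (le_trans (fg x))// ler_norm.
Qed.

Lemma L1_prod_iter2 (g : T2 -> R) : (forall y, L1 m1 (fun x => f (x, y))) ->
  L1 m2 g -> (forall y, \int[m1]_x `|f (x, y)| <= g y) -> L1 (m1 \x m2)%E f.
Proof.
move=> l1 l2 fg; apply/integrable21ltyP; first exact/measurable_EFinP.
have mEf : measurable_fun setT (fun z => `|f z|%:E).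
  by apply/measurable_EFinP; exact: measurableT_comp.
apply: (@le_lt_trans _ _ (\int[m2]_x `|g x|%:E)%E); last by have [] := (L1P _ _).1 l2.
apply: ge0_le_integral => //.
- by move=> x _; exact: integral_ge0.
- exact: (measurable_fun_fubini_tonelli_G (fun z => `|f z|%:E)).
- by apply/measurable_EFinP; apply: measurableT_comp => //; exact: L1_measurable l2.
- move=> x _; rewrite -EFin_Rint; last exact: L1_norm.
  by rewrite lee_fin (le_trans (fg x))// ler_norm.
Qed.

End prod_iter.

Section convolution.
Context {R : realType} {n : nat}.
Local Notation mu := (lebesgue_rV n).
Implicit Types K v : 'rV[R]_n -> R.

Lemma measurable_conv_kernel K v : measurable_fun setT K -> measurable_fun setT v ->
  measurable_fun setT (fun q : 'rV[R]_n * 'rV[R]_n => K (q.1 - q.2) * v q.2).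
Proof.
move=> mK mv; apply: measurable_funM; last exact: (measurableT_comp mv measurable_snd).
apply: (measurableT_comp mK).
by apply: measurable_fun_subv; [exact: measurable_fst|exact: measurable_snd].
Qed.

Lemma L1_conv_kernel K v : L1 mu K -> L1 mu v ->
  L1 (mu \x mu)%E (fun q => K (q.1 - q.2) * v q.2).
Proof.
move=> lK lv; have mK := L1_measurable lK; have mv := L1_measurable lv.
apply: (@L1_prod_iter2 _ _ _ _ _ mu mu _ _ (fun y => \int[mu]_x `|K x| * `|v y|)).
- exact: measurable_conv_kernel.
- move=> y /=; under eq_fun do rewrite mulrC; apply: L1Z.
  exact: (L1_transl (- y)).
- by apply: L1Z; exact: L1_norm.
- move=> y /=; under eq_Rintegral do rewrite normrM.
  rewrite RintZr; last exact: (L1_norm (L1_transl (- y) lK)).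
  by rewrite (Rint_transl (- y) (L1_norm lK)).
Qed.

Definition convol K v x : R := \int[mu]_y (K (x - y) * v y).

Lemma L1_conv K v : L1 mu K -> L1 mu v -> L1 mu (convol K v).
Proof. by move=> lK lv; exact: (L1_Rint1 (L1_conv_kernel lK lv)). Qed.

Lemma conv_norm_le K v : L1 mu K -> L1 mu v ->
  \int[mu]_x `|convol K v x| <= (\int[mu]_x `|K x|) * (\int[mu]_x `|v x|).
Proof.
move=> lK lv; have l := L1_conv_kernel (L1_norm lK) (L1_norm lv).
have <- : \int[mu]_y \int[mu]_x (`|K (x - y)| * `|v y|) = (\int[mu]_x `|K x|) * (\int[mu]_x `|v x|).
  rewrite -RintZ; last exact: L1_norm.
  apply: eq_Rintegral => y _; rewrite RintZr; last exact: (L1_norm (L1_transl (- y) lK)).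
  by rewrite (Rint_transl (- y) (L1_norm lK)).
rewrite -(Rint_fubini l) /=; apply: ae_ler_Rint.
- exact: L1_norm (L1_conv lK lv).
- exact: (L1_Rint1 l).
apply: filterS (ae_L1_section1 (L1_conv_kernel lK lv)) => x /= lx.
apply: (le_trans (ler_norm_Rint lx)).
by rewrite le_eqVlt; apply/orP; left; apply/eqP; apply: eq_Rintegral => y _; rewrite normrM.
Qed.

End convolution.

Section time_integrals.
Context {R : realType}.

Lemma ler_powR2 (g : R) (x y : R) : 0 <= g -> 0 <= x -> x <= y -> x `^ g <= y `^ g.
Proof. by move=> g0 x0 xy; apply: ge0_ler_powR; rewrite ?nnegrE ?(le_trans x0 xy). Qed.

(** The singularity s^(-g) cut to (0, t), so that time integrals run over the whole line and can be
    reflected or translated freely. *)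
Definition hpow (g t s : R) : R := if (0 < s) && (s < t) then s `^ (- g) else 0.

Lemma hpow_ge0 g t s : 0 <= hpow g t s.
Proof. by rewrite /hpow; case: ifP => // _; exact: powR_ge0. Qed.

Lemma measurable_hpow g t : measurable_fun setT (hpow g t).
Proof.
apply: measurable_fun_ifT => //.
by apply: measurable_and; apply: measurable_fun_ltr.
Qed.

Let power_segment (g a t : R) : g < 1 -> 0 < a -> a < t ->
  (\int[lebesgue_measure]_(s in `[a, t]) (s `^ (- g))%:E =
   (t `^ (1 - g) / (1 - g) - a `^ (1 - g) / (1 - g))%:E)%E.
Proof.
move=> g1 a0 at_.
have g10 : 1 - g != 0 by rewrite gt_eqF// subr_gt0.
pose F (s : R) := s `^ (1 - g) / (1 - g).
have dF (s : R) : 0 < s -> is_derive s (1 : R) F (s `^ (- g)).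
  move=> s0.
  have d1 := is_derive1_powR (1 - g) s0.
  apply: (is_derive_ext (is_deriveM d1 (is_derive_cst ((1 - g)^-1) s (1 : R)))) => //.
  rewrite -![_ *: _]/(_ * _)/= mulr0 add0r (_ : 1 - g - 1 = - g); last by ring.
  by rewrite mulKf.
have := @continuous_FTC2 R (fun s => s `^ (- g)) F a t at_.
rewrite EFinB; apply.
- apply: continuous_in_subspaceT => s; rewrite inE/= in_itv/= => /andP[as_ _].
  have s0 := lt_le_trans a0 as_.
  apply/differentiable_continuous/derivable1_diffP.
  by have [] := is_derive1_powR (- g) s0.
- split.
  + move=> s; rewrite in_itv/= => /andP[as_ _].
    by have [] := dF _ (lt_trans a0 as_).
  + apply: cvg_at_right_filter; apply/differentiable_continuous/derivable1_diffP.
    by have [] := dF _ a0.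
  + apply: cvg_at_left_filter; apply/differentiable_continuous/derivable1_diffP.
    by have [] := dF _ (lt_trans a0 at_).
- move=> s; rewrite in_itv/= => /andP[as_ _].
  by rewrite derive1E (derive_val (is_derive := dF _ (lt_trans a0 as_))).
Qed.

(** The fundamental theorem of calculus applies on [a, t] with a > 0 only; Fatou lets a tend to 0,
    and the upper bound is all that is used. *)
Lemma hpow_int (g t : R) : g < 1 -> 0 < t ->
  L1 leb (hpow g t) /\ \int[leb]_s hpow g t s <= t `^ (1 - g) / (1 - g).
Proof.
move=> g1 t0; have g10 : 0 < 1 - g by rewrite subr_gt0.
pose a (k : nat) : R := t / 2 * k.+1%:R^-1.
have a0 k : 0 < a k by rewrite mulr_gt0// divr_gt0.
have at_ k : a k < t.
  apply: (@le_lt_trans _ _ (t / 2)); last by rewrite ltr_pdivrMr// ltr_pMr// ltr1n.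
  by rewrite ler_piMr ?divr_ge0 ?(ltW t0)// invf_le1// ler1n.
have acvg : a k @[k --> \oo] --> (0 : R).
  rewrite -[X in _ --> X](mulr0 (t / 2)).
  by apply: cvgM; [exact: cvg_cst|exact: cvg_harmonic].
pose F k s := if (a k < s) && (s < t) then s `^ (- g) else 0 : R.
have mF k : measurable_fun setT (F k).
  apply: measurable_fun_ifT => //.
  by apply: measurable_and; apply: measurable_fun_ltr.
have F0 k s : 0 <= F k s by rewrite /F; case: ifP => // _; exact: powR_ge0.
have FI k : (\int[leb]_s (F k s)%:E <= (t `^ (1 - g) / (1 - g))%:E)%E.
  rewrite ge0_integral_leb; [|exact/measurable_EFinP|by move=> s; rewrite lee_fin].
  apply: (@le_trans _ _ (\int[lebesgue_measure]_(s in `[a k, t]) (s `^ (- g))%:E)%E).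
    rewrite [leRHS]integral_mkcond; apply: ge0_le_integral => //.
    - by move=> s _; rewrite lee_fin.
    - by apply/measurable_EFinP; exact: mF.
    - apply/measurable_restrict => //.
      apply: measurable_funTS; apply/measurable_EFinP; exact: measurable_powR.
    - move=> s _; rewrite /F patchE; case: ifPn => [/andP[s1 s2]|_].
        by rewrite mem_set//= in_itv/= !ltW.
      by case: ifPn => // _; rewrite lee_fin powR_ge0.
  rewrite power_segment// lee_fin lerBlDr lerDl.
  by rewrite divr_ge0 ?powR_ge0// ltW.
have lF k : L1 leb (F k).
  by apply: ge0_L1 => //; apply: (le_lt_trans (FI k)); rewrite ltry.
apply: (L1_fatou lF F0).
- move=> s; rewrite /F /hpow.
  have [s0|s0] := ltP 0 s; last first.
    rewrite (_ : (fun k => _) = fun=> 0); first exact: cvg_cst.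
    by apply/funext => k; rewrite ltNge (le_trans s0 (ltW (a0 k))).
  have [N _ HN] := cvgr_lt _ acvg _ s0.
  by apply: cvg_near_cst; exists N => // k /HN /= ->.
- by move=> k; rewrite -lee_fin EFin_Rint.
Qed.

Lemma L1_reflect (f : R -> R) (t : R) : L1 leb f ->
  L1 leb (fun s => f (t - s)) /\ \int[leb]_s f (t - s) = \int[leb]_s f s.
Proof.
move=> lf; have mf := L1_measurable lf.
have mr : measurable_fun setT (fun s : R => t + (-1) * s).
  by apply: measurable_funD => //; exact: measurable_funM.
have E (h : R -> R) : measurable_fun setT h -> (forall s, 0 <= h s) ->
    (\int[leb]_s (h (t - s))%:E = \int[leb]_s (h s)%:E)%E.
  move=> mh h0; have := @ge0_integral_affine1 R (fun s => (h s)%:E) (-1) t.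
  rewrite oppr_eq0 oner_neq0 normrN normr1 invr1 mul1e => <- //.
  - by apply: eq_integral => s _; rewrite mulN1r.
  - exact/measurable_EFinP.
have mfr : measurable_fun setT (fun s : R => f (t - s)).
  have := measurableT_comp mf mr.
  by congr measurable_fun; apply/funext => s /=; rewrite mulN1r.
have lr (h : R -> R) : L1 leb h -> (forall s, 0 <= h s) -> L1 leb (fun s : R => h (t - s)).
  move=> lh h0; have mh := L1_measurable lh; apply: ge0_L1 => //.
  - have := measurableT_comp mh mr.
    by congr measurable_fun; apply/funext => s /=; rewrite mulN1r.
  - by rewrite E// -EFin_Rint// ltry.
have lfr : L1 leb (fun s : R => f (t - s)).
  apply: (@L1_le _ _ _ leb _ (fun s => `|f (t - s)|)) => //.
  by apply: (lr (fun s => `|f s|)) => //; exact: L1_norm.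
split=> //.
have lp : L1 leb (fun s => Num.max (f s) 0).
  apply: (@L1_le _ _ _ leb _ (fun s => `|f s|)); last exact: L1_norm.
    exact: measurable_maxr.
  by move=> s; case: (lerP (f s) 0) => // _; rewrite normr0.
have lm : L1 leb (fun s => Num.max (- f s) 0).
  apply: (@L1_le _ _ _ leb _ (fun s => `|f s|)); last exact: L1_norm.
    by apply: measurable_maxr => //; exact: measurableT_comp.
  by move=> s; case: (lerP (- f s) 0) => H; rewrite ?normr0// normrN.
have fE s : f s = Num.max (f s) 0 - Num.max (- f s) 0.
  by case: (lerP (f s) 0); case: (lerP (- f s) 0); lra.
have max0 (x : R) : 0 <= Num.max x 0 by rewrite le_max lexx orbT.
have E2 h : L1 leb h -> (forall s, 0 <= h s) -> \int[leb]_s h (t - s) = \int[leb]_s h s.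
  by move=> lh h0; apply: EFin_inj; rewrite !EFin_Rint ?E//; [exact: L1_measurable lh|exact: lr].
under eq_Rintegral do rewrite fE.
rewrite RintB; [|exact: (lr _ lp)|exact: (lr _ lm)].
rewrite (E2 _ lp)// (E2 _ lm)// -RintB//.
by apply: eq_Rintegral => s _; rewrite -fE.
Qed.

End time_integrals.

(** * Mild solutions *)

Lemma measurable_fun_nat_select d (T : measurableType d) (R : realType)
    (g : T -> nat) (F : nat -> T -> R) :
  (forall m, measurable [set x | g x = m]) ->
  (forall m, measurable_fun setT (F m)) -> measurable_fun setT (fun x => F (g x) x).
Proof.
move=> mg mF _ A mA; rewrite setTI.
have -> : (fun x => F (g x) x) @^-1` A =
    \bigcup_m ([set x | g x = m] `&` F m @^-1` A).
  apply/seteqP; split => [x Ax|x [m _ [/= <-]]//].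
  by exists (g x).
apply: bigcup_measurable => m _; apply: measurableI => //.
by rewrite -[X in measurable X]setTI; exact: mF.
Qed.

Section dyadic.
Context {R : realType}.

Definition dyn (k : nat) (s : R) : nat := Num.truncn (Num.max (2 ^+ k * s) 0).

(** The right end of the m-th dyadic cell. It is always positive, so [u] is sampled only where it is
    continuous in L^oo. *)
Definition dyt (k m : nat) : R := m.+1%:R / 2 ^+ k.

Lemma dyt_gt0 k m : 0 < dyt k m.
Proof. by rewrite divr_gt0// exprn_gt0. Qed.

Lemma dyt_near k (s : R) : 0 <= s -> s < dyt k (dyn k s) <= s + 2 ^- k.
Proof.
move=> s0; have k0 : 0 < 2 ^+ k :> R by rewrite exprn_gt0.
have y0 : 0 <= 2 ^+ k * s by rewrite mulr_ge0// ltW.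
rewrite /dyn max_l//; have /andP[H1 H2] := truncn_itv y0.
rewrite /dyt; apply/andP; split; first by rewrite ltr_pdivlMr// mulrC.
rewrite ler_pdivrMr// mulrDl mulVf ?gt_eqF// -natr1 lerD2r.
by rewrite (mulrC s).
Qed.

Lemma measurable_dyn k m : measurable [set s : R | dyn k s = m].
Proof.
have mg : measurable_fun setT (fun s : R => Num.max (2 ^+ k * s) 0).
  by apply: measurable_maxr => //; exact: measurable_funM.
have -> : [set s : R | dyn k s = m] =
    setT `&` (fun s : R => Num.max (2 ^+ k * s) 0) @^-1` `[m%:R, m.+1%:R[%classic.
  rewrite setTI; apply/seteqP; split => s /=; rewrite in_itv/= /dyn;
    have y0 : 0 <= Num.max (2 ^+ k * s) 0 by rewrite le_max lexx orbT.
    by move=> <-; exact: truncn_itv.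
  by move=> H; apply/eqP; rewrite truncn_eq.
by apply: mg => //.
Qed.

Lemma dyt_cvg (s : R) : 0 <= s -> dyt k (dyn k s) @[k --> \oo] --> s.
Proof.
move=> s0; apply: (@squeeze_cvgr _ _ _ _ (fun=> s) (fun k => s + 2 ^- k)).
- by apply: nearW => k; have /andP[/ltW -> ->] := dyt_near k s0.
- exact: cvg_cst.
- rewrite -[X in _ --> X]addr0; apply: cvgD; first exact: cvg_cst.
  under eq_fun do rewrite -exprVn; apply: cvg_expr.
  by rewrite ger0_norm ?invr_ge0// invf_lt1// ltr1n.
Qed.

End dyadic.

(** Compactness of [a, T] turns local bounds in time into a uniform one. Stating it for a property
    monotone in [M] covers sup bounds, L^1 bounds and moduli of continuity alike. *)
Lemma compact_uniform (R : realType) (P : R -> R -> Prop) (a T : R) :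
  (forall M M' s, M <= M' -> P M s -> P M' s) ->
  (forall t, a <= t <= T -> exists2 dl : R, 0 < dl & exists M, forall s,
    a <= s <= T -> `|s - t| < dl -> P M s) ->
  exists M, forall s, a <= s <= T -> P M s.
Proof.
move=> Pmono Ploc.
have := @compact_near_coveringP _ `[a, T]%classic.
move=> [/(_ (@segment_compact _ a T)) cov _].
have := cov _ (pinfty_nbhs R) (fun M s => a <= s <= T -> P M s) _.
case.
  move=> t; rewrite /= in_itv/= => /Ploc[dl dl0 [M HM]].
  exists ([set s | `|s - t| < dl], [set M' | M < M']); last first.
    by move=> [s M'] /= [sd MM'] sT; apply: (Pmono M) (ltW MM') _; exact: HM.
  split => /=; last by exists M; split => //; exact: num_real.
  by exists dl => // s /=; rewrite distrC.
move=> M [_ HM]; exists (M + 1) => s sT.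
by apply: (HM (M + 1)); rewrite //= ?ltrDl// in_itv.
Qed.

Section mild.
Context {R : realType} {n : nat}.
Variable be : R.
Hypotheses (be_half : 2^-1 < be) (be1 : be < 1).
Variables (b : 'rV[R]_n) (q : R) (u0 : 'rV[R]_n -> R) (u : R -> 'rV[R]_n -> R).
Hypothesis q0 : 0 < q.
Hypothesis hu : mild_solution (2 * be) q b u0 u.
Local Notation mu := (lebesgue_rV n).

Lemma mild_L1 t : 0 <= t -> L1 mu (u t).
Proof.
move=> t0; have [H _ _ _] := hu.
have It : `[0, +oo[%classic t by rewrite /= in_itv/= t0.
have [+ _] := H t It.
by move/Lfun1_integrable.
Qed.

Let cont_Lp_near (p : \bar R) (I : set R) t (e : R) : continuous_Lp p I u -> I t -> 0 < e ->
  exists2 dl : R, 0 < dl & forall s, I s -> `|s - t| < dl ->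
    ('N[mu]_p [EFin \o (u s \- u t)%R] < e%:E)%E.
Proof.
move=> H It e0; have [_] := H t It.
move=> /(_ [set x | (x < e%:E)%E]) [].
  by apply: open_ereal_lt'; rewrite lte_fin.
move=> dl /= dl0 Hd; exists dl => // s Is sd; apply: Hd => //=.
by rewrite distrC.
Qed.

Lemma mild_cont1 t e : 0 <= t -> 0 < e -> exists2 dl : R, 0 < dl &
  forall s, 0 <= s -> `|s - t| < dl -> \int[mu]_x `|u s x - u t x| <= e.
Proof.
move=> t0 e0; have [H _ _ _] := hu.
have It : `[0, +oo[%classic t by rewrite /= in_itv/= t0.
have [dl dl0 Hd] := cont_Lp_near H It e0; exists dl => // s s0 sd.
have Is : `[0, +oo[%classic s by rewrite /= in_itv/= s0.
have := Hd s Is sd; rewrite Lnorm1 => /ltW.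
have lst : L1 mu (fun x => u s x - u t x) by apply: L1B; exact: mild_L1.
by rewrite -lee_fin EFin_Rint//; exact: L1_norm.
Qed.

Hypothesis mu0 : (0 < mu [set: 'rV[R]_n])%E.

(** The L^oo norm unfolds to the essential supremum when the total mass is positive, which is what
    [mu0] provides. *)
Let Lnorm_oo_le (f : 'rV[R]_n -> R) (e : R) : ('N[mu]_+oo [EFin \o f] <= e%:E)%E ->
  {ae mu, forall x, `|f x| <= e}.
Proof.
rewrite unlock /= mu0 => /ess_supP; apply: filterS => x /=.
by rewrite lee_fin.
Qed.

Lemma mild_bdd t : 0 < t -> exists2 M : R, 0 <= M & {ae mu, forall x, `|u t x| <= M}.
Proof.
move=> t0; have [_ H _ _] := hu.
have It : `]0, +oo[%classic t by rewrite /= in_itv/= t0.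
have [+ _] := H t It.
rewrite inE => /andP[_]; rewrite inE /= /finite_norm => Hf.
have N0 := Lnorm_ge0 mu +oo%E (EFin \o u t).
exists (fine ('N[mu]_+oo [EFin \o u t])); first by rewrite fine_ge0.
by apply: Lnorm_oo_le; rewrite fineK// ge0_fin_numE.
Qed.

Lemma mild_contoo t e : 0 < t -> 0 < e -> exists2 dl : R, 0 < dl &
  forall s, 0 < s -> `|s - t| < dl -> {ae mu, forall x, `|u s x - u t x| <= e}.
Proof.
move=> t0 e0; have [_ H _ _] := hu.
have It : `]0, +oo[%classic t by rewrite /= in_itv/= t0.
have [dl dl0 Hd] := cont_Lp_near H It e0; exists dl => // s s0 sd.
have Is : `]0, +oo[%classic s by rewrite /= in_itv/= s0.
by apply: Lnorm_oo_le; apply/ltW/Hd.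
Qed.

Let Uk k (p : R * 'rV[R]_n) : R := u (dyt k (dyn k p.1)) p.2.

(* The hypotheses give u t for each t separately; mildU is a version of u that is
   jointly measurable in (t, x), a limit of samples at dyadic times. *)
Definition mildU (p : R * 'rV[R]_n) : R :=
  if 0 < p.1 then fine (limn_esup (fun k => (Uk k p)%:E)) else 0.

Lemma measurable_mildU : measurable_fun setT mildU.
Proof.
have mUk k : measurable_fun setT (Uk k).
  apply: (@measurable_fun_nat_select _ _ _ (fun p => dyn k p.1)
    (fun m p => u (dyt k m) p.2)).
    move=> m; have -> : [set x : R * 'rV[R]_n | dyn k x.1 = m] =
        setT `&` fst @^-1` [set s | dyn k s = m] by rewrite setTI.
    by apply: measurable_fst => //; exact: measurable_dyn.
  move=> m; apply: (measurableT_comp _ measurable_snd).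
  by apply: (L1_measurable (mild_L1 _)); exact/ltW/dyt_gt0.
apply: measurable_fun_ifT => //.
  by apply: measurable_fun_ltr => //; exact: measurable_fst.
apply: measurableT_comp => //.
apply: measurable_fun_limn_esup => k; exact/measurable_EFinP.
Qed.

Lemma mildU_le0 s z : s <= 0 -> mildU (s, z) = 0.
Proof. by rewrite /mildU/= ltNge => ->. Qed.

(** Continuity in L^oo at s gives, for each accuracy 1 / (j + 1) and each dyadic sample close
    enough, an estimate off a null set; these sets are countably many, and off their union the
    samples converge to u(s). *)
Lemma mildU_ae s : 0 < s -> {ae mu, forall z, mildU (s, z) = u s z}.
Proof.
move=> s0.
have H j : exists dl : R, 0 < dl /\
    forall r, 0 < r -> `|r - s| < dl -> {ae mu, forall x, `|u r x - u s x| <= j.+1%:R^-1}.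
  by have [dl ? ?] := @mild_contoo s j.+1%:R^-1 s0 (ltac:(by rewrite invr_gt0)); exists dl.
have [dl Hdl] := choice H.
have A : {ae mu, forall x, forall j k, `|dyt k (dyn k s) - s| < dl j ->
    `|u (dyt k (dyn k s)) x - u s x| <= j.+1%:R^-1}.
  apply: ae_foralln => j; apply: ae_foralln => k.
  have [C|C] := boolP (`|dyt k (dyn k s) - s| < dl j); last by apply: nearW.
  have [_ Hj] := Hdl j; apply: filterS (Hj _ (dyt_gt0 _ _) C) => x ? _ //.
apply: filterS A => z Hz; rewrite /mildU/= s0.
have C : Uk k (s, z) @[k --> \oo] --> u s z.
  apply/cvgrPdist_le => e e0.
  have [j je] : exists j : nat, j.+1%:R^-1 <= e :> R.
    have [N _ HN] := cvgr_le _ (@cvg_harmonic R) _ e0.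
    by exists N; exact: (HN N (leqnn N)).
  have [dj0 _] := Hdl j.
  have /cvgrPdist_lt/(_ _ dj0) [N _ HN] := dyt_cvg (ltW s0).
  exists N => // k Nk; rewrite distrC; apply: le_trans je; apply: Hz.
  by rewrite distrC; exact: HN.
have /cvg_limn_einf_sup[_ ->] // : (fun k => (Uk k (s, z))%:E) @ \oo --> (u s z)%:E.
by apply: cvg_EFin => //; exact: nearW.
Qed.

Definition nonlin (v : R) : R := v * `|v| `^ q.

Lemma measurable_nonlin d (T : measurableType d) (f : T -> R) :
  measurable_fun setT f -> measurable_fun setT (fun x => nonlin (f x)).
Proof.
move=> mf; apply: measurable_funM => //.
by apply: (measurableT_comp (measurable_powR _)); exact: measurableT_comp.
Qed.

Definition mildG (p : R * 'rV[R]_n) : R := nonlin (mildU p).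

Lemma measurable_mildG : measurable_fun setT mildG.
Proof. exact: measurable_nonlin measurable_mildU. Qed.

(** Vanishes outside 0 < s < t by the conventions on [mildU] and [kk], so that the Duhamel term is
    an integral over the whole of space-time. *)
Definition duh t x (p : R * 'rV[R]_n) : R := kk be b (t - p.1) (x - p.2) * mildG p.

Lemma measurable_duh t x : measurable_fun setT (duh t x).
Proof.
apply: measurable_funM; last exact: measurable_mildG.
apply: measurable_kkT => //.
  by apply: measurable_funB => //; exact: measurable_fst.
by apply: measurable_fun_subv; [exact: measurable_cst|exact: measurable_snd].
Qed.

Let duh_out t x s z : ~~ ((0 < s) && (s < t)) -> duh t x (s, z) = 0.
Proof.
rewrite negb_and -!leNgt => /orP[s0|ts].
  by rewrite /duh /mildG mildU_le0//= /nonlin mul0r mulr0.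
by rewrite /duh/= kk0 ?mul0r// subr_le0.
Qed.

Let duh_in t x s : 0 < s -> s < t ->
  {ae mu, forall z, duhamel_integrand (2 * be) q b u t x s z = duh t x (s, z)}.
Proof.
move=> s0 st; apply: filterS (mildU_ae s0) => z Uz.
rewrite /duhamel_integrand /duh /mildG Uz/= dot_grad_heat ?subr_gt0//.
by rewrite kkE// subr_gt0.
Qed.

Let measurable_duhamel t x s : 0 < s -> s < t ->
  measurable_fun setT (duhamel_integrand (2 * be) q b u t x s).
Proof.
move=> s0 st.
have -> : duhamel_integrand (2 * be) q b u t x s =
    (fun z => kk be b (t - s) (x - z) * nonlin (u s z)).
  apply/funext => z; rewrite /duhamel_integrand dot_grad_heat ?subr_gt0//.
  by rewrite kkE// subr_gt0.
apply: measurable_funM; last by apply: measurable_nonlin; exact: (L1_measurable (mild_L1 (ltW s0))).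
apply: measurable_kkT => //.
by apply: measurable_fun_subv => //; exact: measurable_cst.
Qed.

Let measurable_duh_section t x s : measurable_fun setT (fun z => duh t x (s, z)).
Proof. exact: (measurableT_comp (measurable_duh t x) (pair1_measurable s)). Qed.

Let itvE t (s : R) : (s \in `]0, t[%classic) = (0 < s) && (s < t).
Proof. by apply/idP/idP => [|H]; [rewrite inE/= in_itv|rewrite inE/= in_itv]. Qed.

(** The iterated integrals of the hypothesis concern a function not known to be jointly measurable.
    For each s the integrand agrees almost everywhere in z with [duh], which is, and the finiteness
    clause becomes integrability on space-time. *)
Lemma mild_duhamel t x : 0 < t -> L1 (@stm R n) (duh t x) /\
  u t x = convol (pk be t) u0 x + \int[@stm R n]_p duh t x p.
Proof.
move=> t0; have [_ _ _ H] := hu; have [Hfin ->] := H t x t0.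
have mD := measurable_duh t x.
have mnD : measurable_fun setT (fun p => `|duh t x p|%:E).
  by apply/measurable_EFinP; exact: measurableT_comp.
have lD : L1 stm (duh t x).
  apply: (L1_prod mD); rewrite ge0_integral_leb; last 2 first.
  - exact: (measurable_fun_fubini_tonelli_F (fun p => `|duh t x p|%:E)).
  - by move=> s; exact: integral_ge0.
  apply: le_lt_trans Hfin; rewrite [leRHS]integral_mkcond le_eqVlt; apply/orP; left; apply/eqP.
  apply: eq_integral => s _; rewrite patchE itvE; case: ifPn => [/andP[s0 st]|out].
    apply: ae_eq_integral => //.
    - apply/measurable_EFinP; apply: measurableT_comp; last exact: (measurable_duh_section t x s).
      exact: normr_measurable.
    - by apply/measurable_EFinP; apply: measurableT_comp => //; exact: measurable_duhamel.
    - by apply: filterS (duh_in x s0 st) => z -> _.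
  by under eq_integral do rewrite duh_out// normr0; rewrite integral0.
split=> //; congr (_ + _).
  by apply: eq_Rintegral => y _; rewrite heat_kernelE pkE.
rewrite -(Rint_prod1 lD) /Rintegral; congr fine.
rewrite integral_leb; last first.
  by apply/measurable_EFinP; exact: (measurable_Rint1 lD).
rewrite [LHS]integral_mkcond; apply: eq_integral => s _.
rewrite patchE itvE; case: ifPn => [/andP[s0 st]|out].
  congr EFin; apply: ae_eq_Rint; [exact: measurable_duhamel|exact: measurable_duh_section|].
  exact: duh_in.
by under eq_integral do rewrite duh_out//; rewrite integral0.
Qed.

Lemma mild_bdd_loc a T : 0 < a -> exists2 M : R, 0 <= M &
  forall s, a <= s <= T -> {ae mu, forall x, `|u s x| <= M}.
Proof.
move=> a0.
suff [M HM] : exists M, forall s, a <= s <= T -> {ae mu, forall x, `|u s x| <= M}.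
  by exists (Num.max M 0) => [|s /HM]; [rewrite le_max lexx orbT|apply: filterS => x H; rewrite le_max H].
apply: (@compact_uniform _ (fun M s => {ae mu, forall x, `|u s x| <= M})).
- by move=> M M' s MM'; apply: filterS => x /le_trans; exact.
- move=> t /andP[at_ _]; have t0 := lt_le_trans a0 at_.
  have [dl dl0 Hdl] := mild_contoo t0 (@ltr01 R); have [M _ HM] := mild_bdd t0.
  exists dl => //; exists (M + 1) => s /andP[as_ _] sd.
  apply: filterS2 HM (Hdl s (lt_le_trans a0 as_) sd) => x H1 H2.
  by rewrite -(subrK (u t x) (u s x)) (le_trans (ler_normD _ _))// addrC lerD.
Qed.

Lemma mild_L1_loc T : exists2 B : R, 0 <= B &
  forall s, 0 <= s <= T -> \int[mu]_x `|u s x| <= B.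
Proof.
suff [M HM] : exists M, forall s, 0 <= s <= T -> \int[mu]_x `|u s x| <= M.
  by exists (Num.max M 0) => [|s /HM H]; rewrite le_max ?lexx ?orbT// H.
apply: (@compact_uniform _ (fun M s => \int[mu]_x `|u s x| <= M)).
- by move=> M M' s MM' /le_trans; exact.
- move=> t /andP[t0 _]; have [dl dl0 Hdl] := mild_cont1 t0 (@ltr01 R).
  exists dl => //; exists (\int[mu]_x `|u t x| + 1) => s /andP[s0 _] sd.
  have ls := mild_L1 s0; have lt := mild_L1 t0.
  apply: (@le_trans _ _ (\int[mu]_x `|u t x| + \int[mu]_x `|u s x - u t x|)).
    rewrite -RintD; [|exact: L1_norm|exact/L1_norm/L1B].
    apply: ler_Rint; [exact: L1_norm| |].
      by apply: L1D; [exact: L1_norm|exact/L1_norm/L1B].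
    by move=> x; rewrite -{1}(subrK (u t x) (u s x)) addrC ler_normD.
  by rewrite lerD2l; exact: Hdl.
Qed.

Lemma mild_modulus T e : 0 < e -> exists2 dl : R, 0 < dl &
  forall s s', 0 <= s <= T -> 0 <= s' <= T -> `|s - s'| < dl ->
    \int[mu]_x `|u s x - u s' x| <= e.
Proof.
move=> e0; have e20 : 0 < e / 2 by rewrite divr_gt0.
(* The radius is encoded as the inverse of [M], so that the property is monotone in the direction
   that [compact_uniform] requires. *)
pose P (M s : R) := 0 < M /\ forall s', 0 <= s' <= T -> `|s - s'| < M^-1 ->
  \int[mu]_x `|u s x - u s' x| <= e.
suff [M HM] : exists M, forall s, 0 <= s <= T -> P M s.
  have [T0|T0] := leP 0 T; last first.
    by exists 1 => // s s' /andP[s0 /(le_trans s0)]; rewrite leNgt T0.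
  have [M0 _] := HM 0 (ltac:(by rewrite lexx T0)).
  exists M^-1; first by rewrite invr_gt0.
  by move=> s s' sT s'T; have [_] := HM s sT; exact.
apply: compact_uniform.
- move=> M M' s MM' [M0 H]; split; first exact: lt_le_trans MM'.
  move=> s' s'T sd; apply: H => //; apply: (lt_le_trans sd).
  by rewrite lef_pV2 ?posrE// (lt_le_trans M0).
- move=> t /andP[t0 _]; have [dl dl0 Hdl] := mild_cont1 t0 e20.
  exists (dl / 2); first by rewrite divr_gt0.
  exists (dl / 2)^-1 => s /andP[s0 _] sd; split; first by rewrite invr_gt0 divr_gt0.
  move=> s' /andP[s'0 _]; rewrite invrK => ss'.
  have ls := mild_L1 s0; have lt := mild_L1 t0; have ls' := mild_L1 s'0.
  have H1 := Hdl s s0; have H2 := Hdl s' s'0.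
  apply: (@le_trans _ _ (\int[mu]_x `|u s x - u t x| + \int[mu]_x `|u s' x - u t x|)).
    rewrite -RintD; [|exact/L1_norm/L1B|exact/L1_norm/L1B].
    apply: ler_Rint; [exact/L1_norm/L1B| |].
      by apply: L1D; exact/L1_norm/L1B.
    move=> x; rewrite (distrC (u s' x)).
    by rewrite (_ : u s x - u s' x = (u s x - u t x) + (u t x - u s' x)) ?ler_normD//; ring.
  rewrite (splitr e) lerD//.
    by apply: H1; apply: (lt_trans sd); rewrite ltr_pdivrMr// ltr_pMr// ltr1n.
  apply: H2; rewrite (_ : s' - t = (s' - s) + (s - t)); last by ring.
  by rewrite (le_lt_trans (ler_normD _ _))// (splitr dl) ltrD// distrC.
Qed.

End mild.

(** * A weight for the increments of the kernel along b *)

Section weight.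
Context {R : realType} {n : nat}.
Variable be : R.
Hypotheses (be_half : 2^-1 < be) (be1 : be < 1).
Variable b : 'rV[R]_n.
Hypothesis b0 : b != 0.
Implicit Types (x y z v : 'rV[R]_n) (t s r e a : R).
Local Notation mu := (lebesgue_rV n).
Local Notation nu := ((2 * be)^-1).
Local Notation E := (n%:R / 2 + 1 + be).

Let be0 : 0 < be. Proof. by apply: lt_trans be_half; rewrite invr_gt0. Qed.
Let nu0 : 0 <= nu. Proof. by rewrite invr_ge0 mulr_ge0// ltW. Qed.
Let E0 : 0 <= E. Proof. by rewrite !addr_ge0// ltW. Qed.

Let sb0 : 0 < sqn b.
Proof.
by rewrite lt_neqAle sqn_ge0 andbT eq_sym; apply: contra_neq b0; exact: sqn_eq0.
Qed.

Lemma fp_increment t h y : 0 < t -> 0 <= h -> exists2 c : R, 0 <= c <= h &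
  fp be t (h *: b + y) - fp be t y = - fk be b t (c *: b + y) * h.
Proof.
move=> t0 h0; pose f (r : R) := fp be t (r *: b + y).
have df (r : R) : is_derive r (1 : R) f (- fk be b t (r *: b + y)).
  apply: (is_derive_quad (C := cpi * (\int[mu]_y (dotv b y ^+ 2 * `|wt be t y|)))) => k.
  have -> : f (k *: (1 : R) + r) = fp be t (k *: b + (r *: b + y)).
    by rewrite /f addrA -scalerDl [k *: 1]mulr1.
  by rewrite mulrN opprK; exact: fp_quad.
have [|c] := @MVT_segment R f _ 0 h h0 (fun r _ => df r).
  by apply: continuous_subspaceT; exact: is_derive_continuous df.
rewrite in_itv/= subr0 => ch H; exists c => //.
by rewrite -H /f scale0r add0r.
Qed.

(** The size of [kk] for times in a compact subset of (0, oo), with |b.y| replaced by 1 + |b.y|: the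
    kernel vanishes where b.y = 0, the weight does not. *)
Definition wgt y : R := (1 + `|dotv b y|) * (1 + sqn y) `^ (- E).

Lemma wgt_ge0 y : 0 <= wgt y.
Proof. by rewrite mulr_ge0 ?powR_ge0// addr_ge0. Qed.

Lemma measurable_wgt : measurable_fun setT wgt.
Proof.
apply: measurable_funM.
  by apply: measurable_funD => //; apply: measurableT_comp => //; exact: measurable_dotv.
apply: (measurableT_comp (measurable_powR _)).
by apply: measurable_funD => //; exact: measurable_sqn.
Qed.

Lemma abs_dotv_le v : sqn v <= sqn b -> `|dotv b v| <= sqn b.
Proof.
move=> vb; rewrite -(@ler_pXn2r _ 2)// ?nnegrE ?sqn_ge0//.
rewrite real_normK ?num_real// (le_trans (dotv_cauchy _ _))//.
by rewrite expr2 ler_wpM2l// sqn_ge0.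
Qed.

Lemma powR_E_shift v y : sqn v <= sqn b ->
  (1 + sqn (y + v)) `^ (- E) <= (2 + 2 * sqn b) `^ E * (1 + sqn y) `^ (- E).
Proof.
move=> vb; apply: powR_sqn_mono => //; try exact: sqn1_gt0.
  by have := sqn_ge0 b; lra.
have := sqnD_le (y + v) (- v); rewrite addrK sqnN.
by have := sqn_ge0 (y + v); have := sqn_ge0 b; nra.
Qed.

Lemma wgt_shift : exists2 C : R, 0 < C &
  forall v y, sqn v <= sqn b -> wgt (y + v) <= C * wgt y.
Proof.
have C0 : 0 < (2 + 2 * sqn b) `^ E by rewrite powR_gt0//; have := sqn_ge0 b; lra.
exists ((1 + sqn b) * (2 + 2 * sqn b) `^ E); first by rewrite mulr_gt0// sqn1_gt0.
move=> v y vb; rewrite /wgt mulrACA; apply: ler_pM; rewrite ?powR_ge0//.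
- rewrite dotvDr; have := abs_dotv_le vb; have := ler_normD (dotv b y) (dotv b v).
  by have := normr_ge0 (dotv b y); have := sqn_ge0 b; nra.
- exact: powR_E_shift.
Qed.

Let sqn_scale_nu r y : 0 < r -> sqn y = r `^ (2 * nu) * sqn (r `^ (- nu) *: y).
Proof.
move=> r0; rewrite sqnZ -powR_mulrn ?powR_ge0// -powRrM mulrA -powRD.
  by rewrite (_ : 2 * nu + - nu * 2 = 0) ?powRr0 ?mul1r//; ring.
by rewrite (gt_eqF r0) implybT.
Qed.

Let kk_pre r y : 0 < r ->
  `|kk be b r y| = r `^ (- (n.+1%:R * nu)) * `|fk be b 1 (r `^ (- nu) *: y)|.
Proof. by move=> r0; rewrite kk_scale// normrM ger0_norm ?powR_ge0// kkE. Qed.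

Let pow_comb r : 0 < r ->
  r `^ (- (n.+1%:R * nu)) * r `^ (- nu) = r `^ (- (n.+2%:R * nu)).
Proof.
move=> r0; rewrite -powRD; last by rewrite (gt_eqF r0) implybT.
by congr (_ `^ _); rewrite -(natr1 n.+1); ring.
Qed.

Lemma kk_upper r0 r1 : 0 < r0 -> exists2 C : R, 0 < C & forall r y, r0 <= r <= r1 ->
  `|kk be b r y| <= C * wgt y.
Proof.
move=> r00; have [c [C [c0 C0 H]]] := fk_bounds be_half be1 b0.
have D0 : 0 < 1 + r1 `^ (2 * nu) by rewrite ltr_pwDl// powR_ge0.
exists (r0 `^ (- (n.+2%:R * nu)) * C * (1 + r1 `^ (2 * nu)) `^ E).
  by rewrite !mulr_gt0 ?powR_gt0.
move=> r y /andP[r0r rr1]; have rp := lt_le_trans r00 r0r.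
rewrite kk_pre//; set z := _ *: y.
have /andP[_ Hz] := H z.
apply: (le_trans (ler_wpM2l (powR_ge0 _ _) Hz)).
have -> : `|dotv b z| = r `^ (- nu) * `|dotv b y|.
  by rewrite dotvZr normrM ger0_norm// powR_ge0.
have P : (1 + sqn z) `^ (- E) <= (1 + r1 `^ (2 * nu)) `^ E * (1 + sqn y) `^ (- E).
  apply: powR_sqn_mono => //; try exact: sqn1_gt0.
  rewrite (sqn_scale_nu y rp) -/z.
  have : r `^ (2 * nu) <= r1 `^ (2 * nu) by apply: ler_powR2; rewrite ?mulr_ge0 ?(ltW rp).
  by have := sqn_ge0 z; have := powR_ge0 r1 (2 * nu); nra.
have Q : r `^ (- (n.+2%:R * nu)) <= r0 `^ (- (n.+2%:R * nu)).
  by apply: ler_powRN => //; rewrite mulr_ge0.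
have -> : r `^ (- (n.+1%:R * nu)) *
    (C * (r `^ (- nu) * `|dotv b y| * (1 + sqn z) `^ (- E))) =
    r `^ (- (n.+2%:R * nu)) * C * `|dotv b y| * (1 + sqn z) `^ (- E).
  by rewrite -pow_comb//; ring.
apply: (@le_trans _ _ (r0 `^ (- (n.+2%:R * nu)) * C * (1 + `|dotv b y|) *
   ((1 + r1 `^ (2 * nu)) `^ E * (1 + sqn y) `^ (- E)))).
  apply: ler_pM; rewrite ?mulr_ge0 ?powR_ge0 ?(ltW C0)//.
  apply: ler_pM; rewrite ?mulr_ge0 ?powR_ge0 ?(ltW C0) ?lerDr//.
  by rewrite ler_wpM2r// ltW.
by rewrite /wgt le_eqVlt; apply/orP; left; apply/eqP; ring.
Qed.

Lemma kk_lower r0 r1 : 0 < r0 -> exists2 C : R, 0 < C & forall r y, r0 <= r <= r1 ->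
  `|dotv b y| * (1 + sqn y) `^ (- E) <= C * `|kk be b r y|.
Proof.
move=> r00; have [c [C [c0 C0 H]]] := fk_bounds be_half be1 b0.
have D0 : 0 < 1 + r0 `^ (- (2 * nu)) by rewrite ltr_pwDl// powR_ge0.
have r10 : 0 < 1 + r1 `^ (n.+2%:R * nu) by rewrite ltr_pwDl// powR_ge0.
exists (c^-1 * (1 + r1 `^ (n.+2%:R * nu)) * (1 + r0 `^ (- (2 * nu))) `^ E).
  by rewrite !mulr_gt0 ?invr_gt0 ?powR_gt0.
move=> r y /andP[r0r rr1]; have rp := lt_le_trans r00 r0r.
rewrite kk_pre//; set z := _ *: y.
have /andP[Hz _] := H z.
have bz : `|dotv b z| = r `^ (- nu) * `|dotv b y|.
  by rewrite dotvZr normrM ger0_norm// powR_ge0.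
have P : (1 + sqn y) `^ (- E) <= (1 + r0 `^ (- (2 * nu))) `^ E * (1 + sqn z) `^ (- E).
  apply: powR_sqn_mono => //; try exact: sqn1_gt0.
  rewrite /z sqnZ -powR_mulrn ?powR_ge0// -powRrM mulNr (mulrC nu).
  have : r `^ (- (2 * nu)) <= r0 `^ (- (2 * nu)) by apply: ler_powRN; rewrite // mulr_ge0.
  by have := sqn_ge0 y; have := powR_ge0 r0 (- (2 * nu)); nra.
have Q : 1 <= (1 + r1 `^ (n.+2%:R * nu)) * r `^ (- (n.+2%:R * nu)).
  rewrite powRN ler_pdivlMr ?powR_gt0// mul1r.
  apply: (@le_trans _ _ (r1 `^ (n.+2%:R * nu))); last by rewrite lerDr.
  by apply: ler_powR2; rewrite ?mulr_ge0 ?(ltW rp).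
apply: (le_trans (ler_wpM2l (normr_ge0 _) P)).
have K : c * (`|dotv b y| * (1 + sqn z) `^ (- E)) * r `^ (- nu) <= `|fk be b 1 z|.
  by apply: le_trans Hz; rewrite bz le_eqVlt; apply/orP; left; apply/eqP; ring.
have -> : c^-1 * (1 + r1 `^ (n.+2%:R * nu)) * (1 + r0 `^ (- (2 * nu))) `^ E *
    (r `^ (- (n.+1%:R * nu)) * `|fk be b 1 z|) =
    (1 + r0 `^ (- (2 * nu))) `^ E * (c^-1 * (1 + r1 `^ (n.+2%:R * nu)) *
     r `^ (- (n.+1%:R * nu)) * `|fk be b 1 z|) by ring.
rewrite mulrCA ler_wpM2l ?powR_ge0//.
apply: le_trans (ler_wpM2l _ K); last first.
  by rewrite !mulr_ge0 ?powR_ge0 ?invr_ge0 ?(ltW c0) ?(ltW r10).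
rewrite [leRHS](_ : _ = ((1 + r1 `^ (n.+2%:R * nu)) * r `^ (- (n.+2%:R * nu))) *
   (`|dotv b y| * (1 + sqn z) `^ (- E))); last first.
  by rewrite -pow_comb//; field; rewrite gt_eqF.
by rewrite ler_peMl ?mulr_ge0 ?powR_ge0.
Qed.

(** The numbers b.y and b.(y + b) differ by |b|^2, so they are not both small; the kernel at the two
    points together controls the weight. *)
Lemma wgt_le_kk r0 r1 : 0 < r0 -> exists2 C : R, 0 < C & forall r y, r0 <= r <= r1 ->
  wgt y <= C * (`|kk be b r y| + `|kk be b r (y + b)|).
Proof.
move=> r00; have [C C0 H] := kk_lower r1 r00.
pose S : R := 1 + (2 + 2 * sqn b) `^ E.
have S0 : 0 < S by rewrite ltr_pwDl// powR_ge0.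
have s10 : 0 < 1 + (sqn b)^-1 by rewrite ltr_pwDl// invr_ge0 ltW.
exists ((1 + (sqn b)^-1) * S * C); first by rewrite !mulr_gt0.
move=> r y rr.
have B : 1 + `|dotv b y| <= (1 + (sqn b)^-1) * (`|dotv b y| + `|dotv b (y + b)|).
  have : 1 <= (sqn b)^-1 * (`|dotv b y| + `|dotv b (y + b)|).
    rewrite ler_pdivlMl// mulr1 dotvDr dotvv.
    have := ler_normB (dotv b y + sqn b) (dotv b y).
    rewrite addrAC subrr add0r (gtr0_norm sb0); lra.
  by have := normr_ge0 (dotv b (y + b)); nra.
have P : (1 + sqn y) `^ (- E) <= (2 + 2 * sqn b) `^ E * (1 + sqn (y + b)) `^ (- E).
  by have := @powR_E_shift (- b) (y + b); rewrite sqnN addrK; exact.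
have H1 := H r y rr; have H2 := H r (y + b) rr.
apply: (@le_trans _ _ ((1 + (sqn b)^-1) * (S * (`|dotv b y| * (1 + sqn y) `^ (- E) +
     `|dotv b (y + b)| * (1 + sqn (y + b)) `^ (- E))))).
  apply: (le_trans (ler_wpM2r (powR_ge0 _ _) B)).
  rewrite -mulrA ler_wpM2l ?(ltW s10)// mulrDl mulrDr lerD//.
    by rewrite ler_peMl ?mulr_ge0 ?powR_ge0// lerDl powR_ge0.
  apply: (le_trans (ler_wpM2l (normr_ge0 _) P)).
  by rewrite mulrCA ler_wpM2r ?mulr_ge0 ?powR_ge0// lerDr.
rewrite -!mulrA ler_pM2l// ler_pM2l// mulrDr; exact: lerD.
Qed.

Let tailE y : (1 + sqn y) * (1 + sqn y) `^ (- E) = (1 + sqn y) `^ (- (n%:R / 2 + be)).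
Proof.
rewrite -{1}(powRr1 (ltW (sqn1_gt0 y))) -powRD; last by rewrite (gt_eqF (sqn1_gt0 y)) implybT.
by congr (_ `^ _); ring.
Qed.

(** The second factor 1 + |b.y| pays for (1 + |b.(y - z)|) <= (1 + |b.y|) (1 + |b.z|); the product
    is still integrable. *)
Definition wgt2 y : R := (1 + `|dotv b y|) * wgt y.

Let L1_tail : L1 mu (fun y => (1 + sqn y) `^ (- (n%:R / 2 + be))).
Proof.
have [c [C [c0 C0 H]]] := @fp_bounds R n be be_half be1.
apply: (@L1_le _ _ _ _ _ (fun y => c^-1 * fp be 1 y)).
- apply: (measurableT_comp (measurable_powR _)).
  by apply: measurable_funD => //; exact: measurable_sqn.
- move=> y; rewrite ger0_norm ?powR_ge0// ler_pdivlMl//.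
  by have /andP[] := H y.
- by apply: L1Z; exact: L1_fp_space.
Qed.


Lemma L1_wgt2 : L1 mu wgt2.
Proof.
apply: (@L1_le _ _ _ _ _ (fun y => (2 + 2 * sqn b) * (1 + sqn y) `^ (- (n%:R / 2 + be)))).
- apply: measurable_funM; last exact: measurable_wgt.
  by apply: measurable_funD => //; apply: measurableT_comp => //; exact: measurable_dotv.
- move=> y; rewrite ger0_norm; last by rewrite mulr_ge0 ?wgt_ge0// addr_ge0.
  rewrite -tailE /wgt2 /wgt !mulrA ler_wpM2r ?powR_ge0//.
  have H := dotv_cauchy b y; have : `|dotv b y| ^+ 2 = dotv b y ^+ 2 by rewrite real_normK// num_real.
  have := sqr_ge0 (`|dotv b y| - 1); have := sqn_ge0 y; have := sqn_ge0 b; nra.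
- exact: L1Z.
Qed.

Let wgt_split y z : sqn y <= 4 * sqn (y - z) ->
  wgt (y - z) * wgt z <= 4 `^ E * wgt y * wgt2 z.
Proof.
move=> yz.
have P : (1 + sqn (y - z)) `^ (- E) <= 4 `^ E * (1 + sqn y) `^ (- E).
  by apply: powR_sqn_mono => //; try exact: sqn1_gt0; have := sqn_ge0 (y - z); lra.
have Q : 1 + `|dotv b (y - z)| <= (1 + `|dotv b y|) * (1 + `|dotv b z|).
  rewrite dotvBr; have := ler_normB (dotv b y) (dotv b z).
  by have := normr_ge0 (dotv b y); have := normr_ge0 (dotv b z); nra.
rewrite /wgt2 [leRHS]mulrA ler_wpM2r ?wgt_ge0//.
rewrite [leRHS](_ : _ = ((1 + `|dotv b y|) * (1 + `|dotv b z|)) * (4 `^ E * (1 + sqn y) `^ (- E))); last first.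
  by rewrite /wgt; ring.
by apply: ler_pM; rewrite ?powR_ge0// addr_ge0.
Qed.

(** At least one of |y - z| and |z| is at least |y| / 2, so the corresponding weight is comparable
    to the weight at y. This makes the weight stable under convolution. *)
Lemma wgt_conv_pw y z :
  wgt (y - z) * wgt z <= 4 `^ E * wgt y * (wgt2 z + wgt2 (y - z)).
Proof.
have w0 x : 0 <= wgt2 x by rewrite mulr_ge0 ?wgt_ge0// addr_ge0.
have c0 : 0 <= 4 `^ E * wgt y by rewrite mulr_ge0 ?powR_ge0 ?wgt_ge0.
have [yz|yz] := leP (sqn y) (4 * sqn (y - z)).
  by apply: (le_trans (wgt_split yz)); rewrite ler_wpM2l// lerDl.
have yz' : sqn y <= 4 * sqn (y - (y - z)).
  rewrite opprB addrC subrK; have := sqnD_le (y - z) z; rewrite subrK; lra.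
have := wgt_split yz'; have -> : y - (y - z) = z by rewrite opprB addrC subrK.
rewrite mulrC => H.
by apply: (le_trans H); rewrite ler_wpM2l// lerDr.
Qed.

Lemma wgt_conv : exists2 C : R, 0 < C & forall y,
  L1 mu (fun z => wgt (y - z) * wgt z) /\ \int[mu]_z (wgt (y - z) * wgt z) <= C * wgt y.
Proof.
pose I := \int[mu]_z wgt2 z.
have I0 : 0 <= I by apply: Rint_ge0 => z; rewrite mulr_ge0 ?wgt_ge0// addr_ge0.
exists (4 `^ E * (I + I + 1)); first by rewrite mulr_gt0 ?powR_gt0// ltr_wpDl ?addr_ge0.
move=> y; have lS : L1 mu (fun z => 4 `^ E * wgt y * (wgt2 z + wgt2 (y - z))).
  by apply: L1Z; apply: L1D; [exact: L1_wgt2|exact: L1_shift L1_wgt2].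
have ww0 z : 0 <= wgt (y - z) * wgt z by rewrite mulr_ge0 ?wgt_ge0.
have lw : L1 mu (fun z => wgt (y - z) * wgt z).
  apply: L1_le lS; last by move=> z; rewrite ger0_norm// wgt_conv_pw.
  apply: measurable_funM; last exact: measurable_wgt.
  apply: (measurableT_comp measurable_wgt).
  by apply: measurable_fun_subv => //; exact: measurable_cst.
split=> //; apply: (le_trans (ler_Rint lw lS (wgt_conv_pw y))).
rewrite RintZ; last by apply: L1D; [exact: L1_wgt2|exact: L1_shift L1_wgt2].
rewrite RintD; [|exact: L1_wgt2|exact: L1_shift L1_wgt2].
rewrite (Rint_shift _ L1_wgt2) -/I mulrAC ler_wpM2r ?wgt_ge0//.
by rewrite ler_wpM2l ?powR_ge0// lerDl.
Qed.

(** Mean value theorem along b. The increment decays one power faster than the kernel, which itself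
    is not bounded by the weight. *)
Lemma pk_diff_wgt t : 0 < t -> exists2 C : R, 0 < C & forall y,
  `|pk be t y - pk be t (y + b)| <= C * wgt y.
Proof.
move=> t0; have [C C0 H] := kk_upper t t0; have [D D0 HD] := wgt_shift.
exists (C * D); first exact: mulr_gt0.
move=> y; have [c /andP[c0 c1]] := fp_increment y t0 (@ler01 R).
rewrite scale1r mulr1 !pkE// distrC (addrC y) => ->; rewrite normrN.
rewrite -(kkE be b (c *: b + y) t0).
apply: (le_trans (H t _ _)); first by rewrite !lexx.
rewrite -mulrA ler_pM2l// (addrC _ y); apply: HD.
rewrite sqnZ ler_piMl ?sqn_ge0//; by rewrite expr2 mulr_ile1.
Qed.

End weight.

Section periodic.
Context {R : realType} {n : nat}.
Local Notation mu := (lebesgue_rV n).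

(** The integral of |H| psi(. + k b), with psi = 1 / (1 + (b.y)^2), does not depend on k by
    periodicity, and tends to 0 as k grows by dominated convergence. *)
Lemma L1_periodic_eq0 (H : 'rV[R]_n -> R) (b : 'rV[R]_n) : b != 0 ->
  L1 mu H -> (forall x, H (x + b) = H x) -> {ae mu, forall x, H x = 0}.
Proof.
move=> b0 lH Hb.
have sb0 : 0 < sqn b.
  by rewrite lt_neqAle sqn_ge0 andbT eq_sym; apply: contra_neq b0; exact: sqn_eq0.
pose psi (y : 'rV[R]_n) : R := (1 + dotv b y ^+ 2)^-1.
have psi0 y : 0 < psi y by rewrite invr_gt0 ltr_pwDl// sqr_ge0.
have psi1 y : psi y <= 1 by rewrite invf_le1 ?ltr_pwDl ?sqr_ge0// lerDl sqr_ge0.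
have mpsi : measurable_fun setT psi.
  have -> : psi = (fun y => (1 + dotv b y ^+ 2) `^ (-1)).
    by apply/funext => y; rewrite powR_inv1// addr_ge0// sqr_ge0.
  apply: (measurableT_comp (measurable_powR _)); apply: measurable_funD => //.
  by apply: measurable_funX; exact: measurable_dotv.
have lHp : L1 mu (fun x => `|H x| * psi x).
  under eq_fun do rewrite mulrC; apply: (L1_bddM (c := 1)) => //; last exact: L1_norm.
  by move=> x; rewrite ger0_norm// ltW.
have HE (k : nat) x : H (x + k%:R *: b) = H x.
  elim: k => [|k IH]; first by rewrite scale0r addr0.
  by rewrite -natr1 scalerDl scale1r addrA Hb.
have E k : \int[mu]_x (`|H x| * psi (x + k%:R *: b)) = \int[mu]_x (`|H x| * psi x).
  rewrite -(Rint_transl (k%:R *: b) lHp); apply: eq_Rintegral => x _.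
  by rewrite HE.
have C : (fun k => \int[mu]_x (`|H x| * psi (x + k%:R *: b))) @ \oo --> \int[mu]_x (0 : R).
  apply: (Rint_cvg (g := fun x => `|H x|)) => //.
  - move=> k; apply: measurable_funM.
      by apply: measurableT_comp => //; exact: L1_measurable lH.
    have := measurableT_comp mpsi (measurable_affine 1 (k%:R *: b)).
    by congr measurable_fun; apply/funext => x /=; rewrite scale1r addrC.
  - exact: L1_norm.
  - move=> x; rewrite -[X in _ --> X](mulr0 `|H x|); apply: cvgM; first exact: cvg_cst.
    apply/cvgrPdist_le => e e0.
    have := nbhs_infty_ger ((e^-1 - dotv b x) / sqn b).
    apply: filterS => k /= kb; rewrite sub0r normrN (gtr0_norm (psi0 _)).
    rewrite /psi dotvDr dotvZr dotvv.
    have ey : e^-1 <= dotv b x + k%:R * sqn b by rewrite -lerBlDl -ler_pdivrMr.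
    rewrite -[leRHS]invrK lef_pV2 ?posrE ?invr_gt0 ?ltr_pwDl ?sqr_ge0//.
    apply: (le_trans ey); set y := _ + _.
    by have := sqr_ge0 (y - 1); have := sqr_ge0 y; nra.
  - move=> k x; rewrite normrM normr_id ger0_norm ?(ltW (psi0 _))//.
    by rewrite ler_piMr.
have I0 : \int[mu]_x (`|H x| * psi x) = 0.
  have C2 : (fun k : nat => \int[mu]_x (`|H x| * psi (x + k%:R *: b))) @ \oo --> \int[mu]_x (`|H x| * psi x).
    by under eq_fun do rewrite E; exact: cvg_cst.
  have -> : \int[mu]_x (`|H x| * psi x) = \int[mu]_x (0 : R) by exact: (cvg_unique _ C2 C).
  by rewrite /Rintegral integral0.
have := ae_ge0_L1_eq0 lHp (fun x => mulr_ge0 (normr_ge0 _) (ltW (psi0 x))).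
rewrite I0 lexx => /(_ isT); apply: filterS => x /eqP.
by rewrite mulf_eq0 (gt_eqF (psi0 x)) orbF normr_eq0 => /eqP.
Qed.

End periodic.

Lemma subr_swap (R : realType) (x y z w : R) :
  x - y = z - w -> z - x - (w - y) = 0.
Proof. by lra. Qed.

Lemma half_gap (R : realFieldType) (a s : R) : s < a / 2 -> 0 < s -> a / 2 <= a - s <= a.
Proof. by move=> ? ?; apply/andP; split; lra. Qed.

Lemma half_gap1 (R : realFieldType) (a s : R) : a / 2 <= s -> a - s < a / 2 + 1.
Proof. by move=> ?; lra. Qed.

Section semigroup_convol.
Context {R : realType} {n : nat}.
Variable be : R.
Hypotheses (be_half : 2^-1 < be) (be1 : be < 1).
Variable b : 'rV[R]_n.
Implicit Types (x y z : 'rV[R]_n) (t s r : R) (v : 'rV[R]_n -> R).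
Local Notation mu := (lebesgue_rV n).
Local Notation nu := ((2 * be)^-1).

Lemma pk_norm_le t x : `|pk be t x| <= pk be 1 (0 : 'rV[R]_n) * t `^ (- (n%:R * nu)).
Proof. by rewrite ger0_norm ?pk_ge0// pk_le0. Qed.

Lemma L1_pkM t x v : L1 mu v -> L1 mu (fun y => pk be t (x - y) * v y).
Proof.
move=> lv; apply: (L1_bddM (c := pk be 1 (0 : 'rV[R]_n) * t `^ (- (n%:R * nu)))) => //.
- apply: measurable_pkT => //.
  by apply: measurable_fun_subv => //; exact: measurable_cst.
- by move=> y; exact: pk_norm_le.
Qed.

Lemma L1_convol_pk t v : L1 mu v -> L1 mu (convol (pk be t) v).
Proof. by move=> lv; apply: L1_conv => //; exact: L1_pk. Qed.

Lemma convol_pk_semigroup t s v x : 0 < t -> 0 < s -> L1 mu v ->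
  convol (pk be t) (convol (pk be s) v) x = convol (pk be (t + s)) v x.
Proof.
move=> t0 s0 lv; have lp := @L1_pk R n be be_half be1 s.
pose c := pk be 1 (0 : 'rV[R]_n) * t `^ (- (n%:R * nu)).
pose F (w : 'rV[R]_n * 'rV[R]_n) : R := pk be t (x - w.1) * (pk be s (w.1 - w.2) * v w.2).
have lF : L1 (mu \x mu)%E F.
  apply: (L1_bddM (c := c)) (L1_conv_kernel lp lv); last by move=> w; exact: pk_norm_le.
  apply: measurable_pkT => //.
  by apply: measurable_fun_subv; [exact: measurable_cst|exact: measurable_fst].
transitivity (\int[mu]_y \int[mu]_z F (y, z)).
  apply: eq_Rintegral => y _; rewrite /F/= /convol RintZ//; exact: L1_pkM.
rewrite (Rint_fubini lF); apply: eq_Rintegral => z _; rewrite /F/=.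
under eq_Rintegral do rewrite mulrA.
rewrite RintZr; last first.
  apply: L1_pkM; exact: (L1_transl (- z) lp).
congr (_ * _); rewrite -(pk_semigroup be_half be1 (x - z) t0 s0).
have l : L1 mu (fun y => pk be t (x - z - y) * pk be s y) by exact: L1_pkM.
rewrite -(Rint_transl (- z) l); apply: eq_Rintegral => y _.
by congr (pk _ _ _ * _); rewrite opprB addrA subrK.
Qed.

Lemma pk_kk_semigroup t r x z : 0 < t -> 0 < r ->
  \int[mu]_y (pk be t (x - y) * kk be b r (y - z)) = kk be b (r + t) (x - z).
Proof.
move=> t0 r0; rewrite -(kk_semigroup be_half be1 b (x - z) r0 t0).
have lk := L1_kk be_half be1 b r.
have l : L1 mu (fun y => kk be b r (x - z - y) * pk be t y).
  under eq_fun do rewrite mulrC.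
  apply: (L1_bddM (c := pk be 1 (0 : 'rV[R]_n) * t `^ (- (n%:R * nu)))) (L1_shift (x - z) lk).
    by apply: measurable_pkT => //; exact: measurable_cst.
  by move=> y; exact: pk_norm_le.
rewrite -[RHS](Rint_shift x l); apply: eq_Rintegral => y _.
by rewrite mulrC (_ : x - z - (x - y) = y - z)// opprB addrC addrA subrK.
Qed.

End semigroup_convol.

(** * The equation restarted at a positive time *)

Section restart.
Context {R : realType} {n : nat}.
Variable be : R.
Hypotheses (be_half : 2^-1 < be) (be1 : be < 1).
Variables (b : 'rV[R]_n) (q : R) (u0 : 'rV[R]_n -> R) (u : R -> 'rV[R]_n -> R).
Hypothesis q0 : 0 < q.
Hypothesis lu0 : L1 (lebesgue_rV n) u0.
Hypothesis hu : mild_solution (2 * be) q b u0 u.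
Local Notation mu := (lebesgue_rV n).
Local Notation nu := ((2 * be)^-1).
Hypothesis mu0 : (0 < mu [set: 'rV[R]_n])%E.
Implicit Types (x y z : 'rV[R]_n) (t s r T a : R).
Local Notation G := (mildG q u).

Let be0 : 0 < be. Proof. by apply: lt_trans be_half; rewrite invr_gt0. Qed.
Let nu1 : nu < 1. Proof. by rewrite invf_lt1 ?mulr_gt0//; move: be_half; lra. Qed.

Lemma nonlin_norm (v : R) : `|nonlin q v| = `|v| * `|v| `^ q.
Proof. by rewrite /nonlin normrM (ger0_norm (powR_ge0 _ _)). Qed.

Lemma nonlin_le (v M : R) : `|v| <= M -> `|nonlin q v| <= M `^ q * `|v|.
Proof.
move=> vM; rewrite nonlin_norm mulrC ler_wpM2r//.
by apply: ler_powR2 => //; exact: ltW.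
Qed.

Lemma mildG_slice a T : 0 < a -> exists2 M : R, 0 <= M & forall s, a <= s <= T ->
  L1 mu (fun z => G (s, z)) /\ \int[mu]_z `|G (s, z)| <= M.
Proof.
move=> a0; have [M M0 HM] := mild_bdd_loc hu mu0 T a0.
have [B B0 HB] := mild_L1_loc hu T.
exists (M `^ q * B); first by rewrite mulr_ge0 ?powR_ge0.
move=> s /andP[as_ sT]; have s0 := lt_le_trans a0 as_.
have aeG : {ae mu, forall z, nonlin q (u s z) = G (s, z)}.
  by apply: filterS (mildU_ae hu mu0 s0) => z; rewrite /mildG => ->.
have lus := mild_L1 hu (ltW s0).
have Mas : {ae mu, forall x, `|u s x| <= M} by apply: HM; rewrite as_.
have mG : measurable_fun setT (fun z => G (s, z)).
  exact: (measurableT_comp (measurable_mildG hu) (pair1_measurable s)).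
have leG : {ae mu, forall z, `|G (s, z)| <= M `^ q * `|u s z|}.
  by apply: filterS2 aeG Mas => z <- H; exact: nonlin_le.
have lG : L1 mu (fun z => G (s, z)).
  pose g z := Num.min `|G (s, z)| (M `^ q * `|u s z|).
  have lg : L1 mu g.
    apply: (@L1_le _ _ _ _ _ (fun z => M `^ q * `|u s z|)).
    - apply: measurable_minr; first exact: measurableT_comp.
      by apply: measurable_funM => //; apply: measurableT_comp => //; exact: L1_measurable lus.
    - move=> z; rewrite ger0_norm ?ge_min ?lexx ?orbT//.
      by rewrite le_min normr_ge0 mulr_ge0 ?powR_ge0.
    - by apply: L1Z; exact: L1_norm.
  have : L1 mu (fun z => `|G (s, z)|).
    apply: (ae_L1 lg); first exact: measurableT_comp.
    by apply: filterS leG => z H; rewrite /g min_l.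
  by apply: L1_le => // z.
split=> //; apply: (@le_trans _ _ (\int[mu]_z (M `^ q * `|u s z|))).
  by apply: ae_ler_Rint => //; [exact: L1_norm|apply: L1Z; exact: L1_norm].
rewrite RintZ; last exact: L1_norm.
by rewrite ler_wpM2l ?powR_ge0//; apply: HB; rewrite ltW.
Qed.

Definition cutG a (p : R * 'rV[R]_n) : R := if a <= p.1 then G p else 0.

Lemma measurable_cutG a : measurable_fun setT (cutG a).
Proof.
apply: measurable_fun_ifT => //; last exact: (measurable_mildG hu).
by apply: measurable_fun_ler => //; exact: measurable_fst.
Qed.

Lemma L1_hpow_cutG a T1 T : 0 < a ->
  L1 (@stm R n) (fun p => hpow nu T1 (T - p.1) * `|cutG a p|).
Proof.
move=> a0; have [M M0 HM] := mildG_slice T a0.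
have [T10|T10] := leP T1 0.
  rewrite (_ : (fun p => _) = fun=> 0); first exact: L1_0.
  apply/funext => p; rewrite /hpow; case: ifP => [/andP[H1 H2]|_]; last by rewrite mul0r.
  by have := lt_trans H1 H2; rewrite ltNge T10.
have [lh _] := hpow_int nu1 T10; have [lhr _] := L1_reflect T lh.
have mf : measurable_fun setT (fun p : R * 'rV[R]_n => hpow nu T1 (T - p.1) * `|cutG a p|).
  apply: measurable_funM.
    apply: (measurableT_comp (measurable_hpow _ _)).
    by apply: measurable_funB => //; exact: measurable_fst.
  by apply: measurableT_comp => //; exact: measurable_cutG.
have H s : L1 mu (fun z => hpow nu T1 (T - s) * `|cutG a (s, z)|) /\
    \int[mu]_z `|hpow nu T1 (T - s) * `|cutG a (s, z)| | <= hpow nu T1 (T - s) * M.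
  have [sT|sT] := boolP ((a <= s) && (s < T)).
    have /andP[s1 s2] := sT.
    have [|lG iG] := HM s; first by rewrite s1 ltW.
    rewrite /cutG/= s1; split; first by apply: L1Z; exact: L1_norm.
    under eq_Rintegral do rewrite normrM normr_id (ger0_norm (hpow_ge0 _ _ _)).
    by rewrite RintZ ?ler_wpM2l ?hpow_ge0//; exact: L1_norm.
  have Z z : hpow nu T1 (T - s) * `|cutG a (s, z)| = 0.
    rewrite /cutG/=; case: ifPn => as_; last by rewrite normr0 mulr0.
    by move: sT; rewrite as_/= -leNgt => Ts; rewrite /hpow subr_gt0 ltNge Ts/= mul0r.
  split; first by under eq_fun do rewrite Z; exact: L1_0.
  under eq_Rintegral do rewrite Z normr0.
  by rewrite /Rintegral integral0 mulr_ge0 ?hpow_ge0.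
apply: (@L1_prod_iter1 _ _ _ _ _ (@leb R) mu _ mf (fun s => hpow nu T1 (T - s) * M)).
- by move=> s; have [] := H s.
- by under eq_fun do rewrite mulrC; exact: L1Z.
- by move=> s; have [] := H s.
Qed.

Definition duhcut a T x (p : R * 'rV[R]_n) : R := kk be b (T - p.1) (x - p.2) * cutG a p.

Lemma measurable_duhcut a T x : measurable_fun setT (duhcut a T x).
Proof.
apply: measurable_funM; last exact: measurable_cutG.
apply: measurable_kkT => //.
  by apply: measurable_funB => //; exact: measurable_fst.
by apply: measurable_fun_subv; [exact: measurable_cst|exact: measurable_snd].
Qed.

Lemma L1_duhcut a T x : 0 < T -> L1 (@stm R n) (duhcut a T x).
Proof.
move=> T0; have [lD _] := mild_duhamel be_half hu mu0 x T0.
apply: L1_le (L1_norm lD); first exact: measurable_duhcut.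
move=> p; rewrite /duhcut /cutG /duh; case: ifP => _ //.
by rewrite mulr0 normr0.
Qed.

(** [hpow nu (r + 1) r] is r^(-nu) for r > 0 and 0 otherwise, which matches the convention that [kk]
    vanishes at nonpositive times. *)
Lemma kk_int_bound : exists2 C : R, 0 < C & forall r, \int[mu]_y `|kk be b r y| <= C * hpow nu (r + 1) r.
Proof.
have [C C0 H] := kk_bound be_half be1 b; exists C => // r.
have [r0|r0] := leP r 0.
  under eq_Rintegral do rewrite kk0// normr0.
  by rewrite /Rintegral integral0 mulr_ge0 ?hpow_ge0// ltW.
apply: (@le_trans _ _ (\int[mu]_y (C * r `^ (- nu) * pk be r y))).
  apply: ler_Rint; [exact/L1_norm/L1_kk|exact/L1Z/L1_pk|].
  by move=> y; exact: H.
rewrite RintZ; last exact: L1_pk.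
by rewrite Rint_pk// mulr1 /hpow r0 ltrDl ltr01.
Qed.

Lemma L1_duhcut_prod a T : 0 < a ->
  L1 (mu \x @stm R n)%E (fun w : 'rV[R]_n * (R * 'rV[R]_n) => duhcut a T w.1 w.2).
Proof.
move=> a0; have [C C0 HC] := kk_int_bound.
pose f (w : 'rV[R]_n * (R * 'rV[R]_n)) := duhcut a T w.1 w.2.
change (L1 (mu \x @stm R n)%E f).
have mf : measurable_fun setT f.
  apply: measurable_funM; last exact: (measurableT_comp (measurable_cutG a) measurable_snd).
  apply: measurable_kkT => //.
    apply: measurable_funB => //; apply: (measurableT_comp measurable_fst); exact: measurable_snd.
  apply: measurable_fun_subv; first exact: measurable_fst.
  by apply: (measurableT_comp measurable_snd); exact: measurable_snd.
apply: (@L1_prod_iter2 _ _ _ _ _ mu (@stm R n) _ mf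
  (fun p => C * (hpow nu (T - a + 1) (T - p.1) * `|cutG a p|))).
- move=> p /=; rewrite /f/= /duhcut; under eq_fun do rewrite mulrC; apply: L1Z.
  exact: (L1_transl (- p.2) (L1_kk be_half be1 b _)).
- apply: L1Z; exact: L1_hpow_cutG.
- move=> p; rewrite /f/= /duhcut.
  under eq_Rintegral do rewrite normrM.
  have lk := L1_norm (L1_kk be_half be1 b (T - p.1)).
  rewrite RintZr; last exact: (L1_transl (- p.2) lk).
  rewrite (Rint_transl (- p.2) lk) /cutG; case: ifPn => ap; last by rewrite normr0 !mulr0.
  rewrite mulrA ler_wpM2r//; apply: (le_trans (HC _)); rewrite ler_wpM2l ?(ltW C0)//.
  rewrite /hpow; case: (ltP 0 (T - p.1)) => //= Tp.
  by rewrite !ltrDl ltr01 (_ : T - p.1 < T - a + 1)//; move: ap; lra.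
Qed.

Lemma L1_duhcut_x a T : 0 < a -> L1 mu (fun x => \int[@stm R n]_p duhcut a T x p).
Proof. by move=> a0; exact: (L1_Rint1 (L1_duhcut_prod T a0)). Qed.

(** The complement of [cutG]: the nonlinear term before time a. The corresponding part [low a T] of
    the Duhamel integral is what P_(T - a) has to reproduce from [low a a]. *)
Let Gl a (p : R * 'rV[R]_n) : R := if a <= p.1 then 0 else G p.

Let low a T x : R := \int[@stm R n]_p (kk be b (T - p.1) (x - p.2) * Gl a p).

Let measurable_low a T x :
  measurable_fun setT (fun p : R * 'rV[R]_n => kk be b (T - p.1) (x - p.2) * Gl a p).
Proof.
apply: measurable_funM.
  apply: measurable_kkT => //.
    by apply: measurable_funB => //; exact: measurable_fst.
  by apply: measurable_fun_subv; [exact: measurable_cst|exact: measurable_snd].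
apply: measurable_fun_ifT => //; last exact: (measurable_mildG hu).
by apply: measurable_fun_ler => //; exact: measurable_fst.
Qed.

Let L1_low a T x : 0 < T ->
  L1 (@stm R n) (fun p => kk be b (T - p.1) (x - p.2) * Gl a p).
Proof.
move=> T0; have [lD _] := mild_duhamel be_half hu mu0 x T0.
apply: L1_le (L1_norm lD); first exact: measurable_low.
move=> p; rewrite /Gl /duh; case: ifP => _ //.
by rewrite mulr0 normr0.
Qed.

Let duh_low a T x : 0 < T -> \int[@stm R n]_p duh be b q u T x p =
  low a T x + \int[@stm R n]_p duhcut a T x p.
Proof.
move=> T0; rewrite /low -RintD; [|exact: L1_low|exact: L1_duhcut].
apply: eq_Rintegral => p _; rewrite /duh /Gl /duhcut /cutG.
by case: ifP => _; rewrite mulr0 ?add0r ?addr0.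
Qed.

(* Only |b.y|-weighted integrability of the nonlinear term near time 0 is
   available, so P_t cannot be exchanged with the Duhamel integral directly;
   the increment of the kernel along b decays fast enough. *)
Let low_increment a T x : b != 0 -> 0 < a -> a < T ->
  \int[mu]_y ((pk be (T - a) (x - y) - pk be (T - a) (x - y + b)) * low a a y) =
  low a T x - low a T (x + b).
Proof.
move=> b0 a0 aT; have T0 := lt_trans a0 aT.
pose t := T - a; have t0 : 0 < t by rewrite subr_gt0.
pose kb y := pk be t y - pk be t (y + b).
have [C1 C10 H1] := pk_diff_wgt be_half be1 b0 t0.
have a20 : 0 < a / 2 by rewrite divr_gt0.
have [C2 C20 H2] := kk_upper be_half be1 b0 a a20.
have [C3 C30 H3] := wgt_le_kk be_half be1 b0 a a20.
have [C4 C40 H4] := wgt_conv be_half be1 b.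
have [C5 C50 H5] := kk_int_bound.
pose Kb := pk be 1 (0 : 'rV[R]_n) * t `^ (- (n%:R * nu)).
have Kb0 : 0 <= Kb by rewrite mulr_ge0 ?powR_ge0 ?pk_ge0.
have lkb : L1 mu kb by apply: L1B; [exact: L1_pk|exact/L1_transl/L1_pk].
have kbK y : `|kb y| <= Kb.
  have := pk_ge0 be_half be1 t y; have := pk_ge0 be_half be1 t (y + b).
  have := pk_le0 be_half be1 t y; have := pk_le0 be_half be1 t (y + b).
  by rewrite -/Kb /kb => ? ? ? ?; rewrite ler_norml; apply/andP; split; lra.
pose F (w : (R * 'rV[R]_n) * 'rV[R]_n) : R :=
  kb (x - w.2) * (kk be b (a - w.1.1) (w.2 - w.1.2) * Gl a w.1).
have mkb : measurable_fun setT kb := L1_measurable lkb.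
have mF : measurable_fun setT F.
  apply: measurable_funM.
    apply: (measurableT_comp mkb).
    by apply: measurable_fun_subv; [exact: measurable_cst|exact: measurable_snd].
  apply: measurable_funM.
    apply: measurable_kkT => //.
      by apply: measurable_funB => //; apply: (measurableT_comp measurable_fst); exact: measurable_fst.
    apply: measurable_fun_subv; first exact: measurable_snd.
    by apply: (measurableT_comp measurable_snd); exact: measurable_fst.
  apply: (measurableT_comp _ measurable_fst).
  apply: measurable_fun_ifT => //; last exact: (measurable_mildG hu).
  by apply: measurable_fun_ler => //; exact: measurable_fst.
have lk s : L1 mu (kk be b s) by exact: L1_kk.
have lFp p : L1 mu (fun y => F (p, y)).
  rewrite /F/=; apply: (L1_bddM (c := Kb)) => [|y|].
  - apply: (measurableT_comp mkb).
    by apply: measurable_fun_subv => //; exact: measurable_cst.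
  - exact: kbK.
  - by under eq_fun do rewrite mulrC; apply: L1Z; exact: L1_transl.
pose A x' := fun p => kk be b (a - p.1) (x' - p.2) * Gl a p.
have lF : L1 (@stm R n \x mu)%E F.
  (* Before a / 2 all that is known of G is that the Duhamel integrals at time a converge absolutely
     at each point; convolving two weights and returning to the kernel at x and x + b uses exactly
     this at two points. Between a / 2 and a, G is bounded in L^1 and the kernel has an integrable
     singularity. *)
  pose g p := C1 * C2 * C4 * C3 * (`|A x p| + `|A (x + b) p|) +
    Kb * C5 * (hpow nu (a / 2 + 1) (a - p.1) * `|cutG (a / 2) p|).
  apply: (@L1_prod_iter1 _ _ _ _ _ (@stm R n) mu _ mF g) => //.
    apply: L1D; first apply: L1Z.
      by apply: L1D; apply: L1_norm; exact: L1_low.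
    by apply: L1Z; exact: L1_hpow_cutG.
  move=> p.
  have g1 : 0 <= C1 * C2 * C4 * C3 * (`|A x p| + `|A (x + b) p|).
    by rewrite !mulr_ge0 ?addr_ge0// ltW.
  have g2 : 0 <= Kb * C5 * (hpow nu (a / 2 + 1) (a - p.1) * `|cutG (a / 2) p|).
    apply: mulr_ge0; first by apply: mulr_ge0 => //; exact: ltW.
    by rewrite mulr_ge0 ?hpow_ge0.
  have [ap|pa] := leP a p.1.
    rewrite Rint_eq0; first exact: addr_ge0.
    by move=> y; rewrite /F/= /Gl ap !mulr0 normr0.
  have GE : Gl a p = G p by rewrite /Gl leNgt pa.
  have FE y : `|F (p, y)| = `|kb (x - y)| * `|kk be b (a - p.1) (y - p.2)| * `|G p|.
    by rewrite /F/= normrM (normrM (kk _ _ _ _)) GE mulrA.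
  have lkk : L1 mu (fun y => `|kb (x - y)| * `|kk be b (a - p.1) (y - p.2)|).
    apply: (L1_bddM (c := Kb)).
    - apply: measurableT_comp => //; apply: (measurableT_comp mkb).
      by apply: measurable_fun_subv => //; exact: measurable_cst.
    - by move=> y; rewrite normr_id.
    - exact: (L1_norm (L1_transl (- p.2) (lk _))).
  under eq_Rintegral do rewrite FE.
  rewrite RintZr//.
  have [ap2|ap2] := leP (a / 2) p.1.
    apply: (@le_trans _ _ (Kb * C5 * (hpow nu (a / 2 + 1) (a - p.1) * `|cutG (a / 2) p|))); last by rewrite lerDr.
    rewrite /cutG ap2 [leRHS]mulrA ler_wpM2r//.
    apply: (@le_trans _ _ (\int[mu]_y (Kb * `|kk be b (a - p.1) (y - p.2)|))).
      apply: (ler_Rint lkk).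
        by apply: L1Z; exact: (L1_norm (L1_transl (- p.2) (lk _))).
      by move=> y; exact: (ler_wpM2r (normr_ge0 _) (kbK _)).
    have lnk := L1_norm (lk (a - p.1)).
    rewrite RintZ; last exact: (L1_transl (- p.2) lnk).
    rewrite (Rint_transl (- p.2) lnk) -mulrA ler_wpM2l//.
    apply: (le_trans (H5 _)); rewrite ler_wpM2l ?(ltW C50)//.
    rewrite /hpow subr_gt0 pa /= !ltrDl ltr01.
    by rewrite (half_gap1 ap2).
  have [p0|p0] := leP p.1 0.
    have -> : G p = 0.
      by case: p p0 {ap2 pa GE FE lkk g1 g2} => s z /= s0; rewrite /mildG mildU_le0// /nonlin mul0r.
    by rewrite normr0 mulr0 addr_ge0.
  have rr := half_gap ap2 p0.
  apply: (@le_trans _ _ (C1 * C2 * C4 * C3 * (`|A x p| + `|A (x + b) p|))); last by rewrite lerDl.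
  rewrite /A GE (normrM (kk be b _ (x - _))) (normrM (kk be b _ (x + b - _))) -mulrDl mulrA ler_wpM2r//.
  have [lw iw] := H4 (x - p.2).
  apply: (@le_trans _ _ (\int[mu]_y (C1 * C2 * (wgt be b (x - y) * wgt be b (y - p.2))))).
    apply: ler_Rint => //.
      apply: L1Z; have := L1_transl (- p.2) lw.
      congr L1; apply/funext => y; by rewrite opprB addrA subrK.
    by move=> y; rewrite mulrACA; exact: (ler_pM (normr_ge0 _) (normr_ge0 _) (H1 _) (H2 _ _ rr)).
  have wE : \int[mu]_y (C1 * C2 * (wgt be b (x - y) * wgt be b (y - p.2))) =
      C1 * C2 * \int[mu]_y (wgt be b (x - p.2 - y) * wgt be b y).
    rewrite -(Rint_transl (- p.2) lw) -RintZ; last exact: (L1_transl (- p.2) lw).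
    by apply: eq_Rintegral => y _; rewrite opprB addrA subrK.
  rewrite wE -(mulrA (C1 * C2)) -(mulrA (C1 * C2)) ler_wpM2l ?mulr_ge0 ?(ltW C10) ?(ltW C20)//.
  apply: (le_trans iw); rewrite -mulrA ler_wpM2l ?(ltW C40)//.
  by have := H3 (a - p.1) (x - p.2) rr; rewrite addrAC.
transitivity (\int[mu]_y \int[@stm R n]_p F (p, y)).
  apply: eq_Rintegral => y _; rewrite /F/= /low -RintZ//; exact: L1_low.
rewrite -(Rint_fubini lF) /low -RintB; [|exact: L1_low|exact: L1_low].
apply: eq_Rintegral => p _; rewrite /F/=.
have [ap|pa] := leP a p.1.
  have -> : Gl a p = 0 by rewrite /Gl ap.
  by rewrite Rint_eq0 => [|y]; rewrite ?mulr0 ?subrr.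
have r0 : 0 < a - p.1 by rewrite subr_gt0.
under eq_Rintegral do rewrite mulrA.
rewrite RintZr; last first.
  apply: (L1_bddM (c := Kb)) => //.
  - apply: (measurableT_comp mkb).
    by apply: measurable_fun_subv => //; exact: measurable_cst.
  - exact: (L1_transl (- p.2)).
rewrite -mulrBl; congr (_ * _).
have lpk x' : L1 mu (fun y => pk be t (x' - y) * kk be b (a - p.1) (y - p.2)).
  by apply: L1_pkM => //; exact: (L1_transl (- p.2)).
rewrite (_ : T - p.1 = a - p.1 + t); last by rewrite /t; ring.
rewrite -!pk_kk_semigroup// -RintB//; apply: eq_Rintegral => y _.
by rewrite /kb mulrBl addrAC.
Qed.

(** The defect [H] is what is missing for P_(T - a) to commute with the early part of the Duhamel
    integral. [low_increment] makes it b-periodic; its vanishing, hence the identity, is then only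
    almost everywhere. *)
Theorem restart a T : 0 < a -> a < T ->
  {ae mu, forall x, u T x = convol (pk be (T - a)) (u a) x +
    \int[@stm R n]_p duhcut a T x p}.
Proof.
move=> a0 aT; have T0 := lt_trans a0 aT; have t0 : 0 < T - a by rewrite subr_gt0.
have uE x : u a x = convol (pk be a) u0 x + low a a x.
  have [_ ->] := mild_duhamel be_half hu mu0 x a0; rewrite (duh_low a x a0); congr (_ + _).
  rewrite -[RHS]addr0; congr (_ + _).
  rewrite (_ : (fun p => duhcut a a x p) = fun=> 0); first by rewrite /Rintegral integral0.
  apply/funext => p; rewrite /duhcut /cutG; case: ifPn => ap; last by rewrite mulr0.
  by rewrite kk0 ?mul0r// subr_le0.
have lua := mild_L1 hu (ltW a0); have luT := mild_L1 hu (ltW T0).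
have lpu : L1 mu (convol (pk be a) u0) by exact: L1_convol_pk.
have llow : L1 mu (low a a).
  by have := L1B lua lpu; congr L1; apply/funext => x; rewrite uE addrC addKr.
pose H x := low a T x - convol (pk be (T - a)) (low a a) x.
have uTE x : u T x = convol (pk be (T - a)) (u a) x + \int[@stm R n]_p duhcut a T x p + H x.
  have [_ ->] := mild_duhamel be_half hu mu0 x T0; rewrite (duh_low a x T0).
  have -> : convol (pk be (T - a)) (u a) x =
      convol (pk be T) u0 x + convol (pk be (T - a)) (low a a) x.
    rewrite -{2}(subrK a T) -(convol_pk_semigroup be_half be1 x t0 a0 lu0).
    rewrite -(RintD (L1_pkM be_half be1 (T - a) x lpu) (L1_pkM be_half be1 (T - a) x llow)).
    by apply: eq_Rintegral => y _; rewrite -mulrDr uE.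
  by rewrite /H; ring.
(* Integrability of the defect is indirect: all other terms of the identity [uTE] are in L^1. *)
have lH : L1 mu H.
  have := L1B luT (L1D (L1_convol_pk be_half be1 (T - a) lua) (L1_duhcut_x T a0)).
  by congr L1; apply/funext => x; rewrite uTE addrC addKr.
(* For b = 0 periodicity gives no information, but the Duhamel kernel is identically zero. *)
have [bE|b0] := eqVneq b 0.
  apply: nearW => x; rewrite uTE; suff -> : H x = 0 by rewrite addr0.
  have kz t y : kk be b t y = 0.
    rewrite bE /kk; case: ifP => // _; rewrite /fk.
    by under eq_Rintegral do rewrite dotv0l !mul0r; rewrite /Rintegral integral0 mulr0.
  have lz c d : low c d = fun=> 0.
    apply/funext => y; rewrite /low; under eq_Rintegral do rewrite kz mul0r.
    by rewrite /Rintegral integral0.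
  rewrite /H !lz /convol; under eq_Rintegral do rewrite mulr0.
  by rewrite /Rintegral integral0 subr0.
have Hb x : H (x + b) = H x.
  apply/eqP; rewrite eq_sym -subr_eq0 /H; apply/eqP.
  have := low_increment x b0 a0 aT.
  have -> : \int[mu]_y ((pk be (T - a) (x - y) - pk be (T - a) (x - y + b)) * low a a y) =
      convol (pk be (T - a)) (low a a) x - convol (pk be (T - a)) (low a a) (x + b).
    rewrite /convol -RintB; [|exact: L1_pkM|exact: L1_pkM].
    by apply: eq_Rintegral => y _; rewrite mulrBl (addrAC x).
  exact: subr_swap.
apply: filterS (L1_periodic_eq0 b0 lH Hb) => x Hx.
by rewrite uTE Hx addr0.
Qed.

End restart.

Lemma powR_half (R : realType) (c T : R) : 0 < T -> (T / 2) `^ (- c) * T `^ c = 2 `^ c.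
Proof.
move=> T0; rewrite powRM ?(ltW T0)// mulrAC -powRD ?(gt_eqF T0) ?implybT//.
by rewrite addNr powRr0 mul1r -powR_inv1// -powRrM mulN1r opprK.
Qed.

Lemma quarters_le_half (R : realFieldType) (x y : R) : x <= 4^-1 -> y <= 4^-1 -> x + y <= 2^-1.
Proof. by move=> ? ?; lra. Qed.

Lemma grid_gap (R : realFieldType) (a c s t : R) j : t <= a + j.+1%:R * c ->
  a + j%:R * c < s -> t - s < c.
Proof. by rewrite -natr1 mulrDl mul1r => ? ?; lra. Qed.

(** * Domination by the linear evolution and the limit at time 0 *)

Section beta_majorant.
Context {R : realType}.
Variable nu : R.
Hypotheses (nu0 : 0 < nu) (nu1 : nu < 1).

(** Majorizes the Beta integrand (t - s)^(-nu) (s - a)^(-(1 - nu)): in each half of (a, t) the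
    regular factor is frozen at its value at the midpoint. Since the exponents add up to 1, the
    integral is bounded by [beta_cst] whatever a and t are. *)
Definition beta_maj (a t s : R) : R :=
  ((t - a) / 2) `^ (- nu) * hpow (1 - nu) (t - a) (s - a) +
  ((t - a) / 2) `^ (- (1 - nu)) * hpow nu (t - a) (t - s).

Definition beta_cst : R := 2 `^ nu / nu + 2 `^ (1 - nu) / (1 - nu).

Lemma beta_maj_ge0 a t s : 0 <= beta_maj a t s.
Proof. by rewrite addr_ge0// mulr_ge0 ?powR_ge0 ?hpow_ge0. Qed.

Lemma beta_cst_gt0 : 0 < beta_cst.
Proof. by rewrite addr_gt0// divr_gt0 ?powR_gt0// subr_gt0. Qed.

Lemma L1_transl1 (f : R -> R) (a : R) : L1 leb f ->
  L1 leb (fun s => f (s - a)) /\ \int[leb]_s f (s - a) = \int[leb]_s f s.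
Proof.
move=> lf; have [l1 e1] := L1_reflect 0 lf; have [l2 e2] := L1_reflect a l1.
have E s : 0 - (a - s) = s - a by rewrite sub0r opprB.
split; first by move: l2; under eq_fun do rewrite E.
by rewrite -e1 -e2; apply: eq_Rintegral => s _; rewrite E.
Qed.

Lemma beta_maj_int a t : a < t ->
  L1 leb (beta_maj a t) /\ \int[leb]_s beta_maj a t s <= beta_cst.
Proof.
move=> at_; set T := t - a; have T0 : 0 < T by rewrite subr_gt0.
have m1 : 1 - nu < 1 by rewrite ltrBlDr ltrDl.
have [l1 i1] := hpow_int m1 T0; have [l1' e1] := L1_transl1 a l1.
have [l2 i2] := hpow_int nu1 T0; have [l2' e2] := L1_reflect t l2.
have L : L1 leb (beta_maj a t) by apply: L1D; apply: L1Z.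
split; first exact: L.
rewrite /beta_maj -/T (RintD (L1Z _ l1') (L1Z _ l2')) (RintZ _ l1') (RintZ _ l2') e1 e2.
have E c := powR_half c T0.
apply: lerD.
  apply: (le_trans (ler_wpM2l (powR_ge0 _ _) i1)).
  by rewrite subKr mulrA E.
apply: (le_trans (ler_wpM2l (powR_ge0 _ _) i2)).
by rewrite mulrA E.
Qed.

Lemma beta_maj_ge a t s : a < s -> s < t ->
  (t - s) `^ (- nu) * (s - a) `^ (- (1 - nu)) <= beta_maj a t s.
Proof.
move=> as_ st; have T0 : 0 < (t - a) / 2 by rewrite divr_gt0// subr_gt0 (lt_trans as_).
have mn : 0 <= 1 - nu by rewrite subr_ge0 ltW.
rewrite /beta_maj /hpow subr_gt0 as_ subr_gt0 st/=.
have -> : s - a < t - a by rewrite ltrD2r.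
have -> : t - s < t - a by rewrite ltrD2l ltrN2.
have [H|H] := leP ((t - a) / 2) (t - s).
  apply: (@le_trans _ _ (((t - a) / 2) `^ (- nu) * (s - a) `^ (- (1 - nu)))).
    by rewrite ler_wpM2r ?powR_ge0//; apply: ler_powRN => //; exact: ltW.
  by rewrite lerDl mulr_ge0 ?powR_ge0.
apply: (@le_trans _ _ (((t - a) / 2) `^ (- (1 - nu)) * (t - s) `^ (- nu))).
  rewrite mulrC ler_wpM2r ?powR_ge0//; apply: ler_powRN => //.
  by move: H; lra.
by rewrite lerDr mulr_ge0 ?powR_ge0.
Qed.

End beta_majorant.

Section bootstrap.
Context {R : realType} {n : nat}.
Variable be : R.
Hypotheses (be_half : 2^-1 < be) (be1 : be < 1).
Variables (b : 'rV[R]_n) (q : R) (u0 : 'rV[R]_n -> R) (u : R -> 'rV[R]_n -> R).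
Hypothesis q0 : 0 < q.
Hypothesis lu0 : L1 (lebesgue_rV n) u0.
Hypothesis hu : mild_solution (2 * be) q b u0 u.
Local Notation mu := (lebesgue_rV n).
Local Notation nu := ((2 * be)^-1).
Hypothesis mu0 : (0 < mu [set: 'rV[R]_n])%E.
Implicit Types (x y z : 'rV[R]_n) (t s r T a : R).
Local Notation G := (mildG q u).

Let be0 : 0 < be. Proof. by apply: lt_trans be_half; rewrite invr_gt0. Qed.
Let nu0 : 0 < nu. Proof. by rewrite invr_gt0 mulr_gt0. Qed.
Let nu1 : nu < 1. Proof. by rewrite invf_lt1 ?mulr_gt0//; move: be_half; lra. Qed.

Lemma leb_neq a : {ae (@leb R), forall s, s != a}.
Proof.
exists [set a]; split; first exact: measurable_set1.
  exact: lebesgue_measure_set1.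
by move=> s /= /negP; rewrite negbK => /eqP.
Qed.

Lemma L1_pk_cst t x (m : R) : L1 mu (fun y => pk be t (x - y) * m).
Proof.
under eq_fun do rewrite mulrC; apply: L1Z.
exact: (L1_shift x (L1_pk be_half be1 t)).
Qed.

Lemma Rint_pk_cst t x (m : R) : 0 < t -> \int[mu]_y (pk be t (x - y) * m) = m.
Proof.
move=> t0; rewrite RintZr; last exact: (L1_shift x (L1_pk be_half be1 t)).
by rewrite (Rint_shift x (L1_pk be_half be1 t)) Rint_pk// mul1r.
Qed.

(** Separates time from space: [H] collects the singularities in s, while the profile W(s) only has
    to satisfy P_(t - s) W(s) <= Wt at x, which for W(s) = P_s v is the semigroup law. *)
Lemma duh_estimate (C : R) a t x (H : R -> R) (W : R -> 'rV[R]_n -> R) (Wt : R) :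
  (forall t x, 0 < t -> `|kk be b t x| <= C * t `^ (- nu) * pk be t x) ->
  0 <= a -> a < t -> L1 leb H -> (forall s, 0 <= H s) -> 0 <= Wt ->
  (forall s, a < s -> s < t ->
    {ae mu, forall z, C * (t - s) `^ (- nu) * `|G (s, z)| <= H s * W s z}) ->
  (forall s, a < s -> s < t -> L1 mu (fun z => pk be (t - s) (x - z) * W s z)) ->
  (forall s, a < s -> s < t -> \int[mu]_z (pk be (t - s) (x - z) * W s z) <= Wt) ->
  `|\int[@stm R n]_p duhcut be b q u a t x p| <= (\int[leb]_s H s) * Wt.
Proof.
move=> HC a0 at_ lH H0 Wt0 HG lW IW; have t0 := le_lt_trans a0 at_.
have lD := L1_norm (L1_duhcut be_half hu mu0 a x t0).
apply: (le_trans (ler_norm_Rint (L1_duhcut be_half hu mu0 a x t0))).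
rewrite -[leLHS](Rint_prod1 lD) -RintZr//.
apply: ae_ler_Rint; [exact: (L1_Rint1 lD)|by under eq_fun do rewrite mulrC; exact: L1Z|].
(* The hypotheses concern s > a, whereas [cutG] keeps s = a; this single time is discarded. *)
apply: filterS (leb_neq a) => s sa.
have Z0 : (s < a) || (t <= s) -> \int[mu]_z `|duhcut be b q u a t x (s, z)| <= H s * Wt.
  move=> out; have Z z : duhcut be b q u a t x (s, z) = 0.
    rewrite /duhcut /cutG/=; case/orP: out => [sa'|ts].
      by rewrite leNgt sa'/= mulr0.
    by rewrite kk0 ?mul0r// subr_le0.
  under eq_Rintegral do rewrite Z normr0.
  by rewrite /Rintegral integral0 mulr_ge0.
have [sa'|as'] := ltP s a; first by rewrite Z0// sa'.
have [ts|st] := leP t s; first by rewrite Z0// ts orbT.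
have as_ : a < s by rewrite lt_neqAle eq_sym sa.
have s0 := le_lt_trans a0 as_.
have [M M0 HM] := mildG_slice q0 hu mu0 s s0.
have [lG _] := HM s (ltac:(by rewrite lexx)).
have lkG : L1 mu (fun z => `|duhcut be b q u a t x (s, z)|).
  apply: L1_norm; rewrite /duhcut /cutG/= (ltW as_).
  have [C' C'0 HC'] := kk_bound be_half be1 b.
  apply: (L1_bddM (c := C' * (t - s) `^ (- nu) * (pk be 1 (0 : 'rV[R]_n) * (t - s) `^ (- (n%:R * nu))))) => //.
    apply: measurable_kkT => //.
    by apply: measurable_fun_subv => //; exact: measurable_cst.
  move=> z; apply: (le_trans (HC' _ _ _)); first by rewrite subr_gt0.
  by rewrite ler_wpM2l ?pk_le0// mulr_ge0 ?powR_ge0// ltW.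
apply: (@le_trans _ _ (\int[mu]_z (H s * (pk be (t - s) (x - z) * W s z)))).
  apply: ae_ler_Rint => //; first by apply: L1Z; exact: lW.
  apply: filterS (HG s as_ st) => z HGz.
  rewrite /duhcut /cutG/= (ltW as_) normrM.
  apply: (le_trans (ler_wpM2r (normr_ge0 _) (HC _ _ _))); first by rewrite subr_gt0.
  rewrite mulrAC mulrC [leRHS]mulrCA ler_wpM2l//; exact: pk_ge0.
by rewrite RintZ ?ler_wpM2l ?IW//; exact: lW.
Qed.

(** If |u| <= 2 P + m, then the Duhamel formula gives |u| <= P + (2 P + m) / 2 = 2 P + m / 2.
    Starting from the a priori bound m = M, the remainder is halved at each round and disappears in
    the limit. *)
Lemma iteration (C : R) a T (M : R) :
  (forall t x, 0 < t -> `|kk be b t x| <= C * t `^ (- nu) * pk be t x) ->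
  0 < a -> 0 <= M -> (forall s, a < s <= T -> {ae mu, forall z, `|u s z| <= M}) ->
  (forall t, a < t <= T -> exists H : R -> R, [/\ L1 leb H, forall s, 0 <= H s,
    \int[leb]_s H s <= 2^-1 & forall s, a < s -> s < t ->
    {ae mu, forall z, C * (t - s) `^ (- nu) * `|u s z| `^ q <= H s}]) ->
  forall t, a < t <= T ->
    {ae mu, forall x, `|u t x| <= 2 * convol (pk be (t - a)) (fun y => `|u a y|) x}.
Proof.
move=> HC a0 M0 HM HH; have lua := mild_L1 hu (ltW a0).
have lnua := L1_norm lua.
pose P t := convol (pk be (t - a)) (fun y => `|u a y|).
have P0 t x : 0 <= P t x by apply: Rint_ge0 => y; rewrite mulr_ge0// pk_ge0.
have lP t : L1 mu (P t) by exact: L1_convol_pk.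
suff claim (k : nat) : forall t, a < t <= T ->
    {ae mu, forall x, `|u t x| <= 2 * P t x + M * 2^-1 ^+ k}.
  move=> t tT; have H : {ae mu, forall x, forall k, `|u t x| <= 2 * P t x + M * 2^-1 ^+ k}.
    by apply: ae_foralln => k; exact: claim.
  apply: filterS H => x Hx; rewrite -[leRHS]addr0 -(mulr0 M).
  have C2 : (fun k => 2 * P t x + M * 2^-1 ^+ k) @ \oo --> 2 * P t x + M * 0.
    apply: cvgD; first exact: cvg_cst.
    apply: cvgM; first exact: cvg_cst.
    by apply: cvg_expr; rewrite ger0_norm ?invr_ge0// invf_lt1// ltr1n.
  rewrite -subr_ge0; apply: (cvgn_ge0 (u := fun k => 2 * P t x + M * 2^-1 ^+ k - `|u t x|)).
    by apply: cvgB => //; exact: cvg_cst.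
  by move=> k; rewrite subr_ge0.
elim: k => [|k IH] t tT.
  rewrite expr0 mulr1; apply: filterS (HM t tT) => x Hx.
  by apply: (le_trans Hx); rewrite lerDr mulr_ge0.
have /andP[at_ tT'] := tT; have [H [lH H0 iH Hs]] := HH t tT.
set m := M * 2^-1 ^+ k; have m0 : 0 <= m by rewrite mulr_ge0// exprn_ge0// invr_ge0.
apply: filterS (restart be_half be1 q0 lu0 hu mu0 a0 at_) => x ->.
apply: (le_trans (ler_normD _ _)).
have c1 : `|convol (pk be (t - a)) (u a) x| <= P t x.
  apply: (le_trans (ler_norm_Rint _)); first exact: L1_pkM.
  rewrite le_eqVlt; apply/orP; left; apply/eqP; apply: eq_Rintegral => y _.
  by rewrite normrM (ger0_norm (pk_ge0 be_half be1 _ _)).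
have WI s : a < s -> s < t ->
  L1 mu (fun z => pk be (t - s) (x - z) * (2 * P s z + m)) /\
  \int[mu]_z (pk be (t - s) (x - z) * (2 * P s z + m)) <= 2 * P t x + m.
  move=> as_ st; have l2 : L1 mu (fun z => pk be (t - s) (x - z) * (2 * P s z)).
    by apply: L1_pkM => //; exact: L1Z.
  have E z : pk be (t - s) (x - z) * (2 * P s z + m) =
    pk be (t - s) (x - z) * (2 * P s z) + pk be (t - s) (x - z) * m by rewrite mulrDr.
  split; first by under eq_fun do rewrite E; apply: L1D => //; exact: L1_pk_cst.
  under eq_Rintegral do rewrite E.
  rewrite RintD//; last exact: L1_pk_cst.
  rewrite Rint_pk_cst ?subr_gt0// lerD2r.
  under eq_Rintegral do rewrite mulrCA.
  rewrite RintZ; last exact: L1_pkM.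
  have ts0 : 0 < t - s by rewrite subr_gt0.
  have sa0 : 0 < s - a by rewrite subr_gt0.
  have S := convol_pk_semigroup be_half be1 x ts0 sa0 lnua.
  rewrite addrA subrK in S.
  have -> : \int[mu]_z (pk be (t - s) (x - z) * P s z) = P t x by exact: S.
  by [].
have D := @duh_estimate C a t x H (fun s z => 2 * P s z + m) (2 * P t x + m) HC
  (ltW a0) at_ lH H0 _ _ (fun s as_ st => (WI s as_ st).1) (fun s as_ st => (WI s as_ st).2).
apply: (le_trans (lerD c1 (D _ _))).
- by rewrite addr_ge0// mulr_ge0.
- move=> s as_ st; have s0 := lt_trans a0 as_.
  have sT : a < s <= T by rewrite as_ (le_trans (ltW st)).
  apply: filterS3 (mildU_ae hu mu0 s0) (Hs s as_ st) (IH s sT) => z Uz Hz IHz.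
  rewrite /mildG Uz nonlin_norm mulrCA mulrC; apply: ler_pM => //.
  by rewrite mulr_ge0 ?powR_ge0// mulr_ge0 ?powR_ge0//; move: (HC 1 0 ltr01); rewrite powR1 mulr1 => /(le_trans (normr_ge0 _)); rewrite pmulr_lge0 ?pk_gt0.
have X0 : 0 <= 2 * P t x + m by rewrite addr_ge0// mulr_ge0.
have := ler_wpM2r X0 iH; rewrite exprSr mulrA -/m; lra.
Qed.

(** Induction over time steps of length [kap]: the gauge and the bound already proved control
    earlier times, while in the last step the crude bound [M] is used. [M] depends on a and T but
    enters only through [kap], so neither the smallness of eta nor T depends on it. *)
Lemma bootstrap (C : R) (eta : R) a T :
  (forall t x, 0 < t -> `|kk be b t x| <= C * t `^ (- nu) * pk be t x) -> 0 < C ->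
  0 <= eta -> C * 2 `^ q * eta * beta_cst nu <= 4^-1 -> 0 < a ->
  (forall s, a < s <= T -> forall x,
    (convol (pk be (s - a)) (fun y => `|u a y|) x) `^ q <= eta * (s - a) `^ (- (1 - nu))) ->
  forall t, a < t <= T ->
    {ae mu, forall x, `|u t x| <= 2 * convol (pk be (t - a)) (fun y => `|u a y|) x}.
Proof.
move=> HC C0 eta0 etas a0 Hg.
have [M' M'0 HM'] := mild_bdd_loc hu mu0 T a0.
pose M := M' + 1; have M0 : 0 < M by rewrite ltr_wpDl.
have HM s : a < s <= T -> {ae mu, forall x, `|u s x| <= M}.
  move=> /andP[as_ sT]; have sT' : a <= s <= T by rewrite ltW.
  by apply: filterS (HM' s sT') => x Hx; rewrite (le_trans Hx)// lerDl.
pose P t := convol (pk be (t - a)) (fun y => `|u a y|).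
have mn0 : 0 < 1 - nu by rewrite subr_gt0.
pose A := C * M `^ q / (1 - nu).
have A0 : 0 < A by rewrite divr_gt0// mulr_gt0// powR_gt0.
(* The step for which the crude part of the majorant integrates to at most 1 / 4; with the 1 / 4
   from the gauge this makes the total 1 / 2 needed by [iteration]. *)
pose kap := (4 * A)^-1 `^ (1 - nu)^-1.
have kap0 : 0 < kap by rewrite powR_gt0// invr_gt0 mulr_gt0.
have kapE : C * M `^ q * (kap `^ (1 - nu) / (1 - nu)) <= 4^-1.
  have -> : kap `^ (1 - nu) = (4 * A)^-1.
    by rewrite /kap -powRrM mulVf ?gt_eqF// powRr1// invr_ge0 mulr_ge0// ltW.
  rewrite le_eqVlt; apply/orP; left; apply/eqP.
  rewrite /A; field.
  apply/and4P; split; rewrite gt_eqF ?powR_gt0//.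
  by rewrite subr_gt0 -ltr_pdivrMl// mulr1.
suff claim (j : nat) : forall t, a < t <= Num.min T (a + j%:R * kap) ->
    {ae mu, forall x, `|u t x| <= 2 * P t x}.
  move=> t /andP[at_ tT]; pose j := Num.truncn ((t - a) / kap).
  have ta0 : 0 <= (t - a) / kap by rewrite divr_ge0// ?ltW// subr_gt0.
  have /andP[_ Hj] := truncn_itv ta0.
  apply: (claim j.+1); rewrite at_ le_min tT/=.
  by rewrite -lerBlDl -ler_pdivrMr// ltW.
elim: j => [|j IH]; first by move=> t; rewrite mul0r addr0 le_min => /andP[at_ /andP[_]]; rewrite leNgt at_.
apply: (iteration (C := C) (M := M)) => //; first exact: ltW.
  by move=> s /andP[as_]; rewrite le_min => /andP[sT _]; apply: HM; rewrite as_.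
move=> t /andP[at_]; rewrite le_min => /andP[tT tj].
have [lb ib] := beta_maj_int nu0 nu1 at_.
have [lh ih] := hpow_int nu1 kap0; have [lh' eh] := L1_reflect t lh.
exists (fun s => C * 2 `^ q * eta * beta_maj nu a t s + C * M `^ q * hpow nu kap (t - s)).
have c1 : 0 <= C * 2 `^ q * eta := mulr_ge0 (mulr_ge0 (ltW C0) (powR_ge0 _ _)) eta0.
have c2 : 0 <= C * M `^ q := mulr_ge0 (ltW C0) (powR_ge0 _ _).
split.
- by apply: L1D; exact: L1Z.
- by move=> s; exact: (addr_ge0 (mulr_ge0 c1 (beta_maj_ge0 _ _ _ _)) (mulr_ge0 c2 (hpow_ge0 _ _ _))).
- rewrite (RintD (L1Z _ lb) (L1Z _ lh')) (RintZ _ lb) (RintZ _ lh') eh.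
  exact: quarters_le_half (le_trans (ler_wpM2l c1 ib) etas) (le_trans (ler_wpM2l c2 ih) kapE).
move=> s as_ st.
(* Up to the last grid point the induction hypothesis applies; after it t - s < kap, where the
   second term of the majorant is active. *)
have [sj|js] := leP s (a + j%:R * kap).
  have sT : a < s <= Num.min T (a + j%:R * kap).
    by rewrite as_ le_min sj andbT (le_trans (ltW st)).
  have sT' : a < s <= T by rewrite as_ (le_trans (ltW st)).
  apply: filterS (IH s sT) => z Hz.
  have P0 : 0 <= P s z by apply: Rint_ge0 => y; rewrite mulr_ge0// pk_ge0.
  have Hq : `|u s z| `^ q <= 2 `^ q * (eta * (s - a) `^ (- (1 - nu))).
    apply: (@le_trans _ _ ((2 * P s z) `^ q)).
      exact: (ler_powR2 (ltW q0) (normr_ge0 _) Hz).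
    by rewrite (powRM _ (ler0n _ 2) P0); apply: ler_wpM2l; [exact: powR_ge0|exact: Hg].
  apply: (@le_trans _ _ (C * 2 `^ q * eta * beta_maj nu a t s)); last first.
    by rewrite lerDl mulr_ge0 ?hpow_ge0.
  apply: (le_trans (ler_wpM2l _ Hq)); first by rewrite mulr_ge0 ?powR_ge0// ltW.
  have := ler_wpM2l c1 (beta_maj_ge nu0 nu1 as_ st); apply: le_trans.
  by rewrite le_eqVlt; apply/orP; left; apply/eqP; ring.
have sT' : a < s <= T by rewrite as_ (le_trans (ltW st)).
apply: filterS (HM s sT') => z Hz.
apply: (@le_trans _ _ (C * M `^ q * hpow nu kap (t - s))); last first.
  by rewrite lerDr mulr_ge0 ?beta_maj_ge0.
have -> : hpow nu kap (t - s) = (t - s) `^ (- nu).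
  by rewrite /hpow subr_gt0 st (grid_gap tj js).
rewrite mulrAC; apply: ler_wpM2r; first exact: powR_ge0.
by apply: (ler_wpM2l (ltW C0)); exact: (ler_powR2 (ltW q0) (normr_ge0 _) Hz).
Qed.

End bootstrap.

Section final_estimate.
Context {R : realType} {n : nat}.
Variable be : R.
Hypotheses (be_half : 2^-1 < be) (be1 : be < 1).
Variables (b : 'rV[R]_n) (q : R) (u0 : 'rV[R]_n -> R) (u : R -> 'rV[R]_n -> R).
Hypothesis q0 : 0 < q.
Hypothesis lu0 : L1 (lebesgue_rV n) u0.
Hypothesis hu : mild_solution (2 * be) q b u0 u.
Local Notation mu := (lebesgue_rV n).
Local Notation nu := ((2 * be)^-1).
Hypothesis mu0 : (0 < mu [set: 'rV[R]_n])%E.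
Hypothesis u0_ge0 : {ae mu, forall x, 0 <= u0 x}.
Implicit Types (x y z : 'rV[R]_n) (t s r T a : R).

Let be0 : 0 < be. Proof. by apply: lt_trans be_half; rewrite invr_gt0. Qed.
Let nu0 : 0 < nu. Proof. by rewrite invr_gt0 mulr_gt0. Qed.
Let nu1 : nu < 1. Proof. by rewrite invf_lt1 ?mulr_gt0//; move: be_half; lra. Qed.

(** Lets P_(s - a) be replaced by P_s, at the cost of a constant, when the restarting time a is at
    most s / 2. *)
Lemma pk_compare : exists2 D : R, 1 <= D & forall r s x, 0 < s -> s / 2 <= r <= s ->
  pk be r x <= D * pk be s x.
Proof.
have [c [C [c0 C0 H]]] := @fp_bounds R n be be_half be1.
pose e := n%:R / 2 + be : R.
have e0 : 0 <= e by rewrite addr_ge0// ltW.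
have n0 : 0 <= n%:R * nu by rewrite mulr_ge0// ltW.
exists (1 + 2 `^ (n%:R * nu) * C / c).
  by rewrite lerDl divr_ge0 ?(ltW c0)// mulr_ge0 ?powR_ge0 ?(ltW C0).
move=> r s x s0 /andP[sr rs]; have s20 : 0 < s / 2 by rewrite divr_gt0.
have r0 := lt_le_trans s20 sr.
apply: (@le_trans _ _ (2 `^ (n%:R * nu) * C / c * pk be s x)); last first.
  by rewrite ler_wpM2r ?pk_ge0// lerDr.
rewrite (pk_scale be_half _ r0) (pk_scale be_half _ s0) !pkE//.
have /andP[_ H1] := H (r `^ (- nu) *: x); have /andP[H2 _] := H (s `^ (- nu) *: x).
have P1 : r `^ (- (n%:R * nu)) <= 2 `^ (n%:R * nu) * s `^ (- (n%:R * nu)).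
  apply: (le_trans (ler_powRN n0 s20 sr)).
  rewrite powRM ?(ltW s0) ?invr_ge0// mulrC ler_wpM2r ?powR_ge0//.
  by rewrite -powR_inv1// -powRrM mulN1r opprK.
have P2 : (1 + sqn (r `^ (- nu) *: x)) `^ (- e) <= (1 + sqn (s `^ (- nu) *: x)) `^ (- e).
  apply: ler_powRN => //; first exact: sqn1_gt0.
  rewrite lerD2l !sqnZ ler_wpM2r ?sqn_ge0// ler_pXn2r ?nnegrE ?powR_ge0//.
  by apply: ler_powRN => //; exact: ltW.
have P3 : fp be 1 (r `^ (- nu) *: x) <= C / c * fp be 1 (s `^ (- nu) *: x).
  apply: (le_trans H1); apply: (le_trans (ler_wpM2l (ltW C0) P2)).
  rewrite -mulrA; apply: (ler_wpM2l (ltW C0)).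
  by rewrite (ler_pdivlMl _ _ c0).
apply: (@le_trans _ _ ((2 `^ (n%:R * nu) * s `^ (- (n%:R * nu))) *
   (C / c * fp be 1 (s `^ (- nu) *: x)))).
  by apply: ler_pM P1 P3; [exact: powR_ge0|by apply: ltW; exact: fp_gt0].
by rewrite le_eqVlt; apply/orP; left; apply/eqP; ring.
Qed.

Lemma convol_pk_compare (D : R) v r s x :
  (forall r s x, 0 < s -> s / 2 <= r <= s -> pk be r x <= D * pk be s x) ->
  L1 mu v -> (forall y, 0 <= v y) -> 0 < s -> s / 2 <= r <= s ->
  convol (pk be r) v x <= D * convol (pk be s) v x.
Proof.
move=> HD lv v0 s0 rs; have l1 := L1_pkM be_half be1 s x lv.
rewrite /convol -(RintZ D l1); apply: ler_Rint.
- exact: L1_pkM.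
- exact: L1Z.
by move=> y; rewrite mulrA; apply: ler_wpM2r => //; exact: HD.
Qed.

(** The borderline rate r^(-(1 - nu)) with an arbitrarily small factor. It is required at all small
    restarting times a with one common T, because a is sent to 0 with T fixed. *)
Definition small_gauge : Prop := forall eta : R, 0 < eta -> exists2 T : R, 0 < T &
  exists2 e0 : R, 0 < e0 & forall a, 0 < a < e0 -> forall r, 0 < r <= T -> forall x,
  (convol (pk be r) (fun y => `|u a y|) x) `^ q <= eta * r `^ (- (1 - nu)).

Hypothesis Hg : small_gauge.

Let ek (k : nat) : R := k.+1%:R^-1.
Let ek0 k : 0 < ek k. Proof. by rewrite invr_gt0. Qed.

Lemma mild_cont0 : \int[mu]_x `|u (ek k) x - u0 x| @[k --> \oo] --> (0 : R).
Proof.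
apply/cvgrPdist_le => e e0; have [dl dl0 H] := mild_cont1 hu (lexx 0) e0.
have [N _ HN] := cvgr_lt _ (@cvg_harmonic R) _ dl0.
exists N => // k Nk; rewrite sub0r normrN.
have lk := mild_L1 hu (ltW (ek0 k)).
rewrite ger0_norm; last by apply: Rint_ge0 => x.
have -> : \int[mu]_x `|u (ek k) x - u0 x| = \int[mu]_x `|u (ek k) x - u 0 x|.
  have l0 := mild_L1 hu (lexx 0).
  apply: ae_eq_Rint.
  - exact: (L1_measurable (L1_norm (L1B lk lu0))).
  - exact: (L1_measurable (L1_norm (L1B lk l0))).
  have [_ _ + _] := hu; apply: filterS => x ->.
  by [].
apply: H; first exact: ltW.
by rewrite subr0 ger0_norm ?ltW//; exact: HN.
Qed.

Let P0 r x : 0 <= convol (pk be r) (fun y => `|u0 y|) x.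
Proof. by apply: Rint_ge0 => y; rewrite mulr_ge0// pk_ge0. Qed.

Let lnu0 : L1 mu (fun y => `|u0 y|). Proof. exact: L1_norm. Qed.

Lemma convol_abs_cvg r x :
  convol (pk be r) (fun y => `|u (ek k) y|) x @[k --> \oo] -->
  convol (pk be r) (fun y => `|u0 y|) x.
Proof.
pose K := pk be 1 (0 : 'rV[R]_n) * r `^ (- (n%:R * nu)).
have K0 : 0 <= K by rewrite mulr_ge0 ?powR_ge0 ?pk_ge0.
have C : K * \int[mu]_y `|u (ek k) y - u0 y| @[k --> \oo] --> (0 : R).
  by rewrite -[X in _ --> X](mulr0 K); apply: cvgM; [exact: cvg_cst|exact: mild_cont0].
apply/cvgrPdist_le => e e0.
have [N _ HN] := cvgr_le _ C _ e0; exists N => // k Nk; apply: le_trans (HN k Nk).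
have lk := mild_L1 hu (ltW (ek0 k)); have lnk := L1_norm lk.
rewrite /convol -RintB; [|exact: L1_pkM|exact: L1_pkM].
rewrite -RintZ; last exact/L1_norm/L1B.
apply: ler_norm_Rint_le.
- by apply: L1B; exact: L1_pkM.
- exact/L1Z/L1_norm/L1B.
move=> y; rewrite -mulrBr normrM; apply: ler_pM => //; first exact: pk_norm_le.
by rewrite distrC (le_trans (ler_dist_dist _ _)).
Qed.

Lemma gauge_limit (eta T e0 : R) : 0 < e0 ->
  (forall a, 0 < a < e0 -> forall r, 0 < r <= T -> forall x,
  (convol (pk be r) (fun y => `|u a y|) x) `^ q <= eta * r `^ (- (1 - nu))) ->
  forall r, 0 < r <= T -> forall x,
  (convol (pk be r) (fun y => `|u0 y|) x) `^ q <= eta * r `^ (- (1 - nu)).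
Proof.
move=> e00 H r rT x.
have C : convol (pk be r) (fun y => `|u (ek k) y|) x `^ q @[k --> \oo] -->
    (convol (pk be r) (fun y => `|u0 y|) x) `^ q.
  apply: cvg_powR => //; last exact: convol_abs_cvg.
  by move=> k; apply: Rint_ge0 => y; rewrite mulr_ge0// pk_ge0.
have [N _ HN] := cvgr_lt _ (@cvg_harmonic R) _ e00.
rewrite leNgt; apply/negP => lt_.
have [N' _ HN'] := cvgr_gt _ C _ lt_.
have := HN' (maxn N N') (leq_maxr _ _); apply/negP; rewrite -leNgt.
by apply: H => //; rewrite ek0/=; exact: (HN (maxn N N') (leq_maxl _ _)).
Qed.

Lemma upper_by_linear : exists2 D : R, 1 <= D & exists2 T : R, 0 < T &
  forall s, 0 < s <= T ->
    {ae mu, forall x, `|u s x| <= D * convol (pk be s) (fun y => `|u0 y|) x}.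
Proof.
have [C C0 HC] := kk_bound be_half be1 b.
have [D D1 HD] := pk_compare.
have B0 := beta_cst_gt0 nu0 nu1.
(* The value giving equality in the smallness condition of [bootstrap]. *)
pose eta := (4 * (C * 2 `^ q * beta_cst nu))^-1.
have X0 : 0 < C * 2 `^ q * beta_cst nu by rewrite !mulr_gt0// powR_gt0.
have eta0 : 0 < eta by rewrite invr_gt0 mulr_gt0.
have etas : C * 2 `^ q * eta * beta_cst nu <= 4^-1.
  have -> : C * 2 `^ q * eta * beta_cst nu = (C * 2 `^ q * beta_cst nu) * eta by ring.
  by rewrite /eta; move: X0; generalize (C * 2 `^ q * beta_cst nu) => X X0;
    rewrite invfM mulrCA divff ?mulr1// gt_eqF.
have [T T0 [e0 e00 H]] := Hg eta0.
exists (2 * D); first by move: D1; lra.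
exists T => // s /andP[s0 sT]; have s20 : 0 < s / 2 by rewrite divr_gt0.
have ae1 k : {ae mu, forall x, ek k < e0 -> ek k <= s / 2 ->
    `|u s x| <= 2 * D * convol (pk be s) (fun y => `|u (ek k) y|) x}.
  have [ke|ke] := ltP (ek k) e0; last by apply: nearW => x.
  have [ks|ks] := leP (ek k) (s / 2); last by apply: nearW => x.
  have ss : s / 2 < s by rewrite ltr_pdivrMr// ltr_pMr// ltr1n.
  have as_ : ek k < s <= s by rewrite lexx andbT (le_lt_trans ks).
  have Hgk r : ek k < r <= s -> forall x,
      (convol (pk be (r - ek k)) (fun y => `|u (ek k) y|) x) `^ q <=
      eta * (r - ek k) `^ (- (1 - nu)).
    move=> /andP[kr rs] x; apply: H; first by rewrite ek0.
    by rewrite subr_gt0 kr (le_trans _ sT)// (le_trans _ rs)// gerBl ltW.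
  have HB := bootstrap be_half be1 q0 lu0 hu mu0 HC C0 (ltW eta0) etas (ek0 k) Hgk as_.
  apply: filterS HB => x Hx _ _; apply: (le_trans Hx).
  have lnk := L1_norm (mild_L1 hu (ltW (ek0 k))).
  rewrite -[leRHS]mulrA; apply: ler_wpM2l; first exact: ler0n.
  apply: (convol_pk_compare (v := fun y => `|u (ek k) y|) x HD lnk _ s0); first by move=> y.
  rewrite gerBl (ltW (ek0 k)) andbT.
  by rewrite lerBrDr -lerBrDl; move: ks; rewrite [X in _ -> _ <= X - _](splitr s) addrK.
have /ae_foralln ae2 := ae1; apply: filterS ae2 => x Hx.
have C2 : 2 * D * convol (pk be s) (fun y => `|u (ek k) y|) x @[k --> \oo] -->
    2 * D * convol (pk be s) (fun y => `|u0 y|) x.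
  by apply: cvgM; [exact: cvg_cst|exact: convol_abs_cvg].
rewrite leNgt; apply/negP => lt_.
have [N1 _ HN1] := cvgr_lt _ C2 _ lt_.
have [N2 _ HN2] := cvgr_lt _ (@cvg_harmonic R) _ e00.
have [N3 _ HN3] := cvgr_lt _ (@cvg_harmonic R) _ s20.
pose k := maxn N1 (maxn N2 N3).
have k1 : (N1 <= k)%N by exact: leq_maxl.
have k2 : (N2 <= k)%N by rewrite /k leq_max leq_maxl orbT.
have k3 : (N3 <= k)%N by rewrite /k !leq_max leqnn !orbT.
have := Hx k (HN2 k k2) (ltW (HN3 k k3)).
by apply/negP; rewrite -ltNge; exact: HN1 k k1.
Qed.

(** Valid at every x although the bounds on u(s) hold only almost everywhere: they are used inside
    the Duhamel integral, and the Duhamel formula itself is available at every point. *)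
Theorem final_estimate (dl : R) : 0 < dl -> exists2 T : R, 0 < T &
  forall t, 0 < t <= T -> forall x,
    `|u t x - convol (pk be t) u0 x| <= dl * convol (pk be t) u0 x.
Proof.
move=> dl0; have [C C0 HC] := kk_bound be_half be1 b.
have [D D1 [T1 T10 HD]] := upper_by_linear.
have D0 : 0 < D by exact: lt_le_trans D1.
have B0 := beta_cst_gt0 nu0 nu1.
pose A := C * D `^ q * D * beta_cst nu.
have A0 : 0 < A by rewrite !mulr_gt0// powR_gt0.
(* The Duhamel term is at most A eta P_t u0; this choice makes the factor equal to dl. *)
pose eta := dl / A; have eta0 : 0 < eta by rewrite divr_gt0.
have [T2 T20 [e0 e00 H]] := Hg eta0.
have Hq := gauge_limit e00 H.
exists (Num.min T1 T2); first by rewrite lt_min T10.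
move=> t /andP[t0]; rewrite le_min => /andP[tT1 tT2] x.
have PE : convol (pk be t) u0 x = convol (pk be t) (fun y => `|u0 y|) x.
  apply: ae_eq_Rint.
  - exact: (L1_measurable (L1_pkM be_half be1 t x lu0)).
  - exact: (L1_measurable (L1_pkM be_half be1 t x lnu0)).
  - by apply: filterS u0_ge0 => y y0; rewrite ger0_norm.
have [lD ->] := mild_duhamel be_half hu mu0 x t0.
rewrite addrAC subrr add0r PE.
have -> : \int[@stm R n]_p duh be b q u t x p = \int[@stm R n]_p duhcut be b q u 0 t x p.
  apply: eq_Rintegral => p _; rewrite /duh /duhcut /cutG; case: ifPn => // p0.
  rewrite -ltNge in p0; case: p p0 => s z /= s0.
  by rewrite /mildG mildU_le0 ?(ltW s0)// /nonlin mul0r.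
have [lb ib] := beta_maj_int nu0 nu1 t0.
have c0 : 0 <= C * D `^ q * D * eta.
  by apply: mulr_ge0 (ltW eta0); rewrite !mulr_ge0 ?powR_ge0 ?(ltW C0) ?(ltW D0).
pose Hs s := C * D `^ q * D * eta * beta_maj nu 0 t s.
have lH : L1 leb Hs by exact: L1Z.
apply: (le_trans (@duh_estimate _ _ _ be_half be1 b q u0 u q0 hu mu0 C 0 t x Hs
  (fun s => convol (pk be s) (fun y => `|u0 y|)) (convol (pk be t) (fun y => `|u0 y|) x) HC (lexx 0) t0 lH _ _ _ _ _)).
- by move=> s; rewrite mulr_ge0// beta_maj_ge0.
- exact: P0.
- move=> s s0 st.
  have sT1 : 0 < s <= T1 by rewrite s0 (le_trans (ltW st)).
  have sT2 : 0 < s <= T2 by rewrite s0 (le_trans (ltW st)).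
  apply: filterS2 (mildU_ae hu mu0 s0) (HD s sT1) => z Uz Hz.
  rewrite /mildG Uz nonlin_norm; set P := convol _ _ z in Hz *.
  have Q : `|u s z| `^ q <= D `^ q * (eta * s `^ (- (1 - nu))).
    apply: (@le_trans _ _ ((D * P) `^ q)).
      by apply: ler_powR2 => //; exact: ltW.
    by rewrite powRM ?(ltW D0) ?P0// ler_wpM2l ?powR_ge0//; exact: Hq.
  have Bm := beta_maj_ge nu0 nu1 s0 st; rewrite subr0 in Bm.
  apply: (@le_trans _ _ (C * (t - s) `^ (- nu) * ((D * P) * (D `^ q * (eta * s `^ (- (1 - nu))))))).
    rewrite ler_wpM2l ?mulr_ge0 ?powR_ge0 ?(ltW C0)//.
    by apply: ler_pM => //; exact: powR_ge0.
  rewrite [leLHS](_ : _ = (C * D `^ q * D * eta) * ((t - s) `^ (- nu) * s `^ (- (1 - nu))) * P); last by ring.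
  by rewrite /Hs ler_wpM2r ?P0// ler_wpM2l.
- by move=> s s0 st; apply: L1_pkM => //; exact: L1_convol_pk.
- move=> s s0 st; have ts0 : 0 < t - s by rewrite subr_gt0.
  by have := convol_pk_semigroup be_half be1 x ts0 s0 lnu0; rewrite subrK /convol => ->.
rewrite ler_wpM2r ?P0//.
rewrite /Hs RintZ//; apply: (le_trans (ler_wpM2l c0 ib)).
rewrite le_eqVlt; apply/orP; left; apply/eqP.
rewrite /eta /A -[X in X = _]mulrA (mulrC (dl / _)) mulrA mulrCA divff ?mulr1//.
by rewrite gt_eqF.
Qed.

End final_estimate.

(** * The maximum principle *)

Lemma powR_1B_le (R : realType) (e dl : R) : 0 <= e -> 0 <= dl ->
  1 - e * dl <= (1 + dl) `^ (- e) <= 1.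
Proof.
move=> e0 d0; have d1 : 0 < 1 + dl by rewrite ltr_wpDr.
apply/andP; split; last first.
  have := ler_powRN e0 (ltr01 : 0 < (1 : R)) (_ : 1 <= 1 + dl).
  by rewrite powR1 lerDl; exact.
rewrite /powR (gt_eqF d1); apply: le_trans (expR_ge1Dx _).
by rewrite lerD2l mulNr lerN2; apply: ler_wpM2l => //; apply: le_ln1Dx; rewrite (lt_le_trans _ d0)// ltrN10.
Qed.

Section kernel_regularity.
Context {R : realType} {n : nat}.
Variable be : R.
Hypotheses (be_half : 2^-1 < be) (be1 : be < 1).
Variable b : 'rV[R]_n.
Implicit Types (x y z v w : 'rV[R]_n) (t s r c h : R).
Local Notation mu := (lebesgue_rV n).
Local Notation nu := ((2 * be)^-1).
Local Notation E := (n%:R / 2 + 1 + be).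
Local Notation B := (1 + sqn b).

Let be0 : 0 < be. Proof. by apply: lt_trans be_half; rewrite invr_gt0. Qed.
Let nu0 : 0 < nu. Proof. by rewrite invr_gt0 mulr_gt0. Qed.
Let nu1 : nu < 1. Proof. by rewrite invf_lt1 ?mulr_gt0//; move: be_half; lra. Qed.
Let B0 : 0 < B. Proof. exact: sqn1_gt0. Qed.
Let e0 : 0 <= n%:R / 2 + be. Proof. by rewrite addr_ge0// ltW. Qed.

(** The constants of [fk_bounds] depend on the direction of differentiation; summing those of the
    basis directions gives one that is uniform in the moving direction x. *)
Lemma fk_ray : exists2 C : R, 0 < C & forall c x, 0 <= c ->
  `|fk be x 1 (c *: x)| <= C * (c * sqn x) * (1 + sqn (c *: x)) `^ (- E).
Proof.
have H (i : 'I_n) : exists C : R, 0 < C /\ forall x,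
    `|fk be (delta_mx 0 i) 1 x| <= C * (`|x 0 i| * (1 + sqn x) `^ (- E)).
  have d0 : delta_mx 0 i != 0 :> 'rV[R]_n.
    by apply/eqP => /rowP/(_ i); rewrite !mxE !eqxx => /eqP; rewrite oner_eq0.
  have [c [C [_ C0 HC]]] := fk_bounds be_half be1 d0; exists C; split => // x.
  have /andP[_ +] := HC x; congr (_ <= _ * (`|_| * _)).
  rewrite /dotv (bigD1 i)//= mxE !eqxx mul1r big1 ?addr0// => j ji.
  by rewrite mxE (negbTE ji) andbF mul0r.
have [C HC] := choice H.
exists (1 + \sum_i C i).
  by rewrite ltr_pwDl// sumr_ge0// => i _; rewrite ltW//; have [] := HC i.
move=> c x c0; rewrite fk_sum_delta//; set w := _ `^ _.
have w0 : 0 <= w by exact: powR_ge0.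
have Ci i : C i <= 1 + \sum_j C j.
  rewrite (bigD1 i)//= addrCA lerDl addr_ge0// sumr_ge0// => j _.
  by rewrite ltW//; have [] := HC j.
have -> : (1 + \sum_i C i) * (c * sqn x) * w =
    \sum_i (1 + \sum_j C j) * (c * x 0 i ^+ 2) * w.
  by rewrite -mulr_suml -mulr_sumr -mulr_sumr.
apply: (le_trans (ler_norm_sum _ _ _)); apply: ler_sum => i _.
have [_ /(_ (c *: x)) Hi] := HC i.
rewrite normrM; apply: (le_trans (ler_wpM2l (normr_ge0 _) Hi)).
have -> : (c *: x) 0 i = c * x 0 i by rewrite mxE.
rewrite normrM (ger0_norm c0) -(real_normK (num_real (x 0 i))) -/w.
rewrite [leLHS](_ : _ = C i * ((c * `|x 0 i| ^+ 2) * w)); last by ring.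
rewrite -[leRHS]mulrA; apply: ler_wpM2r (Ci i).
by rewrite mulr_ge0// mulr_ge0// exprn_ge0.
Qed.

Lemma pk_dilate : exists2 C : R, 0 < C & forall c x, 2^-1 <= c <= 1 ->
  pk be 1 (c *: x) <= C * pk be 1 x.
Proof.
have [c1 [C1 [c0 C0 H]]] := @fp_bounds R n be be_half be1.
exists (C1 * 4 `^ (n%:R / 2 + be) / c1); first by rewrite divr_gt0// mulr_gt0// powR_gt0.
move=> c x /andP[c2 c1']; rewrite !pkE//.
have /andP[_ H1] := H (c *: x); have /andP[H2 _] := H x.
have XY : 1 + sqn x <= 4 * (1 + sqn (c *: x)).
  rewrite sqnZ; have := sqn_ge0 x; set X := sqn x => X0.
  have : 4^-1 * X <= c ^+ 2 * X.
    apply: ler_wpM2r => //; rewrite [leLHS](_ : _ = 2^-1 ^+ 2).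
      by rewrite ler_pXn2r ?nnegrE// (le_trans _ c2).
    by rewrite expr2; field.
  by lra.
have H3 := powR_sqn_mono e0 (ltr0n R 4 : 0 < 4) (sqn1_gt0 x) (sqn1_gt0 (c *: x)) XY.
apply: (le_trans H1); apply: (le_trans (ler_wpM2l (ltW C0) H3)).
rewrite [leRHS](_ : _ = C1 * (4 `^ (n%:R / 2 + be) * (fp be 1 x / c1))); last by ring.
apply: (ler_wpM2l (ltW C0)); apply: (ler_wpM2l (powR_ge0 _ _)).
by rewrite ler_pdivlMr// mulrC.
Qed.

(** Mean value theorem on the segment from c x to x. The radial derivative costs a factor of order
    |x|^2 against one more power (1 + |x|^2)^(-1), so it is bounded by the kernel itself. *)
Lemma pk_ray : exists2 C : R, 0 < C & forall c x, 2^-1 <= c <= 1 ->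
  `|pk be 1 (c *: x) - pk be 1 x| <= C * (1 - c) * pk be 1 x.
Proof.
have [c1 [C1 [c10 C10 H1]]] := @fp_bounds R n be be_half be1.
have [C2 C20 H2] := fk_ray; have [C3 C30 H3] := pk_dilate.
exists (C2 * 2 / c1 * C3); first by rewrite mulr_gt0// divr_gt0// mulr_gt0.
move=> c x /andP[c2 c1']; have c0 : 0 < c by apply: lt_le_trans c2; rewrite invr_gt0.
have h0 : 0 <= 1 - c by rewrite subr_ge0.
have [k /andP[k0 kh]] := fp_increment be_half x (c *: x) (ltr01 : 0 < (1 : R)) h0.
rewrite -!scalerDl subrK scale1r => E1.
have kc2 : 2^-1 <= k + c <= 1.
  by rewrite (le_trans c2) ?lerDr//= -lerBrDr.
set a := k + c in E1 kc2; have a0 : 0 < a by case/andP: kc2 => + _; apply: lt_le_trans; rewrite invr_gt0.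
rewrite !pkE// distrC E1 normrM normrN (ger0_norm h0).
have Ha : `|fk be x 1 (a *: x)| <= C2 * 2 / c1 * C3 * fp be 1 x.
  have := H3 a x kc2; rewrite !pkE// => Hd.
  have /andP[Hl _] := H1 (a *: x).
  apply: (le_trans (H2 a x (ltW a0))); set Y := 1 + sqn (a *: x) in Hl *.
  have Y0 : 0 < Y by exact: sqn1_gt0.
  have YE : Y `^ (- (n%:R / 2 + be)) = Y * Y `^ (- E).
    rewrite -{2}(powRr1 (ltW Y0)) -powRD; last by rewrite (gt_eqF Y0) implybT.
    by congr (_ `^ _); ring.
  have aY : a * sqn x <= 2 * Y.
    rewrite /Y sqnZ; have := sqn_ge0 x; set X := sqn x => X0.
    have : a * X <= 2 * (a ^+ 2 * X).
      rewrite expr2 [leRHS](_ : _ = (2 * a) * (a * X)); last by ring.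
      by apply: ler_peMl; [rewrite mulr_ge0// ltW|case/andP: kc2; lra].
    by lra.
  apply: (@le_trans _ _ (C2 * (2 * Y) * Y `^ (- E))).
    apply: ler_wpM2r; first exact: powR_ge0.
    by apply: ler_wpM2l aY; exact: ltW.
  rewrite [leLHS](_ : _ = C2 * 2 * Y `^ (- (n%:R / 2 + be))); last by rewrite YE; ring.
  rewrite [leRHS](_ : _ = C2 * 2 * (c1^-1 * (C3 * fp be 1 x))); last by ring.
  apply: ler_wpM2l; first by rewrite mulr_ge0// ltW.
  by rewrite ler_pdivlMl//; apply: le_trans Hd.
by rewrite mulrAC; apply: ler_wpM2r.
Qed.

(** By scaling, changing the time from s to s + r is a dilation by (1 + r / s)^(-nu) and a change of
    prefactor; both are within a multiple of r / s of 1. *)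
Lemma pk_time : exists2 C : R, 0 < C & forall s r x, 0 < s -> 0 <= r <= s ->
  `|pk be (s + r) x - pk be s x| <= C * (r / s) * pk be s x.
Proof.
have [C1 C10 H1] := pk_ray; have [C2 C20 H2] := pk_dilate.
pose d : R := n%:R * nu; have d0 : 0 <= d by rewrite mulr_ge0// ltW.
exists (d * C2 + C1 * nu); first by rewrite ltr_wpDl ?mulr_gt0// mulr_ge0// ltW.
move=> s r x s0 /andP[r0 rs]; have sr0 : 0 < s + r by rewrite ltr_wpDr.
pose dl := r / s; have dl0 : 0 <= dl by rewrite divr_ge0// ltW.
have dl1 : dl <= 1 by rewrite ler_pdivrMr// mul1r.
have srE : s + r = s * (1 + dl) by rewrite mulrDr mulr1 /dl mulrCA divff ?mulr1// gt_eqF.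
have d1 : 0 <= 1 + dl by rewrite addr_ge0.
rewrite (pk_scale be_half _ sr0) (pk_scale be_half _ s0) -/d srE !powRM ?(ltW s0)//.
set l := (1 + dl) `^ (- nu); set p := (1 + dl) `^ (- d).
have /andP[l1 l2] := powR_1B_le (ltW nu0) dl0; have /andP[p1 p2] := powR_1B_le d0 dl0.
rewrite -/l in l1 l2; rewrite -/p in p1 p2.
rewrite (mulrC _ l) -scalerA; set y := _ *: x.
have lh : 2^-1 <= l <= 1.
  rewrite l2 andbT; apply: (@le_trans _ _ (2 `^ (- nu))).
    by rewrite -[2^-1](@powR_inv1 R 2)//; apply: ler_powR; rewrite ?ler1n// lerN2 ltW.
  by apply: ler_powRN; [exact: ltW|rewrite ltr_wpDr|move: dl1; lra].
have Hy1 := H1 l y lh; have Hy2 := H2 l y lh.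
set Q := s `^ (- d); have Q0 : 0 <= Q by exact: powR_ge0.
set P := pk be 1 y in Hy1 Hy2 *; set P' := pk be 1 (l *: y) in Hy1 Hy2 *.
have P0 : 0 <= P by exact: pk_ge0.
have P'0 : 0 <= P' by exact: pk_ge0.
rewrite [X in `|X|](_ : _ = Q * ((p - 1) * P' + (P' - P))); last by ring.
rewrite normrM (ger0_norm Q0) [leRHS](_ : _ = Q * ((d * C2 + C1 * nu) * dl * P)); last by rewrite /dl; ring.
apply: ler_wpM2l => //.
apply: (le_trans (ler_normD _ _)); rewrite normrM (ger0_norm P'0) distrC ger0_norm ?subr_ge0//.
have A1 : (1 - p) * P' <= (d * dl) * (C2 * P).
  by apply: ler_pM => //; [rewrite subr_ge0|move: p1; lra].
have A2 : C1 * (1 - l) * P <= C1 * (nu * dl) * P.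
  apply: ler_wpM2r => //; apply: ler_wpM2l; first exact: ltW.
  by move: l1; lra.
apply: (le_trans (lerD A1 (le_trans Hy1 A2))).
by rewrite le_eqVlt; apply/orP; left; apply/eqP; ring.
Qed.


(** The difference quotient that replaces -b.grad p_r, that is [kk], in the splitting scheme. *)
Definition ck h r y : R := (pk be r (y - h *: b) - pk be r y) / h.

Lemma L1_ck h r : L1 mu (ck h r).
Proof.
rewrite (_ : ck h r = fun y => h^-1 * (pk be r (y - h *: b) - pk be r y)).
  apply: L1Z; apply: L1B; last exact: L1_pk.
  exact: (L1_transl (- (h *: b)) (@L1_pk R n be be_half be1 r)).
by apply/funext => y; rewrite /ck mulrC.
Qed.

Lemma ck_kk h r y : 0 < h -> 0 < r -> exists2 c : R, 0 <= c <= h &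
  ck h r y = kk be b r (y - c *: b).
Proof.
move=> h0 r0; have [c /andP[c0 ch] E1] := fp_increment be_half b (y - h *: b) r0 (ltW h0).
exists (h - c); first by rewrite subr_ge0 ch gerBl.
rewrite addrCA subrr addr0 in E1.
have E2 : fp be r (y - h *: b) - fp be r y = fk be b r (c *: b + (y - h *: b)) * h.
  by rewrite -opprB E1 mulNr opprK.
rewrite /ck !pkE// kkE// E2 mulfK ?gt_eqF//.
by congr fk; rewrite scalerBl opprB addrCA addrC -!addrA addrC -addrA.
Qed.

Lemma shift_small c r : 0 <= c -> c * B <= r `^ nu -> sqn (c *: b) <= r `^ (2 * nu).
Proof.
move=> c0 cB; rewrite mulrC powRrM powR_mulrn ?powR_ge0// sqnZ.
have b0 := sqn_ge0 b; have X0 : 0 <= c * B by rewrite mulr_ge0// ltW.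
apply: (@le_trans _ _ ((c * B) ^+ 2)); last by rewrite ler_pXn2r ?nnegrE ?powR_ge0.
by rewrite exprMn; apply: ler_wpM2l; [exact: sqr_ge0|nra].
Qed.

Lemma ck_bound : exists2 C : R, 0 < C & forall h r y, 0 < h -> 0 < r ->
  h * B <= r `^ nu -> `|ck h r y| <= C * r `^ (- nu) * pk be r y.
Proof.
have [C C0 H] := kk_bound be_half be1 b; have [D D0 H'] := @harnack R n be be_half be1.
exists (C * D); first exact: mulr_gt0.
move=> h r y h0 r0 hB; have [c /andP[c0 ch] ->] := ck_kk y h0 r0.
apply: (le_trans (H _ _ r0)).
rewrite [leRHS](_ : _ = C * r `^ (- nu) * (D * pk be r y)); last by ring.
apply: ler_wpM2l; first by rewrite mulr_ge0 ?powR_ge0// ltW.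
apply: H' => //; apply: shift_small => //.
by apply: le_trans hB; apply: ler_wpM2r => //; exact: ltW.
Qed.

(** For h below the scale r^nu, [ck_bound] applies. For larger h the trivial bound 2 / h is already
    of order r^(-nu). Uniformity in h is essential, because r may be as small as one time step. *)
Lemma ck_norm : exists2 C : R, 0 < C & forall h r, 0 < h -> 0 < r ->
  \int[mu]_y `|ck h r y| <= C * r `^ (- nu).
Proof.
have [C C0 H] := ck_bound; exists (C + 2 * B); first by rewrite addr_gt0// mulr_gt0.
move=> h r h0 r0; have p0 : 0 <= r `^ (- nu) by exact: powR_ge0.
have lp := @L1_pk R n be be_half be1 r.
have [hB|hB] := leP (h * B) (r `^ nu).
  apply: (@le_trans _ _ (\int[mu]_y (C * r `^ (- nu) * pk be r y))).
    apply: ler_Rint; [exact/L1_norm/L1_ck|exact: L1Z|by move=> y; exact: H].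
  rewrite RintZ// Rint_pk// mulr1; apply: ler_wpM2r => //.
  by rewrite lerDl mulr_ge0// ltW.
have lt_ : L1 mu (fun y => pk be r (y - h *: b)) by exact: (L1_transl (- (h *: b)) lp).
apply: (@le_trans _ _ (\int[mu]_y (h^-1 * (pk be r (y - h *: b) + pk be r y)))).
  apply: ler_Rint; [exact/L1_norm/L1_ck|by apply: L1Z; exact: L1D|move=> y].
  rewrite /ck mulrC normrM ger0_norm ?invr_ge0 ?(ltW h0)//; apply: ler_wpM2l; first by rewrite invr_ge0 ltW.
  by apply: (le_trans (ler_normB _ _)); rewrite !ger0_norm// pk_ge0.
rewrite RintZ; last exact: L1D.
rewrite RintD// (Rint_transl (- (h *: b)) lp) !Rint_pk//.
have h1 : h^-1 <= B * r `^ (- nu).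
  by rewrite powRN ler_pdivlMr ?powR_gt0// mulrC ler_pdivrMr// [B * h]mulrC ltW.
apply: (@le_trans _ _ (B * r `^ (- nu) * 2)); first exact: ler_wpM2r.
rewrite [leRHS](_ : _ = C * r `^ (- nu) + B * r `^ (- nu) * 2); last by ring.
by rewrite lerDr mulr_ge0// ltW.
Qed.

Lemma kk_norm : exists2 C : R, 0 < C & forall r, 0 < r ->
  \int[mu]_y `|kk be b r y| <= C * r `^ (- nu).
Proof.
have [C C0 H] := kk_bound be_half be1 b; exists C => // r r0.
have lp := @L1_pk R n be be_half be1 r.
apply: (@le_trans _ _ (\int[mu]_y (C * r `^ (- nu) * pk be r y))).
  apply: ler_Rint; [exact/L1_norm/L1_kk|exact: L1Z|by move=> y; exact: H].
by rewrite RintZ// Rint_pk// mulr1.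
Qed.

Lemma conv_kk_diff : exists2 C : R, 0 < C & forall s a (D : 'rV[R]_n -> R) x, 0 < s ->
  0 <= a -> L1 mu D -> (forall w, `|D w| <= a * pk be s w) ->
  `|\int[mu]_y (D (x - y) * kk be b s y)| <= C * s `^ (- nu) * a * pk be (s + s) x.
Proof.
have [C C0 H] := kk_bound be_half be1 b; exists C => // s a D x s0 a0 lD HD.
rewrite -(pk_semigroup be_half be1 x s0 s0).
have l2 : L1 mu (fun y => pk be s (x - y) * pk be s y).
  by apply: L1_pkM => //; exact: L1_pk.
rewrite -RintZ//.
have bnd y : `|D (x - y) * kk be b s y| <= C * s `^ (- nu) * a * (pk be s (x - y) * pk be s y).
  rewrite normrM [leRHS](_ : _ = (a * pk be s (x - y)) * (C * s `^ (- nu) * pk be s y)); last by ring.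
  by apply: ler_pM => //; exact: H.
apply: ler_norm_Rint_le => //; last exact: L1Z.
apply: (L1_le _ bnd); last exact: L1Z.
apply: measurable_funM; last exact: (L1_measurable (L1_kk be_half be1 b s)).
exact: (L1_measurable (L1_shift x lD)).
Qed.

Lemma kk_shift : exists2 C : R, 0 < C & forall r c x, 0 < r -> 0 <= c ->
  c * B <= (r / 2) `^ nu ->
  `|kk be b r (x - c *: b) - kk be b r x| <= C * c * (r / 2) `^ (- nu) * (r / 2) `^ (- nu) * pk be r x.
Proof.
have [C C0 H] := conv_kk_diff; have [C1 C10 H1] := ck_bound.
exists (C * C1); first exact: mulr_gt0.
move=> r c x r0; rewrite le_eqVlt => /predU1P[<- _|c0 cB].
  by rewrite scale0r subr0 subrr normr0 mulr0 !mul0r.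
have s0 : 0 < r / 2 by rewrite divr_gt0.
have lk := L1_kk be_half be1 b (r / 2); have lp := @L1_pk R n be be_half be1 (r / 2).
have E1 z : kk be b r z = \int[mu]_y (pk be (r / 2) (z - y) * kk be b (r / 2) y).
  have := pk_kk_semigroup be_half be1 b z 0 s0 s0; rewrite -splitr !subr0 => <-.
  by apply: eq_Rintegral => y _; rewrite subr0.
rewrite !E1 -RintB; [|exact: L1_pkM|exact: L1_pkM].
pose D w := pk be (r / 2) (w - c *: b) - pk be (r / 2) w.
have -> : \int[mu]_y (pk be (r / 2) (x - c *: b - y) * kk be b (r / 2) y -
     pk be (r / 2) (x - y) * kk be b (r / 2) y) = \int[mu]_y (D (x - y) * kk be b (r / 2) y).
  by apply: eq_Rintegral => y _; rewrite -mulrBl /D addrAC.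
have lD : L1 mu D.
  by apply: L1B => //; exact: (L1_transl (- (c *: b)) lp).
have HD w : `|D w| <= (C1 * (r / 2) `^ (- nu) * c) * pk be (r / 2) w.
  have := H1 c (r / 2) w c0 s0 cB; rewrite /ck normrM normfV (ger0_norm (ltW c0)).
  by rewrite ler_pdivrMr// mulrAC.
have a0 : 0 <= C1 * (r / 2) `^ (- nu) * c by rewrite !mulr_ge0 ?powR_ge0// ltW.
have := H (r / 2) _ D x s0 a0 lD HD; rewrite -splitr => /le_trans; apply.
by rewrite le_eqVlt; apply/orP; left; apply/eqP; ring.
Qed.

Lemma kk_time : exists2 C : R, 0 < C & forall r dl x, 0 < r -> 0 <= dl <= r / 2 ->
  `|kk be b (r + dl) x - kk be b r x| <= C * dl * (r / 2) `^ (- nu) / (r / 2) * pk be r x.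
Proof.
have [C C0 H] := conv_kk_diff; have [C1 C10 H1] := pk_time.
exists (C * C1); first exact: mulr_gt0.
move=> r dl x r0 dlr; have s0 : 0 < r / 2 by rewrite divr_gt0.
have dl0 : 0 <= dl by case/andP: dlr.
have sd0 : 0 < r / 2 + dl by rewrite ltr_wpDr.
have lk := L1_kk be_half be1 b (r / 2); have lp := @L1_pk R n be be_half be1.
have E1 s z : 0 < s -> kk be b (r / 2 + s) z = \int[mu]_y (pk be s (z - y) * kk be b (r / 2) y).
  move=> s0'; have := pk_kk_semigroup be_half be1 b z 0 s0' s0; rewrite subr0 => <-.
  by apply: eq_Rintegral => y _; rewrite subr0.
rewrite {1 2}(splitr r) -addrA !E1// -RintB; [|exact: L1_pkM|exact: L1_pkM].
pose D w := pk be (r / 2 + dl) w - pk be (r / 2) w.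
have -> : \int[mu]_y (pk be (r / 2 + dl) (x - y) * kk be b (r / 2) y -
     pk be (r / 2) (x - y) * kk be b (r / 2) y) = \int[mu]_y (D (x - y) * kk be b (r / 2) y).
  by apply: eq_Rintegral => y _; rewrite -mulrBl.
have lD : L1 mu D := L1B (lp (r / 2 + dl)) (lp (r / 2)).
have HD w : `|D w| <= (C1 * (dl / (r / 2))) * pk be (r / 2) w by exact: H1.
have a0 : 0 <= C1 * (dl / (r / 2)) by rewrite mulr_ge0 ?divr_ge0// ltW.
have := H (r / 2) _ D x s0 a0 lD HD; rewrite -splitr => /le_trans; apply.
by rewrite le_eqVlt; apply/orP; left; apply/eqP; ring.
Qed.


(** The error is split at kk_(r'): a change of time by at most tau, then a shift by at most L tau
    along b, since [ck] is [kk] at an intermediate point. Both are O(tau) for r >= rho. *)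
Lemma kernel_consistency_away (L rho e : R) : 0 < L -> 0 < rho -> 0 < e ->
  exists2 tau0 : R, 0 < tau0 & forall tau r r', 0 < tau -> tau < tau0 -> rho <= r ->
    r <= r' <= r + tau -> \int[mu]_y `|kk be b r y - ck (L * tau) r' y| <= e.
Proof.
move=> L0 rho0 e_0; have s0 : 0 < rho / 2 by rewrite divr_gt0.
have [C C0 H] := kk_shift; have [C1 C10 H1] := kk_time.
pose p := (rho / 2) `^ (- nu); have p0 : 0 < p by exact: powR_gt0.
pose A := C1 * p / (rho / 2) + C * L * p * p.
have A0 : 0 < A by rewrite addr_gt0// ?divr_gt0// !mulr_gt0.
exists (Num.min (rho / 2) (Num.min ((rho / 2) `^ nu / (L * B)) (e / A))).
  by rewrite !lt_min s0 !divr_gt0 ?powR_gt0 ?mulr_gt0.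
move=> tau r r' t0; rewrite !lt_min => /and3P[t1 t2 t3] rr /andP[r1 r2].
have r0 : 0 < r by exact: lt_le_trans rr. have r'0 : 0 < r' by exact: lt_le_trans r1.
have h0 : 0 < L * tau by exact: mulr_gt0.
have rr2 : rho / 2 <= r / 2 by rewrite ler_pM2r.
have rr2' : rho / 2 <= r' / 2 by rewrite ler_pM2r// (le_trans rr).
have l1 : L1 mu (kk be b r') by exact: L1_kk.
have lr : L1 mu (kk be b r) by exact: L1_kk.
have lc := L1_ck (L * tau) r'.
have lp := @L1_pk R n be be_half be1.
have pw s : rho / 2 <= s -> s `^ (- nu) <= p by move=> ?; apply: ler_powRN => //; exact: ltW.
have I1 : \int[mu]_y `|kk be b r y - kk be b r' y| <= C1 * p / (rho / 2) * tau.
  have dlr : 0 <= r' - r <= r / 2.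
    by rewrite subr_ge0 r1 lerBlDl (le_trans r2)// lerD2l (le_trans (ltW t1)).
  have K0 : C1 * (r' - r) * (r / 2) `^ (- nu) / (r / 2) <= C1 * p / (rho / 2) * tau.
    rewrite [leRHS](_ : _ = C1 * tau * p / (rho / 2)); last by ring.
    apply: ler_pM.
    - by rewrite !mulr_ge0 ?powR_ge0 ?(ltW C10)// subr_ge0.
    - by rewrite invr_ge0 divr_ge0// ltW.
    - apply: ler_pM; rewrite ?powR_ge0 ?pw//.
        by rewrite mulr_ge0 ?(ltW C10)// subr_ge0.
      by apply: ler_wpM2l; [exact: ltW|rewrite lerBlDl].
    - by rewrite lef_pV2// posrE divr_gt0.
  apply: (@le_trans _ _ (\int[mu]_y (C1 * (r' - r) * (r / 2) `^ (- nu) / (r / 2) * pk be r y))).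
    apply: ler_Rint; [exact: (L1_norm (L1B lr l1))|exact: (L1Z _ (lp r))|move=> y].
    by rewrite distrC; have := H1 r (r' - r) y r0 dlr; rewrite [r + _]addrC subrK.
  by rewrite (RintZ _ (lp r)) (Rint_pk be_half be1 r0) mulr1.
have I2 : \int[mu]_y `|kk be b r' y - ck (L * tau) r' y| <= C * L * p * p * tau.
  have K0 c : 0 <= c <= L * tau ->
      C * c * (r' / 2) `^ (- nu) * (r' / 2) `^ (- nu) <= C * L * p * p * tau.
    move=> /andP[c0 ch]; rewrite [leRHS](_ : _ = C * (L * tau) * p * p); last by ring.
    have q0 : 0 <= (r' / 2) `^ (- nu) by exact: powR_ge0.
    apply: ler_pM; rewrite ?pw//; first by rewrite !mulr_ge0 ?(ltW C0).
    apply: ler_pM; rewrite ?pw//; first by rewrite !mulr_ge0 ?(ltW C0).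
    by apply: ler_wpM2l; first exact: ltW.
  apply: (@le_trans _ _ (\int[mu]_y (C * L * p * p * tau * pk be r' y))).
    apply: ler_Rint; [exact: (L1_norm (L1B l1 lc))|exact: (L1Z _ (lp r'))|move=> y].
    have [c /andP[c0 ch] ->] := ck_kk y h0 r'0; rewrite distrC.
    have cB : c * B <= (r' / 2) `^ nu.
      apply: (@le_trans _ _ ((rho / 2) `^ nu)); last first.
        by apply: ler_powR2 => //; exact: ltW.
      apply: (@le_trans _ _ (L * tau * B)); first by apply: ler_wpM2r => //; exact: ltW.
      by move: t2; rewrite ltr_pdivlMr ?mulr_gt0// => /ltW; congr (_ <= _); ring.
    apply: (le_trans (H r' c y r'0 c0 cB)); apply: ler_wpM2r; first exact: pk_ge0.
    by apply: K0; rewrite c0.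
  by rewrite (RintZ _ (lp r')) (Rint_pk be_half be1 r'0) mulr1.
have l3 := L1_norm (L1B lr l1); have l4 := L1_norm (L1B l1 lc).
apply: (@le_trans _ _ (\int[mu]_y (`|kk be b r y - kk be b r' y| + `|kk be b r' y - ck (L * tau) r' y|))).
  apply: ler_Rint; [exact: (L1_norm (L1B lr lc))|exact: L1D l3 l4|move=> y].
  exact: ler_distD.
rewrite (RintD l3 l4).
apply: (le_trans (lerD I1 I2)); rewrite -mulrDl -/A.
by move: t3; rewrite ltr_pdivlMr// mulrC => /ltW.
Qed.

(** Near r = 0 the kernels are not close, merely both of order r^(-nu). Giving up the exponent nu
    for (1 + nu) / 2, still below 1 and hence integrable, leaves a positive power of r that makes
    this small for r < rho. *)
Lemma kernel_consistency (L S e : R) : 0 < L -> 0 < S -> 0 < e ->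
  exists2 tau0 : R, 0 < tau0 & forall tau r r', 0 < tau -> tau < tau0 -> 0 < r <= S ->
    r <= r' <= r + tau ->
    \int[mu]_y `|kk be b r y - ck (L * tau) r' y| <= e * r `^ (- ((1 + nu) / 2)).
Proof.
move=> L0 S0 e_0; have [C1 C10 H1] := kk_norm; have [C2 C20 H2] := ck_norm.
pose g := (1 + nu) / 2; have gnu : 0 < g - nu by rewrite /g; move: nu1; lra.
have g0 : 0 < g by rewrite /g divr_gt0// addr_gt0.
pose X := e / (C1 + C2); have X0 : 0 < X by rewrite divr_gt0// addr_gt0.
pose rho := X `^ (g - nu)^-1; have rho0 : 0 < rho by exact: powR_gt0.
have eS : 0 < e * S `^ (- g) by rewrite mulr_gt0// powR_gt0.
have [tau0 t00 Ht] := kernel_consistency_away L0 rho0 eS.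
exists tau0 => // tau r r' t0 tt /andP[r0 rS] /andP[r1 r2].
have [rr|rr] := leP rho r.
  apply: (le_trans (Ht tau r r' t0 tt rr _)); first by rewrite r1.
  by apply: ler_wpM2l; [exact: ltW|apply: ler_powRN => //; exact: ltW].
have r'0 : 0 < r' by exact: lt_le_trans r1.
have h0 : 0 < L * tau by exact: mulr_gt0.
have lr : L1 mu (kk be b r) by exact: L1_kk.
have lc := L1_ck (L * tau) r'.
apply: (@le_trans _ _ (\int[mu]_y (`|kk be b r y| + `|ck (L * tau) r' y|))).
  apply: ler_Rint; [exact/L1_norm/L1B|by apply: L1D; exact/L1_norm|move=> y].
  exact: ler_normB.
rewrite RintD; [|exact: L1_norm|exact: L1_norm].
have K2 : C2 * r' `^ (- nu) <= C2 * r `^ (- nu).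
  by apply: ler_wpM2l; [exact: ltW|apply: ler_powRN => //; exact: ltW].
apply: (le_trans (lerD (H1 r r0) (le_trans (H2 _ _ h0 r'0) K2))).
rewrite -mulrDl.
have -> : r `^ (- nu) = r `^ (g - nu) * r `^ (- g).
  rewrite -powRD; last by rewrite (gt_eqF r0) implybT.
  by congr (_ `^ _); ring.
rewrite mulrA; apply: ler_wpM2r; first exact: powR_ge0.
rewrite mulrC -ler_pdivlMr ?addr_gt0// -/X.
apply: (@le_trans _ _ (rho `^ (g - nu))).
  by apply: ler_powR2; exact: ltW.
by rewrite -powRrM mulVf ?gt_eqF// powRr1// ltW.
Qed.

End kernel_regularity.

Section minkowski.
Context {R : realType} {n : nat}.
Local Notation mu := (lebesgue_rV n).

(* Duality: pairing with the sign of the inner integral reduces the claim to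
   Fubini, without reassociating the triple product. *)
Lemma minkowski_stm (H : 'rV[R]_n -> R * 'rV[R]_n -> R) (g : R -> R) :
  L1 (mu \x @stm R n)%E (fun w => H w.1 w.2) ->
  (forall s, L1 (mu \x mu)%E (fun w => H w.1 (s, w.2))) -> L1 leb g ->
  {ae (@leb R), forall s, \int[mu]_x `|\int[mu]_z H x (s, z)| <= g s} ->
  \int[mu]_x `|\int[@stm R n]_p H x p| <= \int[leb]_s g s.
Proof.
move=> lH lHs lg Hg; pose X x := \int[@stm R n]_p H x p.
have lX : L1 mu X by exact: (L1_Rint1 lH).
pose sg x : R := if 0 <= X x then 1 else -1.
have msg : measurable_fun setT sg.
  apply: measurable_fun_ifT => //; apply: measurable_fun_ler => //.
  exact: (L1_measurable lX).
have sg1 x : `|sg x| <= 1 by rewrite /sg; case: ifP => _; rewrite ?normrN normr1.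
have sgE x : sg x * X x = `|X x|.
  rewrite /sg; case: ifPn => X0; first by rewrite mul1r ger0_norm.
  by rewrite mulN1r ler0_norm// ltW// ltNge.
have lsH : L1 (mu \x @stm R n)%E (fun w => sg w.1 * H w.1 w.2).
  apply: (L1_bddM (c := 1)) => //.
  by apply: (measurableT_comp msg); exact: measurable_fst.
have lsHs s : L1 (mu \x mu)%E (fun w => sg w.1 * H w.1 (s, w.2)).
  apply: (L1_bddM (c := 1)) => //.
  by apply: (measurableT_comp msg); exact: measurable_fst.
have l2 := L1_Rint2 lsH.
have -> : \int[mu]_x `|\int[@stm R n]_p H x p| = \int[mu]_x \int[@stm R n]_p (sg x * H x p).
  apply: ae_eq_Rint.
  - exact: (L1_measurable (L1_norm lX)).
  - exact: (L1_measurable (L1_Rint1 lsH)).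
  by apply: filterS (ae_L1_section1 lH) => x /= lx; rewrite RintZ// sgE.
rewrite (Rint_fubini lsH) /= Rint_stm -(Rint_prod1 (m1 := leb) (m2 := mu) l2).
apply: ae_ler_Rint => //; first exact: (L1_Rint1 l2).
apply: filterS Hg => s; apply: le_trans.
have E1 := Rint_fubini (lsHs s); rewrite /= in E1; rewrite -E1.
apply: ae_ler_Rint.
- exact: (L1_Rint1 (lsHs s)).
- exact: (L1_norm (L1_Rint1 (lHs s))).
apply: filterS (ae_L1_section1 (lHs s)) => x /= lx.
rewrite RintZ//; apply: (le_trans (ler_norm _)).
by rewrite normrM; apply: ler_piMl.
Qed.

End minkowski.

(** * The monotone splitting scheme *)

Section monotone_step.
Context {R : realType} {n : nat}.
Variable be : R.
Hypotheses (be_half : 2^-1 < be) (be1 : be < 1).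
Variable b : 'rV[R]_n.
Variables (f : R -> R) (L : R).
Hypotheses (mf : measurable_fun setT f) (fN : forall v, f (- v) = - f v).
Hypotheses (fmono : forall v w, v <= w -> f v <= f w).
Hypotheses (L0 : 0 < L) (fL : forall v w, v <= w -> f w - f v <= L * (w - v)).
Implicit Types (x y z : 'rV[R]_n) (t s r h K : R) (v w : 'rV[R]_n -> R).
Local Notation mu := (lebesgue_rV n).
Local Notation nu := ((2 * be)^-1).

Lemma odd_at0 : f 0 = 0.
Proof. by have := fN 0; rewrite oppr0 => /eqP; rewrite -addr_eq0 -mulr2n mulrn_eq0 => /eqP. Qed.

Lemma odd_mono_norm (v : R) : `|f v| = f `|v|.
Proof.
have [v0|v0] := ger0P v; first by rewrite ger0_norm// -odd_at0 fmono.
by rewrite fN ler0_norm// -odd_at0 fmono// ltW.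
Qed.

Lemma slope_lip (v w : R) : `|f v - f w| <= L * `|v - w|.
Proof.
wlog vw : v w / v <= w.
  move=> H; have [/H//|/ltW/H] := leP v w.
  by rewrite distrC [`|w - v|]distrC.
rewrite distrC [`|v - w|]distrC !ger0_norm ?subr_ge0//; first exact: fL.
exact: fmono.
Qed.

Lemma slope_bound (v : R) : `|f v| <= L * `|v|.
Proof. by have := slope_lip v 0; rewrite odd_at0 !subr0. Qed.

Lemma L1_comp_slope v : L1 mu v -> L1 mu (f \o v).
Proof.
move=> lv; apply: (@L1_le _ _ _ _ _ (fun x => L * `|v x|)).
- exact: (measurableT_comp mf (L1_measurable lv)).
- by move=> x; exact: slope_bound.
- exact/L1Z/L1_norm.
Qed.

Lemma L1_dist_comp_slope v w : L1 mu v -> L1 mu w ->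
  \int[mu]_x `|f (v x) - f (w x)| <= L * \int[mu]_x `|v x - w x|.
Proof.
move=> lv lw; have l1 := L1_norm (L1B lv lw).
rewrite -(RintZ _ l1); apply: ler_Rint.
- exact: (L1_norm (L1B (L1_comp_slope lv) (L1_comp_slope lw))).
- exact: L1Z.
by move=> x; exact: slope_lip.
Qed.

Definition exc K (v : R) : R := Num.max (`|v| - K) 0.

Lemma exc_ge0 K (v : R) : 0 <= exc K v.
Proof. by rewrite le_max lexx orbT. Qed.

Lemma measurable_exc K : measurable_fun setT (exc K).
Proof.
apply: measurable_maxr => //; apply: measurable_funB => //; exact: measurableT_comp.
Qed.

Lemma exc_le K (v : R) : 0 <= K -> exc K v <= `|v|.
Proof. by move=> K0; rewrite ge_max normr_ge0 andbT gerBl. Qed.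

Lemma exc_lip K (v w : R) : exc K v <= exc K w + `|v - w|.
Proof.
have := ler_dist_dist v w; have := ler_norm (`|v| - `|w|).
rewrite /exc; move: `|v| `|w| `|v - w| (normr_ge0 (v - w)) => V W D D0.
by rewrite /Num.max; case: ifPn; case: ifPn; rewrite -?leNgt; lra.
Qed.

Lemma L1_exc K v : 0 <= K -> L1 mu v -> L1 mu (fun x => exc K (v x)).
Proof.
move=> K0 lv; apply: (@L1_le _ _ _ _ _ (fun x => `|v x|)).
- exact: (measurableT_comp (measurable_exc K) (L1_measurable lv)).
- by move=> x; rewrite (ger0_norm (exc_ge0 _ _)) exc_le.
- exact: L1_norm.
Qed.

Lemma exc_Rint_lip K v w : 0 <= K -> L1 mu v -> L1 mu w ->
  \int[mu]_x exc K (v x) <= \int[mu]_x exc K (w x) + \int[mu]_x `|v x - w x|.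
Proof.
move=> K0 lv lw; have l1 := L1_norm (L1B lv lw); have l2 := L1_exc K0 lw.
rewrite -(RintD l2 l1); apply: ler_Rint; [exact: L1_exc|exact: L1D|].
by move=> x; exact: exc_lip.
Qed.

(** |P_r v| <= P_r |v| <= K + P_r (|v| - K)_+, because P_r is positive with mass 1; the integral of
    the last term is preserved. *)
Lemma exc_convol K r v : 0 <= K -> 0 < r -> L1 mu v ->
  \int[mu]_x exc K (convol (pk be r) v x) <= \int[mu]_x exc K (v x).
Proof.
move=> K0 r0 lv; have le := L1_exc K0 lv; have lp := @L1_pk R n be be_half be1 r.
apply: (@le_trans _ _ (\int[mu]_x `|convol (pk be r) (fun y => exc K (v y)) x|)); last first.
  apply: (le_trans (conv_norm_le lp le)).
  have -> : \int[mu]_x `|pk be r x| = 1.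
    by rewrite -(@Rint_pk R n be be_half be1 r r0); apply: eq_Rintegral => x _; rewrite ger0_norm// pk_ge0.
  rewrite mul1r le_eqVlt; apply/orP; left; apply/eqP.
  by apply: eq_Rintegral => x _; rewrite ger0_norm// exc_ge0.
apply: ler_Rint; [exact: (L1_exc K0 (L1_conv lp lv))|exact: (L1_norm (L1_conv lp le))|move=> x].
have l1 := L1_pkM be_half be1 r x lv; have l2 := L1_pkM be_half be1 r x le.
apply: le_trans (ler_norm _); rewrite ge_max; apply/andP; split; last first.
  by apply: Rint_ge0 => y; rewrite mulr_ge0 ?pk_ge0 ?exc_ge0.
rewrite lerBlDr; have lK : L1 mu (fun y => K * pk be r (x - y)) by apply: L1Z; exact: L1_shift.
have IK : \int[mu]_y (K * pk be r (x - y)) = K.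
  by rewrite (RintZ _ (L1_shift x lp)) (Rint_shift x lp) Rint_pk// mulr1.
rewrite -{2}IK /convol -(RintD l2 lK); apply: ler_norm_Rint_le => //; first exact: L1D.
move=> y; have p0 : 0 <= pk be r (x - y) by exact: pk_ge0.
rewrite normrM (ger0_norm p0) (mulrC K) -mulrDr; apply: ler_wpM2l => //.
by rewrite -lerBlDr le_max lexx.
Qed.

(** An explicit upwind step for v_t + b.grad f(v) = 0 with space step h along b and time step h / L;
    the ratio 1 / L keeps id - f / L nondecreasing. *)
Definition stepM h v x : R := v x - (f (v x) - f (v (x - h *: b))) / L.

Lemma L1_stepM h v : L1 mu v -> L1 mu (stepM h v).
Proof.
move=> lv; have lf := L1_comp_slope lv.
apply: L1B => //; under eq_fun do rewrite mulrC.
by apply: L1Z; apply: L1B => //; exact: (L1_transl (- (h *: b)) lf).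
Qed.

(* stepM splits as A(v) + B(v(. - h b)) with A = id - f / L and B = f / L both
   odd and nondecreasing; A + B = id and translation invariance conclude. *)
Lemma exc_stepM h K v : 0 <= K -> L1 mu v ->
  \int[mu]_x exc K (stepM h v x) <= \int[mu]_x exc K (v x).
Proof.
move=> K0 lv; have li : 0 <= L^-1 by rewrite invr_ge0 ltW.
pose A (w : R) := w - f w / L.
have Amono (p q : R) : p <= q -> A p <= A q.
  move=> pq; have := fL pq; rewrite -ler_pdivrMl// => H.
  by rewrite /A; move: H; rewrite mulrC mulrBl; lra.
pose P (w : R) := Num.max (A `|w| - A K) 0; pose Q (w : R) := Num.max (f `|w| / L - f K / L) 0.
have mA : measurable_fun setT A.
  by apply: measurable_funB => //; apply: measurable_funM.
have PQ (w : R) : P w + Q w = exc K w.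
  rewrite /P /Q /exc; have [wK|wK] := leP `|w| K.
    rewrite !max_r ?addr0 ?subr_le0// ?Amono//.
    by rewrite ler_wpM2r// fmono.
  have wK' := ltW wK; rewrite !max_l ?subr_ge0 ?Amono//; first by rewrite /A; ring.
  by rewrite ler_wpM2r// fmono.
have P0 (w : R) : 0 <= P w by rewrite le_max lexx orbT.
have Q0 (w : R) : 0 <= Q w by rewrite le_max lexx orbT.
have lE := L1_exc K0 lv.
have lP : L1 mu (fun x => P (v x)).
  apply: (L1_le _ _ lE) => [|x]; last by rewrite ger0_norm// -PQ lerDl.
  apply: measurable_maxr => //; apply: measurable_funB => //.
  by apply: (measurableT_comp mA); apply: measurableT_comp => //; exact: (L1_measurable lv).
have lQ : L1 mu (fun x => Q (v x)).
  apply: (L1_le _ _ lE) => [|x]; last by rewrite ger0_norm// -PQ lerDr.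
  apply: measurable_maxr => //; apply: measurable_funB => //; apply: measurable_funM => //.
  by apply: (measurableT_comp mf); apply: measurableT_comp => //; exact: (L1_measurable lv).
have lQt : L1 mu (fun x => Q (v (x - h *: b))) := L1_transl (- (h *: b)) lQ.
apply: (@le_trans _ _ (\int[mu]_x (P (v x) + Q (v (x - h *: b))))).
  apply: ler_Rint; [exact: (L1_exc K0 (L1_stepM h lv))|exact: L1D|move=> x].
  rewrite ge_max addr_ge0// andbT.
  have -> : stepM h v x = A (v x) + f (v (x - h *: b)) / L by rewrite /stepM /A; ring.
  have nA : `|A (v x)| = A `|v x|.
    have A0 : A 0 = 0 by rewrite /A odd_at0 mul0r subr0.
    have [v0|v0] := ger0P (v x); first by rewrite ger0_norm// -A0 Amono.
    have -> : A (v x) = - A (- v x) by rewrite /A fN; ring.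
    by rewrite normrN ger0_norm// -A0 Amono// oppr_ge0 ltW.
  have nB : `|f (v (x - h *: b)) / L| = f `|v (x - h *: b)| / L.
    by rewrite normrM odd_mono_norm (ger0_norm li).
  apply: (@le_trans _ _ ((A `|v x| - A K) + (f `|v (x - h *: b)| / L - f K / L))).
    have := ler_normD (A (v x)) (f (v (x - h *: b)) / L); rewrite nA nB.
    by have -> : A K = K - f K / L by []; lra.
  by apply: lerD; rewrite le_max lexx.
rewrite (RintD lP lQt) (Rint_transl (- (h *: b)) lQ) -(RintD lP lQ).
by rewrite le_eqVlt; apply/orP; left; apply/eqP; apply: eq_Rintegral => x _.
Qed.

Lemma L1_ckM h r x v : L1 mu v -> L1 mu (fun y => ck be b h r (x - y) * v y).
Proof.
move=> lv; have l1 := L1_pkM be_half be1 r (x - h *: b) lv; have l2 := L1_pkM be_half be1 r x lv.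
rewrite (_ : (fun y => _) = fun y => h^-1 * (pk be r (x - h *: b - y) * v y - pk be r (x - y) * v y)).
  by apply: L1Z; exact: L1B.
by apply/funext => y; rewrite /ck [x - y - _]addrAC; ring.
Qed.

Lemma convol_ck h r v x : L1 mu v ->
  convol (ck be b h r) v x = (convol (pk be r) v (x - h *: b) - convol (pk be r) v x) / h.
Proof.
move=> lv; have l1 := L1_pkM be_half be1 r (x - h *: b) lv; have l2 := L1_pkM be_half be1 r x lv.
rewrite /convol -(RintB l1 l2) mulrC -RintZ; last exact: L1B.
by apply: eq_Rintegral => y _; rewrite /ck [x - y - _]addrAC; ring.
Qed.

Lemma convol_pk_transl r v (w x : 'rV[R]_n) : L1 mu v ->
  convol (pk be r) (fun y => v (y - w)) x = convol (pk be r) v (x - w).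
Proof.
move=> lv; have l := L1_pkM be_half be1 r (x - w) lv.
rewrite /convol -(Rint_transl (- w) l); apply: eq_Rintegral => y _.
by congr (pk be r _ * _); rewrite opprB addrA addrNK.
Qed.

(** Convolution moves the difference quotient from f(v) to the kernel, as the Duhamel formula does
    with the gradient. *)
Lemma convol_stepM r h v x : h != 0 -> L1 mu v ->
  convol (pk be r) (stepM h v) x =
  convol (pk be r) v x + h / L * convol (ck be b h r) (f \o v) x.
Proof.
move=> h0 lv; have lf := L1_comp_slope lv.
have lft : L1 mu (fun y => (f \o v) (y - h *: b)) := L1_transl (- (h *: b)) lf.
have l1 := L1_pkM be_half be1 r x lv; have l2 := L1_pkM be_half be1 r x lf.
have l3 := L1_pkM be_half be1 r x lft.
rewrite convol_ck// -(convol_pk_transl r (h *: b) x lf) /convol.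
rewrite [h / L * _](_ : _ = L^-1 * (\int[mu]_y (pk be r (x - y) * (f \o v) (y - h *: b)) -
  \int[mu]_y (pk be r (x - y) * (f \o v) y))); last first.
  by field; rewrite h0 gt_eqF.
rewrite -(RintB l3 l2) -RintZ; last exact: L1B.
rewrite -RintD//; last by apply: L1Z; exact: L1B.
by apply: eq_Rintegral => y _; rewrite /stepM /=; ring.
Qed.

Lemma convol_pkB_div t v w h x : L1 mu v -> L1 mu w ->
  (convol (pk be t) v x - convol (pk be t) w x) / h =
  convol (pk be t) (fun y => (v y - w y) / h) x.
Proof.
move=> lv lw; have l1 := L1_pkM be_half be1 t x lv; have l2 := L1_pkM be_half be1 t x lw.
rewrite /convol -(RintB l1 l2) mulrC -(RintZ _ (L1B l1 l2)).
by apply: eq_Rintegral => y _; ring.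
Qed.

Lemma convol_pk_ck t r h v x : 0 < t -> 0 < r -> L1 mu v ->
  convol (pk be t) (convol (ck be b h r) v) x = convol (ck be b h (t + r)) v x.
Proof.
move=> t0 r0 lv; have lc := L1_convol_pk be_half be1 r lv.
have lct : L1 mu (fun y => convol (pk be r) v (y - h *: b)) := L1_transl (- (h *: b)) lc.
rewrite (convol_ck h (t + r) x lv).
rewrite -(convol_pk_semigroup be_half be1 x t0 r0 lv).
rewrite -(convol_pk_semigroup be_half be1 (x - h *: b) t0 r0 lv).
rewrite -(convol_pk_transl t (h *: b) x lc) (convol_pkB_div t h x lct lc).
by congr (convol _ _ x); apply/funext => y; exact: convol_ck.
Qed.

Definition scheme tau v0 : nat -> 'rV[R]_n -> R :=
  fix loop k := if k is k'.+1 then convol (pk be tau) (stepM (L * tau) (loop k')) else v0.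

Lemma L1_scheme tau v0 k : L1 mu v0 -> L1 mu (scheme tau v0 k).
Proof.
by move=> l0; elim: k => //= k lk; apply: L1_conv; [exact: L1_pk|exact: L1_stepM].
Qed.

Lemma exc_scheme K tau v0 k : 0 <= K -> 0 < tau -> L1 mu v0 ->
  \int[mu]_x exc K (scheme tau v0 k x) <= \int[mu]_x exc K (v0 x).
Proof.
move=> K0 t0 l0; elim: k => //= k; apply: le_trans.
have lk := L1_scheme tau k l0.
apply: (le_trans (exc_convol K0 t0 (L1_stepM (L * tau) lk))).
exact: exc_stepM.
Qed.

(** A discrete Duhamel formula. The j-th term carries the kernel at time (k + 1 - j) tau, the
    left-endpoint value of the elapsed time on the j-th step. *)
Lemma schemeE tau v0 k x : 0 < tau -> L1 mu v0 ->
  scheme tau v0 k.+1 x = convol (pk be (k.+1%:R * tau)) v0 x +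
    tau * \sum_(j < k.+1) convol (ck be b (L * tau) ((k.+1 - j)%:R * tau)) (f \o scheme tau v0 j) x.
Proof.
move=> t0 l0; have h0 : L * tau != 0 by rewrite gt_eqF// mulr_gt0.
have hL : L * tau / L = tau by rewrite mulrAC divff ?mul1r// gt_eqF.
elim: k x => [|k IH] x.
  by rewrite big_ord1 subn0 /= mul1r convol_stepM// hL.
have lk := L1_scheme tau k.+1 l0.
have lF j := L1_comp_slope (L1_scheme tau j l0).
rewrite [LHS]/= -/(scheme tau v0 k.+1) (convol_stepM tau x h0 lk) hL big_ord_recr/= mulrDr addrA.
rewrite subSnn mul1r; congr (_ + _).
have lc j : L1 mu (convol (ck be b (L * tau) ((k.+1 - j)%:R * tau)) (f \o scheme tau v0 j)).
  by apply: L1_conv => //; exact: L1_ck.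
have lp j := L1_pkM be_half be1 tau x (lc j).
have lp0 := L1_pkM be_half be1 tau x (L1_convol_pk be_half be1 (k.+1%:R * tau) l0).
have kt m : (0 < m)%N -> 0 < m%:R * tau :> R by move=> m0; rewrite mulr_gt0// ltr0n.
have -> : convol (pk be tau) (scheme tau v0 k.+1) x =
    \int[mu]_y (pk be tau (x - y) * convol (pk be (k.+1%:R * tau)) v0 y +
      tau * \sum_(j < k.+1) (pk be tau (x - y) *
        convol (ck be b (L * tau) ((k.+1 - j)%:R * tau)) (f \o scheme tau v0 j) y)).
  by apply: eq_Rintegral => y _; rewrite IH -mulr_sumr; ring.
rewrite RintD//; last by apply: L1Z; apply: L1_sum => j; exact: lp.
rewrite RintZ; last by apply: L1_sum => j; exact: lp.
rewrite Rint_sum; last by move=> j; exact: lp.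
congr (_ + _ * _).
  rewrite -/(convol (pk be tau) (convol (pk be (k.+1%:R * tau)) v0) x).
  rewrite (convol_pk_semigroup be_half be1 x t0 (kt _ (ltn0Sn k)) l0).
  by have -> : tau + k.+1%:R * tau = k.+2%:R * tau by rewrite -[in RHS]natr1 mulrDl mul1r addrC.
apply: eq_bigr => j _.
rewrite -/(convol (pk be tau) (convol (ck be b (L * tau) ((k.+1 - j)%:R * tau)) (f \o scheme tau v0 j)) x).
have jk : (0 < k.+1 - j)%N by rewrite subn_gt0.
have -> : (k.+2 - j)%:R * tau = tau + (k.+1 - j)%:R * tau.
  by rewrite subSn ?(ltnW (ltn_ord j))// -natr1 mulrDl mul1r addrC.
exact: (convol_pk_ck (L * tau) x t0 (kt _ jk) (lF j)).
Qed.

End monotone_step.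

Lemma hpow_int_reflect (R : realType) (g t c S : R) : 0 <= g < 1 -> c < t -> t - c <= S ->
  L1 leb (fun s => hpow g (t - c) (t - s)) /\
  \int[leb]_s hpow g (t - c) (t - s) <= S `^ (1 - g) / (1 - g).
Proof.
move=> /andP[g0 g1] ct tS; have tc0 : 0 < t - c by rewrite subr_gt0.
have g10 : 0 < 1 - g by rewrite subr_gt0.
have [l1 i1] := hpow_int g1 tc0; have [l1' ->] := L1_reflect t l1; split=> //.
apply: (le_trans i1); apply: ler_wpM2r; first by rewrite invr_ge0 ltW.
by apply: ler_powR2 tS; exact: ltW.
Qed.

Section products.
Context {R : realType} {n : nat}.
Local Notation mu := (lebesgue_rV n).

Definition itv_step (c d s : R) : R := if (c <= s) && (s < d) then 1 else 0.

Lemma measurable_itv_step c d : measurable_fun setT (itv_step c d).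
Proof.
apply: measurable_fun_ifT => //; apply: measurable_and.
  exact: measurable_fun_ler.
exact: measurable_fun_ltr.
Qed.

Lemma itv_step_int c d : c <= d -> L1 leb (itv_step c d) /\ \int[leb]_s itv_step c d s = d - c.
Proof.
move=> cd; have E : EFin \o itv_step c d = EFin \o \1_(`[c, d[%classic : set R).
  apply/funext => s; rewrite /= indicE /itv_step; case: ifPn => H.
    by rewrite mem_set//= in_itv/=.
  by rewrite memNset//= in_itv/=; exact/negP.
have I : (\int[leb]_s (itv_step c d s)%:E = (d - c)%:E)%E.
  transitivity (\int[leb]_s (\1_(`[c, d[%classic : set R) s)%:E)%E.
    by rewrite (_ : (fun s => _) = EFin \o itv_step c d)// E.
  rewrite integral_indic//= setIT /leb; have := lebesgue_measure_itv `[c, d[%R.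
  move=> -> /=; rewrite lte_fin; case: ltgtP cd => // -> _.
  by rewrite subrr.
have l : L1 leb (itv_step c d).
  apply: ge0_L1; first exact: measurable_itv_step.
  - by move=> s; rewrite /itv_step; case: ifP.
  - by rewrite I ltry.
by split=> //; apply: EFin_inj; rewrite EFin_Rint.
Qed.

Lemma stm_prod (g : R -> R) (h : 'rV[R]_n -> R) : L1 leb g -> L1 mu h ->
  L1 (@stm R n) (fun p => g p.1 * h p.2) /\
  \int[@stm R n]_p (g p.1 * h p.2) = \int[leb]_s g s * \int[mu]_z h z.
Proof.
move=> lg lh; have l := @L1_prodM _ _ _ _ _ leb mu _ _ lg lh.
split=> //; rewrite Rint_stm -(Rint_prod1 l) /= -RintZr//.
by apply: eq_Rintegral => s _; rewrite RintZ.
Qed.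

Lemma L1_stm_conv (g : R -> R) (K v : 'rV[R]_n -> R) : L1 leb g -> L1 mu K -> L1 mu v ->
  L1 (mu \x @stm R n)%E
    (fun w : 'rV[R]_n * (R * 'rV[R]_n) => g w.2.1 * (K (w.1 - w.2.2) * v w.2.2)).
Proof.
move=> lg lK lv; have mK := L1_measurable lK; have mv := L1_measurable lv.
have mg := L1_measurable lg.
have m22 : measurable_fun setT (fun w : 'rV[R]_n * (R * 'rV[R]_n) => w.2.2).
  by apply: (measurableT_comp measurable_snd); exact: measurable_snd.
apply: (@L1_prod_iter2 _ _ _ _ _ mu (@stm R n) _ _
  (fun p => (\int[mu]_x `|K x|) * (`|g p.1| * `|v p.2|))).
- apply: measurable_funM.
    by apply: (measurableT_comp mg); apply: (measurableT_comp measurable_fst); exact: measurable_snd.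
  apply: measurable_funM; last exact: (measurableT_comp mv).
  apply: (measurableT_comp mK); apply: measurable_fun_subv => //; exact: measurable_fst.
- move=> [s z] /=; apply: L1Z; under eq_fun do rewrite mulrC.
  by apply: L1Z; exact: (L1_transl (- z) lK).
- by apply: L1Z; have [] := stm_prod (L1_norm lg) (L1_norm lv).
- move=> [s z] /=; under eq_Rintegral do rewrite !normrM mulrCA mulrC.
  have lt_ := L1_norm (L1_transl (- z) lK).
  by rewrite (RintZ _ lt_) (Rint_transl (- z) (L1_norm lK)) mulrC.
Qed.

(** K1 v - K2 y is telescoped as K1 (v - w) + (K1 - K2) w + K2 (w - y), products being convolutions;
    each term is bounded by Young's inequality. *)
Lemma convol_diff_norm (K1 K2 v w y : 'rV[R]_n -> R) (N1 N2 N12 e1 e2 B : R) :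
  L1 mu K1 -> L1 mu K2 -> L1 mu v -> L1 mu w -> L1 mu y ->
  \int[mu]_x `|K1 x| <= N1 -> \int[mu]_x `|K2 x| <= N2 ->
  \int[mu]_x `|K1 x - K2 x| <= N12 ->
  \int[mu]_x `|v x - w x| <= e1 -> \int[mu]_x `|w x| <= B ->
  \int[mu]_x `|w x - y x| <= e2 ->
  \int[mu]_x `|convol K1 v x - convol K2 y x| <= N1 * e1 + N12 * B + N2 * e2.
Proof.
move=> l1 l2 lv lw ly H1 H2 H12 He1 HB He2.
have lvw := L1B lv lw; have l12 := L1B l1 l2; have lwy := L1B lw ly.
pose A x := convol K1 (fun z => v z - w z) x.
pose B' x := convol (fun z => K1 z - K2 z) w x.
pose C x := convol K2 (fun z => w z - y z) x.
have lA : L1 mu A := L1_conv l1 lvw; have lB : L1 mu B' := L1_conv l12 lw.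
have lC : L1 mu C := L1_conv l2 lwy.
have lS := L1D (L1D (L1_norm lA) (L1_norm lB)) (L1_norm lC).
apply: (@le_trans _ _ (\int[mu]_x (`|A x| + `|B' x| + `|C x|))).
  apply: ae_ler_Rint => //; first exact: (L1_norm (L1B (L1_conv l1 lv) (L1_conv l2 ly))).
  have S1 := ae_L1_section1 (L1_conv_kernel l1 lv).
  have S2 := ae_L1_section1 (L1_conv_kernel l1 lw).
  have S3 := ae_L1_section1 (L1_conv_kernel l2 lw).
  have S4 := ae_L1_section1 (L1_conv_kernel l2 ly).
  apply: filterS2 (filterI S1 S2) (filterI S3 S4) => x /= [s1 s2] [s3 s4].
  have AE : A x = convol K1 v x - convol K1 w x.
    by rewrite /A /convol -(RintB s1 s2); apply: eq_Rintegral => z _; ring.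
  have BE : B' x = convol K1 w x - convol K2 w x.
    by rewrite /B' /convol -(RintB s2 s3); apply: eq_Rintegral => z _; ring.
  have CE : C x = convol K2 w x - convol K2 y x.
    by rewrite /C /convol -(RintB s3 s4); apply: eq_Rintegral => z _; ring.
  have -> : convol K1 v x - convol K2 y x = A x + B' x + C x by rewrite AE BE CE; ring.
  by apply: (le_trans (ler_normD _ _)); rewrite lerD2r; exact: ler_normD.
rewrite (RintD (L1D (L1_norm lA) (L1_norm lB)) (L1_norm lC)) (RintD (L1_norm lA) (L1_norm lB)).
have I0 (f : 'rV[R]_n -> R) : 0 <= \int[mu]_x `|f x| by apply: Rint_ge0.
apply: lerD; first apply: lerD.
- by apply: (le_trans (conv_norm_le l1 lvw)); apply: ler_pM.
- by apply: (le_trans (conv_norm_le l12 lw)); apply: ler_pM.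
- by apply: (le_trans (conv_norm_le l2 lwy)); apply: ler_pM.
Qed.

End products.

Section clamped_nonlinearity.
Context {R : realType}.
Variables (q M : R).
Hypotheses (q0 : 0 < q) (M0 : 0 < M).
Implicit Types v w : R.

(** The nonlinearity is not globally Lipschitz, as the scheme requires. The clamped one is, with
    constant [clampL], stays odd and nondecreasing, and coincides with it where |u| <= M. *)
Definition clampf v : R := nonlin q (Num.max (- M) (Num.min v M)).

Definition clampL : R := (1 + q) * M `^ q.

Lemma clampL_gt0 : 0 < clampL.
Proof. by rewrite mulr_gt0 ?powR_gt0// addr_gt0. Qed.

Lemma nonlinN v : nonlin q (- v) = - nonlin q v.
Proof. by rewrite /nonlin normrN mulNr. Qed.

(** For v > 0, write v^q = w^q (w / v)^(-q) >= w^q (1 - q (w - v) / v): a Bernoulli inequality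
    replaces the derivative of v^(q+1). *)
Lemma nonlin_slope_ge0 v w : 0 <= v -> v <= w -> w <= M ->
  0 <= nonlin q w - nonlin q v <= clampL * (w - v).
Proof.
move=> v0 vw wM; have w0 := le_trans v0 vw.
rewrite /nonlin (ger0_norm v0) (ger0_norm w0); apply/andP; split.
  rewrite subr_ge0; apply: ler_pM => //; first exact: powR_ge0.
  by apply: ler_powR2 => //; exact: ltW.
have WM : w `^ q <= M `^ q by apply: ler_powR2 => //; exact: ltW.
have q1 : 0 <= 1 + q by rewrite addr_ge0// ltW.
apply: (@le_trans _ _ ((1 + q) * w `^ q * (w - v))); last first.
  by rewrite ler_wpM2r ?subr_ge0// ler_wpM2l.
move: v0; rewrite le_eqVlt => /predU1P[<-|v0].
  rewrite mul0r !subr0 mulrC; apply: ler_wpM2r => //.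
  by rewrite ler_peMl ?powR_ge0// lerDl ltW.
have W0 : 0 < w by exact: lt_le_trans vw.
have dl0 : 0 <= (w - v) / v by rewrite divr_ge0 ?subr_ge0// ltW.
have /andP[H _] := powR_1B_le (ltW q0) dl0.
have E1 : 1 + (w - v) / v = w / v by field; rewrite gt_eqF.
have Z : w `^ q * (w / v) `^ (- q) = v `^ q.
  rewrite powRM ?(ltW W0) ?invr_ge0 ?(ltW v0)// mulrA -powRD ?(gt_eqF W0) ?implybT// subrr powRr0 mul1r.
  by rewrite -powR_inv1 ?(ltW v0)// -powRrM mulN1r opprK.
have H2 : w `^ q * (v - q * (w - v)) <= v * v `^ q.
  rewrite -Z; rewrite E1 in H; have := ler_wpM2l (ltW v0) H.
  move=> H3; have := ler_wpM2l (powR_ge0 w q) H3.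
  rewrite [X in _ <= X](_ : _ = v * (w `^ q * (w / v) `^ (- q))); last by ring.
  congr (_ * _ <= _); field; exact: lt0r_neq0.
rewrite lerBlDr -lerBlDl; apply: le_trans H2.
by rewrite le_eqVlt; apply/orP; left; apply/eqP; ring.
Qed.

Lemma nonlin_slope v w : - M <= v -> v <= w -> w <= M ->
  0 <= nonlin q w - nonlin q v <= clampL * (w - v).
Proof.
move=> Mv vw wM; have [v0|v0] := leP 0 v; first exact: nonlin_slope_ge0.
have [w0|w0] := leP 0 w; last first.
  have := @nonlin_slope_ge0 (- w) (- v); rewrite !nonlinN lerN2 => /(_ _ vw).
  rewrite oppr_ge0 (ltW w0) lerNl Mv => /(_ isT isT).
  by rewrite !opprK ![- _ + _]addrC.
have /andP[a1 a2] := nonlin_slope_ge0 (lexx 0) w0 wM.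
have nv0 : 0 <= - v by rewrite oppr_ge0 ltW.
have nvM : - v <= M by rewrite lerNl.
have /andP[b1 b2] := nonlin_slope_ge0 (lexx 0) nv0 nvM.
rewrite nonlinN in b1 b2; have z : nonlin q 0 = 0 by rewrite /nonlin mul0r.
rewrite z !subr0 in a1 a2 b1 b2; apply/andP; split; first by lra.
rewrite mulrBr; move: a2 b2; rewrite mulrN; lra.
Qed.

Let clamp_bnd v : - M <= Num.max (- M) (Num.min v M) <= M.
Proof.
by rewrite le_max lexx /= ge_max ge_min lexx orbT andbT; move: M0; lra.
Qed.

Let clamp_lip v w : v <= w ->
  0 <= Num.max (- M) (Num.min w M) - Num.max (- M) (Num.min v M) <= w - v.
Proof.
move=> vw; rewrite /Num.max /Num.min.
by repeat case: ifPn; rewrite -?leNgt; move: M0 vw; lra.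
Qed.

Lemma measurable_clampf : measurable_fun setT clampf.
Proof.
apply: measurable_nonlin; apply: measurable_maxr => //; exact: measurable_minr.
Qed.

Lemma clampfN v : clampf (- v) = - clampf v.
Proof.
rewrite /clampf -nonlinN; congr nonlin; rewrite /Num.max /Num.min.
by repeat case: ifPn; rewrite -?leNgt; move: M0; lra.
Qed.

Lemma clampf_slope v w : v <= w -> 0 <= clampf w - clampf v <= clampL * (w - v).
Proof.
move=> vw; have /andP[v1 v2] := clamp_bnd v; have /andP[w1 w2] := clamp_bnd w.
have /andP[c1 c2] := clamp_lip vw; rewrite subr_ge0 in c1.
have /andP[-> H] := nonlin_slope v1 c1 w2; apply: (le_trans H).
by apply: ler_wpM2l c2; exact: (ltW clampL_gt0).
Qed.

Lemma clampfE v : `|v| <= M -> clampf v = nonlin q v.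
Proof.
rewrite ler_norml => /andP[v1 v2]; rewrite /clampf; congr nonlin.
by rewrite min_l// max_r.
Qed.

End clamped_nonlinearity.

(** * Convergence of the scheme and the maximum principle *)

Section scheme_error.
Context {R : realType} {n : nat}.
Variable be : R.
Hypotheses (be_half : 2^-1 < be) (be1 : be < 1).
Variables (b : 'rV[R]_n) (q : R) (u0 : 'rV[R]_n -> R) (u : R -> 'rV[R]_n -> R).
Hypothesis q0 : 0 < q.
Hypothesis lu0 : L1 (lebesgue_rV n) u0.
Hypothesis hu : mild_solution (2 * be) q b u0 u.
Local Notation mu := (lebesgue_rV n).
Local Notation nu := ((2 * be)^-1).
Local Notation ga := ((1 + nu) / 2).
Hypothesis mu0 : (0 < mu [set: 'rV[R]_n])%E.
Implicit Types (x y z : 'rV[R]_n) (t s r : R).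
Local Notation G := (mildG q u).

Let be0 : 0 < be. Proof. by apply: lt_trans be_half; rewrite invr_gt0. Qed.
Let nu0 : 0 < nu. Proof. by rewrite invr_gt0 mulr_gt0. Qed.
Let nu1 : nu < 1. Proof. by rewrite invf_lt1 ?mulr_gt0//; move: be_half; lra. Qed.
Let ga0 : 0 < ga. Proof. by rewrite divr_gt0// addr_gt0. Qed.
Let ga1 : ga < 1. Proof. by move: nu1; lra. Qed.

Let nu01 : 0 <= nu < 1. Proof. by rewrite (ltW nu0). Qed.
Let ga01 : 0 <= ga < 1. Proof. by rewrite (ltW ga0). Qed.

Variables (f : R -> R) (L : R).
Hypotheses (mf : measurable_fun setT f) (fN : forall v, f (- v) = - f v).
Hypotheses (fmono : forall v w, v <= w -> f v <= f w).
Hypotheses (L0 : 0 < L) (fL : forall v w, v <= w -> f w - f v <= L * (w - v)).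

Variables (a T : R).
Hypothesis a0 : 0 < a.
Hypothesis Gf : forall s, a <= s <= T -> {ae mu, forall z, G (s, z) = f (u s z)}.

Variables (tau S C1 C2 om ep Bd eta : R) (N : nat).
Hypotheses (tau0 : 0 < tau) (S0 : 0 < S).
Local Notation tn j := (a + j%:R * tau).
Hypotheses (NT : tn N <= T) (NS : N%:R * tau <= S).
Hypotheses (C20 : 0 <= C2) (C10 : 0 <= C1) (om0 : 0 <= om) (ep0 : 0 <= ep) (eta0 : 0 <= eta) (Bd0 : 0 <= Bd).
Hypothesis HC1 : forall r, 0 < r -> \int[mu]_y `|kk be b r y| <= C1 * r `^ (- nu).
Hypothesis HC2 : forall h r, 0 < h -> 0 < r -> \int[mu]_y `|ck be b h r y| <= C2 * r `^ (- nu).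
Hypothesis Hom : forall s s', a <= s <= T -> a <= s' <= T -> `|s - s'| <= tau ->
  \int[mu]_x `|u s x - u s' x| <= om.
Hypothesis HB : forall s, a <= s <= T -> \int[mu]_x `|u s x| <= Bd.
Hypothesis Hep : forall r r', 0 < r <= S -> r <= r' <= r + tau ->
  \int[mu]_y `|kk be b r y - ck be b (L * tau) r' y| <= ep * r `^ (- ga).

Local Notation sch := (scheme be b f L tau (u a)).
Let A1 := C1 * (L * om) + C2 * (L * eta).
Let A2 := ep * (L * Bd).
Hypothesis Heta : A1 * (S `^ (1 - nu) / (1 - nu)) + A2 * (S `^ (1 - ga) / (1 - ga)) <= eta.

Let A10 : 0 <= A1. Proof. by rewrite addr_ge0// mulr_ge0// mulr_ge0// ltW. Qed.
Let A20 : 0 <= A2. Proof. by rewrite mulr_ge0// mulr_ge0// ltW. Qed.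
Let lu s : a <= s -> L1 mu (u s). Proof. by move=> as_; apply: (mild_L1 hu); rewrite (le_trans (ltW a0)). Qed.
Let lua : L1 mu (u a). Proof. exact: lu. Qed.
Let lF j : L1 mu (f \o sch j).
Proof. exact: (L1_comp_slope mf fN fmono fL (L1_scheme be_half be1 b mf fN fmono fL tau j lua)). Qed.
Let h0 : 0 < L * tau. Proof. exact: mulr_gt0. Qed.
Let tn_le i j : (i <= j)%N -> tn i <= tn j.
Proof. by move=> ij; rewrite lerD2l ler_wpM2r ?ler_nat// ltW. Qed.
Let tnS j : tn j.+1 = tn j + tau. Proof. by rewrite -natr1 mulrDl mul1r addrA. Qed.
Let atn j : a <= tn j. Proof. by rewrite lerDl mulr_ge0// ltW. Qed.

(** Its space-time integral is the error u(t_k) - sch k almost everywhere: the restarted and the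
    discrete Duhamel formulas are subtracted, the discrete sum being spread as a step function in
    time. *)
Let H k x (p : R * 'rV[R]_n) : R := duhcut be b q u a (tn k) x p -
  \sum_(j < k) itv_step (tn j) (tn j.+1) p.1 *
    (ck be b (L * tau) ((k - j)%:R * tau) (x - p.2) * (f \o sch j) p.2).

(** In [A1], the variation [om] of u within a time step and the earlier error [eta]; in [A2], the
    kernel error, with its stronger singularity. *)
Let g k s : R := A1 * hpow nu (tn k - a) (tn k - s) + A2 * hpow ga (tn k - a) (tn k - s).

Let l_step j : L1 leb (itv_step (tn j) (tn j.+1)) /\ \int[leb]_s itv_step (tn j) (tn j.+1) s = tau.
Proof.
have tt : tn j <= tn j.+1 by exact: tn_le.
by have [l ->] := itv_step_int tt; split=> //; rewrite tnS addrC addKr.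
Qed.

Let g_int k : (0 < k <= N)%N -> L1 leb (g k) /\ \int[leb]_s g k s <= eta.
Proof.
move=> /andP[k0 kN]; have tk0 : 0 < tn k - a by rewrite addrAC subrr add0r mulr_gt0// ltr0n.
have tkS : tn k - a <= S.
  by rewrite addrAC subrr add0r (le_trans _ NS)// ler_wpM2r ?ler_nat// ltW.
have tk : a < tn k by rewrite -subr_gt0.
have [l1 i1] := hpow_int_reflect nu01 tk tkS; have [l2 i2] := hpow_int_reflect ga01 tk tkS.
split; first by apply: L1D; exact: L1Z.
rewrite /g (RintD (L1Z A1 l1) (L1Z A2 l2)) (RintZ _ l1) (RintZ _ l2).
apply: le_trans Heta; apply: lerD; [exact: (ler_wpM2l A10 i1)|exact: (ler_wpM2l A20 i2)].
Qed.

Let lH k : L1 (mu \x @stm R n)%E (fun w => H k w.1 w.2).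
Proof.
apply: L1B; first exact: (L1_duhcut_prod be_half be1 q0 hu mu0 (tn k) a0).
apply: L1_sum => j; have [ls _] := l_step j.
exact: (L1_stm_conv ls (L1_ck be_half be1 b (L * tau) ((k - j)%:R * tau)) (lF j)).
Qed.

Let L1_cutG s : L1 mu (fun z => cutG q u a (s, z)).
Proof.
rewrite /cutG /=; have [as_|as_] := leP a s; last exact: L1_0.
have [M _ HM] := mildG_slice q0 hu mu0 s a0.
by have [] := HM s; rewrite ?as_ ?lexx.
Qed.

Let lHs k s : L1 (mu \x mu)%E (fun w => H k w.1 (s, w.2)).
Proof.
apply: L1B.
  exact: (L1_conv_kernel (L1_kk be_half be1 b (tn k - s)) (L1_cutG s)).
have lj (j : 'I_k) := L1Z (itv_step (tn j) (tn j.+1) s)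
  (L1_conv_kernel (L1_ck be_half be1 b (L * tau) ((k - j)%:R * tau)) (lF j)).
by apply: L1_sum => j; exact: (lj j).
Qed.

Let Hout k s x z : (s < a) || (tn k <= s) -> H k x (s, z) = 0.
Proof.
move=> out; rewrite /H /duhcut /cutG /= big1 ?subr0.
  case/orP: out => [sa|ts]; first by rewrite leNgt sa/= mulr0.
  by rewrite kk0 ?mul0r// subr_le0.
move=> j _; rewrite /itv_step; case: ifPn; rewrite ?mul0r// => /andP[s1 s2].
case/orP: out => [sa|ts].
  by move: (le_lt_trans (le_trans (atn j) s1) sa); rewrite ltxx.
have := lt_le_trans s2 (tn_le (ltn_ord j)).
by rewrite ltNge ts.
Qed.

Let find_step k s : a <= s -> s < tn k -> exists2 j : 'I_k, tn j <= s & s < tn j.+1.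
Proof.
elim: k => [|k IH] as_ st; first by move: (le_lt_trans as_ st); rewrite mul0r addr0 ltxx.
have [ks|sk] := leP (tn k) s; first by exists ord_max.
by have [j j1 j2] := IH as_ sk; exists (widen_ord (leqnSn k) j).
Qed.

Let HE k s (i : 'I_k) : tn i <= s -> s < tn i.+1 ->
  {ae mu, forall x, \int[mu]_z H k x (s, z) =
    convol (kk be b (tn k - s)) (fun z => cutG q u a (s, z)) x -
    convol (ck be b (L * tau) ((k - i)%:R * tau)) (f \o sch i) x}.
Proof.
move=> is_ si; pose c := ck be b (L * tau) ((k - i)%:R * tau).
have lc := L1_conv_kernel (L1_ck be_half be1 b (L * tau) ((k - i)%:R * tau)) (lF i).
have lk := L1_conv_kernel (L1_kk be_half be1 b (tn k - s)) (L1_cutG s).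
apply: filterS2 (ae_L1_section1 lc) (ae_L1_section1 lk) => x /= l1 l2.
rewrite /convol -(RintB l2 l1); apply: eq_Rintegral => z _.
rewrite /H /duhcut /=; congr (_ - _).
rewrite (bigD1 i)//= {1}/itv_step is_ si /= mul1r big1 ?addr0// => j ji.
rewrite /itv_step; case: ifPn; rewrite ?mul0r// => /andP[s1 s2].
have : (j < i)%N || (i < j)%N by rewrite -neq_ltn; move: ji; apply: contra_neq => /val_inj.
case/orP => ij.
  by have := lt_le_trans s2 (le_trans (tn_le ij) is_); rewrite ltxx.
by have := lt_le_trans si (le_trans (tn_le ij) s1); rewrite ltxx.
Qed.

(** [convol_diff_norm] with G(s), f(u(t_i)) and f(sch i) as the three functions, where t_i is the
    grid point just before s. The elapsed time t_k - t_i lies between t_k - s and t_k - s + tau, as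
    kernel consistency requires. *)
Let slice_bound k s : (k <= N)%N ->
  (forall j, (j < k)%N -> \int[mu]_x `|u (tn j) x - sch j x| <= eta) -> s != a ->
  \int[mu]_x `|\int[mu]_z H k x (s, z)| <= g k s.
Proof.
move=> kN IH sa.
have [out|] := boolP ((s < a) || (tn k <= s)).
  rewrite Rint_eq0; first by rewrite addr_ge0// mulr_ge0// hpow_ge0.
  by move=> x; rewrite Rint_eq0 ?normr0// => z; exact: Hout.
rewrite negb_or -leNgt -ltNge => /andP[as_ st].
have a_s : a < s by rewrite lt_neqAle eq_sym sa.
have [i is_ si] := find_step as_ st; have ik := ltn_ord i.
have lsch := L1_scheme be_half be1 b mf fN fmono fL tau i lua.
have tkT : tn k <= T by apply: le_trans NT; exact: tn_le.
have sT : a <= s <= T by rewrite as_ (le_trans (ltW st)).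
have iT : a <= tn i <= T by rewrite atn (le_trans (tn_le (ltnW ik))).
have lw := L1_comp_slope mf fN fmono fL (lu (atn i)).
have r0 : 0 < tn k - s by rewrite subr_gt0.
have rE : (k - i)%:R * tau = tn k - tn i.
  by rewrite natrB ?(ltnW ik)//; ring.
have r'0 : 0 < (k - i)%:R * tau by rewrite mulr_gt0// ltr0n subn_gt0.
have rr1 : tn k - s <= (k - i)%:R * tau by rewrite rE lerD2l lerN2.
have rr2 : (k - i)%:R * tau <= tn k - s + tau.
  by rewrite rE; move: si; rewrite tnS; set p := tn k; set p' := tn i; lra.
have rS : 0 < tn k - s <= S.
  rewrite r0/=; apply: le_trans NS; apply: (@le_trans _ _ (k%:R * tau)).
    by move: as_; rewrite addrAC; set p := k%:R * tau; lra.
  by rewrite ler_wpM2r ?ler_nat// ltW.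
have st' : `|s - tn i| <= tau.
  by rewrite ger0_norm ?subr_ge0// lerBlDl -tnS ltW.
have lKK := L1_kk be_half be1 b (tn k - s).
have lCK := L1_ck be_half be1 b (L * tau) ((k - i)%:R * tau).
have D1 : \int[mu]_z `|cutG q u a (s, z) - (f \o u (tn i)) z| <= L * om.
  apply: (@le_trans _ _ (\int[mu]_z `|f (u s z) - f (u (tn i) z)|)).
    rewrite le_eqVlt; apply/orP; left; apply/eqP; apply: ae_eq_Rint.
    - exact: (L1_measurable (L1_norm (L1B (L1_cutG s) lw))).
    - exact: (L1_measurable (L1_norm (L1B (L1_comp_slope mf fN fmono fL (lu as_)) lw))).
    by apply: filterS (Gf sT) => z Hz; rewrite /cutG /= as_ Hz.
  apply: (le_trans (L1_dist_comp_slope mf fN fmono fL (lu as_) (lu (atn i)))).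
  by apply: (ler_wpM2l (ltW L0)); exact: Hom.
have D2 : \int[mu]_z `|(f \o u (tn i)) z| <= L * Bd.
  have ln := L1_norm (lu (atn i)).
  apply: (@le_trans _ _ (\int[mu]_z (L * `|u (tn i) z|))).
    apply: ler_Rint; [exact: (L1_norm lw)|exact: (L1Z L ln)|move=> z].
    exact: (slope_bound fN fmono fL).
  by rewrite (RintZ _ ln); apply: (ler_wpM2l (ltW L0)); exact: HB.
have D3 : \int[mu]_z `|(f \o u (tn i)) z - (f \o sch i) z| <= L * eta.
  apply: (le_trans (L1_dist_comp_slope mf fN fmono fL (lu (atn i)) lsch)).
  by apply: (ler_wpM2l (ltW L0)); exact: IH.
have K2 : \int[mu]_y `|ck be b (L * tau) ((k - i)%:R * tau) y| <= C2 * (tn k - s) `^ (- nu).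
  apply: (le_trans (HC2 h0 r'0)); apply: (ler_wpM2l C20).
  by apply: ler_powRN rr1; [exact: ltW|].
have K12 : \int[mu]_y `|kk be b (tn k - s) y - ck be b (L * tau) ((k - i)%:R * tau) y| <=
    ep * (tn k - s) `^ (- ga) by apply: Hep; rewrite ?rr1.
have := convol_diff_norm lKK lCK (L1_cutG s) lw (lF i) (HC1 r0) K2 K12 D1 D2 D3.
have -> : \int[mu]_x `|\int[mu]_z H k x (s, z)| = \int[mu]_x `|convol (kk be b (tn k - s)) (fun z => cutG q u a (s, z)) x -
    convol (ck be b (L * tau) ((k - i)%:R * tau)) (f \o sch i) x|.
  apply: ae_eq_Rint.
  - exact: (L1_measurable (L1_norm (L1_Rint1 (lHs k s)))).
  - exact: (L1_measurable (L1_norm (L1B (L1_conv lKK (L1_cutG s)) (L1_conv lCK (lF i))))).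
  by apply: filterS (HE is_ si) => x ->.
move=> Hb; apply: (le_trans Hb); rewrite /g /hpow r0 /= ltrD2l ltrN2 a_s.
by rewrite le_eqVlt; apply/orP; left; apply/eqP; rewrite /A1 /A2; ring.
Qed.

(** Strong induction with the same [eta] at every step: [Heta] says that the window S is short
    enough for the accumulated error to return below [eta], which replaces a singular Gronwall
    inequality. *)
Theorem scheme_error k : (k <= N)%N -> \int[mu]_x `|u (tn k) x - sch k x| <= eta.
Proof.
elim/ltn_ind: k => -[_ _|k IH kN].
  by rewrite mul0r addr0 /= Rint_eq0// => x; rewrite subrr normr0.
have k1N : (0 < k.+1 <= N)%N by [].
have {}IH j : (j < k.+1)%N -> \int[mu]_x `|u (tn j) x - sch j x| <= eta.
  by move=> jk; apply: IH => //; exact: leq_trans (ltnW jk) kN.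
have [lg ig] := g_int k1N; apply: le_trans ig.
have lsch j := L1_scheme be_half be1 b mf fN fmono fL tau j lua.
have atk : a < tn k.+1 by rewrite ltrDl mulr_gt0// ltr0n.
have lX := L1_Rint1 (lH k.+1).
have -> : \int[mu]_x `|u (tn k.+1) x - sch k.+1 x| = \int[mu]_x `|\int[@stm R n]_p H k.+1 x p|.
  apply: ae_eq_Rint.
  - exact: (L1_measurable (L1_norm (L1B (lu (atn k.+1)) (lsch k.+1)))).
  - exact: (L1_measurable (L1_norm lX)).
  apply: filterS (restart be_half be1 q0 lu0 hu mu0 a0 atk) => x ->.
  rewrite (schemeE be_half be1 b mf fN fmono L0 fL k x tau0 lua).
  rewrite [tn _ - a]addrAC subrr add0r opprD addrACA subrr add0r; congr (`|_|).
  have lp (j : 'I_k.+1) := stm_prod (l_step j).1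
    (L1_ckM be_half be1 b (L * tau) ((k.+1 - j)%:R * tau) x (lF j)).
  rewrite /H RintB; last first.
  - by apply: L1_sum => j; have [] := lp j.
  - exact: (L1_duhcut be_half hu mu0 a x (lt_trans a0 atk)).
  congr (_ - _); rewrite Rint_sum; last by move=> j; have [] := lp j.
  rewrite mulr_sumr; apply: eq_bigr => j _; have [_ ->] := lp j.
  by rewrite (l_step j).2.
apply: (minkowski_stm (lH k.+1) (lHs k.+1) lg).
apply: filterS (leb_neq a) => s sa; exact: slice_bound.
Qed.

End scheme_error.

Lemma powR_root (R : realType) (e X : R) : 0 < e -> 0 < X -> (X `^ e^-1) `^ e = X.
Proof. by move=> e0 X0; rewrite -powRrM mulVf ?gt_eqF// powRr1// ltW. Qed.

Lemma div_succ_small (R : realFieldType) (e A : R) : 0 < e -> 0 <= A ->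
  0 < e / (4 * (A + 1)) /\ e / (4 * (A + 1)) * A <= e / 4.
Proof.
move=> e0 A0; have A1 : 0 < A + 1 by rewrite ltr_wpDl.
split; first by rewrite divr_gt0// mulr_gt0.
rewrite [leLHS](_ : _ = e / 4 * (A / (A + 1))); last by field; rewrite gt_eqF.
by apply: ler_piMr; [rewrite divr_ge0// ltW|rewrite ler_pdivrMr// mul1r lerDl].
Qed.

Section maximum_principle.
Context {R : realType} {n : nat}.
Variable be : R.
Hypotheses (be_half : 2^-1 < be) (be1 : be < 1).
Variables (b : 'rV[R]_n) (q : R) (u0 : 'rV[R]_n -> R) (u : R -> 'rV[R]_n -> R).
Hypothesis q0 : 0 < q.
Hypothesis lu0 : L1 (lebesgue_rV n) u0.
Hypothesis hu : mild_solution (2 * be) q b u0 u.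
Local Notation mu := (lebesgue_rV n).
Local Notation nu := ((2 * be)^-1).
Local Notation ga := ((1 + nu) / 2).
Hypothesis mu0 : (0 < mu [set: 'rV[R]_n])%E.
Implicit Types (x y z : 'rV[R]_n) (t s r a T K : R).

Let be0 : 0 < be. Proof. by apply: lt_trans be_half; rewrite invr_gt0. Qed.
Let nu0 : 0 < nu. Proof. by rewrite invr_gt0 mulr_gt0. Qed.
Let nu1 : nu < 1. Proof. by rewrite invf_lt1 ?mulr_gt0//; move: be_half; lra. Qed.
Let ga1 : ga < 1. Proof. by move: nu1; lra. Qed.

(** On a short window u is an L^1 limit of schemes started at u(s), none of which increases the
    excess over K. The length S depends on a and T but not on s, so windows can be chained. *)
Lemma exc_window K a T : 0 <= K -> 0 < a -> exists2 S : R, 0 < S &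
  forall s t, a <= s -> s <= t -> t <= T -> t - s <= S ->
    \int[mu]_x exc K (u t x) <= \int[mu]_x exc K (u s x).
Proof.
move=> K0 a0; have [M' M'0 HM'] := mild_bdd_loc hu mu0 T a0.
pose M := M' + 1; have M0 : 0 < M by rewrite ltr_wpDl.
have [Bd Bd0 HB] := mild_L1_loc hu T.
have [C1 C10 HC1] := kk_norm be_half be1 b; have [C2 C20 HC2] := ck_norm be_half be1 b.
pose f := clampf q M; pose L := clampL q M; have L0 : 0 < L by exact: clampL_gt0.
have mf : measurable_fun setT f by exact: measurable_clampf.
have fN v : f (- v) = - f v by exact: clampfN.
have fmono (v w : R) : v <= w -> f v <= f w.
  by move=> /(clampf_slope q0 M0) /andP[+ _]; rewrite subr_ge0.
have fL (v w : R) : v <= w -> f w - f v <= L * (w - v).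
  by move=> /(clampf_slope q0 M0) /andP[_].
have n10 : 0 < 1 - nu by rewrite subr_gt0.
(* Makes the feedback of earlier errors equal to eta / 2; [om] and [ep] below are then chosen to
   contribute at most eta / 4 each. *)
pose X := (1 - nu) / (2 * (C2 * L)).
have D0 : 0 < C2 * L by exact: mulr_gt0.
have X0 : 0 < X by rewrite divr_gt0// mulr_gt0.
pose S := X `^ (1 - nu)^-1; have S0 : 0 < S by exact: powR_gt0.
have SX : S `^ (1 - nu) = X by exact: powR_root.
exists S => // s t as_; rewrite le_eqVlt => /predU1P[<- //|st] tT tS.
have s0 : 0 < s by exact: lt_le_trans as_.
have t0 : 0 < t by exact: lt_trans st.
have lus := mild_L1 hu (ltW s0); have lut := mild_L1 hu (ltW t0).
apply/ler_addgt0Pr => eta eta0.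
pose W := S `^ (1 - nu) / (1 - nu); pose V := S `^ (1 - ga) / (1 - ga).
have W0 : 0 <= W by rewrite divr_ge0 ?powR_ge0// ltW.
have V0 : 0 <= V by rewrite divr_ge0 ?powR_ge0// subr_ge0 ltW.
pose om := eta / (4 * (C1 * L * W + 1)); pose ep := eta / (4 * (L * Bd * V + 1)).
have [om0 E1] : 0 < om /\ om * (C1 * L * W) <= eta / 4.
  by apply: div_succ_small => //; rewrite mulr_ge0// mulr_ge0// ltW.
have [ep0 E3] : 0 < ep /\ ep * (L * Bd * V) <= eta / 4.
  by apply: div_succ_small => //; rewrite mulr_ge0// mulr_ge0// ltW.
have Heta : (C1 * (L * om) + C2 * (L * eta)) * W + ep * (L * Bd) * V <= eta.
  have E2 : C2 * (L * eta) * W = eta / 2.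
    rewrite /W SX /X (mulrA C2); move: D0 n10; move: (C2 * L) (1 - nu) => D c D0 c0.
    by field; rewrite !gt_eqF.
  rewrite [leLHS](_ : _ = om * (C1 * L * W) + C2 * (L * eta) * W + ep * (L * Bd * V)); last by ring.
  rewrite E2; move: E1 E3; set p := om * _; set p' := ep * _; lra.
have [dl dl0 Hdl] := mild_modulus hu T om0.
have [tau0 tau00 Hk] := kernel_consistency be_half be1 b L0 S0 ep0.
(* The window is cut into k + 1 equal steps, with k large enough for the step to meet both the
   modulus of continuity of u and the kernel consistency. *)
pose m := Num.min dl tau0 / (t - s).
have m0 : 0 < m by rewrite divr_gt0 ?subr_gt0// lt_min dl0.
have [k _ Hkk] := cvgr_lt _ (@cvg_harmonic R) _ m0.
have {}Hkk := Hkk k (leqnn k).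
pose tau := (t - s) / k.+1%:R.
have ta0 : 0 < tau by rewrite divr_gt0// subr_gt0.
have : tau < Num.min dl tau0.
  by move: Hkk; rewrite /m ltr_pdivlMr ?subr_gt0// mulrC.
rewrite lt_min => /andP[tau_dl tau_tau0].
have Nt : k.+1%:R * tau = t - s by rewrite mulrC divfK.
have sNt : s + k.+1%:R * tau = t by rewrite Nt addrC subrK.
have Gf r : s <= r <= t -> {ae mu, forall z, mildG q u (r, z) = f (u r z)}.
  move=> /andP[sr rt]; have r0 : 0 < r by exact: lt_le_trans sr.
  have ar : a <= r <= T by rewrite (le_trans as_)//= (le_trans rt).
  apply: filterS2 (mildU_ae hu mu0 r0) (HM' r ar) => z Hz Mz.
  by rewrite /mildG Hz /f clampfE// (le_trans Mz)// lerDl.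
have in0T r : s <= r <= t -> 0 <= r <= T.
  by move=> /andP[sr rt]; rewrite (le_trans (ltW s0) sr) (le_trans rt).
have Hom r r' : s <= r <= t -> s <= r' <= t -> `|r - r'| <= tau ->
    \int[mu]_x `|u r x - u r' x| <= om.
  by move=> /in0T r1 /in0T r2 rr; apply: Hdl => //; exact: le_lt_trans tau_dl.
have HB' r : s <= r <= t -> \int[mu]_x `|u r x| <= Bd by move=> /in0T; exact: HB.
have Hep r r' : 0 < r <= S -> r <= r' <= r + tau ->
    \int[mu]_y `|kk be b r y - ck be b (L * tau) r' y| <= ep * r `^ (- ga).
  by move=> r1 r2; exact: Hk.
have NT : s + k.+1%:R * tau <= t by rewrite sNt.
have NS : k.+1%:R * tau <= S by rewrite Nt.
have := @scheme_error R n be be_half be1 b q u0 u q0 lu0 hu mu0 f L mf fN fmono L0 fL s t s0 Gf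
  tau S C1 C2 om ep Bd eta k.+1 ta0 NT NS (ltW C20) (ltW C10) (ltW om0) (ltW ep0) (ltW eta0) Bd0
  HC1 HC2 Hom HB' Hep Heta k.+1 (leqnn _).
rewrite sNt => He.
have lsch := L1_scheme be_half be1 b mf fN fmono fL tau k.+1 lus.
apply: (le_trans (exc_Rint_lip K0 lut lsch)); apply: lerD He.
exact: exc_scheme.
Qed.

Lemma exc_mono K a t : 0 <= K -> 0 < a -> a <= t ->
  \int[mu]_x exc K (u t x) <= \int[mu]_x exc K (u a x).
Proof.
move=> K0 a0 at_; have [S S0 HS] := exc_window t K0 a0.
suff claim k r : a <= r <= t -> r <= a + k%:R * S ->
    \int[mu]_x exc K (u r x) <= \int[mu]_x exc K (u a x).
  apply: (claim (Num.truncn ((t - a) / S)).+1); first by rewrite at_ lexx.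
  rewrite -lerBlDl -ler_pdivrMr// ltW//.
  have d0 : 0 <= (t - a) / S by rewrite divr_ge0 ?subr_ge0// ltW.
  by have /andP[] := truncn_itv d0.
elim: k r => [|k IH] r /andP[ar rt] rk.
  by have -> : r = a by apply/eqP; rewrite eq_le ar andbT; move: rk; rewrite mul0r addr0.
pose r' := Num.max a (r - S).
have r'r : r' <= r by rewrite ge_max ar gerBl ltW.
have ar' : a <= r' by rewrite le_max lexx.
apply: (@le_trans _ _ (\int[mu]_x exc K (u r' x))).
  by apply: HS => //; rewrite lerBlDl -lerBlDr le_max lexx orbT.
apply: IH; first by rewrite ar' (le_trans r'r).
rewrite ge_max lerDl mulr_ge0 ?(ltW S0)//= lerBlDr -addrA.
by move: rk; rewrite -natr1 mulrDl mul1r.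
Qed.

(** The excess of u0 over K vanishes. Monotonicity is known only from positive times, but the excess
    is 1-Lipschitz in L^1, so continuity at 0 carries the value 0 to all t > 0. *)
Theorem max_principle K : {ae mu, forall x, `|u0 x| <= K} -> 0 <= K ->
  forall t, 0 < t -> {ae mu, forall x, `|u t x| <= K}.
Proof.
move=> HK K0 t t0; have lut := mild_L1 hu (ltW t0); have le := L1_exc K0 lut.
have Z : \int[mu]_x exc K (u0 x) = 0.
  rewrite -(Rint_eq0 mu (f := fun=> 0))//; apply: ae_eq_Rint => //.
    exact: (L1_measurable (L1_exc K0 lu0)).
  by apply: filterS HK => x Kx; rewrite /exc max_r// subr_le0.
have C := mild_cont0 lu0 hu.
have I0 : \int[mu]_x exc K (u t x) <= 0.
  rewrite leNgt; apply/negP => pos.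
  have [N1 _ H1] := cvgr_lt _ C _ pos.
  have [N2 _ H2] := cvgr_lt _ (@cvg_harmonic R) _ t0.
  pose k := maxn N1 N2; have e0 : 0 < k.+1%:R^-1 :> R by rewrite invr_gt0.
  have := H1 k (leq_maxl _ _); apply/negP; rewrite -leNgt.
  apply: (le_trans (exc_mono K0 e0 (ltW (H2 k (leq_maxr _ _))))).
  by apply: (le_trans (exc_Rint_lip K0 (mild_L1 hu (ltW e0)) lu0)); rewrite Z add0r.
apply: filterS (ae_ge0_L1_eq0 le (fun x => exc_ge0 K _) I0) => x Hx.
by rewrite -subr_le0 -Hx /exc le_max lexx.
Qed.

(** By the maximum principle the left side of the gauge is at most K^q, whereas the right side blows
    up as r -> 0. The 1 added to K^q covers K = 0. *)
Lemma gauge_bounded K : 0 <= K -> {ae mu, forall x, `|u0 x| <= K} -> small_gauge be q u.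
Proof.
move=> K0 HK eta eta0; have n10 : 0 < 1 - nu by rewrite subr_gt0.
pose X := eta / (K `^ q + 1); have K1 : 0 < K `^ q + 1 by rewrite ltr_wpDl// powR_ge0.
have X0 : 0 < X by rewrite divr_gt0.
exists (X `^ (1 - nu)^-1); first exact: powR_gt0.
exists 1 => // a /andP[a0 _] r /andP[r0 rT] x.
have lna := L1_norm (mild_L1 hu (ltW a0)).
have P : convol (pk be r) (fun y => `|u a y|) x <= K.
  rewrite -(Rint_pk_cst be_half be1 x K r0); apply: ae_ler_Rint.
  - exact: L1_pkM.
  - exact: L1_pk_cst.
  by apply: filterS (max_principle HK K0 a0) => y Hy; apply: ler_wpM2l => //; exact: pk_ge0.
have P0 : 0 <= convol (pk be r) (fun y => `|u a y|) x.
  by apply: Rint_ge0 => y; rewrite mulr_ge0// pk_ge0.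
apply: (@le_trans _ _ (K `^ q)); first by apply: ler_powR2 => //; exact: ltW.
apply: (@le_trans _ _ (eta * X^-1)).
  by rewrite /X invf_div mulrCA divff ?gt_eqF// mulr1 lerDl.
apply: (ler_wpM2l (ltW eta0)).
have := ler_powRN (ltW n10) r0 rT; apply: le_trans.
by rewrite powRN (powR_root n10 X0).
Qed.

Lemma exc_tail (dl : R) : 0 < dl -> exists2 N : R, 0 <= N & \int[mu]_x exc N (u0 x) <= dl.
Proof.
move=> dl0; have C : \int[mu]_x exc k%:R (u0 x) @[k --> \oo] --> \int[mu]_x (0 : R).
  apply: (Rint_cvg _ _ (L1_norm lu0)) => //.
  - move=> k; exact: (L1_measurable (L1_exc (ler0n _ k) lu0)).
  - move=> x; apply: cvg_near_cst; exists (Num.truncn `|u0 x|).+1 => // k Hk.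
    rewrite /exc max_r// subr_le0; have /andP[_ H] := truncn_itv (normr_ge0 (u0 x)).
    by apply: (le_trans (ltW H)); rewrite ler_nat.
  - by move=> k x; rewrite (ger0_norm (exc_ge0 _ _)) exc_le.
rewrite Rint_eq0// in C.
have [N _ HN] := cvgr_lt _ C _ dl0; exists N%:R => //.
exact: (ltW (HN N (leqnn _))).
Qed.

(** |u(a)| is split at a level N. The part above it is small in L^1 uniformly for small a, so P_r
    maps it below (X / 2) r^(-d) with d = n nu; the level N itself is below (X / 2) r^(-d) for small
    r. Since d q = 1 - nu, raising to the power q gives the gauge with eta = X^q. *)
Lemma gauge_critical : (0 < n)%N -> q = (2 * be - 1) / n%:R -> small_gauge be q u.
Proof.
move=> n0 qE eta eta0; have n10 : 0 < 1 - nu by rewrite subr_gt0.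
have nR : 0 < n%:R :> R by rewrite ltr0n.
pose d : R := n%:R * nu; have d0 : 0 < d by rewrite mulr_gt0.
have dq : d * q = 1 - nu by rewrite /d qE; field; rewrite !gt_eqF// mulr_gt0.
pose X := eta `^ q^-1; have X0 : 0 < X by exact: powR_gt0.
have XE : X `^ q = eta by exact: powR_root.
pose pm := pk be 1 (0 : 'rV[R]_n); have pm0 : 0 < pm by exact: pk_gt0.
(* [dl] is spent twice, on the tail of u0 and on the distance from u(a) to u0; together they
   contribute 2 pm dl = X / 2. *)
pose dl := X / (4 * pm); have dl0 : 0 < dl by rewrite divr_gt0// mulr_gt0.
have [N N0 HN] := exc_tail dl0.
have [e0 e00 He0] := mild_cont1 hu (lexx 0) dl0.
pose Y := X / (2 * (N + 1)); have Y0 : 0 < Y by rewrite divr_gt0// mulr_gt0// ltr_wpDl.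
exists (Y `^ d^-1); first exact: powR_gt0.
exists e0 => // a /andP[a0 ae] r /andP[r0 rT] x.
have lua := mild_L1 hu (ltW a0); have lna := L1_norm lua; have le := L1_exc N0 lua.
have Ia : \int[mu]_x exc N (u a x) <= dl + dl.
  apply: (le_trans (exc_Rint_lip N0 lua lu0)); apply: lerD HN _.
  have l0 := mild_L1 hu (lexx 0).
  have -> : \int[mu]_x `|u a x - u0 x| = \int[mu]_x `|u a x - u 0 x|.
    apply: ae_eq_Rint.
    - exact: (L1_measurable (L1_norm (L1B lua lu0))).
    - exact: (L1_measurable (L1_norm (L1B lua l0))).
    by have [_ _ + _] := hu; apply: filterS => y ->.
  by apply: He0; rewrite ?subr0 ?(ltW a0)// ger0_norm// ltW.
have P0 : 0 <= convol (pk be r) (fun y => `|u a y|) x.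
  by apply: Rint_ge0 => y; apply: mulr_ge0; [exact: pk_ge0|exact: normr_ge0].
have rd0 : 0 < r `^ (- d) by exact: powR_gt0.
have P : convol (pk be r) (fun y => `|u a y|) x <= X * r `^ (- d).
  apply: (@le_trans _ _ (pm * r `^ (- d) * (dl + dl) + N)).
    apply: (@le_trans _ _ (\int[mu]_y (pm * r `^ (- d) * exc N (u a y) + pk be r (x - y) * N))).
      apply: ler_Rint; [exact: L1_pkM|apply: L1D; [exact: L1Z|exact: L1_pk_cst]|move=> y].
      have p0 : 0 <= pk be r (x - y) by exact: pk_ge0.
      apply: (@le_trans _ _ (pk be r (x - y) * exc N (u a y) + pk be r (x - y) * N)).
        by rewrite -mulrDr; apply: ler_wpM2l => //; rewrite -lerBlDr le_max lexx.
      rewrite lerD2r; apply: ler_wpM2r; first exact: exc_ge0.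
      by have := pk_le0 be_half be1 r (x - y).
    rewrite RintD; [|exact: L1Z|exact: L1_pk_cst].
    rewrite (RintZ _ le) (Rint_pk_cst be_half be1 x N r0) lerD2r.
    by apply: ler_wpM2l => //; rewrite mulr_ge0// ltW.
  have rY : r `^ d <= Y.
    by rewrite -(powR_root d0 Y0); apply: ler_powR2; [exact: ltW|exact: ltW|].
  have NX : N <= X / 2 * r `^ (- d).
    rewrite powRN ler_pdivlMr ?powR_gt0//; apply: (le_trans (ler_wpM2l N0 rY)).
    rewrite /Y invfM mulrCA !mulrA; rewrite ler_pdivrMr ?ltr_wpDl//.
    rewrite [leLHS](_ : _ = X / 2 * N); last by ring.
    by apply: ler_wpM2l; [rewrite divr_ge0// ltW|rewrite lerDl].
  apply: (le_trans (lerD (lexx _) NX)).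
  rewrite le_eqVlt; apply/orP; left; apply/eqP; rewrite /dl; field.
  by rewrite gt_eqF.
apply: (@le_trans _ _ ((X * r `^ (- d)) `^ q)); first by apply: ler_powR2 => //; exact: ltW.
rewrite powRM ?(ltW X0) ?(ltW rd0)// XE -powRrM mulNr dq.
by rewrite lexx.
Qed.

End maximum_principle.

(** * Essential suprema and positivity of the linear evolution *)

Section essential_sup.
Context {R : realType} {n : nat}.
Local Notation mu := (lebesgue_rV n).

(** On a null space every L^1 norm is 0. The positivity of the total mass, on which the reading of
    L^oo norms rests, is thus drawn from u0. *)
Lemma Lnorm1_gt0_measure_gt0 (u0 : 'rV[R]_n -> R) : L1 mu u0 -> (0 < 'N[mu]_1 [EFin \o u0])%E ->
  (0 < mu [set: 'rV[R]_n])%E.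
Proof.
move=> lu0 u0_gt0; rewrite lt0e measure_ge0 andbT; apply/eqP => m0.
move: u0_gt0; rewrite Lnorm1 null_set_integral ?ltxx//.
exact: ((measurable_EFinP _ _).2 (L1_measurable (L1_norm lu0))).
Qed.

Lemma Lnorm_oo_le (f : 'rV[R]_n -> R) (e : R) : (0 < mu [set: 'rV[R]_n])%E ->
  (forall x, `|f x| <= e) -> ('N[mu]_+oo [EFin \o f] <= e%:E)%E.
Proof.
move=> mu0 fe; rewrite unlock /= mu0; apply/ess_supP; apply: nearW => x /=.
by rewrite lee_fin.
Qed.

Lemma Lfun_oo_bounded (f : 'rV[R]_n -> R) : (0 < mu [set: 'rV[R]_n])%E ->
  f \in Lfun mu +oo%E -> exists2 K : R, 0 <= K & {ae mu, forall x, `|f x| <= K}.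
Proof.
move=> mu0; rewrite inE => /andP[_]; rewrite inE /= /finite_norm => Hf.
have N0 := Lnorm_ge0 mu +oo%E (EFin \o f).
exists (fine ('N[mu]_+oo [EFin \o f])); first by rewrite fine_ge0.
have : ('N[mu]_+oo [EFin \o f] <= (fine ('N[mu]_+oo [EFin \o f]))%:E)%E.
  by rewrite fineK// ge0_fin_numE.
by rewrite {1}unlock /= mu0 => /ess_supP; apply: filterS => x /=; rewrite lee_fin.
Qed.

End essential_sup.

Section positivity.
Context {R : realType} {n : nat}.
Variable be : R.
Hypotheses (be_half : 2^-1 < be) (be1 : be < 1).
Local Notation mu := (lebesgue_rV n).
Variable u0 : 'rV[R]_n -> R.
Hypothesis lu0 : L1 mu u0.

Lemma stable_semigroupE t x : 0 < t ->
  stable_semigroup (2 * be) t u0 x = convol (pk be t) u0 x.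
Proof. by move=> t0; apply: eq_Rintegral => y _; rewrite heat_kernelE pkE. Qed.

(** The kernel is strictly positive, so a vanishing integral would force u0 = 0 almost everywhere.
    Strict positivity makes the quotient in the theorem a genuine one. *)
Lemma convol_pk_gt0 t x : {ae mu, forall y, 0 <= u0 y} ->
  (0 < 'N[mu]_1 [EFin \o u0])%E -> 0 < t -> 0 < convol (pk be t) u0 x.
Proof.
move=> u0_ge0 u0_gt0 t0; have ln := L1_norm lu0.
have l1 := L1_pkM be_half be1 t x lu0; have l2 := L1_pkM be_half be1 t x ln.
have -> : convol (pk be t) u0 x = \int[mu]_y (pk be t (x - y) * `|u0 y|).
  apply: ae_eq_Rint; [exact: (L1_measurable l1)|exact: (L1_measurable l2)|].
  by apply: filterS u0_ge0 => y y0; rewrite ger0_norm.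
rewrite ltNge; apply/negP => le0.
have Z : {ae mu, forall y, pk be t (x - y) * `|u0 y| = 0}.
  by apply: ae_ge0_L1_eq0 => // y; rewrite mulr_ge0// pk_ge0.
suff I0 : \int[mu]_y `|u0 y| = 0.
  by move: u0_gt0; rewrite Lnorm1 -EFin_Rint// I0 ltxx.
rewrite -(Rint_eq0 mu (f := fun=> 0))//; apply: ae_eq_Rint => //.
  exact: (L1_measurable ln).
apply: filterS Z => y /eqP; rewrite mulf_eq0 => /orP[|/eqP//].
by rewrite gt_eqF// pk_gt0.
Qed.

End positivity.

Theorem theorem4p2 (R : realType) (d : nat) (hd : (1 <= d)%N)
    (alpha : R) (halpha1 : 1 < alpha) (halpha2 : alpha < 2)
    (b : 'rV[R]_d) (q : R) (hq : (alpha - 1) / d%:R <= q)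
    (u0 : 'rV[R]_d -> R)
    (hu0_ge0 : {ae lebesgue_rV d, forall x, 0 <= u0 x})
    (hu0_gt0 : (0 < 'N[lebesgue_rV d]_1 [EFin \o u0])%E)
    (hu0 : (q = (alpha - 1) / d%:R /\ u0 \in Lfun (lebesgue_rV d) 1%E) \/
           ((alpha - 1) / d%:R < q /\ u0 \in Lfun (lebesgue_rV d) 1%E /\
            u0 \in Lfun (lebesgue_rV d) +oo%E))
    (u : R -> 'rV[R]_d -> R) (hu : mild_solution alpha q b u0 u) :
  ('N[lebesgue_rV d]_+oo [EFin \o (fun x : 'rV[R]_d =>
     (rescale alpha u t x /
      rescale alpha (fun s => stable_semigroup alpha s u0) t x - 1)%R)])%E
    @[t --> 0^'+] --> 0%E.
Proof.
have [be aE] : exists be, alpha = 2 * be by exists (alpha / 2); rewrite mulrC divfK.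
subst alpha.
have be_half : 2^-1 < be by move: halpha1; lra.
have be1 : be < 1 by move: halpha2; lra.
have q0 : 0 < q.
  by apply: lt_le_trans hq; rewrite divr_gt0 ?ltr0n// subr_gt0.
have lu0 : L1 (lebesgue_rV d) u0.
  by case: hu0 => [[_ H]|[_ [H _]]]; exact/Lfun1_integrable.
have mu0 := Lnorm1_gt0_measure_gt0 lu0 hu0_gt0.
have Hg : small_gauge be q u.
  case: hu0 => [[qE _]|[_ [_ Hoo]]]; first exact: (gauge_critical be_half be1 q0 lu0 hu hd qE).
  by have [K K0 HK] := Lfun_oo_bounded mu0 Hoo; exact: (gauge_bounded be_half be1 q0 lu0 hu mu0 K0 HK).
have bound (e : R) : 0 < e -> exists2 T : R, 0 < T & forall t, 0 < t <= T -> forall x,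
    `|rescale (2 * be) u t x /
      rescale (2 * be) (fun s => stable_semigroup (2 * be) s u0) t x - 1| <= e.
  move=> e0; have [T T0 HT] := final_estimate be_half be1 q0 lu0 hu mu0 hu0_ge0 Hg e0.
  exists T => // t tT x; have t0 : 0 < t by case/andP: tT.
  rewrite /rescale stable_semigroupE//; set X := _ *: x.
  have P0 := convol_pk_gt0 be_half be1 lu0 X hu0_ge0 hu0_gt0 t0.
  have c0 : 0 < t `^ (d%:R / (2 * be)) by exact: powR_gt0.
  have := HT t tT X; move: P0 c0; move: (convol _ _ X) (u t X) (t `^ _) => P v c P0 c0 H.
  (* Both rescalings use the same factor and the same point, so the quotient reduces to that of the
     unscaled functions there. *)
  have -> : c * v / (c * P) - 1 = (v - P) / P by field; rewrite !gt_eqF.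
  by rewrite normrM normfV (gtr0_norm P0) ler_pdivrMr.
(* Convergence to 0 in the extended reals amounts to finiteness near 0 together with convergence of
   the real values; [bound] gives both. *)
apply/fine_cvgP; split.
  have [T T0 HT] := bound 1 ltr01; near=> t.
  have tT : 0 < t <= T by apply/andP; split; near: t; [exact: nbhs_right_gt|exact: nbhs_right_le].
  rewrite ge0_fin_numE ?Lnorm_ge0//.
  by apply: le_lt_trans (ltry 1); apply: Lnorm_oo_le => //; exact: HT.
apply/cvgrPdist_le => e e0; have [T T0 HT] := bound e e0; near=> t.
have tT : 0 < t <= T by apply/andP; split; near: t; [exact: nbhs_right_gt|exact: nbhs_right_le].
rewrite /= sub0r normrN ger0_norm ?fine_ge0 ?Lnorm_ge0//.
have H := Lnorm_oo_le mu0 (HT t tT).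
rewrite -lee_fin fineK//; rewrite ge0_fin_numE ?Lnorm_ge0//.
exact: (le_lt_trans H (ltry e)).
Unshelve. all: by end_near.
Qed.
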